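(* Let $\widetilde f:\mathbb R^2\to\mathbb R^2$ be a lift of $f:\mathbb T^2\to\mathbb T^2$. Suppose either that $f\in \mathrm{Diff}_0^{1+\epsilon}(\mathbb T^2)$ and $\mathrm{int}(\rho(\widetilde f))$ is not empty, or that $f\in \mathrm{Diff}_k^{1+\epsilon}(\mathbb T^2)$ for some integer $k\ne0$ and $\mathrm{int}(\rho_V(\widetilde f))$ is not empty. If $f$ is transitive, then $f$ cannot have a periodic open disk. In the general case ($f$ not necessarily transitive), there exists $M=M(f)>0$ such that if $D\subset\mathbb T^2$ is an $f$-periodic open disk, then for any connected component $\widetilde D$ of $\Pi^{-1}(D)$, $\mathrm{diam}(\widetilde D)<M$.
   Context: $\mathbb T^2=\mathbb R^2/\mathbb Z^2$ and $\Pi:\mathbb R^2\to\mathbb T^2$ is the covering map; $p_2(\tilde x,\tilde y)=\tilde y$. $\mathrm{Diff}_0^{1+\epsilon}(\mathbb T^2)$ is the set of area-preserving diffeomorphisms of $\mathbb T^2$ of class $C^{1+\epsilon}$ (for some $\epsilon>0$) homotopic to the identity; $\mathrm{Diff}_k^{1+\epsilon}(\mathbb T^2)$ ($k\ne0$ an integer) is the set of area-preserving $C^{1+\epsilon}$ diffeomorphisms (some $\epsilon>0$) homotopic to the Dehn twist $(x,y)\mapsto(x+ky \bmod 1,\ y \bmod 1)$. Rotation sets: for $f$ homotopic to the identity, $\rho(\widetilde f)=\bigcap_{i\ge1}\overline{\bigcup_{n\ge i}\{(\widetilde f^n(\widetilde z)-\widetilde z)/n:\widetilde z\in\mathbb R^2\}}\subset\mathbb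 R^2$; for $f$ homotopic to a Dehn twist, $\rho_V(\widetilde f)=\bigcap_{i\ge1}\overline{\bigcup_{n\ge i}\{(p_2\circ\widetilde f^n(\widetilde z)-p_2(\widetilde z))/n:\widetilde z\in\mathbb R^2\}}\subset\mathbb R$. Interiors are taken in $\mathbb R^2$ and $\mathbb R$ respectively. An open disk in $\mathbb T^2$ is a connected, simply connected open subset of $\mathbb T^2$; it is $f$-periodic if $f^n(D)=D$ for some integer $n>0$. *)

(* Defs.v *)
(* MathComp-Analysis *)
From HB Require Import structures.
From mathcomp Require Import all_boot all_order all_algebra.
From mathcomp Require Import all_classical all_reals all_analysis.

Set Implicit Arguments.
Unset Strict Implicit.
Unset Printing Implicit Defensive.

Import Order.TTheory GRing.Theory Num.Theory.
Import numFieldNormedType.Exports.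

Local Open Scope classical_set_scope.
Local Open Scope ring_scope.
Local Open Scope quotient_scope.

Section torus.
Context {R : realType}.

Definition int_rel (z w : R * R) : bool :=
  (z.1 - w.1 \is a Num.int) && (z.2 - w.2 \is a Num.int).

Lemma int_rel_refl : reflexive int_rel.
Proof. by move=> z; rewrite /int_rel !subrr !rpred0. Qed.

Lemma int_rel_sym : symmetric int_rel.
Proof. by move=> z w; rewrite /int_rel -(opprB w.1) -(opprB w.2) !rpredN. Qed.

Lemma int_rel_trans : transitive int_rel.
Proof.
move=> w z t /andP[h1 h2] /andP[k1 k2]; apply/andP; split.
  by rewrite -(subrKA w.1) rpredD.
by rewrite -(subrKA w.2) rpredD.
Qed.

Definition int_equiv := EquivRel int_rel int_rel_refl int_rel_sym int_rel_trans.

Definition torus : Type := {eq_quot int_equiv}.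

HB.instance Definition _ := Topological.copy torus
  (quotient_topology {eq_quot int_equiv}).
HB.instance Definition _ := Quotient.on torus.

Definition torus_pi (z : R * R) : torus := \pi_torus z.

Lemma torus_piP (z w : R * R) : torus_pi z = torus_pi w <-> int_rel z w.
Proof. by split=> [/eqmodP //|h]; apply/eqmodP. Qed.

Definition dehn_twist (k : int) (t : torus) : torus :=
  torus_pi ((repr t).1 + k%:~R * (repr t).2, (repr t).2).

Lemma dehn_twistE (k : int) (z : R * R) :
  dehn_twist k (torus_pi z) = torus_pi (z.1 + k%:~R * z.2, z.2).
Proof.
have /andP[h1 h2] : int_rel (repr (torus_pi z)) z.
  by apply/torus_piP; rewrite /torus_pi reprK.
apply/torus_piP/andP; split=> //=.
by rewrite opprD addrACA -mulrBr rpredD// rpredM// intr_int.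
Qed.

Definition is_lift (F : R * R -> R * R) (f : torus -> torus) : Prop :=
  continuous F /\ forall z, torus_pi (F z) = f (torus_pi z).

(* The torus carries the smooth structure that makes torus_pi a local
   diffeomorphism, so regularity of f is regularity of a lift. The derivative of
   a lift is Z^2-periodic, hence locally Hoelder and globally Hoelder agree. The
   norms are the sup norms of R * R, which only affects C. *)
Definition C1holder (eps : R) (f : torus -> torus) : Prop :=
  exists2 F : R * R -> R * R, is_lift F f &
    (forall z : R * R, differentiable F z) /\
    exists C : R, forall z w v : R * R,
      `|'d F z v - 'd F w v| <= C * `|z - w| `^ eps * `|v|.

Definition torus_borel : set (set torus) := <<s [set U : set torus | open U] >>.

Definition torus_area (A : set torus) : \bar R :=
  ((@lebesgue_measure R) \x (@lebesgue_measure R))%E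
    ((torus_pi @^-1` A) `&` (`[0, 1[ `*` `[0, 1[)).

Definition area_preserving (f : torus -> torus) : Prop :=
  forall A, torus_borel A -> torus_area (f @^-1` A) = torus_area A.

(* Hoelder exponents above 1 would force an affine lift; the union over
   0 < eps <= 1 is already the union over all eps > 0. *)
Definition area_preserving_diffeo (f : torus -> torus) : Prop :=
  area_preserving f /\
  exists2 eps : R, 0 < eps <= 1 &
    exists g : torus -> torus,
      [/\ cancel f g, cancel g f, C1holder eps f & C1holder eps g].

Definition homotopic (f g : torus -> torus) : Prop :=
  exists H : R * torus -> torus,
    [/\ {within `[0, 1] `*` [set: torus], continuous H},
        forall t, H (0, t) = f t & forall t, H (1, t) = g t].

Definition Diff0 (f : torus -> torus) : Prop :=
  area_preserving_diffeo f /\ homotopic f id.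

Definition DiffDehn (k : int) (f : torus -> torus) : Prop :=
  area_preserving_diffeo f /\ homotopic f (dehn_twist k).

Definition rotation_set (F : R * R -> R * R) : set (R * R) :=
  \bigcap_(i in [set i | (1 <= i)%N]) closure
    (\bigcup_(n in [set n | (i <= n)%N])
      [set n%:R^-1 *: (iter n F z - z) | z in [set: R * R]]).

Definition vertical_rotation_set (F : R * R -> R * R) : set R :=
  \bigcap_(i in [set i | (1 <= i)%N]) closure
    (\bigcup_(n in [set n | (i <= n)%N])
      [set ((iter n F z).2 - z.2) / n%:R | z in [set: R * R]]).

Definition topologically_transitive (f : torus -> torus) : Prop :=
  forall U V : set torus, open U -> open V -> U !=set0 -> V !=set0 ->
    exists n : nat, (iter n f @` U) `&` V !=set0.

Definition path_connected (D : set torus) : Prop :=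
  forall a b, D a -> D b ->
    exists c : R -> torus,
      [/\ {within `[0, 1], continuous c}, c @` `[0, 1] `<=` D,
          c 0 = a & c 1 = b].

Definition loops_contractible (D : set torus) : Prop :=
  forall c : R -> torus,
    {within `[0, 1], continuous c} -> c @` `[0, 1] `<=` D -> c 0 = c 1 ->
    exists H : R * R -> torus,
      [/\ {within `[0, 1] `*` `[0, 1], continuous H},
          H @` (`[0, 1] `*` `[0, 1]) `<=` D,
          forall t : R, `[0, 1]%classic t -> H (0, t) = c t,
          forall t : R, `[0, 1]%classic t -> H (1, t) = c 0 &
          forall s : R, `[0, 1]%classic s -> H (s, 0) = c 0 /\ H (s, 1) = c 0].

Definition simply_connected (D : set torus) : Prop :=
  path_connected D /\ loops_contractible D.

(* The empty set, which is connected in the library, is not a disk. *)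
Definition open_disk (D : set torus) : Prop :=
  [/\ open D, D !=set0, connected D & simply_connected D].

Definition periodic_open_disk (f : torus -> torus) (D : set torus) : Prop :=
  open_disk D /\ exists2 n : nat, (0 < n)%N & iter n f @` D = D.

(* The library norm on R * R is the sup norm; this is the Euclidean distance. *)
Definition euclidean_dist (z w : R * R) : R :=
  Num.sqrt ((z.1 - w.1) ^+ 2 + (z.2 - w.2) ^+ 2).

Definition diam (A : set (R * R)) : \bar R :=
  ereal_sup [set (euclidean_dist p.1 p.2)%:E | p in A `*` A].

End torus.

Arguments torus R : clear implicits.

(* Main.v *)
Require Import Defs.
From HB Require Import structures.
From mathcomp Require Import all_boot all_order all_algebra.
From mathcomp Require Import all_classical all_reals all_analysis.
From mathcomp Require Import ring lra zify.
Import Order.TTheory GRing.Theory Num.Theory.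
Import numFieldNormedType.Exports.
Set Implicit Arguments.
Unset Strict Implicit.
Unset Printing Implicit Defensive.
Local Open Scope classical_set_scope.
Local Open Scope ring_scope.

(* Let E be a component of the preimage of an f-periodic disk, so that F^n E = E + m
   for some integer vector m; put a = id for maps homotopic to the identity and let
   a be the projection to the vertical axis for maps homotopic to a Dehn twist.  As
   the rotation set has interior, for every c with a c = c the rate r(c) of linear
   growth of a (F^n z) - a z - n c exceeds the distance from c to a fixed interior
   point by a definite amount.  A maximal inequality yields, for suitable c, a velocity
   v with |v - c| = r(c) and orbits moving at velocity v over arbitrarily long two-sided
   time windows with a small linear error; there are three such non-collinear velocities
   (two distinct ones for a twist).  Integer translates of these steady orbits can be
   started near any point, and a parity count of crossings shows that two orbits of a
   connected set, joined by an arc carried along by F, cannot overtake such an orbit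
   on opposite sides.  Rescale time and space and take limits along an ultrafilter:
   since |v - c| is the largest rate about c, a limit path which has moved off the line
   of velocity v never comes back to it, and this irreversibility contradicts the
   crossing count in two situations.
   (1) Area preservation makes the points of E recurrent under G = F^n - m.  If E were
   unbounded, recurrent orbits reaching far from a base point, closed up inside E to
   periodic pseudo-orbits, would have such contradictory limits; so E is bounded, and
   all its iterates have bounded diameter.
   (2) Connected sets whose iterates have bounded diameter have diameter at most a
   constant depending on F only: otherwise rescale by the largest diameter of the
   iterates.  Under a twist horizontal lengths scale as the square of vertical ones.
   If f is transitive, the iterates of the disk are dense and (1) bounds the
   displacements of G on the whole plane, so the rotation set is a single point. *)

(** * Continuous maps and crossings of the plane axes *)

(** Euclidean discs are used because they are strictly convex. If limit paths advance within the
    disc of radius [|v - c|] about [c], then in the frame of velocity [v] a displacement [x] in time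
    [T] satisfies [|x|^2 <= 2 T <v - c, -x>] ([rate_energy]). So the component along [v - c], called
    the level, never increases, and a path that keeps its level stands still: this is the source of
    irreversibility. The crossing count needs no isotopy. Dilation about a point of the separating
    orbit joins [F] to its linear part, so a sampled parity is carried from one time to the next. A
    single class of velocities only confines coincidences to a line. Without a twist the other
    velocities remove this freedom, and of three orderings of two paths by level two must agree.
    With a twist the horizontal drift, proportional to the level, replaces the missing direction.
    Simple connectedness acts twice: an arc in [E] may be exchanged for any other with the same
    ends, and [E] is disjoint from its integer translates. *)

Section continuity.
Context {R : realType}.

Lemma cont_comp (T U W : topologicalType) (f : T -> U) (g : U -> W) :
  continuous f -> continuous g -> continuous (fun x => g (f x)).
Proof. by move=> cf cg x; apply: (@cvg_comp _ _ _ f g _ (nbhs (f x))); [exact: cf|exact: cg]. Qed.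

Lemma cont_pair (T U W : topologicalType) (f : T -> U) (g : T -> W) :
  continuous f -> continuous g -> continuous (fun x => (f x, g x)).
Proof.
move=> cf cg x; apply: (@cvg_pair _ _ _ _ (nbhs (f x)) (nbhs (g x))).
  exact: cf.
exact: cg.
Qed.

Lemma cont_id (T : topologicalType) : continuous (fun x : T => x).
Proof. by move=> x; exact: cvg_id. Qed.

Lemma cont_cst (T U : topologicalType) (c : U) : continuous (fun _ : T => c).
Proof. by move=> x; exact: cvg_cst. Qed.

Lemma cont_fst (T U W : topologicalType) (f : T -> U * W) :
  continuous f -> continuous (fun x => (f x).1).
Proof. by move=> cf x; apply: cvg_comp (cf x) _; exact: cvg_fst. Qed.

Lemma cont_snd (T U W : topologicalType) (f : T -> U * W) :
  continuous f -> continuous (fun x => (f x).2).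
Proof. by move=> cf x; apply: cvg_comp (cf x) _; exact: cvg_snd. Qed.

Lemma cont_add (T : topologicalType) (f g : T -> R) :
  continuous f -> continuous g -> continuous (fun x => f x + g x).
Proof. by move=> cf cg x; apply: cvgD; [exact: cf|exact: cg]. Qed.

Lemma cont_sub (T : topologicalType) (f g : T -> R) :
  continuous f -> continuous g -> continuous (fun x => f x - g x).
Proof. by move=> cf cg x; apply: cvgB; [exact: cf|exact: cg]. Qed.

Lemma cont_mul (T : topologicalType) (f g : T -> R) :
  continuous f -> continuous g -> continuous (fun x => f x * g x).
Proof. by move=> cf cg x; apply: cvgM; [exact: cf|exact: cg]. Qed.

Lemma cont_vadd (T : topologicalType) (f g : T -> R * R) :
  continuous f -> continuous g -> continuous (fun x => f x + g x).
Proof. by move=> cf cg x; apply: cvgD; [exact: cf|exact: cg]. Qed.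

Lemma cont_vsub (T : topologicalType) (f g : T -> R * R) :
  continuous f -> continuous g -> continuous (fun x => f x - g x).
Proof. by move=> cf cg x; apply: cvgB; [exact: cf|exact: cg]. Qed.

Lemma cont_vscale (T : topologicalType) (f : T -> R) (g : T -> R * R) :
  continuous f -> continuous g -> continuous (fun x => f x *: g x).
Proof. by move=> cf cg x; apply: cvgZ; [exact: cf|exact: cg]. Qed.

Definition clamp (t : R) : R := Num.max 0 (Num.min 1 t).

Lemma clamp01 t : 0 <= clamp t <= 1.
Proof. by rewrite /clamp le_max lexx /= ge_max ler01 /= ge_min lexx. Qed.

Lemma clamp_id t : 0 <= t <= 1 -> clamp t = t.
Proof. by move=> /andP[t0 t1]; rewrite /clamp (min_idPr t1) (max_idPr t0). Qed.

Lemma clamp_cont : continuous clamp.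
Proof.
move=> x; apply: (@continuous_max R R (cst 0) (fun t => Num.min 1 t)).
  exact: cvg_cst.
apply: (@continuous_min R R (cst 1) id); [exact: cvg_cst|exact: cvg_id].
Qed.

(** Replaces continuity within the unit interval or square by continuity everywhere, so that paths
    and homotopies can be total functions. *)
Lemma within_retract (S T U : topologicalType) (A : set T) (r : S -> T) (f : T -> U) :
  continuous r -> (forall x, A (r x)) -> {within A, continuous f} ->
  continuous (fun x => f (r x)).
Proof.
move=> cr Ar /subspace_continuousP cf x W HW.
have /= := cf (r x) (Ar x) W HW; rewrite /within /= => near_r.
have := cr x _ near_r; rewrite !near_simpl.
by apply: (@filterS _ (nbhs x)) => y /= h; exact: h.
Qed.

Definition clamp2 (z : R * R) : R * R := (clamp z.1, clamp z.2).

Lemma cfst : continuous (fun z : R * R => z.1).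
Proof. by move=> x; exact: cvg_fst. Qed.

Lemma csnd : continuous (fun z : R * R => z.2).
Proof. by move=> x; exact: cvg_snd. Qed.

Lemma clamp2_cont : continuous clamp2.
Proof.
exact: (cont_pair (cont_comp cfst clamp_cont) (cont_comp csnd clamp_cont)).
Qed.

End continuity.

(** * Parity of crossings of a half-axis *)

Section parity.
Context {R : realType}.
Implicit Types (a b : R * R) (u v : R -> R * R).

(** Lebesgue numbers for a hereditary property of sets: half the radius found at [x] serves all
    points near [x], and compactness makes the choice uniform. *)
Lemma lebesgue_number (T : pseudoMetricType R) (K : set T) (P : set T -> Prop) :
  (forall A B, A `<=` B -> P B -> P A) -> compact K ->
  (forall x, K x -> exists2 e : R, 0 < e & P (ball x e)) ->
  exists N : nat, forall n, (N <= n)%N -> forall x, K x -> P (ball x n.+1%:R^-1).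
Proof.
move=> Pmon /compact_near_coveringP Kc HP.
have := Kc nat \oo (fun n x => P (ball x n.+1%:R^-1)).
case=> [x Kx|N _ HN]; last by exists N => n /HN.
have [e e0 Pe] := HP x Kx.
have e20 : 0 < e / 2 by rewrite divr_gt0.
near=> y n => /=.
apply: (Pmon _ _ _ Pe) => z yz.
rewrite (splitr e); apply: (@ball_triangle _ _ y); first by near: y; exact: nbhsx_ballx.
apply: le_ball yz; apply: ltW; near: n.
exact: (near_infty_natSinv_lt (PosNum e20)).
Unshelve. all: by end_near. Qed.

(** A sampled passage across the right half of the first axis. Zero counts as not positive, so no
    general position is needed; once the steps are short compared with the distance to the origin,
    it does not matter which end supplies the sign of the first coordinate. *)
Definition crosses a b : bool := ((0 < a.2) (+) (0 < b.2)) && (0 < a.1).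

Definition parity n u : bool :=
  \big[addb/false]_(i < n) crosses (u (i%:R / n%:R)) (u (i.+1%:R / n%:R)).

Definition off_right a : Prop := a.2 != 0 \/ a.1 < 0.
Definition off_left a : Prop := a.2 != 0 \/ 0 < a.1.

Lemma unit_grid n i : (i <= n)%N -> (0 < n)%N -> 0 <= (i%:R / n%:R : R) <= 1.
Proof.
move=> lin n0; rewrite divr_ge0//= ler_pdivrMr ?ltr0n// mul1r ler_nat//.
Qed.

Lemma grid_step n i e : (0 < n)%N -> n%:R^-1 < e ->
  ball (i%:R / n%:R : R) e (i.+1%:R / n%:R).
Proof.
move=> n0 ne; rewrite -ball_normE /= -mulrBl -natr1 opprD addNKr mulN1r normrN.
by rewrite gtr0_norm// invr_gt0 ltr0n.
Qed.

Lemma near_sign (T : topologicalType) (g : T -> R) x : {for x, continuous g} ->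
  g x != 0 -> \forall y \near x, (0 < g y) = (0 < g x).
Proof.
move=> cg; rewrite neq_lt => /orP[gx|gx].
  apply: filterS (cvgr_lt (g x) cg 0 gx) => y gy.
  by rewrite !ltNge (ltW gy) (ltW gx).
by apply: filterS (cvgr_gt (g x) cg 0 gx) => y ->.
Qed.

(** In a fine sampling each step either keeps the sign of the second coordinate or starts where the
    first one is not positive, so no step counts. *)
Lemma parity_off_right u : continuous u ->
  (forall t, 0 <= t <= 1 -> off_right (u t)) ->
  exists N, forall n, (N <= n)%N -> parity n u = false.
Proof.
move=> cu Hu.
pose P (A : set R) := (exists b : bool, forall y, A y -> (0 < (u y).2) = b) \/
  (forall y, A y -> (0 < (u y).1) = false).
have c1 x : {for x, continuous (fun y => (u y).1)}.
  by apply: cvg_comp (cu x) _; exact: cvg_fst.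
have c2 x : {for x, continuous (fun y => (u y).2)}.
  by apply: cvg_comp (cu x) _; exact: cvg_snd.
have [A B AB [[b Hb]|Hb]||x|N HN] := @lebesgue_number R `[0, 1] P.
- by left; exists b => y /AB; exact: Hb.
- by right => y /AB; exact: Hb.
- exact: segment_compact.
- rewrite /= in_itv /= => /Hu[h|h].
    have /nbhs_ballP[e e0 He] := near_sign (@c2 x) h.
    by exists e => //; left; exists (0 < (u x).2) => y /He.
  have /nbhs_ballP[e e0 He] := near_sign (@c1 x) (ltr0_neq0 h).
  by exists e => //; right => y /He ->; rewrite ltNge ltW.
(* The sampling has [n.+1] steps, strictly shorter than the radius [1/n] at which [P] holds; the two
   extra units ensure [N <= n.-1] and [0 < n]. *)
exists N.+2 => -[//|n] Nn; rewrite /parity big1// => i _.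
have n1 : (n.+1%:R^-1 : R) < n.-1.+1%:R^-1.
  rewrite ltf_pV2 ?posrE ?ltr0n// ltr_nat prednK//; by case: n Nn {i}.
have := HN n.-1 _ (i%:R / n.+1%:R) _; case.
- by case: n Nn {i n1}.
- by rewrite /= in_itv /=; apply: unit_grid => //; apply: ltnW.
- case=> b Hb; rewrite /crosses !Hb ?addbb//; [exact: grid_step|].
  by apply: ballxx; rewrite invr_gt0 ltr0n.
- move=> Hb; rewrite /crosses Hb ?andbF//.
  by apply: ballxx; rewrite invr_gt0 ltr0n.
Qed.

Lemma addb_telescope (g : nat -> bool) n :
  \big[addb/false]_(i < n) (g i (+) g i.+1) = g 0%N (+) g n.
Proof.
elim: n => [|n IH]; first by rewrite big_ord0 addbb.
by rewrite big_ord_recr /= IH addbA -(addbA (g 0%N)) addbb addbF.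
Qed.

(** Here every change of sign of the second coordinate happens where the first one is positive, so
    all of them count and the sum telescopes. *)
Lemma parity_off_left u : continuous u ->
  (forall t, 0 <= t <= 1 -> off_left (u t)) ->
  exists N, forall n, (N <= n)%N ->
    parity n u = (0 < (u 0).2) (+) (0 < (u 1).2).
Proof.
move=> cu Hu.
pose P (A : set R) := (exists b : bool, forall y, A y -> (0 < (u y).2) = b) \/
  (forall y, A y -> 0 < (u y).1).
have c1 x : {for x, continuous (fun y => (u y).1)}.
  by apply: cvg_comp (cu x) _; exact: cvg_fst.
have c2 x : {for x, continuous (fun y => (u y).2)}.
  by apply: cvg_comp (cu x) _; exact: cvg_snd.
have [A B AB [[b Hb]|Hb]||x|N HN] := @lebesgue_number R `[0, 1] P.
- by left; exists b => y /AB; exact: Hb.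
- by right => y /AB; exact: Hb.
- exact: segment_compact.
- rewrite /= in_itv /= => /Hu[h|h].
    have /nbhs_ballP[e e0 He] := near_sign (@c2 x) h.
    by exists e => //; left; exists (0 < (u x).2) => y /He.
  have /nbhs_ballP[e e0 He] := near_sign (@c1 x) (lt0r_neq0 h).
  by exists e => //; right => y /He ->.
exists N.+2 => -[//|n] Nn.
have n1 : (n.+1%:R^-1 : R) < n.-1.+1%:R^-1.
  rewrite ltf_pV2 ?posrE ?ltr0n// ltr_nat prednK//; by case: n Nn.
have := addb_telescope (fun i => 0 < (u (i%:R / n.+1%:R)).2) n.+1.
rewrite mul0r divff ?pnatr_eq0// => <-.
rewrite /parity; apply: eq_bigr => i _.
have := HN n.-1 _ (i%:R / n.+1%:R) _; case.
- by case: n Nn {i n1}.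
- by rewrite /= in_itv /=; apply: unit_grid => //; apply: ltnW.
- case=> b Hb; rewrite /crosses !Hb ?addbb//; [exact: grid_step|].
  by apply: ballxx; rewrite invr_gt0 ltr0n.
- move=> Hb; rewrite /crosses Hb ?andbT//.
  by apply: ballxx; rewrite invr_gt0 ltr0n.
Qed.

(* Each small cell has an even number of crossings: on it either the sign of
   the second coordinate or that of the first one is constant. *)
Lemma parity_square (Phi : R * R -> R * R) : continuous Phi ->
  (forall s t, 0 <= s <= 1 -> 0 <= t <= 1 -> Phi (s, t) != 0) ->
  exists N, forall n, (N <= n)%N ->
    parity n (fun s => Phi (s, 0)) (+) parity n (fun s => Phi (s, 1)) =
    parity n (fun t => Phi (0, t)) (+) parity n (fun t => Phi (1, t)).
Proof.
move=> cu Hu.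
pose P (A : set (R * R)) := (exists b : bool, forall y, A y -> (0 < (Phi y).2) = b) \/
  (exists b : bool, forall y, A y -> (0 < (Phi y).1) = b).
have c1 x : {for x, continuous (fun y => (Phi y).1)}.
  by apply: cvg_comp (cu x) _; exact: cvg_fst.
have c2 x : {for x, continuous (fun y => (Phi y).2)}.
  by apply: cvg_comp (cu x) _; exact: cvg_snd.
have [A B AB [[b Hb]|[b Hb]]||x|N HN] := @lebesgue_number (R * R)%type (`[0, 1]%classic `*` `[0, 1]%classic) P.
- by left; exists b => y /AB; exact: Hb.
- by right; exists b => y /AB; exact: Hb.
- by apply: compact_setX; exact: segment_compact.
- case: x => s t [] /=; rewrite !in_itv /= => s01 t01.
  have [h|h] := eqVneq (Phi (s, t)).2 0; last first.
    have /nbhs_ballP[e e0 He] := near_sign (@c2 (s, t)) h.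
    by exists e => //; left; exists (0 < (Phi (s, t)).2) => y /He.
  have h1 : (Phi (s, t)).1 != 0.
    apply: contra (Hu s t s01 t01) => /eqP h1.
    by rewrite (surjective_pairing (Phi (s, t))) h1 h.
  have /nbhs_ballP[e e0 He] := near_sign (@c1 (s, t)) h1.
  by exists e => //; right; exists (0 < (Phi (s, t)).1) => y /He.
exists N.+2 => -[//|n] Nn.
have n1 : (n.+1%:R^-1 : R) < n.-1.+1%:R^-1.
  rewrite ltf_pV2 ?posrE ?ltr0n// ltr_nat prednK//; by case: n Nn.
have n0 : 0 < (n.-1.+1%:R^-1 : R) by rewrite invr_gt0 ltr0n.
pose x i : R := i%:R / n.+1%:R.
pose h i j := crosses (Phi (x i, x j)) (Phi (x i.+1, x j)).
pose w i j := crosses (Phi (x i, x j)) (Phi (x i, x j.+1)).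
have cell i j : (i < n.+1)%N -> (j < n.+1)%N ->
    h i j (+) h i j.+1 = w i j (+) w i.+1 j.
  move=> lin ljn.
  have Bs k l : (k = i \/ k = i.+1) -> (l = j \/ l = j.+1) ->
      ball (x i, x j) n.-1.+1%:R^-1 (x k, x l).
    by move=> [->|->] [->|->]; split => /=; try exact: ballxx; exact: grid_step.
  have := HN n.-1 _ (x i, x j) _; case.
  - by case: n Nn {n1 n0 x h w lin ljn Bs}.
  - by split; rewrite /= in_itv /=; apply: unit_grid => //; apply: ltnW.
  - case=> b Hb; rewrite /h /w /crosses.
    by rewrite !Hb ?addbb//; apply: Bs; by [left|right].
  - case=> b Hb; rewrite /h /w /crosses.
    rewrite !Hb ?addbb//; try (by apply: Bs; by [left|right]).
    case: b {Hb}; rewrite ?andbT ?andbF//.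
    by do 4 case: (0 < _).
have rows j : (j <= n.+1)%N ->
    \big[addb/false]_(i < n.+1) h i 0%N (+) \big[addb/false]_(i < n.+1) h i j =
    \big[addb/false]_(k < j) w 0%N k (+) \big[addb/false]_(k < j) w n.+1 k.
  elim: j => [|j IH] jn; first by rewrite addbb !big_ord0.
  rewrite !(big_ord_recr j) /= addbACA -IH; last exact: ltnW.
  have -> : w 0%N j (+) w n.+1 j =
      \big[addb/false]_(i < n.+1) (h i j (+) h i j.+1).
    by rewrite -(addb_telescope (w^~ j)); apply: eq_bigr => i _; rewrite cell.
  rewrite big_split /= -!addbA; congr addb.
  by rewrite addbA addbb.
have := rows n.+1 (leqnn _).
rewrite /parity /h /w.
have x0 : x 0%N = 0 by rewrite /x mul0r.
have x1 : x n.+1 = 1 by rewrite /x divff ?pnatr_eq0.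
by rewrite x0 x1 => ->.
Qed.

(** The term added to the parity compensates for the motion of the right end: while that end avoids
    the left half-axis, its crossings amount to its change of side ([parity_off_left]). *)
Definition homotopic_rows u v : Prop :=
  exists N, forall n, (N <= n)%N ->
    parity n u (+) (0 < (u 1).2) = parity n v (+) (0 < (v 1).2).

Lemma homotopic_rows_trans v u w :
  homotopic_rows u v -> homotopic_rows v w -> homotopic_rows u w.
Proof.
move=> [N HN] [M HM]; exists (maxn N M) => n; rewrite geq_max => /andP[a b].
by rewrite HN// HM.
Qed.

Lemma homotopic_rows_refl u : homotopic_rows u u.
Proof. by exists 0%N. Qed.

Lemma homotopic_rows_square (Phi : R * R -> R * R) : continuous Phi ->
  (forall s t, 0 <= s <= 1 -> 0 <= t <= 1 -> Phi (s, t) != 0) ->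
  (forall t, 0 <= t <= 1 -> off_right (Phi (0, t))) ->
  (forall t, 0 <= t <= 1 -> off_left (Phi (1, t))) ->
  homotopic_rows (fun s => Phi (s, 0)) (fun s => Phi (s, 1)).
Proof.
move=> cP nz Hl Hr.
have cl c : continuous (fun t => Phi (c, t)).
  exact: (cont_comp (cont_pair (@cont_cst R R c) (@cont_id R)) cP).
have [N0 H0] := parity_square cP nz.
have [N1 H1] := parity_off_right (@cl 0) Hl.
have [N2 H2] := parity_off_left (@cl 1) Hr.
exists (maxn N0 (maxn N1 N2)) => n; rewrite !geq_max => /and3P[n0 n1 n2].
have := H0 n n0; rewrite H1// H2// addFb.
by case: (parity _ _); case: (parity _ _); case: (0 < _); case: (0 < _).
Qed.
End parity.

(** * Homotopies of arcs around an orbit *)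

Section step.
Context {R : realType}.
Implicit Types (M : (R * R) * (R * R)) (z w P : R * R).

(** A matrix is a pair of rows; locking keeps simplification from expanding the product. *)
Definition mx M z : R * R := locked
  (M.1.1 * z.1 + M.1.2 * z.2, M.2.1 * z.1 + M.2.2 * z.2).

Lemma mxE M z : mx M z = (M.1.1 * z.1 + M.1.2 * z.2, M.2.1 * z.1 + M.2.2 * z.2).
Proof. by rewrite /mx -lock. Qed.

Definition det M : R := M.1.1 * M.2.2 - M.1.2 * M.2.1.

Lemma mx_inj0 M z : det M != 0 -> mx M z = 0 -> z = 0.
Proof.
rewrite mxE => dM [e1 e2]; have h1 : det M * z.1 = 0.
  transitivity (M.2.2 * (M.1.1 * z.1 + M.1.2 * z.2) - M.1.2 * (M.2.1 * z.1 + M.2.2 * z.2)).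
    by rewrite /det; ring.
  by rewrite e1 e2 !mulr0 subr0.
have h2 : det M * z.2 = 0.
  transitivity (M.1.1 * (M.2.1 * z.1 + M.2.2 * z.2) - M.2.1 * (M.1.1 * z.1 + M.1.2 * z.2)).
    by rewrite /det; ring.
  by rewrite e1 e2 !mulr0 subr0.
rewrite [z]surjective_pairing; congr pair; apply/eqP.
  by move/eqP: h1; rewrite mulf_eq0 (negbTE dM).
by move/eqP: h2; rewrite mulf_eq0 (negbTE dM).
Qed.

Lemma mx_cont M : continuous (mx M).
Proof.
rewrite (_ : mx M = fun z => (M.1.1 * z.1 + M.1.2 * z.2, M.2.1 * z.1 + M.2.2 * z.2)).
  2: by apply/funext => z; rewrite mxE.
apply: (cont_pair (f := fun z => M.1.1 * z.1 + M.1.2 * z.2) (g := fun z => M.2.1 * z.1 + M.2.2 * z.2)).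
  apply: cont_add; apply: cont_mul; solve [exact: cont_cst|exact: cfst|exact: csnd].
by apply: cont_add; apply: cont_mul; solve [exact: cont_cst|exact: cfst|exact: csnd].
Qed.

Lemma row_bound (f : R -> R * R) : continuous f ->
  (forall s, 0 <= s <= 1 -> f s != 0) ->
  exists2 m : R, 0 < m & forall s, 0 <= s <= 1 -> m <= (f s).1 ^+ 2 + (f s).2 ^+ 2.
Proof.
move=> cf nz; pose g s := (f s).1 ^+ 2 + (f s).2 ^+ 2.
have cg : continuous g.
  by apply: cont_add; apply: cont_mul; solve [exact: cont_fst|exact: cont_snd].
have [c c01 Hc] := @EVT_min R g 0 1 ler01 (continuous_subspaceT cg).
have fc : f c != 0 by apply: nz; move: c01; rewrite in_itv.
exists (g c); last by move=> s s01; apply: Hc; rewrite in_itv.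
rewrite lt_neqAle addr_ge0 ?sqr_ge0// andbT eq_sym paddr_eq0 ?sqr_ge0// !sqrf_eq0.
apply: contra fc => /andP[/eqP h1 /eqP h2].
by rewrite [f c]surjective_pairing h1 h2.
Qed.

(** The margins absorb one application of a map that is, up to errors [C], a shear of slope at most
    [|ka|]: where [|f.2| <= C], shear and error together move the first coordinate by at most
    [(1 + |ka|) C]. *)
Definition safe_left (C ka : R) (f : R * R) : Prop :=
  C < `|f.2| \/ f.1 < - ((1 + `|ka|) * C).
Definition safe_right (C ka : R) (f : R * R) : Prop :=
  C < `|f.2| \/ (1 + `|ka|) * C < f.1.

Lemma safe_left_off C ka f a b e1 e2 : 0 <= C -> 1 <= a -> `|b| <= a * `|ka| ->
  `|e1| <= C -> `|e2| <= C -> safe_left C ka f ->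
  off_right (a * f.1 + b * f.2 + e1, a * f.2 + e2).
Proof.
move=> C0 a1 bk e1C e2C; have [Cf _|fC [|]] := ltP C `|f.2|.
- left => /=; apply/eqP => h.
  have h2 : a * `|f.2| <= C.
    have <- : `|a * f.2| = a * `|f.2| by rewrite normrM ger0_norm//; lra.
    by rewrite (_ : a * f.2 = - e2) ?normrN//; lra.
  nra.
- by rewrite ltNge fC.
- move=> f1; right => /=.
  have hb : b * f.2 <= a * `|ka| * C.
    apply: le_trans (ler_norm _) _; rewrite normrM.
    by apply: ler_pM.
  have he : e1 <= C by apply: le_trans (ler_norm _) _.
  have : a * f.1 < a * (- ((1 + `|ka|) * C)) by rewrite ltr_pM2l//; lra.
  nra.
Qed.

Lemma safe_right_off C ka f a b e1 e2 : 0 <= C -> 1 <= a -> `|b| <= a * `|ka| ->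
  `|e1| <= C -> `|e2| <= C -> safe_right C ka f ->
  off_left (a * f.1 + b * f.2 + e1, a * f.2 + e2).
Proof.
move=> C0 a1 bk e1C e2C sf.
have := @safe_left_off C ka (- f.1, - f.2) a b (- e1) (- e2) C0 a1 bk.
rewrite !normrN => /(_ e1C e2C) [|/=|/=].
- by case: sf => h; [left; rewrite normrN|right; rewrite ltrN2].
- by rewrite mulrN -opprD oppr_eq0; left.
- by rewrite !mulrN -!opprD oppr_lt0; right.
Qed.

Variables (F : R * R -> R * R) (M : (R * R) * (R * R)) (C ka : R).
Hypotheses (contF : continuous F) (injF : injective F) (dM : det M != 0).
Hypothesis quasi : forall P w,
  `|(mx M (F (P + w) - F P)).1 - ((mx M w).1 + ka * (mx M w).2)| <= C /\
  `|(mx M (F (P + w) - F P)).2 - (mx M w).2| <= C.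

Let C0 : 0 <= C.
Proof. by have [] := quasi 0 0; move=> h _; apply: le_trans (normr_ge0 _) h. Qed.

Lemma mxZ r z : mx M (r *: z) = (r * (mx M z).1, r * (mx M z).2).
Proof. by rewrite !mxE /=; congr pair; rewrite /GRing.scale /=; ring. Qed.

(* The map F is homotopic to its linear part on the complement of P through
   w |-> (F (P + r w) - F P) / r, for r from 1 to infinity. *)
Lemma homotopic_rows_step (g : R -> R * R) P : continuous g ->
  (forall s, 0 <= s <= 1 -> g s != P) ->
  safe_left C ka (mx M (g 0 - P)) -> safe_right C ka (mx M (g 1 - P)) ->
  homotopic_rows (fun s => mx M (g s - P)) (fun s => mx M (F (g s) - F P)).
Proof.
move=> cg gP sl sr.
pose u s := g s - P.
have cu : continuous u by apply: cont_vsub => //; exact: cont_cst.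
have unz s : 0 <= s <= 1 -> mx M (u s) != 0.
  move=> s01; apply/eqP => /(mx_inj0 dM) /eqP; rewrite subr_eq0; apply/negP; exact: gP.
have cMu : continuous (fun s => mx M (u s)) by exact: cont_comp cu (@mx_cont M).
have [m m0 Hm] := row_bound cMu unz.
pose K := (1 + `|ka|) * C.
have K0 : 0 <= K by rewrite mulr_ge0// addr_ge0.
(* A zero of the straight-line homotopy below would give [r |f1| <= K] and [r |f2| <= K], hence
   [r (f1^2 + f2^2) <= 2 K^2 < r m], against the lower bound [m] on the row. *)
pose r := 1 + 2 * K ^+ 2 / m.
have r1 : 1 <= r by rewrite lerDl divr_ge0 ?mulr_ge0 ?sqr_ge0// ltW.
have rm : 2 * K ^+ 2 < r * m.
  by rewrite /r [ltRHS]mulrDl divfK ?lt0r_neq0// mul1r ltrDr.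
have expd a s : exists e1 e2, [/\ `|e1| <= C, `|e2| <= C &
    mx M (F (P + a *: u s) - F P) =
    (a * (mx M (u s)).1 + a * ka * (mx M (u s)).2 + e1, a * (mx M (u s)).2 + e2)].
  have [h1 h2] := quasi P (a *: u s); move: h1 h2.
  rewrite mxZ /=; move: (mx M (_ - _)) (mx M (u s)) => X f h1 h2.
  exists (X.1 - (a * f.1 + ka * (a * f.2))), (X.2 - a * f.2).
  split; [exact: h1|exact: h2|]; case: X {h1 h2} => X1 X2 /=; congr pair; ring.
have aka a : 1 <= a -> `|a * ka| <= a * `|ka|.
  by move=> a1; rewrite normrM ger0_norm//; lra.
(* The detour through scale [r]: the straight-line homotopy to it has no zero because the linear
   part dominates there, and the return to scale 1 has none because [F] is injective. *)
apply: (@homotopic_rows_trans _ (fun s => mx M (F (P + r *: u s) - F P))).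
  pose Phi (x : R * R) := (1 - x.2) *: mx M (u x.1) + x.2 *: mx M (F (P + r *: u x.1) - F P).
  have cPhi : continuous Phi.
    apply: cont_vadd; apply: cont_vscale.
    - by apply: cont_sub; [exact: cont_cst|exact: csnd].
    - exact: cont_comp cfst cMu.
    - exact: csnd.
    - apply: cont_comp (@mx_cont M); apply: cont_vsub; last exact: cont_cst.
      apply: cont_comp contF; apply: cont_vadd; first exact: cont_cst.
      apply: cont_vscale; first exact: cont_cst.
      exact: cont_comp cfst cu.
  have PhiE s t : 0 <= t <= 1 -> exists a b e1 e2, [/\ 1 <= a, t * r <= a, `|b| <= a * `|ka|,
      `|e1| <= t * C /\ `|e2| <= t * C &
      Phi (s, t) = (a * (mx M (u s)).1 + b * (mx M (u s)).2 + e1, a * (mx M (u s)).2 + e2)].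
    move=> /andP[t0 t1]; have [e1 [e2 [h1 h2 h3]]] := expd r s.
    exists (1 - t + t * r), (t * r * ka), (t * e1), (t * e2); split; last 1 first.
    - rewrite /Phi /= h3; congr pair; rewrite /GRing.scale /=; rewrite -?[_ *: _]/(_ * _); ring.
    - by nra.
    - by lra.
    - rewrite !normrM (ger0_norm t0) (@ger0_norm _ r); last lra.
      by apply: ler_wpM2r => //; lra.
    - by rewrite !normrM (ger0_norm t0); split; apply: ler_wpM2l.
  have := @homotopic_rows_square _ Phi cPhi; rewrite /Phi /=.
  under [X in homotopic_rows X]eq_fun do rewrite subr0 scale1r scale0r addr0.
  under [X in homotopic_rows _ X]eq_fun do rewrite subrr scale0r scale1r add0r.
  apply.
  - move=> s t s01 t01; apply/eqP.
    have [a [b [e1 [e2 [a1 ta bk [h1 h2]]]]]] := PhiE s t t01.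
    rewrite -/(Phi (s, t)) => -> [E1 E2].
    move: (Hm s s01); rewrite leNgt => /negP; apply.
    set f1 := (mx M (u s)).1 in E1 E2 *; set f2 := (mx M (u s)).2 in E1 E2 *.
    have a0 : 0 < a by lra.
    have t0 : 0 <= t by case/andP: t01.
    have hf2 : r * `|f2| <= C.
      rewrite -(ler_pM2l a0).
      have -> : a * (r * `|f2|) = r * `|a * f2| by rewrite normrM (gtr0_norm a0); ring.
      rewrite (_ : a * f2 = - e2) ?normrN; last lra.
      apply: (@le_trans _ _ (r * (t * C))); first by apply: ler_wpM2l => //; lra.
      by rewrite mulrA; apply: ler_wpM2r => //; rewrite mulrC.
    have hf1 : r * `|f1| <= K.
      rewrite -(ler_pM2l a0).
      have -> : a * (r * `|f1|) = r * `|a * f1| by rewrite normrM (gtr0_norm a0); ring.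
      rewrite (_ : a * f1 = - (b * f2 + e1)) ?normrN; last lra.
      apply: (@le_trans _ _ (r * (a * `|ka| * `|f2| + t * C))).
        apply: ler_wpM2l; first lra.
        apply: le_trans (ler_normD _ _) _; apply: lerD => //.
        by rewrite normrM; apply: ler_wpM2r.
      have q1 : r * (a * `|ka| * `|f2|) <= a * `|ka| * C.
        rewrite mulrCA; apply: ler_wpM2l => //.
        by rewrite mulr_ge0// ltW.
      have q2 : r * (t * C) <= a * C.
        by rewrite mulrA; apply: ler_wpM2r => //; rewrite mulrC.
      by rewrite /K; lra.
    have hf2' : r * `|f2| <= K by apply: le_trans hf2 _; rewrite /K mulrDl mul1r lerDl mulr_ge0.
    have sq f : r * `|f| <= K -> r * f ^+ 2 <= K ^+ 2.
      move=> h; apply: (@le_trans _ _ ((r * `|f|) ^+ 2)).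
        rewrite exprMn -[f ^+ 2]real_normK ?num_real//; apply: ler_wpM2r; first exact: sqr_ge0.
        by rewrite expr2; nra.
      by rewrite ler_pXn2r ?nnegrE// mulr_ge0//; lra.
    have := sq _ hf1; have := sq _ hf2' => q1 q2.
    rewrite -(@ltr_pM2l _ r); last lra.
    by apply: le_lt_trans rm; lra.
  - move=> t t01; have [a [b [e1 [e2 [a1 ta bk [h1 h2]]]]]] := PhiE 0 t t01.
    rewrite -/(Phi (0, t)) => ->.
    have tC : t * C <= C by case/andP: t01 => t0 t1; rewrite ler_piMl.
    by apply: (@safe_left_off C ka) => //; [exact: le_trans h1 _|exact: le_trans h2 _].
  - move=> t t01; have [a [b [e1 [e2 [a1 ta bk [h1 h2]]]]]] := PhiE 1 t t01.
    rewrite -/(Phi (1, t)) => ->.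
    have tC : t * C <= C by case/andP: t01 => t0 t1; rewrite ler_piMl.
    by apply: (@safe_right_off C ka) => //; [exact: le_trans h1 _|exact: le_trans h2 _].
pose rho (t : R) := r + (1 - r) * t.
pose Phi (x : R * R) := mx M (F (P + rho x.2 *: u x.1) - F P).
have rho1 t : 0 <= t <= 1 -> 1 <= rho t by move=> /andP[t0 t1]; rewrite /rho; nra.
have rho_1 : rho 1 = 1 by rewrite /rho; ring.
have cPhi : continuous Phi.
  apply: cont_comp (@mx_cont M); apply: cont_vsub; last exact: cont_cst.
  apply: cont_comp contF; apply: cont_vadd; first exact: cont_cst.
  apply: cont_vscale; last exact: cont_comp cfst cu.
  apply: cont_add; first exact: cont_cst.
  by apply: cont_mul; [exact: cont_cst|exact: csnd].
have := @homotopic_rows_square _ Phi cPhi; rewrite /Phi /=.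
under [X in homotopic_rows X]eq_fun do rewrite /rho mulr0 addr0.
under [X in homotopic_rows _ X]eq_fun do rewrite rho_1 scale1r /u [P + _]addrC subrK.
apply.
- move=> s t s01 t01; apply/eqP => /(mx_inj0 dM) /eqP; rewrite subr_eq0 => /eqP /injF /eqP.
  rewrite -subr_eq0 addrC addKr scaler_eq0 subr_eq0 => /orP[/eqP h|]; last exact/negP/gP.
  by have := rho1 t t01; rewrite h ler10.
- move=> t t01; have [e1 [e2 [h1 h2 ->]]] := expd (rho t) 0.
  by apply: (@safe_left_off C ka) => //; [exact: rho1|exact/aka/rho1].
- move=> t t01; have [e1 [e2 [h1 h2 ->]]] := expd (rho t) 1.
  by apply: (@safe_right_off C ka) => //; [exact: rho1|exact/aka/rho1].
Qed.
End step.

Section rows.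
Context {R : realType}.
Implicit Types (D : set (R * R)) (p q z P : R * R) (g h u v : R -> R * R).

Definition path_in D g a b : Prop :=
  [/\ continuous g, forall s, D (g s), g 0 = a & g 1 = b].

Definition pathconn D : Prop := forall a b, D a -> D b -> exists g, path_in D g a b.

Definition paths_homotopic D : Prop := forall a b g h,
  path_in D g a b -> path_in D h a b ->
  exists Phi : R * R -> R * R, [/\ continuous Phi,
    forall s t, 0 <= s <= 1 -> 0 <= t <= 1 -> D (Phi (s, t)),
    forall s, 0 <= s <= 1 -> Phi (s, 0) = g s /\ Phi (s, 1) = h s &
    forall t, 0 <= t <= 1 -> Phi (0, t) = a /\ Phi (1, t) = b].

Definition iterz (F Fi : R * R -> R * R) (t : int) : R * R -> R * R :=
  match t with Posz n => iter n F | Negz n => iter n.+1 Fi end.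

Section iterz.
Variables (F Fi : R * R -> R * R).
Hypotheses (FK : cancel F Fi) (FiK : cancel Fi F).

Lemma iterzS t z : iterz F Fi (t + 1) z = F (iterz F Fi t z).
Proof.
case: t => [n|[|n]].
- by rewrite (_ : n%:Z + 1 = n.+1%:Z) // -addn1 PoszD.
- by rewrite NegzE addNr /= FiK.
- rewrite (_ : Negz n.+1 + 1 = Negz n); first by rewrite /= FiK.
  by rewrite !NegzE -[n.+2]addn1 PoszD opprD subrK.
Qed.

Lemma iterzD s t z : iterz F Fi (s + t) z = iterz F Fi s (iterz F Fi t z).
Proof.
elim/int_ind: s => [|n IH|n IH]; first by rewrite add0r.
  have -> : n.+1%:Z + t = (n%:Z + t) + 1 by rewrite -addn1 PoszD; ring.
  by rewrite iterzS IH -iterzS -addn1 PoszD.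
apply: (can_inj FK); rewrite -!iterzS.
have -> : - n.+1%:Z + t + 1 = - n%:Z + t by rewrite -addn1 PoszD; ring.
have -> : - n.+1%:Z + 1 = - n%:Z by rewrite -addn1 PoszD; ring.
exact: IH.
Qed.

Lemma iterz_cont t : continuous F -> continuous Fi -> continuous (iterz F Fi t).
Proof.
move=> cF cFi; case: t => [n|n].
  by elim: n => [|n IH]; [exact: cont_id|exact: cont_comp IH cF].
by elim: n => [|n IH]; [exact: cFi|exact: cont_comp IH cFi].
Qed.

Lemma iterz_inj t : injective (iterz F Fi t).
Proof.
case: t => [n|n]; first by elim: n => [|n IH] a b // /(can_inj FK) /IH.
by elim: n => [|n IH] a b; [move=> /(can_inj FiK)|move=> /(can_inj FiK) /IH].
Qed.

End iterz.

(** The shapes of a whole row for which no step can count as a crossing. *)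
Definition one_sided u : Prop :=
  [\/ forall s, 0 < (u s).2, forall s, (u s).2 < 0 | forall s, (u s).1 < 0].

Lemma parity_one_sided u n : one_sided u -> parity n u = false.
Proof.
move=> H; rewrite /parity big1// => i _; rewrite /crosses.
case: H => H; first by rewrite !H addbb.
  by rewrite !(ltNge 0) !(ltW (H _)).
by rewrite [0 < (u _).1]ltNge (ltW (H _)) andbF.
Qed.

Lemma one_sided_contra u v : homotopic_rows u v -> one_sided u -> one_sided v ->
  0 < (u 1).2 -> (v 1).2 <= 0 -> False.
Proof.
move=> [N /(_ N (leqnn N))] + Hu Hv u0 v0.
by rewrite !parity_one_sided// u0 ltNge v0.
Qed.

Lemma homotopic_rows_ext u u' v v' :
  (forall s, 0 <= s <= 1 -> u s = u' s) -> (forall s, 0 <= s <= 1 -> v s = v' s) ->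
  homotopic_rows u v -> homotopic_rows u' v'.
Proof.
have par_ext n (f f' : R -> R * R) : (0 < n)%N ->
    (forall s, 0 <= s <= 1 -> f s = f' s) -> parity n f = parity n f'.
  move=> n0 H; apply: eq_bigr => i _; rewrite !H//; apply: unit_grid => //.
  exact: ltnW.
move=> Hu Hv [N HN]; exists N.+1 => n Nn; have n0 : (0 < n)%N by case: n Nn.
have i1 : 0 <= (1 : R) <= 1 by rewrite ler01 lexx.
rewrite -(par_ext n u u' n0 Hu) -(par_ext n v v' n0 Hv) -(Hu 1 i1) -(Hv 1 i1).
by apply: HN; exact: ltnW.
Qed.

Variables (F Fi : R * R -> R * R) (M : (R * R) * (R * R)) (C ka : R).
Hypotheses (contF : continuous F) (contFi : continuous Fi).
Hypotheses (FK : cancel F Fi) (FiK : cancel Fi F) (dM : det M != 0).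
Hypothesis quasi : forall P w,
  `|(mx M (F (P + w) - F P)).1 - ((mx M w).1 + ka * (mx M w).2)| <= C /\
  `|(mx M (F (P + w) - F P)).2 - (mx M w).2| <= C.

Local Notation it := (iterz F Fi).
Local Notation rel t z P := (mx M (it t z - it t P)).

(* If, in the frame of the orbit of P, the orbit of p stays away from the right
   half of the first axis and the orbit of q from the left half, an arc from p to
   q which starts on one side of P cannot end on the other side. *)
Lemma no_crossing D p q P (ta tb : int) :
  pathconn D -> D p -> D q -> ~ D P -> ta <= tb ->
  (forall t, ta <= t -> t < tb -> safe_left C ka (rel t p P)) ->
  (forall t, ta <= t -> t < tb -> safe_right C ka (rel t q P)) ->
  ((forall z, D z -> 0 < (rel ta z P).2) \/ (forall z, D z -> (rel ta z P).1 < 0)) ->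
  0 < (rel ta q P).2 ->
  ((forall z, D z -> (rel tb z P).2 < 0) \/ (forall z, D z -> (rel tb z P).1 < 0)) ->
  (rel tb q P).2 <= 0 -> False.
Proof.
move=> cD Dp Dq nP tab sl sr ca qa cb qb.
have [g [cg Dg g0 g1]] := cD _ _ Dp Dq.
pose row t s := rel t (g s) P.
have chain (n : nat) : ta + n%:Z <= tb -> homotopic_rows (row ta) (row (ta + n%:Z)).
  elim: n => [|n IH] ntb; first by rewrite addr0; exact: homotopic_rows_refl.
  have nt : ta + n%:Z < tb by rewrite -addn1 PoszD addrA lezD1 in ntb.
  apply: (homotopic_rows_trans (IH (ltW nt))).
  have -> : ta + n.+1%:Z = (ta + n%:Z) + 1 by rewrite -addn1 PoszD addrA.
  have lt : ta <= ta + n%:Z by rewrite lerDl.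
  have := @homotopic_rows_step _ F M C ka contF (can_inj FK) dM quasi
    (fun s => it (ta + n%:Z) (g s)) (it (ta + n%:Z) P).
  rewrite g0 g1 /row; under [X in homotopic_rows _ X]eq_fun do rewrite -!iterzS//.
  apply.
  - exact: (cont_comp cg (@iterz_cont F Fi (ta + n%:Z) contF contFi)).
  - move=> s _; apply/eqP => /(iterz_inj FK FiK) gP; apply: nP; rewrite -gP; exact: Dg.
  - exact: sl.
  - exact: sr.
have tbE : ta + (absz (tb - ta)%R)%:Z = tb.
  by rewrite gez0_abs ?subr_ge0// addrC subrK.
have := chain (absz (tb - ta)%R); rewrite tbE => /(_ (lexx _)) H.
apply: (one_sided_contra H); rewrite /row ?g1//.
- by case: ca => h; [constructor 1|constructor 3] => s; apply: h.
- by case: cb => h; [constructor 2|constructor 3] => s; apply: h.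
Qed.

(* In the simply connected invariant D the arc may be replaced by any other arc
   with the same endpoints, so that its endpoints may be moved inside D. *)
Lemma homotopic_rows_jump D p (q q' : R * R) P g h sp sq :
  paths_homotopic D -> (forall z, D z -> D (F z)) -> ~ D P -> ~ D (F P) ->
  path_in D g p q -> path_in D h p q' ->
  path_in D sp (F p) p -> path_in D sq (F q) q' ->
  safe_left C ka (mx M (p - P)) -> safe_right C ka (mx M (q - P)) ->
  (forall s, off_right (mx M (sp s - F P))) ->
  (forall s, off_left (mx M (sq s - F P))) ->
  homotopic_rows (fun s => mx M (g s - P)) (fun s => mx M (h s - F P)).
Proof.
move=> hD DF nP nFP [cg Dg g0 g1] [ch Dh h0 h1] [csp Dsp sp0 sp1] [csq Dsq sq0 sq1] sl sr osp osq.
have offz z : D z -> mx M (z - F P) != 0.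
  move=> Dz; apply/eqP => /(mx_inj0 dM)/eqP; rewrite subr_eq0 => /eqP zP.
  by apply: nFP; rewrite -zP.
(* The concatenation of [sp] reversed, [F o g] and [sq], each on one third. Written as a sum of
   clamped increments, it is continuous without any gluing. *)
pose k (y : R) := sp (clamp (1 - 3 * y)) + (F (g (clamp (3 * y - 1))) - F p) + (sq (clamp (3 * y - 2)) - F q).
have clin (a b : R) (f : R -> R * R) : continuous f -> continuous (fun y => f (clamp (a + b * y))).
  move=> cf; apply: cont_comp cf; apply: cont_comp clamp_cont.
  apply: cont_add; first exact: cont_cst.
  by apply: cont_mul; [exact: cont_cst|exact: cont_id].
have ck : continuous k.
  rewrite /k; apply: cont_vadd; first apply: cont_vadd.
  - under eq_fun do rewrite -mulNr; exact: clin.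
  - apply: cont_vsub; last exact: cont_cst.
    apply: cont_comp contF; under eq_fun do rewrite addrC; exact: clin.
  - apply: cont_vsub; last exact: cont_cst.
    under eq_fun do rewrite addrC; exact: clin.
have cl0 (x : R) : x <= 0 -> clamp x = 0.
  by move=> x0; rewrite /clamp (min_idPr _) ?(max_idPl _)// (le_trans x0).
have cl1 (x : R) : 1 <= x -> clamp x = 1.
  by move=> x1; rewrite /clamp (min_idPl _) ?(max_idPr _).
have k1 (y : R) : y <= 1/3 -> k y = sp (clamp (1 - 3 * y)).
  move=> y1; have e1 : 3 * y - 1 <= 0 by lra.
  have e2 : 3 * y - 2 <= 0 by lra.
  by rewrite /k (cl0 _ e1) (cl0 _ e2) g0 sq0 !subrr !addr0.
have k2 (y : R) : 1/3 <= y <= 2/3 -> k y = F (g (clamp (3 * y - 1))).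
  move=> y1; have e1 : 1 - 3 * y <= 0 by lra.
  have e2 : 3 * y - 2 <= 0 by lra.
  by rewrite /k (cl0 _ e1) (cl0 _ e2) sp0 sq0 subrr addr0 addrC subrK.
have k3 (y : R) : 2/3 <= y -> k y = sq (clamp (3 * y - 2)).
  move=> y1; have e1 : 1 - 3 * y <= 0 by lra.
  have e2 : 1 <= 3 * y - 1 by lra.
  by rewrite /k (cl0 _ e1) (cl1 _ e2) sp0 g1 [F p + _]addrC subrK addrC subrK.
have Dk (y : R) : D (k y).
  have [y1|y1] := leP y (1/3); first by rewrite k1.
  have [y2|y2] := leP y (2/3); first by rewrite k2 ?(ltW y1)//; exact: DF.
  by rewrite k3// ltW.
apply: (@homotopic_rows_trans _ (fun s => mx M (F (g s) - F P))).
  apply: (homotopic_rows_step contF (can_inj FK) dM quasi) => //; rewrite ?g0 ?g1//.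
  by move=> s _; apply/eqP => gP; apply: nP; rewrite -gP; exact: Dg.
apply: (@homotopic_rows_trans _ (fun s => mx M (k s - F P))).
  (* Widens the middle third to the whole interval; meanwhile the ends of the row travel along [sp]
     and [sq], which is where [osp] and [osq] are used. *)
  pose x (z : R * R) := (1 - z.2) / 3 + z.1 * (1 - 2 * ((1 - z.2) / 3)).
  have cx : continuous x.
    have c2 : continuous (fun z : R * R => (1 - z.2) / 3).
      apply: cont_mul; last exact: cont_cst.
      by apply: cont_sub; [exact: cont_cst|exact: csnd].
    apply: cont_add => //; apply: cont_mul; first exact: cfst.
    apply: cont_sub; first exact: cont_cst.
    by apply: cont_mul => //; exact: cont_cst.
  have := @homotopic_rows_square _ (fun z => mx M (k (x z) - F P)).
  rewrite /x /= => H; apply: homotopic_rows_ext (H _ _ _ _).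
  - move=> s /andP[s0 s1]; rewrite k2; last by lra.
    by rewrite clamp_id; [congr (mx M (F (g _) - _)); lra|lra].
  - by move=> s _; congr (mx M (k _ - _)); lra.
  - apply: cont_comp (@mx_cont _ M); apply: cont_vsub; last exact: cont_cst.
    exact: cont_comp cx ck.
  - by move=> s t _ _; exact: offz.
  - by move=> t /andP[t0 t1]; rewrite k1; [exact: osp|lra].
  - by move=> t /andP[t0 t1]; rewrite k3; [exact: osq|lra].
have kp : path_in D k p q'.
  have z3 : 0 <= (1 / 3 : R) by lra.
  have o3 : (2 / 3 : R) <= 1 by lra.
  have e1 : 1 <= 1 - 3 * 0 :> R by lra.
  have e2 : 1 <= 3 * 1 - 2 :> R by lra.
  by split; [|exact: Dk|rewrite k1// cl1|rewrite k3// cl1].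
have hp : path_in D h p q' by [].
have [Phi [cPhi DPhi Phi0 Phi1]] := hD _ _ _ _ kp hp.
have := @homotopic_rows_square _ (fun z => mx M (Phi z - F P)).
move=> H; apply: homotopic_rows_ext (H _ _ _ _).
- by move=> s /Phi0[-> _].
- by move=> s /Phi0[_ ->].
- by apply: cont_comp (@mx_cont _ M); apply: cont_vsub => //; exact: cont_cst.
- by move=> s t s01 t01; apply: offz; exact: DPhi.
- by move=> t /Phi1[-> _]; have := osp 1; rewrite sp1.
- by move=> t /Phi1[_ ->]; have := osq 1; rewrite sq1.
Qed.
End rows.

(** * Growth rates of displacements and steady orbits *)

Section euclid.
Context {R : realType}.
Implicit Types (z w : R * R) (c : R).

Definition dot z w : R := z.1 * w.1 + z.2 * w.2.
Definition nrm z : R := Num.sqrt (dot z z).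

Lemma scale1E c z : (c *: z).1 = c * z.1. Proof. by []. Qed.
Lemma scale2E c z : (c *: z).2 = c * z.2. Proof. by []. Qed.

Lemma fstB z w : (z - w).1 = z.1 - w.1. Proof. by []. Qed.
Lemma sndB z w : (z - w).2 = z.2 - w.2. Proof. by []. Qed.
Lemma fstD z w : (z + w).1 = z.1 + w.1. Proof. by []. Qed.
Lemma sndD z w : (z + w).2 = z.2 + w.2. Proof. by []. Qed.
Lemma fstN z : (- z).1 = - z.1. Proof. by []. Qed.
Lemma sndN z : (- z).2 = - z.2. Proof. by []. Qed.
Definition pairE := (scale1E, scale2E, fstB, sndB, fstD, sndD, fstN, sndN).

Lemma veq z w : z.1 = w.1 -> z.2 = w.2 -> z = w.
Proof. by move=> h1 h2; rewrite [z]surjective_pairing [w]surjective_pairing h1 h2. Qed.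

Lemma dot_ge0 z : 0 <= dot z z.
Proof. by rewrite /dot -!expr2 addr_ge0// sqr_ge0. Qed.

Lemma nrm_ge0 z : 0 <= nrm z.
Proof. exact: sqrtr_ge0. Qed.

Lemma nrm_sq z : nrm z ^+ 2 = dot z z.
Proof. by rewrite sqr_sqrtr// dot_ge0. Qed.

Lemma nrm_le z c : 0 <= c -> dot z z <= c ^+ 2 -> nrm z <= c.
Proof. by move=> c0 h; rewrite -(ger0_norm c0) -sqrtr_sqr /nrm ler_sqrt ?sqr_ge0. Qed.

Lemma dot_le z w : dot z w <= nrm z * nrm w.
Proof.
have [h|h] := leP (dot z w) 0; first by rewrite (le_trans h)// mulr_ge0// nrm_ge0.
rewrite -ler_sqr ?nnegrE ?(ltW h) ?mulr_ge0 ?nrm_ge0// exprMn !nrm_sq /dot.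
have := sqr_ge0 (z.1 * w.2 - z.2 * w.1); nra.
Qed.

Lemma dotNl z w : dot (- z) w = - dot z w.
Proof. by rewrite /dot !pairE; ring. Qed.

Lemma dotD z w : dot (z + w) (z + w) = dot z z + 2 * dot z w + dot w w.
Proof. by rewrite /dot /=; ring. Qed.

Lemma nrmD z w : nrm (z + w) <= nrm z + nrm w.
Proof.
apply: nrm_le; first by rewrite addr_ge0 ?nrm_ge0.
by rewrite dotD sqrrD !nrm_sq; have := dot_le z w; rewrite -mulr_natl; lra.
Qed.

Lemma nrmN z : nrm (- z) = nrm z.
Proof. by rewrite /nrm /dot /= !mulrNN. Qed.

Lemma nrmB z w : nrm (z - w) <= nrm z + nrm w.
Proof. by rewrite -(nrmN w); exact: nrmD. Qed.

Lemma nrmC z w : nrm (z - w) = nrm (w - z).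
Proof. by rewrite -nrmN opprB. Qed.

Lemma nrm0 : nrm 0 = 0.
Proof. by rewrite /nrm /dot /= mulr0 addr0 sqrtr0. Qed.

Lemma nrmZ c z : nrm (c *: z) = `|c| * nrm z.
Proof.
have e : dot (c *: z) (c *: z) = c ^+ 2 * dot z z.
  by rewrite /dot !scale1E !scale2E; ring.
by rewrite /nrm e sqrtrM ?sqr_ge0// sqrtr_sqr.
Qed.

Lemma nrm_tri z w x : nrm (z - x) <= nrm (z - w) + nrm (w - x).
Proof. by rewrite -[z - x](subrKA w) nrmD. Qed.

Lemma nrm_fst z : `|z.1| <= nrm z.
Proof.
rewrite /nrm -sqrtr_sqr ler_sqrt ?dot_ge0// /dot -!expr2 lerDl; exact: sqr_ge0.
Qed.

Lemma nrm_snd z : `|z.2| <= nrm z.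
Proof.
rewrite /nrm -sqrtr_sqr ler_sqrt ?dot_ge0// /dot -!expr2 lerDr; exact: sqr_ge0.
Qed.

Lemma nrm_le_sum z : nrm z <= `|z.1| + `|z.2|.
Proof.
apply: nrm_le; first by rewrite addr_ge0.
rewrite /dot -!expr2 sqrrD !real_normK ?num_real// -mulr_natl.
by have := mulr_ge0 (normr_ge0 z.1) (normr_ge0 z.2); lra.
Qed.

Lemma nrm_eq0 z : (nrm z == 0) = (z == 0).
Proof.
apply/idP/eqP => [/eqP h|->]; last by rewrite nrm0.
move: (nrm_fst z) (nrm_snd z); rewrite h !normr_le0 => /eqP h1 /eqP h2.
by rewrite [z]surjective_pairing h1 h2.
Qed.

(** Quantitative strict convexity of the disc: almost maximal advance in the direction [w] pins down
    the vector itself. *)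
Lemma dot_sub_unit (rho : R) z w : nrm w = 1 -> nrm z <= rho ->
  nrm (z - rho *: w) ^+ 2 <= 2 * rho * (rho - dot w z).
Proof.
move=> w1 zr; rewrite nrm_sq.
have -> : dot (z - rho *: w) (z - rho *: w) = dot z z - 2 * rho * dot w z + rho ^+ 2 * dot w w.
  by rewrite /dot !pairE; ring.
rewrite -!nrm_sq w1 expr1n mulr1.
have : nrm z ^+ 2 <= rho ^+ 2 by rewrite ler_pXn2r ?nnegrE ?nrm_ge0// (le_trans (nrm_ge0 z)).
by lra.
Qed.

End euclid.

(** * A discrete maximal inequality *)

Section maximal.
Context {R : realType}.
Implicit Types (d : nat -> R) (N m k : nat) (la : R).

(** A superlevel set of the forward maximal function of [d], restricted to the horizon [N]. *)
Definition excessive d la N k : bool :=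
  `[< exists2 m, (k + m <= N)%N & la * m%:R < \sum_(i < m) d (k + i)%N >].

Lemma excessive_shift d la N j k : (j <= N)%N ->
  excessive d la N (j + k) = excessive (fun i => d (j + i)%N) la (N - j) k.
Proof.
move=> jN; apply/asboolP/asboolP => -[m mN H]; exists m.
- by rewrite leq_subRL// addnA.
- by move: H; under eq_bigr do rewrite -addnA.
- by rewrite leq_subRL// addnA in mN.
- by under eq_bigr do rewrite -addnA.
Qed.

(* Cover {0, ..., N - 1} greedily from the left. *)
Lemma maximal_ineq d la N : 0 <= la -> (forall i, (i < N)%N -> 0 <= d i) ->
  la * (\sum_(k < N) excessive d la N k)%:R <= \sum_(i < N) d i.
Proof.
move=> la0; elim/ltn_ind: N d => -[_|N IH] d d0; first by rewrite !big_ord0 mulr0.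
have split_at j : (0 < j <= N.+1)%N ->
    la * (\sum_(k < j) excessive d la N.+1 k)%:R <= \sum_(i < j) d i ->
    la * (\sum_(k < N.+1) excessive d la N.+1 k)%:R <= \sum_(i < N.+1) d i.
  move=> /andP[j0 jN] H.
  rewrite -(subnKC jN) !big_split_ord /= natrD mulrDr subnKC//; apply: lerD => //.
  under eq_bigr do rewrite excessive_shift//.
  have jlt : (N.+1 - j < N.+1)%N by rewrite ltn_subrL j0.
  by apply: (IH _ jlt) => i iN; apply: d0; rewrite -ltn_subRL.
have [/asboolP[m mN H]|nb] := boolP (excessive d la N.+1 0).
  have m0 : (0 < m)%N by case: m H {mN} => //; rewrite mulr0 big_ord0 ltxx.
  apply: (split_at m); first by rewrite m0.
  apply: le_trans (ltW H); apply: ler_wpM2l => //; rewrite ler_nat.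
  by apply: leq_trans (leq_sum _ (fun i _ => leq_b1 _)) _; rewrite sum1_card card_ord.
apply: (split_at 1%N) => //.
by rewrite !big_ord_recl !big_ord0 (negbTE nb) mulr0 addr0; exact: d0.
Qed.

Definition two_sided_good d la N k : Prop :=
  forall m, ((k + m <= N)%N -> \sum_(i < m) d (k + i)%N <= la * m%:R) /\
            ((m <= k)%N -> \sum_(i < m) d (k - m + i)%N <= la * m%:R).

(** By [maximal_ineq], for [d] and for [d] reversed, each direction spoils at most [N/4] indices.
    The central indices number at least [N - 2W - 1], which exceeds [N/2] because [8W <= N] and
    [16 <= N]. *)
Lemma exists_two_sided_good d la N W : 0 < la ->
  (forall i, (i < N)%N -> 0 <= d i) ->
  \sum_(i < N) d i <= la * N%:R / 4 -> (16 <= N)%N -> (8 * W <= N)%N ->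
  exists k, [/\ (W <= k)%N, (k + W <= N)%N & two_sided_good d la N k].
Proof.
move=> la0 d0 dN N16 WN; have N0 : (0 < N)%N by lia.
pose d' i := d (N - i.+1)%N.
have d'0 i : (i < N)%N -> 0 <= d' i by move=> iN; apply: d0; rewrite ltn_subrL N0.
have d'N : \sum_(i < N) d' i = \sum_(i < N) d i.
  by rewrite -(big_mkord xpredT d) big_nat_rev /= big_mkord add0n.
have := maximal_ineq (ltW la0) d0; have := maximal_ineq (ltW la0) d'0; rewrite d'N.
set b' := (\sum_(k < N) excessive d' la N k)%N.
set b := (\sum_(k < N) excessive d la N k)%N => H' H.
have bN (c : nat) : la * c%:R <= \sum_(i < N) d i -> (c * 4 <= N)%N.
  move=> h; rewrite -(ler_nat R) natrM -(ler_pM2l la0).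
  by have := le_trans h dN; lra.
have {H}bN1 := bN _ H; have {H'}bN2 := bN _ H'.
apply: contrapT => nex.
(* Sums of [d] ending just before [k] are forward sums of the reversed sequence from [N - k]. *)
have bad k : (W <= k)%N -> (k + W <= N)%N -> (k < N)%N -> (0 < k)%N ->
    (1 <= excessive d la N k + excessive d' la N (N - k))%N.
  move=> k1 k2 k3 k4; rewrite lt0n addn_eq0 !eqb0; apply/negP => /andP[g1 g2].
  apply: nex; exists k; split => // m; split => mN.
    by rewrite leNgt; apply/negP => h; move/negP: g1; apply; apply/asboolP; exists m.
  rewrite leNgt; apply/negP => h; move/negP: g2; apply; apply/asboolP; exists m.
    by rewrite -{2}(subnK (ltnW k3)) leq_add2l.
  apply: (lt_le_trans h); rewrite le_eqVlt; apply/orP; left; apply/eqP.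
  rewrite -(big_mkord xpredT (fun i => d (k - m + i)%N)) big_nat_rev /= big_mkord.
  apply: eq_bigr => i _; rewrite /d'; congr d; have := ltn_ord i; lia.
have cnt : (N - 2 * W - 1 <= b + b')%N.
  pose a1 k : nat := excessive d la N k; pose a2 k : nat := excessive d' la N (N - k).
  have e1 : (\sum_(W.+1 <= k < N - W) a1 k <= b)%N.
    rewrite /b -(big_mkord xpredT a1).
    rewrite (@big_cat_nat _ _ _ W.+1 0 N) //=; try lia.
    rewrite (@big_cat_nat _ _ _ (N - W) W.+1 N) //=; try lia.
  have e2 : (\sum_(W.+1 <= k < N - W) a2 k <= b')%N.
    rewrite /b' -(big_mkord xpredT (fun k => nat_of_bool (excessive d' la N k))).
    rewrite (@big_cat_nat _ _ _ W.+1 0 N) //=; try lia.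
    rewrite (@big_cat_nat _ _ _ (N - W) W.+1 N) //=; try lia.
    rewrite [X in (_ <= _ + (X + _))%N]big_nat_rev /=.
    apply: leq_trans (leq_addl _ _); apply: leq_trans (leq_addr _ _).
    rewrite leq_eqVlt; apply/orP; left; apply/eqP; apply: eq_big_nat => k /andP[k1 k2].
    rewrite /a2; congr (nat_of_bool (excessive _ _ _ _)); lia.
  apply: leq_trans (leq_add e1 e2); rewrite -big_split /=.
  apply: leq_trans (_ : \sum_(W.+1 <= k < N - W) 1 <= _)%N; last first.
    by rewrite !big_seq; apply: leq_sum => k; rewrite mem_index_iota => /andP[k1 k2]; apply: bad; lia.
  rewrite sum_nat_const_nat muln1; lia.
by move: N16 WN bN1 bN2 cnt; lia.
Qed.

End maximal.

(** * Growth rates and nearly extremal orbit segments *)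

Section rates.
Context {R : realType}.
Implicit Types (z w c y u : R * R).

(** Compactness of the circle; monotonicity of [Q] in [n] lets one limit direction serve for every
    [n]. *)
Lemma unit_cluster (Q : nat -> R * R -> Prop) :
  (forall m n u, (m <= n)%N -> Q n u -> Q m u) ->
  (forall n, exists2 u, nrm u = 1 & Q n u) ->
  exists2 u0, nrm u0 = 1 & forall e n, 0 < e ->
    exists u, [/\ nrm u = 1, nrm (u - u0) <= e & Q n u].
Proof.
move=> Qm H.
have H' n : exists u, nrm u = 1 /\ Q n u by have [u u1 Qu] := H n; exists u.
have [us /all_and2[us1 usQ]] := choice H'.
pose K : set (R * R) := `[-1, 1]%classic `*` `[-1, 1]%classic.
have Kc : compact K by apply: compact_setX; exact: segment_compact.
have KF : (us @ \oo) K.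
  exists 0%N => // n _; split; rewrite /= in_itv /= -ler_norml -(us1 n).
    exact: nrm_fst.
  exact: nrm_snd.
have [p [Kp pcl]] := Kc _ _ KF.
have near e n : 0 < e -> exists u, [/\ nrm u = 1, nrm (u - p) <= e & Q n u].
  move=> e0; have e20 : 0 < e / 2 by rewrite divr_gt0.
  have A1 : (us @ \oo) [set us k | k in [set k | (n <= k)%N]].
    by exists n => // k nk; exists k.
  have [_ [[k nk <-] pk]] := pcl _ _ A1 (nbhsx_ballx p (e / 2) e20).
  exists (us k); split => //; last exact: Qm nk (usQ k).
  case: pk; rewrite -!ball_normE /= => h1 h2.
  apply: le_trans (nrm_le_sum _) _; rewrite !pairE [e]splitr -[`|_ - p.1|]normrN opprB.
  by rewrite -[`|_ - p.2|]normrN opprB lerD// ltW.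
exists p => //; apply/eqP; rewrite eq_le; apply/andP; split; apply/ler_addgt0Pl => e e0.
  have [u [u1 up _]] := near e 0%N e0; rewrite -u1 -(subrK u p).
  by apply: le_trans (nrmD _ _) _; rewrite lerD2r nrmC.
have [u [u1 up _]] := near e 0%N e0; rewrite -{1}u1 -{1}(subrK p u).
by apply: le_trans (nrmD _ _) _; rewrite lerD2r.
Qed.

Variables (F : R * R -> R * R) (a : R * R -> R * R) (C1 : R).
Hypothesis step_bound : forall z, nrm (a (F z) - a z) <= C1.

Definition disp n z : R * R := a (iter n F z) - a z.

Definition grows c (rho : R) : Prop :=
  exists K, forall n z, nrm (disp n z - n%:R *: c) <= rho * n%:R + K.

(** By subadditivity in [n] this is the limit of the largest value of [|disp n z / n - c|]: the
    radius of the smallest disc about [c] holding all asymptotic velocities. *)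
Definition rate c : R := inf [set rho | grows c rho].

Lemma dispD m n z : disp (m + n) z = disp m (iter n F z) + disp n z.
Proof. by rewrite /disp iterD subrKA. Qed.

Lemma disp_le n z : nrm (disp n z) <= C1 * n%:R.
Proof.
elim: n => [|n IH]; first by rewrite /disp subrr nrm0 mulr0.
rewrite -add1n dispD natrD mulrDr mulr1; apply: le_trans (nrmD _ _) _.
by apply: lerD => //; exact: step_bound.
Qed.

Lemma disp_sub_le n z c : nrm (disp n z - n%:R *: c) <= (C1 + nrm c) * n%:R.
Proof.
apply: le_trans (nrmB _ _) _; rewrite mulrDl lerD ?disp_le// nrmZ ger0_norm ?ler0n//.
by rewrite mulrC.
Qed.

Lemma grows_ge0 c rho : grows c rho -> 0 <= rho.
Proof.
move=> [K HK]; rewrite leNgt; apply/negP => r0.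
pose n := (Num.truncn (K / - rho)).+1.
have nK : K < - rho * n%:R.
  by rewrite mulrC -ltr_pdivrMr ?oppr_gt0// truncnS_gt.
by have := le_trans (nrm_ge0 _) (HK n 0); lra.
Qed.

Lemma rate_has_inf c : has_inf [set rho | grows c rho].
Proof.
split; last by exists 0 => rho /grows_ge0.
by exists (C1 + nrm c), 0 => n z; rewrite addr0; exact: disp_sub_le.
Qed.

Lemma rate_upper c (eta : R) : 0 < eta ->
  exists2 K, 0 <= K & forall n z, nrm (disp n z - n%:R *: c) <= (rate c + eta) * n%:R + K.
Proof.
move=> e0; have [rho [K HK] rlt] := inf_adherent e0 (rate_has_inf c).
exists `|K| => // n z; apply: le_trans (HK n z) _; apply: lerD; last exact: ler_norm.
by apply: ler_wpM2r => //; exact: ltW.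
Qed.

Lemma rate_lower c (rho K : R) : rho < rate c ->
  exists n z, rho * n%:R + K < nrm (disp n z - n%:R *: c).
Proof.
move=> rr; apply: contrapT => H.
have : grows c rho.
  by exists K => n z; rewrite leNgt; apply/negP => h; apply: H; exists n, z.
move=> /(inf_lbound (rate_has_inf c).2); rewrite leNgt => /negP; exact.
Qed.

(** A window of [2W] blocks of length [B] about the midpoint [iter (W * B) F y]. The backward half
    is phrased as forward motion from an earlier point, since only [F] is at hand here. *)
Definition steady c (e : R) (B W : nat) u : Prop := exists y, forall m, (m <= W)%N ->
  nrm (disp (m * B) (iter (W * B) F y) - (m * B)%:R *: (c + rate c *: u)) <= e * (m * B)%:R /\
  nrm (disp (m * B) (iter ((W - m) * B) F y) - (m * B)%:R *: (c + rate c *: u)) <= e * (m * B)%:R.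

Lemma blocks_sum c B m k z :
  \sum_(i < m) (disp B (iter ((k + i) * B) F z) - B%:R *: c) =
  disp (m * B) (iter (k * B) F z) - (m * B)%:R *: c.
Proof.
elim: m => [|m IH]; first by rewrite big_ord0 mul0n /disp subrr scale0r subr0.
rewrite big_ord_recr /= IH mulSn dispD -iterD -mulnDl addnC natrD scalerDl.
by rewrite opprD [RHS]addrACA addrC.
Qed.

Lemma dot_sumr u n (f : nat -> R * R) : dot u (\sum_(i < n) f i) = \sum_(i < n) dot u (f i).
Proof.
elim: n => [|n IH]; first by rewrite !big_ord0 /dot !mulr0 addr0.
by rewrite !big_ord_recr /= -IH /dot !pairE; ring.
Qed.

(** Take an orbit segment whose displacement from [n c] is nearly as long as the rate allows, and
    let [u] be its direction. The defects of its blocks along [u] are nonnegative with small mean,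
    so some midpoint has small mean defect over all windows on both sides; [dot_sub_unit] converts
    this into closeness to [rate c *: u]. *)
Lemma exists_steady_block c (e : R) : 0 < rate c -> 0 < e ->
  exists2 B, (0 < B)%N & forall W, exists2 u, nrm u = 1 & steady c e B W u.
Proof.
move=> r0 e0; set r := rate c.
(* The last bound gives [32 eta (r + 2 eta) <= 64 eta r <= (e/2)^2], which controls the distance to
   the extremal vector; the second one pays for replacing the radius [r + 2 eta] by [r]. *)
pose eta := Num.min (r / 2) (Num.min (e / 4) (e ^+ 2 / (256 * r))).
have r256 : 0 < 256 * r := mulr_gt0 (ltr0Sn R 255) r0.
have eta0 : 0 < eta.
  by rewrite lt_min (divr_gt0 r0 (ltr0Sn R 1)) lt_min (divr_gt0 e0 (ltr0Sn R 3)) divr_gt0// exprn_gt0.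
have eta1 : eta <= r / 2 by rewrite ge_min lexx.
have eta2 : eta <= e / 4 by rewrite !ge_min lexx orbT.
have eta3 : eta * (256 * r) <= e ^+ 2.
  by rewrite -ler_pdivlMr// !ge_min lexx !orbT.
have [K K0 HK] := rate_upper c eta0.
pose B := (Num.truncn (K / eta)).+1.
have BK : K <= eta * B%:R.
  by rewrite mulrC -ler_pdivrMr//; apply: ltW; exact: truncnS_gt.
exists B => // W.
have B0 : 0 < B%:R :> R by rewrite ltr0n.
pose C2 := C1 + nrm c.
have C20 : 0 <= C2.
  by have := le_trans (nrm_ge0 _) (disp_sub_le 1 0 c); rewrite mulr1.
(* The first two terms give the room required by [exists_two_sided_good]; the third makes the
   incomplete last block, worth at most [C2 B], negligible. The additive constant of the next line
   forces [n >= N0 B]. *)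
pose N0 := (8 * W + 16 + (Num.truncn (C2 / eta)).+1)%N.
have [n [z Hn]] := @rate_lower c (r - eta) (C2 * (N0 * B)%:R) ltac:(lra).
set X := disp n z - n%:R *: c in Hn.
have XC : nrm X <= C2 * n%:R by exact: disp_sub_le.
have rn : 0 <= (r - eta) * n%:R by rewrite mulr_ge0//; lra.
have C2p : 0 < C2.
  rewrite lt_neqAle C20 andbT; apply/eqP => C2E.
  by move: Hn XC; rewrite -C2E !mul0r addr0 => h1 h2; have := lt_le_trans h1 h2; rewrite ltNge rn.
have nN : (N0 * B <= n)%N.
  rewrite -(ler_nat R) -(ler_pM2l C2p); apply: le_trans XC; apply: le_trans (ltW Hn).
  by rewrite lerDr.
have X0 : 0 < nrm X.
  by apply: le_lt_trans Hn; rewrite addr_ge0// mulr_ge0.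
pose u := (nrm X)^-1 *: X.
have u1 : nrm u = 1 by rewrite nrmZ ger0_norm ?invr_ge0 ?nrm_ge0// mulVf// lt0r_neq0.
have uX : dot u X = nrm X.
  have -> : dot u X = (nrm X)^-1 * dot X X by rewrite /dot !pairE; ring.
  by rewrite -nrm_sq expr2 mulrA mulVf ?mul1r// lt0r_neq0.
pose N := (n %/ B)%N.
have NB : (N * B <= n)%N by exact: leq_trunc_div.
have N0N : (N0 <= N)%N by rewrite leq_divRL.
have nNB : (n - N * B < B)%N by rewrite ltn_subLR// addnC -mulSn ltn_ceil.
pose blk i := disp B (iter (i * B) F z) - B%:R *: c.
pose d i := (r + 2 * eta) * B%:R - dot u (blk i).
have dsum k m : \sum_(i < m) d (k + i)%N =
    (r + 2 * eta) * (m * B)%:R - dot u (disp (m * B) (iter (k * B) F z) - (m * B)%:R *: c).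
  rewrite -blocks_sum (dot_sumr u m (fun i => blk (k + i)%N)) sumrB; congr (_ - _).
  by rewrite sumr_const card_ord -mulr_natl natrM; ring.
have segle k m : nrm (disp (m * B) (iter (k * B) F z) - (m * B)%:R *: c) <= (r + 2 * eta) * (m * B)%:R.
  case: m => [|m]; first by rewrite mul0n /disp subrr scale0r subr0 nrm0 mulr0.
  apply: le_trans (HK _ _) _.
  have : B%:R <= (m.+1 * B)%:R :> R by rewrite ler_nat leq_pmull.
  by rewrite -/r; nra.
have d0 i : 0 <= d i.
  rewrite subr_ge0; apply: le_trans (dot_le _ _) _; rewrite u1 mul1r.
  by have := segle i 1%N; rewrite mul1n.
(* The total defect is at most [3 eta N B] from the choice of the segment plus [eta N B] from the
   last block, that is [la N / 4]. *)
pose la := 16 * eta * B%:R.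
have dtot : \sum_(i < N) d i <= la * N%:R / 4.
  have := dsum 0%N N; under eq_bigr do rewrite add0n; rewrite mul0n /= => ->.
  set Y := disp _ _ - _.
  have XY : X - Y = disp (n - N * B) (iter (N * B) F z) - (n - N * B)%:R *: c.
    rewrite /X /Y -{1}(subnK NB) dispD (natrB _ NB) scalerBl.
    by rewrite -[_ *: c in LHS](subrK ((N * B)%:R *: c)); ring.
  have : dot u X - dot u Y <= C2 * B%:R.
    have -> : dot u X - dot u Y = dot u (X - Y) by rewrite /dot !pairE; ring.
    apply: le_trans (dot_le _ _) _; rewrite u1 mul1r XY; apply: le_trans (disp_sub_le _ _ _) _.
    by apply: ler_wpM2l => //; rewrite ler_nat ltnW.
  rewrite uX => uY.
  have q1 : (r - eta) * (N * B)%:R <= (r - eta) * n%:R.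
    by apply: ler_wpM2l; [lra|rewrite ler_nat].
  have q2 : C2 <= eta * N%:R.
    rewrite mulrC -ler_pdivrMr//; apply: (@le_trans _ _ (Num.truncn (C2 / eta)).+1%:R).
      by apply: ltW; exact: truncnS_gt.
    by rewrite ler_nat; apply: leq_trans N0N; rewrite leq_addl.
  have q3 : C2 * B%:R <= eta * (N * B)%:R.
    by rewrite natrM mulrA; apply: ler_wpM2r.
  have q4 : 0 <= C2 * (N0 * B)%:R by rewrite mulr_ge0.
  by rewrite /la; move: q1 q3 q4 Hn; rewrite (natrM _ N B) => q1 q3 q4 Hn'; lra.
have la0 : 0 < la by rewrite !mulr_gt0.
have [||k [kW kN good]] := @exists_two_sided_good _ d la N W la0 (fun i _ => d0 i) dtot.
- by apply: leq_trans N0N; rewrite /N0 addnAC leq_addl.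
- by apply: leq_trans N0N; rewrite /N0 -addnA leq_addr.
exists u => //; exists (iter ((k - W) * B) F z) => m mW.
have close j x : x = disp (m * B) (iter (j * B) F z) ->
    \sum_(i < m) d (j + i)%N <= la * m%:R ->
    nrm (x - (m * B)%:R *: (c + r *: u)) <= e * (m * B)%:R.
  move=> ->; rewrite dsum => h.
  set x0 := disp _ _ in h *; set b : R := (m * B)%:R in h *.
  have b0 : 0 <= b by rewrite /b.
  pose rho := (r + 2 * eta) * b.
  have := dot_sub_unit u1 (segle j m); rewrite -/x0 -/b -/rho => hs.
  have -> : x0 - b *: (c + r *: u) = (x0 - b *: c - rho *: u) + (2 * eta * b) *: u.
    by rewrite /rho; apply: veq; rewrite !pairE; ring.
  apply: le_trans (nrmD _ _) _; rewrite nrmZ u1 mulr1 ger0_norm; last first.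
    by rewrite !mulr_ge0// ltW.
  have : nrm (x0 - b *: c - rho *: u) <= e / 2 * b.
    rewrite -ler_sqr ?nnegrE ?nrm_ge0//; last by rewrite mulr_ge0// divr_ge0// ltW.
    apply: le_trans hs _.
    have h' : rho - dot u (x0 - b *: c) <= 16 * eta * b.
      by apply: le_trans h _; rewrite /la /b natrM le_eqVlt; apply/orP; left; apply/eqP; ring.
    apply: (@le_trans _ _ (2 * rho * (16 * eta * b))).
      by apply: ler_wpM2l => //; rewrite !mulr_ge0//; lra.
    rewrite exprMn (_ : 2 * rho * (16 * eta * b) = 32 * eta * (r + 2 * eta) * b ^+ 2); last first.
      by rewrite /rho; ring.
    by apply: ler_wpM2r; [exact: sqr_ge0|nra].
  by nra.
split.
  apply: (close k); last by have [+ _] := good m; apply; apply: leq_trans kN; rewrite leq_add2l.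
  by rewrite -iterD -mulnDl subnKC.
apply: (close (k - m)%N); last by have [_] := good m; apply; exact: leq_trans kW.
by rewrite -iterD -mulnDl; rewrite addnC addnBA// subnK.
Qed.

End rates.

(** * Realised velocities *)

Section classes.
Context {R : realType}.
Implicit Types (z w c y u v : R * R).
Variables (F Fi : R * R -> R * R) (a : R * R -> R * R) (C1 : R).
Hypotheses (FK : cancel F Fi) (FiK : cancel Fi F).
Hypothesis step_bound : forall z, nrm (a (F z) - a z) <= C1.
Local Notation it := (iterz F Fi).
Local Notation dsp := (disp F a).
Local Notation rt := (rate F a).

(** The additive constant depends on [e] but not on the window [W], so both error terms disappear
    after rescaling. *)
Definition realized v : Prop := forall e : R, 0 < e -> exists K : R, forall W : nat,
  exists z, forall t : int, (`|t| <= W)%N ->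
    nrm (a (it t z) - a z - t%:~R *: v) <= e * `|t|%N%:R + K.

Lemma C1_ge0 : 0 <= C1.
Proof. exact: le_trans (nrm_ge0 _) (step_bound 0). Qed.

Lemma steady_mono c (e e' : R) B W W' u : e <= e' -> (W <= W')%N ->
  steady F a c e B W' u -> steady F a c e' B W u.
Proof.
move=> ee WW [y Hy]; exists (iter ((W' - W) * B) F y) => m mW.
have [h1 h2] := Hy m (leq_trans mW WW).
rewrite -!iterD -!mulnDl subnKC// (_ : (W - m + (W' - W) = W' - m)%N); last by lia.
by split; [apply: le_trans h1 _|apply: le_trans h2 _]; apply: ler_wpM2r.
Qed.

(** Two successive cluster arguments: at a fixed tolerance, hence a fixed block length, over the
    window lengths; then over the tolerances. Times that are not multiples of the block length cost
    a bounded amount, which goes into [K]. *)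
Lemma exists_realized c : 0 < rt c -> exists2 v, nrm (v - c) = rt c & realized v.
Proof.
move=> r0; set r := rt c.
pose ej (j : nat) : R := j.+1%:R^-1.
have ej0 j : 0 < ej j by rewrite invr_gt0.
pose Q j u := exists2 B, (0 < B)%N & forall e n, 0 < e ->
  exists u', [/\ nrm u' = 1, nrm (u' - u) <= e & steady F a c (ej j) B n u'].
have [m n u mn [B B0 HB]|n|u0 u01 Hu0] := @unit_cluster _ Q.
- exists B => // e k e0; have [u' [h1 h2 h3]] := HB e k e0.
  exists u'; split=> //; apply: steady_mono h3 => //.
  by rewrite /ej lef_pV2 ?posrE// ler_nat.
- have [B B0 HB] := exists_steady_block step_bound r0 (ej0 n).
  have [m k u' mk|k|u u1 Hu] := @unit_cluster _ (fun W u => steady F a c (ej n) B W u).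
  + exact: steady_mono.
  + exact: HB.
  + by exists u => //; exists B.
exists (c + r *: u0).
  by rewrite addrC addKr nrmZ u01 mulr1 ger0_norm// ltW.
move=> e e0; set v := c + _.
have e30 : 0 < e / 3 by rewrite divr_gt0.
pose j := Num.truncn (e / 3)^-1.
have eje : ej j <= e / 3.
  rewrite /ej -[leRHS]invrK lef_pV2 ?posrE ?invr_gt0//; apply: ltW; exact: truncnS_gt.
have er0 : 0 < e / 3 / r by rewrite divr_gt0.
have [u [u1 uu0 [B B0 HB]]] := Hu0 (e / 3 / r) j er0.
exists ((C1 + nrm v) * B%:R) => W.
have [u' [u'1 u'u [y Hy]]] := HB (e / 3 / r) W er0.
have C10 := C1_ge0.
have blockerr m x : nrm (x - (m * B)%:R *: (c + r *: u')) <= ej j * (m * B)%:R ->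
    nrm (x - (m * B)%:R *: v) <= e * (m * B)%:R.
  move=> h; set b : R := (m * B)%:R in h *.
  have b0 : 0 <= b by rewrite /b.
  have -> : x - b *: v = (x - b *: (c + r *: u')) + (b * r) *: ((u' - u) + (u - u0)).
    by rewrite /v; apply: veq; rewrite !pairE; ring.
  apply: le_trans (nrmD _ _) _; rewrite nrmZ ger0_norm; last by rewrite mulr_ge0// ltW.
  have h2 : r * nrm (u' - u + (u - u0)) <= 2 * (e / 3).
    apply: (@le_trans _ _ (r * (e / 3 / r + e / 3 / r))).
      by apply: ler_wpM2l; [exact: ltW|apply: le_trans (nrmD _ _) _; exact: lerD].
    by rewrite mulrDr (mulrC r) divfK ?lt0r_neq0//; lra.
  have := ler_wpM2l b0 h2; have := ler_wpM2l b0 eje; rewrite -/b in h *.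
  by rewrite mulrA; lra.
have resterr s x : (s < B)%N -> nrm (dsp s x - s%:R *: v) <= (C1 + nrm v) * B%:R.
  move=> sB; apply: le_trans (disp_sub_le step_bound _ _ _) _.
  by apply: ler_wpM2l; [rewrite addr_ge0 ?nrm_ge0|rewrite ler_nat ltnW].
exists (iter (W * B) F y) => t tW.
have [n nE] : exists n, n = `|t|%N by eexists.
rewrite -nE in tW *.
have mW : (n %/ B <= W)%N by apply: leq_trans tW; exact: leq_div.
have [h1 h2] := Hy _ mW.
have sB : (n %% B < B)%N by rewrite ltn_mod.
have nD := divn_eq n B.
have bn : (n %/ B * B)%:R <= n%:R :> R by rewrite ler_nat leq_trunc_div.
have split_err X1 X2 X : X = X1 + X2 ->
   nrm (X1 - (n %/ B * B)%:R *: v) <= e * (n %/ B * B)%:R ->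
   nrm (X2 - (n %% B)%:R *: v) <= (C1 + nrm v) * B%:R ->
   nrm (X - n%:R *: v) <= e * n%:R + (C1 + nrm v) * B%:R.
  move=> -> hX1 hX2.
  have -> : n%:R *: v = (n %/ B * B)%:R *: v + (n %% B)%:R *: v :> R * R.
    by rewrite -scalerDl -natrD -nD.
  rewrite opprD addrACA; apply: le_trans (nrmD _ _) _; apply: lerD => //.
  by apply: le_trans hX1 _; apply: ler_wpM2l => //; exact: ltW.
case: (intP t) nE => [|k|k] nE.
- by rewrite nE /= subrr scale0r subrr nrm0 mulr0 add0r mulr_ge0// addr_ge0 ?nrm_ge0.
- have tE : k.+1 = n by rewrite nE.
  rewrite [in k.+1%:~R]tE -pmulrn (_ : it k.+1 = iter n F) ?tE//.
  apply: (split_err _ _ _ _ (blockerr _ _ h1) (resterr _ (iter (n %/ B * B) F (iter (W * B) F y)) sB)).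
  by rewrite -[LHS]/(dsp n _) {1}nD addnC dispD addrC.
- have tE : k.+1 = n by rewrite nE abszN.
  have nWB : (n <= W * B)%N by apply: leq_trans tW _; rewrite leq_pmulr.
  have itE : it (- n%:Z) (iter (W * B) F y) = iter (W * B - n) F y.
    rewrite -[iter (W * B) F y]/(it (W * B)%N%:Z y) -iterzD// addrC subzn//.
  rewrite tE itE mulrNz scaleNr opprK -pmulrn.
  have -> : a (iter (W * B - n) F y) - a (iter (W * B) F y) + n%:R *: v =
    - ((a (iter (W * B) F y) - a (iter (W * B - n) F y)) - n%:R *: v).
    by rewrite !opprB addrC.
  rewrite nrmN.
  apply: (split_err _ _ _ _ (blockerr _ _ h2) (resterr _ (iter (W * B - n) F y) sB)).
  have e1 : iter (n %% B) F (iter (W * B - n) F y) = iter ((W - n %/ B) * B) F y.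
    by rewrite -iterD mulnBl addnBA// [X in (_ - X)%N]nD addnC subnDr.
  have e2 : iter (n %/ B * B) F (iter ((W - n %/ B) * B) F y) = iter (W * B) F y.
    by rewrite -iterD -mulnDl subnKC.
  by rewrite /disp e1 e2 subrKA.
Qed.

Lemma realized_in_disc v c : realized v -> nrm (v - c) <= rt c.
Proof.
move=> Hv; rewrite leNgt; apply/negP => lt.
pose e := (nrm (v - c) - rt c) / 4.
have e0 : 0 < e by rewrite divr_gt0// subr_gt0.
have [K HK] := Hv e e0; have [K' K'0 HK'] := rate_upper step_bound c e0.
pose W := (Num.truncn ((K + K') / e)).+1.
have WK : K + K' < e * W%:R by rewrite mulrC -ltr_pdivrMr//; exact: truncnS_gt.
have [z /(_ W%:Z (leqnn _)) h1] := HK W.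
have h2 := HK' W z.
have : W%:R * nrm (v - c) <= e * W%:R + K + ((rt c + e) * W%:R + K').
  have -> : W%:R * nrm (v - c) = nrm (W%:R *: (v - c)) by rewrite nrmZ ger0_norm.
  have -> : W%:R *: (v - c) = (dsp W z - W%:R *: c) - (dsp W z - W%:R *: v).
    by apply: veq; rewrite !pairE; ring.
  by apply: le_trans (nrmB _ _) _; rewrite addrC; apply: lerD.
have rE : nrm (v - c) = rt c + 4 * e by rewrite /e; lra.
have W0 : 0 < W%:R :> R by [].
by rewrite rE; nra.
Qed.

(* When a is the projection to the vertical axis, the condition a c = c is needed:
   about points far from the axis the rate exceeds the distance by little. *)
Definition rotation_ball (rho0 : R * R) (delta : R) : Prop :=
  a rho0 = rho0 /\ forall c rho, a c = c -> grows F a c rho -> nrm (rho0 - c) + delta <= rho.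

Lemma rotation_ball_rate rho0 (delta : R) c : rotation_ball rho0 delta -> a c = c ->
  nrm (rho0 - c) + delta <= rt c.
Proof.
move=> [_ H] ac; apply: lb_le_inf; first exact: (rate_has_inf step_bound c).1.
by move=> rho; exact: H.
Qed.

(** The second velocity is extremal about the first one, where the rate is positive, so the two
    differ. *)
Lemma exists_two_realized rho0 (delta : R) : 0 < delta -> rotation_ball rho0 delta ->
  (forall v, realized v -> a v = v) -> exists c1 c2 v1 v2, [/\ realized v1 /\ nrm (v1 - c1) = rt c1,
    realized v2 /\ nrm (v2 - c2) = rt c2 & v1 != v2].
Proof.
move=> d0 H ra.
have rp c : a c = c -> 0 < rt c.
  by move=> ac; apply: lt_le_trans (rotation_ball_rate H ac); rewrite ltr_wpDl ?nrm_ge0.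
have [v1 h1 r1] := exists_realized (rp _ H.1).
have [v2 h2 r2] := exists_realized (rp _ (ra _ r1)).
exists rho0, v1, v1, v2; split => //; apply/eqP => v12.
by have := rp _ (ra _ r1); rewrite -h2 v12 subrr nrm0 ltxx.
Qed.

(** A disc about a remote centre is almost a half-plane. A velocity extremal about a centre far away
    along the normal of the line through [v1] and [v2] must therefore lie off that line. *)
Lemma exists_three_realized rho0 (delta : R) : 0 < delta -> rotation_ball rho0 delta ->
  (forall v, a v = v) ->
  exists c v : 'I_3 -> R * R, (forall i, realized (v i) /\ nrm (v i - c i) = rt (c i)) /\
    let e1 := v (inord 1) - v (inord 0) in let e2 := v (inord 2) - v (inord 0) in
    e1.1 * e2.2 - e1.2 * e2.1 != 0.
Proof.
move=> d0 H ra.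
have [c1 [c2 [v1 [v2 [[r1 h1] [r2 h2] v12]]]]] := exists_two_realized d0 H (fun v _ => ra v).
have rp c : 0 < rt c.
  by apply: lt_le_trans (rotation_ball_rate H (ra c)); rewrite ltr_wpDl ?nrm_ge0.
pose m0 := (- (v2 - v1).2, (v2 - v1).1) : R * R.
have m00 : 0 < nrm m0.
  rewrite lt_neqAle nrm_ge0 eq_sym andbT nrm_eq0; apply: contra v12 => /eqP[/eqP].
  rewrite oppr_eq0 subr_eq0 => /eqP e2 /eqP; rewrite subr_eq0 => /eqP e1.
  by rewrite [v1]surjective_pairing [v2]surjective_pairing e1 e2.
pose m1 := (nrm m0)^-1 *: m0.
have m11 : nrm m1 = 1 by rewrite nrmZ ger0_norm ?invr_ge0 ?nrm_ge0// mulVf// lt0r_neq0.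
(* The sign of the normal is chosen so that the line through [v1] and [v2] does not lie beyond
   [rho0]; it then suffices to find [v3] strictly beyond [rho0]. *)
have [m [mm1 mv mz]] : exists m, [/\ nrm m = 1, dot m (v1 - rho0) <= 0 &
    dot m (v2 - v1) = 0].
  have z1 : dot m1 (v2 - v1) = 0 by rewrite /m1 /m0 /dot !pairE /=; ring.
  have [h|h] := leP (dot m1 (v1 - rho0)) 0; first by exists m1.
  exists (- m1); split; first by rewrite nrmN.
    by apply: ltW; rewrite dotNl oppr_lt0.
  by rewrite dotNl z1 oppr0.
pose s := rt rho0.
have s0 : 0 < s := rp rho0.
(* If [v3] were not beyond [rho0], then [|v3 - c3|^2 <= s^2 + L^2], whereas
   [|v3 - c3| >= L + delta]; the choice [s^2 < L delta] excludes this. *)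
pose L := s ^+ 2 / delta + s + 1.
have L0 : s < L by have := divr_gt0 (exprn_gt0 2 s0) d0; rewrite /L; lra.
have Ld : s ^+ 2 < L * delta.
  have := mulr_gt0 s0 d0.
  by rewrite /L !mulrDl divfK ?lt0r_neq0//; lra.
pose c3 := rho0 - L *: m.
have [v3 h3 r3] := exists_realized (rp c3).
have v3s : nrm (v3 - rho0) <= s := realized_in_disc rho0 r3.
have : L + delta <= nrm (v3 - c3).
  rewrite h3; apply: le_trans (rotation_ball_rate H (ra c3)).
  by rewrite /c3 subKr nrmZ mm1 mulr1 ger0_norm//; lra.
set hh := dot m (v3 - rho0) => h3'.
have hpos : 0 < hh.
  rewrite ltNge; apply/negP => hneg.
  have : nrm (v3 - c3) ^+ 2 = nrm (v3 - rho0) ^+ 2 + 2 * L * hh + L ^+ 2.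
    transitivity (nrm (v3 - rho0) ^+ 2 + 2 * L * hh + L ^+ 2 * dot m m).
      by rewrite !nrm_sq /hh /c3 /dot !pairE; ring.
    by rewrite -(nrm_sq m) mm1 expr1n mulr1.
  have : (L + delta) ^+ 2 <= nrm (v3 - c3) ^+ 2 by rewrite ler_pXn2r ?nnegrE ?nrm_ge0//; lra.
  have : nrm (v3 - rho0) ^+ 2 <= s ^+ 2 by rewrite ler_pXn2r ?nnegrE ?nrm_ge0//; lra.
  have : L * hh <= 0 by rewrite pmulr_rle0//; lra.
  nra.
have hv : 0 < dot m (v3 - v1).
  rewrite (_ : dot _ _ = hh - dot m (v1 - rho0)); last by rewrite /hh /dot !pairE; ring.
  by rewrite subr_gt0 (le_lt_trans mv).
exists (fun i => if val i == 0%N then c1 else if val i == 1%N then c2 else c3).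
exists (fun i => if val i == 0%N then v1 else if val i == 1%N then v2 else v3).
split; first by move=> i; do 2 case: ifP => _ //.
rewrite /= !inordK//=; apply/eqP => det0.
have ml : (m.1 = 0 /\ m.2 = 0).
  have nz : (v2 - v1).1 ^+ 2 + (v2 - v1).2 ^+ 2 != 0.
    have : nrm m0 ^+ 2 = (v2 - v1).1 ^+ 2 + (v2 - v1).2 ^+ 2 by rewrite nrm_sq /dot /m0 /=; ring.
    by move=> <-; rewrite sqrf_eq0 lt0r_neq0.
  have : dot m (v3 - v1) * ((v2 - v1).1 ^+ 2 + (v2 - v1).2 ^+ 2) = 0.
    have d1 : (v2 - v1).1 * (v3 - v1).2 = (v2 - v1).2 * (v3 - v1).1.
      by apply/eqP; rewrite -subr_eq0; apply/eqP.
    rewrite /dot in mz *; move: d1 mz; set A := (v2 - v1).1; set B := (v2 - v1).2.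
    set A' := (v3 - v1).1; set B' := (v3 - v1).2 => d1 mz.
    have -> : (m.1 * A' + m.2 * B') * (A ^+ 2 + B ^+ 2) =
      (m.1 * A + m.2 * B) * (A * A' + B * B') + (A * B' - B * A') * (m.2 * A - m.1 * B) by ring.
    by rewrite mz d1 subrr !mul0r addr0.
  by move=> /eqP; rewrite mulf_eq0 (negbTE nz) orbF => /eqP h; rewrite h ltxx in hv.
by have := mm1; rewrite /nrm /dot ml.1 ml.2 mulr0 addr0 sqrtr0 => /eqP; rewrite eq_sym oner_eq0.
Qed.

End classes.

(** * Limits of rescaled orbits *)

Section ultralimits.
Context {R : realType}.
Variable U : set_system nat.
Hypothesis ultraU : UltraFilter U.
Hypothesis freeU : forall n, U [set j | (n <= j)%N].

Let U_and (A B : set nat) : U A -> U B -> U (A `&` B).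
Proof. exact: filterI. Qed.

Lemma U_sub (A B : set nat) : U A -> (forall j, A j -> B j) -> U B.
Proof. by move=> UA AB; apply: filterS UA. Qed.

Lemma U_ex (A : set nat) : U A -> exists j, A j.
Proof. exact: filter_ex. Qed.

Lemma U_or (A : set nat) : U A \/ U (~` A).
Proof. exact: in_ultra_setVsetC. Qed.

Lemma U_all (A : set nat) : (forall j, A j) -> U A.
Proof. by move=> H; apply: filterS filterT => j _. Qed.

(** Limits along an ultrafilter: every bounded sequence has one, and all limits can be taken at once
    without passing to subsequences. *)
Definition ucvg (u : nat -> R) (l : R) : Prop :=
  forall e, 0 < e -> U [set j | `|u j - l| < e].

Lemma ucvg_ex u (m : R) : U [set j | `|u j| <= m] -> exists l, ucvg u l.
Proof.
move=> um; pose S := [set x | U [set j | x <= u j]].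
have S0 : S (- m) by rewrite /S /=; apply: (U_sub um) => j /=; rewrite ler_norml => /andP[].
have Sub x : S x -> x <= m.
  move=> Sx; have [j [/= h1 h2]] := U_ex (U_and Sx um).
  by apply: le_trans h1 _; apply: le_trans (ler_norm _) h2.
have Ss : has_sup S by split; [exists (- m)|exists m => x /Sub].
exists (sup S) => e e0.
have [x Sx xs] := sup_adherent e0 Ss.
have up : U [set j | u j < sup S + e].
  have [//|h] := U_or [set j | u j < sup S + e].
  have h' : U [set j | sup S + e <= u j].
    by apply: (U_sub h) => j /= /negP; rewrite -leNgt.
  by have := sup_upper_bound Ss h'; rewrite gerDl leNgt e0.
apply: (U_sub (U_and (Sx : U [set j | x <= u j]) up)) => j /= [h1 h2]; rewrite ltr_norml; apply/andP; lra.
Qed.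

Lemma ucvg_cst l : ucvg (fun=> l) l.
Proof. by move=> e e0; apply: U_all => j /=; rewrite subrr normr0. Qed.

Lemma ucvgD u v l m : ucvg u l -> ucvg v m -> ucvg (fun j => u j + v j) (l + m).
Proof.
move=> ul vm e e0; have e2 : 0 < e / 2 by rewrite divr_gt0.
apply: (U_sub (U_and (ul _ e2) (vm _ e2))) => j /= [h1 h2].
by rewrite opprD addrACA (splitr e) (le_lt_trans (ler_normD _ _))// ltrD.
Qed.

Lemma ucvgZ c u l : ucvg u l -> ucvg (fun j => c * u j) (c * l).
Proof.
move=> ul e e0; have e2 : 0 < e / (`|c| + 1) by rewrite divr_gt0// ltr_wpDl.
apply: (U_sub (ul _ e2)) => j /= h; rewrite -mulrBr normrM.
have c1 : 0 < `|c| + 1 by rewrite ltr_wpDl.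
move: h; rewrite ltr_pdivlMr// => h; apply: le_lt_trans h.
by rewrite mulrC ler_wpM2l// lerDl.
Qed.

Lemma ucvgN u l : ucvg u l -> ucvg (fun j => - u j) (- l).
Proof. by move=> ul e e0; apply: (U_sub (ul e e0)) => j /=; rewrite -opprD normrN. Qed.

Lemma ucvgB u v l m : ucvg u l -> ucvg v m -> ucvg (fun j => u j - v j) (l - m).
Proof. by move=> ul /ucvgN; exact: ucvgD. Qed.

Lemma ucvg_le u v l m : ucvg u l -> ucvg v m -> U [set j | u j <= v j] -> l <= m.
Proof.
move=> ul vm uv; rewrite leNgt; apply/negP => ml.
have e2 : 0 < (l - m) / 2 by rewrite divr_gt0// subr_gt0.
have [j [[/= h1 h2] h3]] := U_ex (U_and (U_and (ul _ e2) (vm _ e2)) uv).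
by move: h1 h2; rewrite !ltr_norml => /andP[h1 _] /andP[_ h2]; lra.
Qed.

Lemma ucvg_lec u l c : ucvg u l -> U [set j | u j <= c] -> l <= c.
Proof. by move=> ul; apply: ucvg_le ul (ucvg_cst c). Qed.

Lemma ucvg_gec u l c : ucvg u l -> U [set j | c <= u j] -> c <= l.
Proof. by move=> ul; apply: ucvg_le (ucvg_cst c) ul. Qed.

Lemma ucvg_uniq u l m : ucvg u l -> ucvg u m -> l = m.
Proof.
move=> ul um; apply/eqP; rewrite eq_le.
by rewrite (ucvg_le ul um) ?(ucvg_le um ul)//; apply: U_all => j /=.
Qed.

Lemma ucvg_lt u l c : ucvg u l -> l < c -> U [set j | u j < c].
Proof.
move=> ul lc; have e0 : 0 < c - l by rewrite subr_gt0.
by apply: (U_sub (ul _ e0)) => j /=; rewrite ltr_norml => /andP[_]; rewrite ltrD2r.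
Qed.

Lemma ucvg_gt u l c : ucvg u l -> c < l -> U [set j | c < u j].
Proof.
move=> ul cl; have e0 : 0 < l - c by rewrite subr_gt0.
by apply: (U_sub (ul _ e0)) => j /=; rewrite ltr_norml opprB => /andP[+ _]; rewrite ltrD2r.
Qed.

Lemma ucvg_close u v l : ucvg u l -> ucvg (fun j => v j - u j) 0 -> ucvg v l.
Proof.
move=> ul vu; have := ucvgD vu ul; rewrite add0r => h e e0.
by apply: (U_sub (h e e0)) => j /=; rewrite subrK.
Qed.

Lemma ucvg0_le u v : ucvg v 0 -> U [set j | `|u j| <= v j] -> ucvg u 0.
Proof.
move=> v0 uv e e0; apply: (U_sub (U_and (v0 _ e0) uv)) => j /= [h1 h2].
rewrite subr0 in h1; rewrite subr0; apply: (le_lt_trans h2); exact: le_lt_trans (ler_norm _) h1.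
Qed.

Variable L : nat -> R.
Hypothesis L_infty : forall m : R, U [set j | m <= L j].

Lemma L_gt0 : U [set j | 0 < L j].
Proof. by apply: (U_sub (L_infty 1)) => j /=; exact: lt_le_trans. Qed.

Lemma ucvg_cst_div (mu : nat -> R) c : (forall m : R, U [set j | m <= mu j]) ->
  ucvg (fun j => c / mu j) 0.
Proof.
move=> mui e e0; apply: (U_sub (mui ((`|c| + 1) / e))) => j /= h.
have m0 : 0 < mu j by apply: lt_le_trans h; rewrite divr_gt0// ltr_wpDl.
rewrite subr0 normrM normfV (gtr0_norm m0) ltr_pdivrMr// mulrC.
by move: h; rewrite ler_pdivrMr// => h; apply: lt_le_trans h; rewrite ltrDl.
Qed.

Definition lipschitz_at (b : nat -> int -> R) (mu : nat -> R) : Prop :=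
  forall K : R, 0 <= K -> exists C : R, U [set j | `|b j 0| <= C * mu j /\
    forall s t : int, `|s%:~R| <= K * L j -> `|t%:~R| <= K * L j ->
      `|b j s - b j t| <= C * (mu j / L j) * `|s%:~R - t%:~R|].

(** Convergence is required along all integer times with [t j / L j] tending to [tau], not only
    along [time tau]. The times produced by [event_limit] can thus be inserted directly. *)
Definition path_limit (b : nat -> int -> R) (mu : nat -> R) (f : R -> R) : Prop :=
  forall (tau : R) (t : nat -> int), ucvg (fun j => (t j)%:~R / L j) tau ->
    ucvg (fun j => b j (t j) / mu j) (f tau).

Definition time (tau : R) (j : nat) : int := Num.floor (tau * L j).

Lemma time_cvg tau : ucvg (fun j => (time tau j)%:~R / L j) tau.
Proof.
apply: (ucvg_close (ucvg_cst tau)); apply: (@ucvg0_le _ (fun j => 1 / L j)).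
  exact: ucvg_cst_div.
apply: (U_sub L_gt0) => j /= L0.
have -> : (time tau j)%:~R / L j - tau = ((time tau j)%:~R - tau * L j) / L j.
  by rewrite mulrBl mulfK// lt0r_neq0.
rewrite normrM normfV (gtr0_norm L0).
apply: ler_wpM2r; first by rewrite invr_ge0 ltW.
rewrite ler_norml; have /andP[h1 h2] := floor_itv (tau * L j).
by rewrite /time; apply/andP; lra.
Qed.

Lemma path_limit_ex b mu : lipschitz_at b mu -> U [set j | 0 < mu j] ->
  exists f, path_limit b mu f.
Proof.
move=> lb mu0.
have lim0 tau : exists l, ucvg (fun j => b j (time tau j) / mu j) l.
  have K0 : 0 <= `|tau| + 1 by rewrite addr_ge0.
  have [C HC] := lb _ K0.
  apply: (@ucvg_ex _ (C + C * (`|tau| + 1))).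
  have tb := time_cvg tau ltr01.
  apply: (U_sub (U_and (U_and HC mu0) (U_and L_gt0 tb))) => j /= [[[h0 h] m0] [l0 ht]].
  have tL : `|(time tau j)%:~R| <= (`|tau| + 1) * L j :> R.
    rewrite -ler_pdivrMr// -[X in _ / X](gtr0_norm l0) -normfV -normrM.
    by rewrite -[_ / _](subrK tau); apply: le_trans (ler_normD _ _) _; rewrite addrC lerD2l ltW.
  have z0 : `|0%:~R| <= (`|tau| + 1) * L j by rewrite normr0 mulr_ge0// ltW.
  have := h _ _ tL z0; rewrite subr0 => h1.
  rewrite normrM normfV (gtr0_norm m0) ler_pdivrMr// -[b j _](subrK (b j 0)).
  apply: le_trans (ler_normD _ _) _; rewrite addrC mulrDl; apply: lerD => //.
  apply: le_trans h1 _.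
  have C0 : 0 <= C by rewrite -(pmulr_lge0 _ m0); exact: le_trans h0.
  rewrite -!mulrA; apply: ler_wpM2l => //.
  rewrite [leRHS]mulrC; apply: ler_wpM2l; first exact: ltW.
  by rewrite mulrC ler_pdivrMr.
have [f Hf] := choice lim0; exists f => tau t tt.
apply: (ucvg_close (Hf tau)).
have K0 : 0 <= `|tau| + 1 by rewrite addr_ge0.
have [C HC] := lb _ K0.
have dt : ucvg (fun j => C * `|(t j)%:~R / L j - (time tau j)%:~R / L j|) 0.
  rewrite -(mulr0 C); apply: ucvgZ => e e0.
  have := ucvgB tt (time_cvg tau); rewrite subrr => /(_ e e0) hh.
  by apply: (U_sub hh) => j /=; rewrite !subr0 normr_id.
apply: (ucvg0_le dt).
apply: (U_sub (U_and (U_and HC mu0) (U_and L_gt0 (U_and (time_cvg tau ltr01) (tt _ ltr01))))).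
move=> j /= [[[h0 h] m0] [l0 [ht ht']]].
have bnd (s : int) : `|s%:~R / L j - tau| < 1 -> `|s%:~R| <= (`|tau| + 1) * L j :> R.
  move=> hs; rewrite -ler_pdivrMr// -[X in _ / X](gtr0_norm l0) -normfV -normrM.
  by rewrite -[_ / _](subrK tau); apply: le_trans (ler_normD _ _) _; rewrite addrC lerD2l ltW.
rewrite -mulrBl normrM normfV (gtr0_norm m0) ler_pdivrMr//.
apply: le_trans (h _ _ (bnd _ ht') (bnd _ ht)) _.
rewrite -mulrBl normrM normfV (gtr0_norm l0) le_eqVlt; apply/orP; left; apply/eqP; ring.
Qed.

Lemma path_limitD b b' mu f f' : path_limit b mu f -> path_limit b' mu f' ->
  path_limit (fun j t => b j t + b' j t) mu (fun tau => f tau + f' tau).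
Proof.
move=> H H' tau t tt; have := ucvgD (H _ _ tt) (H' _ _ tt).
by move=> h e e0; apply: (U_sub (h e e0)) => j /=; rewrite -mulrDl.
Qed.

Lemma path_limitB b b' mu f f' : path_limit b mu f -> path_limit b' mu f' ->
  path_limit (fun j t => b j t - b' j t) mu (fun tau => f tau - f' tau).
Proof.
move=> H H' tau t tt; have := ucvgB (H _ _ tt) (H' _ _ tt).
by move=> h e e0; apply: (U_sub (h e e0)) => j /=; rewrite -mulrBl.
Qed.

(* Compactness: an event which happens in a time window happens near a limit time. *)
Lemma event_limit (B : nat -> int -> Prop) (ta tb : R) :
  U [set j | exists t : int, [/\ ta * L j <= t%:~R, t%:~R <= tb * L j & B j t]] ->
  exists tau (t : nat -> int), [/\ ta <= tau <= tb,
    ucvg (fun j => (t j)%:~R / L j) tau & U [set j | B j (t j)]].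
Proof.
move=> H.
have [t Ht] : exists t : nat -> int, U [set j | [/\ ta * L j <= (t j)%:~R, (t j)%:~R <= tb * L j & B j (t j)]].
  have /choice[t Ht] : forall j, exists t : int,
      (exists t : int, [/\ ta * L j <= t%:~R, t%:~R <= tb * L j & B j t]) ->
      [/\ ta * L j <= t%:~R, t%:~R <= tb * L j & B j t].
    by move=> j; have [[t Ht]|h] := pselect (exists t : int, [/\ ta * L j <= t%:~R, t%:~R <= tb * L j & B j t]); [exists t|exists 0].
  by exists t; apply: (U_sub H) => j /= /Ht.
have bnd : U [set j | ta <= (t j)%:~R / L j <= tb].
  apply: (U_sub (U_and Ht L_gt0)) => j /= [[h1 h2 _] l0].
  by rewrite ler_pdivlMr// ler_pdivrMr// h1.
have [tau tt] : exists tau, ucvg (fun j => (t j)%:~R / L j) tau.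
  apply: (@ucvg_ex _ (`|ta| + `|tb|)); apply: (U_sub bnd) => j /= /andP[h1 h2].
  rewrite ler_norml; apply/andP; have := ler_norm tb; have := ler_norm (- ta).
  by rewrite normrN; have := normr_ge0 ta; have := normr_ge0 tb; lra.
exists tau, t; split => //; last by apply: (U_sub Ht) => j /= [].
apply/andP; split; first by apply: (ucvg_gec tt); apply: (U_sub bnd) => j /= /andP[].
by apply: (ucvg_lec tt); apply: (U_sub bnd) => j /= /andP[].
Qed.

End ultralimits.

(** * Limits of planar paths *)

Section orbit_limits.
Context {R : realType}.
Variable U : set_system nat.
Hypothesis ultraU : UltraFilter U.
Variable L : nat -> R.
Hypothesis L_infty : forall m : R, U [set j | m <= L j].

Let usub A B := @U_sub U ultraU A B.
Let uand (A B : set nat) : U A -> U B -> U (A `&` B).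
Proof. exact: filterI. Qed.
Let L0 : U [set j | 0 < L j] := L_gt0 ultraU L_infty.

Lemma int_sum_ge (f : int -> R) (c : R) (t : int) (n : nat) :
  (forall i, (i < n)%N -> c <= f (t + i%:Z + 1) - f (t + i%:Z)) ->
  c * n%:R <= f (t + n%:Z) - f t.
Proof.
elim: n => [|n IH] H; first by rewrite mulr0 addr0 subrr.
have h1 := H n (ltnSn n); have h2 := IH (fun i hi => H i (ltnW hi)).
have -> : t + n.+1%:Z = t + n%:Z + 1 by rewrite -addn1 PoszD addrA.
by rewrite -natr1 mulrDr mulr1; lra.
Qed.

Lemma int_lip (f : int -> R) (c : R) (t : int) (n : nat) :
  (forall i, (i < n)%N -> `|f (t + i%:Z + 1) - f (t + i%:Z)| <= c) ->
  `|f (t + n%:Z) - f t| <= c * n%:R.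
Proof.
move=> H; rewrite ler_norml; apply/andP; split.
  rewrite -mulNr; apply: (@int_sum_ge f) => i /H; rewrite ler_norml => /andP[]//.
suff : - c * n%:R <= - f (t + n%:Z) - - f t by rewrite mulNr; lra.
by apply: (@int_sum_ge (fun i => - f i)) => i /H; rewrite ler_norml => /andP[]; lra.
Qed.

Lemma int_window_lip (f : int -> R) (c W : R) (s t : int) :
  (forall i : int, `|i%:~R| <= W -> `|f (i + 1) - f i| <= c) ->
  `|s%:~R| <= W -> `|t%:~R| <= W -> `|f s - f t| <= c * `|s%:~R - t%:~R|.
Proof.
move=> H; wlog st : s t / t <= s.
  move=> hw hs ht; have [ts|/ltW ts] := leP t s; first exact: hw.
  by rewrite distrC [`|s%:~R - _|]distrC; apply: hw.
move=> hs ht; set n := absz (s - t).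
have nE : n%:Z = s - t by rewrite /n gez0_abs ?subr_ge0.
have sE : s = t + n%:Z by rewrite nE addrC subrK.
have -> : `|s%:~R - t%:~R| = n%:R :> R.
  by rewrite -intrB -nE ger0_norm // ler0z.
rewrite {1}sE; apply: int_lip => i hi; apply: H.
have i0 : 0 <= i%:R :> R by [].
have isn : t%:~R + i%:R <= s%:~R :> R.
  by rewrite sE !intrD lerD2l ler_nat ltnW.
rewrite intrD -pmulrn ler_norml; move: hs ht; rewrite !ler_norml => /andP[? ?] /andP[? ?].
by apply/andP; lra.
Qed.

(** Time and the vertical coordinate are scaled by [L], the horizontal coordinate by [mu]: [mu = L]
    without twist, [mu = L^2] with twist. *)
Definition plimit (mu : nat -> R) (b : nat -> int -> R * R) (f : R -> R * R) : Prop :=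
  path_limit U L (fun j t => (b j t).1) mu (fun x => (f x).1) /\
  path_limit U L (fun j t => (b j t).2) L (fun x => (f x).2).

Lemma plimitB mu b b' f f' : plimit mu b f -> plimit mu b' f' ->
  plimit mu (fun j t => b j t - b' j t) (fun x => f x - f' x).
Proof. by move=> [h1 h2] [h1' h2']; split; apply: path_limitB. Qed.

Lemma ucvg_abs (u : nat -> R) l : ucvg U u l -> ucvg U (fun j => `|u j|) `|l|.
Proof.
move=> ul e e0; apply: (usub (ul e e0)) => j /=.
by apply: le_lt_trans; exact: ler_dist_dist.
Qed.

Lemma ucvg_nrm (u w : nat -> R) l m : ucvg U u l -> ucvg U w m ->
  ucvg U (fun j => nrm (u j, w j)) (nrm (l, m)).
Proof.
move=> ul wm; apply: (ucvg_close ultraU (ucvg_cst ultraU _)).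
have h := ucvgD ultraU (ucvg_abs (ucvgB ultraU ul (ucvg_cst ultraU l)))
  (ucvg_abs (ucvgB ultraU wm (ucvg_cst ultraU m))).
move: h; rewrite !subrr normr0 addr0 => h; apply: (ucvg0_le ultraU h).
apply: (U_all ultraU) => j /=; rewrite ler_norml.
have h1 := nrm_tri (u j, w j) (l, m) 0; have h2 := nrm_tri (l, m) (u j, w j) 0.
rewrite !subr0 in h1 h2; rewrite nrmC in h2.
have := nrm_le_sum ((u j, w j) - (l, m)); rewrite !pairE /= => h3.
by apply/andP; lra.
Qed.

Definition tame (k : R) (mu : nat -> R) (b : nat -> int -> R * R) : Prop :=
  exists C, (forall j t, `|(b j (t + 1)).2 - (b j t).2| <= C /\
     `|(b j (t + 1)).1 - (b j t).1 - k * (b j t).2| <= C) /\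
    U [set j | `|(b j 0).1| <= C * mu j /\ `|(b j 0).2| <= C * L j].

Variables (k : R) (mu : nat -> R) (Kmu : R).
Hypothesis L_mu : U [set j | L j <= mu j].
Hypothesis k_mu : U [set j | `|k| * L j ^+ 2 <= Kmu * mu j].

(** Over times of order [L] the second coordinate stays of order [L], so each step of the shear
    contributes at most a constant times [|k| L], hence at most a constant times [mu / L] by [k_mu]:
    the rescaled path is Lipschitz. *)
Lemma plimit_ex b : tame k mu b -> exists f, plimit mu b f.
Proof.
move=> [C [step init]].
have C0 : 0 <= C by have [h _] := step 0%N 0; apply: le_trans h.
have mu0 : U [set j | 0 < mu j].
  by apply: (usub (uand L0 L_mu)) => j /= [h1]; exact: lt_le_trans.
have w2 j (K : R) t : 0 <= K -> 0 < L j -> `|(b j 0).2| <= C * L j ->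
    `|t%:~R| <= K * L j -> `|(b j t).2| <= C * (1 + K) * L j.
  move=> K0 Lj h0 ht.
  have z0 : `|0%:~R| <= K * L j by rewrite normr0 mulr_ge0// ltW.
  have := @int_window_lip (fun i => (b j i).2) C (K * L j) t 0
    (fun i _ => (step j i).1) ht z0; rewrite subr0 => h.
  rewrite -[(b j t).2](subrK (b j 0).2); apply: le_trans (ler_normD _ _) _.
  rewrite mulrDr mulr1 mulrDl addrC; apply: lerD => //.
  by apply: le_trans h _; rewrite -mulrA; apply: ler_wpM2l.
have l2 : lipschitz_at U L (fun j t => (b j t).2) L.
  move=> K K0; exists C; apply: (usub (uand init L0)) => j /= [[h1 h2] h3].
  split=> // s t hs ht; rewrite divff ?lt0r_neq0// mulr1.
  by apply: (@int_window_lip (fun i => (b j i).2) C (K * L j)) => // i _; case: (step j i).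
have l1 : lipschitz_at U L (fun j t => (b j t).1) mu.
  move=> K K0; exists (C + C * (1 + K) * Kmu).
  apply: (usub (uand (uand (uand init L0) (uand L_mu k_mu)) (L_infty 1))).
  move=> j /= [[[[h1 h2] h3] [h4 h5]] h6].
  have m0 : 0 < mu j by exact: lt_le_trans h4.
  have Kmu0 : 0 <= Kmu.
    by rewrite -(pmulr_lge0 _ m0); apply: le_trans h5; rewrite mulr_ge0// exprn_ge0// ltW.
  split.
    apply: le_trans h1 _; rewrite mulrDl lerDl mulr_ge0 ?(ltW m0)//.
    by rewrite !mulr_ge0// addr_ge0.
  move=> s t hs ht; apply: (@int_window_lip (fun i => (b j i).1) _ (K * L j)) => // i hi.
  have [_ st] := step j i; have b2 := w2 j K i K0 h3 h2 hi.
  rewrite -[_ - (b j i).1](subrK (k * (b j i).2)); apply: le_trans (ler_normD _ _) _.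
  rewrite mulrDl; apply: lerD.
    apply: le_trans st _; rewrite ler_peMr// ler_pdivlMr// mul1r//.
  rewrite normrM; apply: le_trans (ler_wpM2l (normr_ge0 k) b2) _.
  rewrite mulrA -[leRHS]mulrA mulrCA -!mulrA; apply: ler_wpM2l => //.
  apply: ler_wpM2l; first by rewrite addr_ge0.
  by rewrite mulrA ler_pdivlMr// -mulrA -expr2.
have [f1 H1] := path_limit_ex ultraU L_infty l1 mu0.
have [f2 H2] := path_limit_ex ultraU L_infty l2 L0.
by exists (fun x => (f1 x, f2 x)).
Qed.

End orbit_limits.

Section limit_laws.
Context {R : realType}.
Variable U : set_system nat.
Hypothesis ultraU : UltraFilter U.
Variable L : nat -> R.
Hypothesis L_infty : forall m : R, U [set j | m <= L j].

Let usub A B := @U_sub U ultraU A B.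
Let uand (A B : set nat) : U A -> U B -> U (A `&` B).
Proof. exact: filterI. Qed.
Let L0 : U [set j | 0 < L j] := L_gt0 ultraU L_infty.
Let tcvg := time_cvg ultraU L_infty.

Lemma time_succ_cvg s : ucvg U (fun j => (time L s j + 1)%:~R / L j) s.
Proof.
have := ucvgD ultraU (tcvg s) (ucvg_cst_div ultraU 1 L_infty).
rewrite addr0 => h e e0; apply: (usub (h e e0)) => j /=.
by rewrite intrD mulrDl.
Qed.

Lemma time_lt s t : s < t -> U [set j | time L s j + 1 <= time L t j].
Proof.
move=> st; apply: (usub (uand L0 (L_infty (2 / (t - s))))) => j /= [l0].
rewrite ler_pdivrMr ?subr_gt0// => h.
have /andP[h1 _] := floor_itv (s * L j); have /andP[_ h2] := floor_itv (t * L j).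
rewrite /time lezD1 -(ltr_int R); rewrite intrD in h2; nra.
Qed.

Lemma time_le s t j : 0 < L j -> s <= t -> time L s j <= time L t j.
Proof. by move=> l0 st; apply: le_floor; apply: ler_wpM2r => //; exact: ltW. Qed.

(** The limit path obeys [x' = k y] in integrated form; after division by [L^2] the bounded errors
    of the individual steps vanish. *)
Lemma plimit_drift k b f (e m s t : R) :
  let mu := fun j => L j ^+ 2 in
  tame U L k mu b -> plimit U L mu b f -> `|e| = 1 -> s <= t ->
  (forall u, s <= u <= t -> m <= e * (k * (f u).2)) ->
  m * (t - s) <= e * ((f t).1 - (f s).1).
Proof.
move=> mu [C [step _]] [b1 b2] e1; rewrite le_eqVlt => /predU1P[->|st] H.
  by rewrite !subrr !mulr0.
have C0 : 0 <= C by have [h _] := step 0%N 0; apply: le_trans h.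
have ts0 : 0 < t - s by rewrite subr_gt0.
apply/ler_addgt0Pr => eta eta0.
pose eps := eta / (t - s); have eps0 : 0 < eps by rewrite divr_gt0.
suff : (m - eps) * (t - s) <= e * ((f t).1 - (f s).1).
  by rewrite mulrBl divfK ?lt0r_neq0//; lra.
(* A violation of this bound at large [j] would converge to a violation of [H] at a limit time. *)
have ev : U [set j | forall i : int, s * L j <= i%:~R -> i%:~R <= t * L j ->
    (m - eps) * L j <= e * (k * (b j i).2)].
  have [//|h] := U_or ultraU [set j | forall i : int, s * L j <= i%:~R ->
    i%:~R <= t * L j -> (m - eps) * L j <= e * (k * (b j i).2)].
  have h' : U [set j | exists i : int, [/\ s * L j <= i%:~R, i%:~R <= t * L j &
      e * (k * (b j i).2) < (m - eps) * L j]].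
    apply: (usub h) => j /=; rewrite -existsNE => -[i]; rewrite !not_implyE => -[i1 [i2]].
    by move=> /negP; rewrite -ltNge => i3; exists i.
  have [tau [tt [st' tau_cvg Htau]]] := event_limit ultraU L_infty h'.
  have := ucvgZ ultraU e (ucvgZ ultraU k (b2 _ _ tau_cvg)) => lim.
  have le : e * (k * (f tau).2) <= m - eps.
    apply: (ucvg_lec ultraU lim).
    apply: (usub (uand Htau L0)) => j /= [h1 h2].
    by rewrite -(ler_pM2r h2) -!mulrA mulVf ?lt0r_neq0// mulr1 ltW.
  by have := H _ st'; lra.
have lim1 := ucvgZ ultraU e (ucvgB ultraU (b1 _ _ (tcvg t)) (b1 _ _ (time_succ_cvg s))).
have lim2 := ucvgB ultraU (ucvgZ ultraU (m - eps) (ucvgB ultraU (tcvg t) (time_succ_cvg s)))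
   (ucvgZ ultraU (t - s + 2) (ucvg_cst_div ultraU C L_infty)).
rewrite mulr0 subr0 in lim2.
apply: (ucvg_le ultraU lim2 lim1).
have near := uand (tcvg t ltr01) (time_succ_cvg s ltr01).
apply: (usub (uand (uand ev L0) (uand (time_lt st) near))) => j /= [[h1 l0] [h2 [h3 h4]]].
(* Starting one unit after the floor keeps every intermediate time inside [[s L, t L]], where [ev]
   applies. *)
set t1 := time L t j in h2 h3 *; set t0 := time L s j + 1 in h2 h4 *.
pose n := absz (t1 - t0).
have nE : n%:Z = t1 - t0 by rewrite /n gez0_abs ?subr_ge0.
have t1E : t1 = t0 + n%:Z by rewrite nE addrC subrK.
have t0s : s * L j <= t0%:~R.
  by have /andP[_ /ltW] := floor_itv (s * L j).
have t1t : t1%:~R <= t * L j by have /andP[] := floor_itv (t * L j).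
have h5 : ((m - eps) * L j - C) * n%:R <= e * (b j t1).1 - e * (b j t0).1.
  rewrite t1E; apply: (@int_sum_ge _ (fun i => e * (b j i).1)).
  move=> i iN; have [_ st1] := step j (t0 + i%:Z).
  have i1 : s * L j <= (t0 + i%:Z)%:~R by rewrite intrD; apply: le_trans t0s _; rewrite lerDl.
  have i2 : (t0 + i%:Z)%:~R <= t * L j.
    by apply: le_trans t1t; rewrite t1E !intrD lerD2l ler_nat ltnW.
  have := h1 _ i1 i2.
  have : `|e * ((b j (t0 + i%:Z + 1)).1 - (b j (t0 + i%:Z)).1 - k * (b j (t0 + i%:Z)).2)| <= C.
    by rewrite normrM e1 mul1r.
  by rewrite ler_norml => /andP[h5 _]; lra.
have nR : n%:R = t1%:~R - t0%:~R :> R by rewrite -intrB -nE.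
rewrite nR in h5.
have L2 : 0 < L j ^+ 2 by rewrite exprn_gt0.
have Ln0 : L j != 0 by rewrite lt0r_neq0.
rewrite -(ler_pM2r L2) /mu.
have -> : e * ((b j t1).1 / L j ^+ 2 - (b j t0).1 / L j ^+ 2) * L j ^+ 2 =
  e * (b j t1).1 - e * (b j t0).1 by field.
apply: le_trans h5.
have -> : ((m - eps) * (t1%:~R / L j - t0%:~R / L j) - (t - s + 2) * (C / L j)) * L j ^+ 2 =
  (m - eps) * L j * (t1%:~R - t0%:~R) - (t - s + 2) * L j * C by field.
suff : C * (t1%:~R - t0%:~R) <= (t - s + 2) * L j * C by rewrite (mulrBl (t1%:~R - t0%:~R)); lra.
rewrite mulrC; apply: ler_wpM2r => //.
move: h3 h4; rewrite !ltr_norml => /andP[_ h3] /andP[h4 _].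
have : t1%:~R / L j - t0%:~R / L j <= t - s + 2 by lra.
by rewrite -mulrBl ler_pdivrMr.
Qed.

(** Stated for arbitrary sequences of paths because it will also be applied to periodic
    pseudo-orbits. *)
Definition pseudo_rate (A : nat -> int -> R * R) (c : R * R) (r : R) : Prop :=
  forall eta, 0 < eta -> exists K, U [set j | forall (s : int) (n : nat),
    nrm (A j (s + n%:Z) - A j s - n%:R *: c) <= (r + eta) * n%:R + K].

Lemma plimit_rate A g c r s t : pseudo_rate A c r -> plimit U L L A g -> s <= t ->
  nrm (g t - g s - (t - s) *: c) <= (t - s) * r.
Proof.
move=> HA [A1 A2] st; apply/ler_addgt0Pr => eta eta0.
have ts0 : 0 < t - s + 1 by rewrite ltr_wpDl// subr_ge0.
pose eps := eta / (t - s + 1); have eps0 : 0 < eps by rewrite divr_gt0.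
suff : nrm (g t - g s - (t - s) *: c) <= (r + eps) * (t - s).
  have : eps * (t - s) <= eta by rewrite /eps mulrAC ler_pdivrMr//; nra.
  by lra.
have [K HK] := HA _ eps0.
have dt := ucvgB ultraU (tcvg t) (tcvg s).
have c1 := ucvgB ultraU (ucvgB ultraU (A1 _ _ (tcvg t)) (A1 _ _ (tcvg s))) (ucvgZ ultraU c.1 dt).
have c2 := ucvgB ultraU (ucvgB ultraU (A2 _ _ (tcvg t)) (A2 _ _ (tcvg s))) (ucvgZ ultraU c.2 dt).
have lim1 := ucvg_nrm ultraU c1 c2.
have lim2 := ucvgD ultraU (ucvgZ ultraU (r + eps) dt) (ucvg_cst_div ultraU K L_infty).
rewrite addr0 in lim2.
have -> : g t - g s - (t - s) *: c =
    ((g t).1 - (g s).1 - c.1 * (t - s), (g t).2 - (g s).2 - c.2 * (t - s)).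
  by apply: veq; rewrite !pairE mulrC.
apply: (ucvg_le ultraU lim1 lim2).
apply: (usub (uand HK L0)) => j /= [h l0].
set t1 := time L t j; set t0 := time L s j.
have t01 : t0 <= t1 by exact: time_le.
pose n := absz (t1 - t0).
have nE : n%:Z = t1 - t0 by rewrite /n gez0_abs ?subr_ge0.
have := h t0 n; have -> : t0 + n%:Z = t1 by rewrite nE addrC subrK.
have nR : n%:R = t1%:~R - t0%:~R :> R by rewrite -intrB -nE.
rewrite nR => h5; rewrite -(ler_pM2r l0).
have Ln0 : L j != 0 by rewrite lt0r_neq0.
have -> : ((r + eps) * (t1%:~R / L j - t0%:~R / L j) + K / L j) * L j =
   (r + eps) * (t1%:~R - t0%:~R) + K by field.
apply: le_trans h5.
rewrite -[leLHS]mulrC -{1}[L j]gtr0_norm// -nrmZ le_eqVlt; apply/orP; left; apply/eqP.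
congr nrm; by apply: veq; rewrite !pairE /=; field.
Qed.

(** With [x] the displacement in the frame of velocity [v] and [beta = v - c], motion inside the
    disc must be paid for by a loss of the component along [beta]. Expanding the square gives it. *)
Lemma rate_energy (x beta : R * R) (T : R) : 0 <= T ->
  nrm (x + T *: beta) <= T * nrm beta -> nrm x ^+ 2 <= 2 * T * dot beta (- x).
Proof.
move=> T0; rewrite -ler_sqr ?nnegrE ?nrm_ge0 ?mulr_ge0 ?nrm_ge0//.
rewrite exprMn !nrm_sq /dot !pairE => h; nra.
Qed.

Hypothesis freeU : forall n, U [set j | (n <= j)%N].
Variables (F Fi : R * R -> R * R) (a : R * R -> R * R) (C1 : R).
Hypotheses (FK : cancel F Fi) (FiK : cancel Fi F).
Hypothesis step_bound : forall z, nrm (a (F z) - a z) <= C1.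
Local Notation it := (iterz F Fi).

Lemma orbit_pseudo_rate (z : nat -> R * R) c :
  pseudo_rate (fun j t => a (it t (z j))) c (rate F a c).
Proof.
move=> eta eta0; have [K K0 HK] := rate_upper step_bound c eta0.
exists K; apply: (U_all ultraU) => j.
move=> s n; have := HK n (it s (z j)).
by rewrite /disp [s + _]addrC (iterzD FK FiK).
Qed.

(** A diagonal choice: the tolerance tends to 0 slowly enough for its additive constant to remain
    small against [L j]. *)
Lemma steady_sequence v (W : nat -> nat) : realized F Fi a v ->
  exists z : nat -> R * R, forall eps, 0 < eps -> U [set j | forall t : int,
    (`|t| <= W j)%N -> nrm (a (it t (z j)) - a (z j) - t%:~R *: v) <= eps * `|t|%N%:R + eps * L j].
Proof.
move=> Hv.
have e0 (n : nat) : 0 < n.+1%:R^-1 :> R by rewrite invr_gt0.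
have [K HK] := choice (fun n => Hv _ (e0 n)).
have /choice[z Hz] : forall jn : nat * nat, exists z, forall t : int, (`|t| <= W jn.1)%N ->
    nrm (a (it t z) - a z - t%:~R *: v) <= jn.2.+1%:R^-1 * `|t|%N%:R + K jn.2.
  by move=> [j n]; exact: HK.
pose P j n := K n <= n.+1%:R^-1 * L j.
(* The finest tolerance up to index [j] whose constant is already negligible; it eventually exceeds
   every fixed [m]. *)
pose N j := (\max_(n < j.+1 | P j n) n)%N.
exists (fun j => z (j, N j)) => eps eps0.
pose m := Num.truncn eps^-1.
have mE : m.+1%:R^-1 <= eps.
  by rewrite -[eps]invrK lef_pV2 ?posrE ?invr_gt0// ltW// truncnS_gt.
have Pm : U [set j | P j m].
  apply: (usub (uand L0 (L_infty (K m * m.+1%:R)))) => j /= [l0 h].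
  by rewrite /P mulrC ler_pdivlMr.
apply: (usub (uand (uand Pm (freeU m)) L0)) => j /= [[Pmj mj] l0] t ht.
have mj' : (m < j.+1)%N by [].
have mN : (m <= N j)%N by exact: (@leq_bigmax_cond _ _ (fun n : 'I_j.+1 => n : nat) (Ordinal mj')).
have PN : P j (N j).
  have [|i Pi iE] := @eq_bigmax_cond _ [pred n : 'I_j.+1 | P j n] (fun n => n : nat).
    by apply/card_gt0P; exists (Ordinal mj').
  have -> : N j = i by rewrite -iE; apply: eq_bigl.
  exact: Pi.
have Ne : (N j).+1%:R^-1 <= eps.
  by apply: le_trans mE; rewrite lef_pV2 ?posrE// ler_nat ltnS.
apply: le_trans (Hz (j, N j) t ht) _; apply: lerD; first by apply: ler_wpM2r.
by apply: le_trans PN _; apply: ler_wpM2r => //; exact: ltW.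
Qed.

End limit_laws.

(** * Crossing counts for limit paths *)

Section trace.
Context {R : realType}.
Variable U : set_system nat.
Hypothesis ultraU : UltraFilter U.
Variables L mu : nat -> R.
Hypothesis L_infty : forall m : R, U [set j | m <= L j].
Hypothesis L_mu : U [set j | L j <= mu j].

Let usub A B := @U_sub U ultraU A B.
Let uand (A B : set nat) : U A -> U B -> U (A `&` B).
Proof. exact: filterI. Qed.
Let L0 : U [set j | 0 < L j] := L_gt0 ultraU L_infty.
Let tcvg := time_cvg ultraU L_infty.

Lemma mu_infty (m : R) : U [set j | m <= mu j].
Proof. by apply: (usub (uand (L_infty m) L_mu)) => j /= [h]; exact: le_trans. Qed.

Lemma mu_gt0 : U [set j | 0 < mu j].
Proof. by apply: (usub (mu_infty 1)) => j /=; exact: lt_le_trans. Qed.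

(** Unsafe times at arbitrarily large [j] accumulate at a limit time where [f] lies on the closed
    right half-axis. *)
Lemma safe_window_left (A : nat -> int -> R * R) f (ta tb : nat -> int) (s t K : R) :
  plimit U L mu A f -> ucvg U (fun j => (ta j)%:~R / L j) s ->
  ucvg U (fun j => (tb j)%:~R / L j) t ->
  (forall u, s <= u <= t -> (f u).2 = 0 -> (f u).1 < 0) ->
  U [set j | forall i, ta j <= i <= tb j -> K < `|(A j i).2| \/ (A j i).1 < - K].
Proof.
move=> [A1 A2] cs ct H.
have [//|h] := U_or ultraU [set j | forall i, ta j <= i <= tb j ->
  K < `|(A j i).2| \/ (A j i).1 < - K].
pose E j i := ta j <= i <= tb j /\ (`|(A j i).2| <= K /\ - K <= (A j i).1).
have h' : U [set j | exists i : int, [/\ (s - 1) * L j <= i%:~R, i%:~R <= (t + 1) * L j & E j i]].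
  apply: (usub (uand (uand h L0) (uand (cs _ ltr01) (ct _ ltr01)))) => j /= [[+ l0] [h1 h2]].
  rewrite -existsNE => -[i]; rewrite not_implyE not_orE => -[/andP[i1 i2] [i3 i4]].
  move: h1 h2; rewrite !ltr_norml => /andP[h1 _] /andP[_ h2].
  have h3 : s - 1 <= (ta j)%:~R / L j by lra.
  have h4 : (tb j)%:~R / L j <= t + 1 by lra.
  rewrite ler_pdivlMr// in h3; rewrite ler_pdivrMr// in h4.
  exists i; split.
  - by apply: le_trans h3 _; rewrite ler_int.
  - by apply: le_trans h4; rewrite ler_int.
  - split; first by rewrite i1.
    by rewrite !leNgt; split; apply/negP.
have [u [i [_ iu Ei]]] := event_limit ultraU L_infty h'.
have su : s <= u.
  apply: (ucvg_le ultraU cs iu); apply: (usub (uand Ei L0)) => j /= [[/andP[h1 _] _] l0].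
  by rewrite ler_pM2r ?invr_gt0// ler_int.
have ut : u <= t.
  apply: (ucvg_le ultraU iu ct); apply: (usub (uand Ei L0)) => j /= [[/andP[_ h1] _] l0].
  by rewrite ler_pM2r ?invr_gt0// ler_int.
have f2 : (f u).2 = 0.
  apply: (ucvg_uniq ultraU (A2 _ _ iu)).
  apply: (ucvg0_le ultraU (ucvg_cst_div ultraU K L_infty)).
  apply: (usub (uand Ei L0)) => j /= [[_ [h1 _]] l0].
  by rewrite normrM normfV (gtr0_norm l0) ler_pM2r ?invr_gt0.
have f1 : 0 <= (f u).1.
  apply: (ucvg_le ultraU _ (A1 _ _ iu)); first exact: (ucvg_cst_div ultraU (- K) mu_infty).
  apply: (usub (uand Ei mu_gt0)) => j /= [[_ [_ h1]] m0].
  by rewrite ler_pM2r ?invr_gt0.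
have := H u; rewrite su ut => /(_ isT f2).
by rewrite ltNge f1.
Qed.

Lemma plimitN (A : nat -> int -> R * R) f : plimit U L mu A f ->
  plimit U L mu (fun j t => - A j t) (fun u => - f u).
Proof.
move=> [A1 A2]; split => u t tt.
  have := ucvgN ultraU (A1 _ _ tt) => h e e0; apply: (usub (h e e0)) => j /=.
  by rewrite mulNr.
have := ucvgN ultraU (A2 _ _ tt) => h e e0; apply: (usub (h e e0)) => j /=.
by rewrite mulNr.
Qed.

Lemma safe_window_right (A : nat -> int -> R * R) f (ta tb : nat -> int) (s t K : R) :
  plimit U L mu A f -> ucvg U (fun j => (ta j)%:~R / L j) s ->
  ucvg U (fun j => (tb j)%:~R / L j) t ->
  (forall u, s <= u <= t -> (f u).2 = 0 -> 0 < (f u).1) ->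
  U [set j | forall i, ta j <= i <= tb j -> K < `|(A j i).2| \/ K < (A j i).1].
Proof.
move=> Af cs ct H; have := safe_window_left K (plimitN Af) cs ct.
move=> h; apply: (usub (h _)) => [u su|j /= hj i /hj].
  by rewrite /= oppr_lt0 => /eqP; rewrite oppr_eq0 => /eqP; exact: H.
by rewrite normrN ltrN2.
Qed.

Variables (F Fi : R * R -> R * R) (M : (R * R) * (R * R)) (C ka : R).
Hypotheses (contF : continuous F) (contFi : continuous Fi).
Hypotheses (FK : cancel F Fi) (FiK : cancel Fi F) (dM : det M != 0).
Hypothesis quasi : forall P w,
  `|(mx M (F (P + w) - F P)).1 - ((mx M w).1 + ka * (mx M w).2)| <= C /\
  `|(mx M (F (P + w) - F P)).2 - (mx M w).2| <= C.

Local Notation it := (iterz F Fi).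
Local Notation rel t z P := (mx M (it t z - it t P)).

Definition spread (D : nat -> set (R * R)) (P : nat -> R * R) (kappa : R) (t : int) (j : nat) : Prop :=
  forall z w, D j z -> D j w ->
    `|(rel t z (P j) - rel t w (P j)).1| <= kappa * mu j /\
    `|(rel t z (P j) - rel t w (P j)).2| <= kappa * L j.

(** An instance of [no_crossing] at one large [j]. The hypotheses at [s] and [t] exceed the sizes
    [k1] and [k2] of the image of [D j], so all of it lies on one side at both times; the same
    margin at [t] keeps [P j] outside [D j]. *)
Lemma no_limit_crossing (D : nat -> set (R * R)) (p q P : nat -> R * R) fp fq (s t k1 k2 : R) :
  U [set j | pathconn (D j)] -> (forall j, D j (p j)) -> (forall j, D j (q j)) ->
  plimit U L mu (fun j i => rel i (p j) (P j)) fp ->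
  plimit U L mu (fun j i => rel i (q j) (P j)) fq -> s < t ->
  (forall u, s <= u <= t -> (fp u).2 = 0 -> (fp u).1 < 0) ->
  (forall u, s <= u <= t -> (fq u).2 = 0 -> 0 < (fq u).1) ->
  U [set j | spread D P k1 (time L s j) j] ->
  U [set j | spread D P k2 (time L t j) j] ->
  k1 < (fq s).2 \/ (0 < (fq s).2 /\ (fq s).1 < - k1) ->
  (fq t).2 < - k2 \/ ((fq t).2 < 0 /\ (fq t).1 < - k2) -> False.
Proof.
move=> cD Dp Dq lp lq st Hp Hq S1 S2 E1 E2.
pose K := (1 + `|ka|) * C + C.
have C0 : 0 <= C by have [] := quasi 0 0; move=> h _; apply: le_trans (normr_ge0 _) h.
have kaC : 0 <= `|ka| * C by rewrite mulr_ge0.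
have w1 := safe_window_left K lp (tcvg s) (tcvg t) Hp.
have w2 := safe_window_right K lq (tcvg s) (tcvg t) Hq.
have q1 := lq.1 _ _ (tcvg s); have q2 := lq.2 _ _ (tcvg s).
have r1 := lq.1 _ _ (tcvg t); have r2 := lq.2 _ _ (tcvg t).
have e1 : U [set j | 0 < (rel (time L s j) (q j) (P j)).2 /\
   (k1 * L j < (rel (time L s j) (q j) (P j)).2 \/ (rel (time L s j) (q j) (P j)).1 < - k1 * mu j)].
  case: E1 => [h|[h h']].
    have k10 : 0 <= k1.
      have [j [[/= Sj l0] m0]] := U_ex ultraU (uand (uand S1 L0) mu_gt0).
      have [_] := Sj _ _ (Dp j) (Dp j); rewrite subrr normr0.
      by rewrite pmulr_lge0.
    apply: (usub (uand (ucvg_gt ultraU q2 h) L0)) => j /= [h1 l0].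
    rewrite ltr_pdivlMr// in h1; split; last by left.
    by apply: le_lt_trans h1; rewrite mulr_ge0// ltW.
  apply: (usub (uand (uand (ucvg_gt ultraU q2 h) (ucvg_lt ultraU q1 h')) (uand L0 mu_gt0))) => j /=.
  by move=> [[h1 h2] [l0 m0]]; rewrite ltr_pdivlMr// mul0r in h1; rewrite ltr_pdivrMr// in h2; split=> //; right.
have e2 : U [set j | (rel (time L t j) (q j) (P j)).2 <= 0 /\
   ((rel (time L t j) (q j) (P j)).2 < - k2 * L j \/ (rel (time L t j) (q j) (P j)).1 < - k2 * mu j)].
  case: E2 => [h|[h h']].
    have k20 : 0 <= k2.
      have [j [[/= Sj l0] m0]] := U_ex ultraU (uand (uand S2 L0) mu_gt0).
      have [_] := Sj _ _ (Dp j) (Dp j); rewrite subrr normr0.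
      by rewrite pmulr_lge0.
    apply: (usub (uand (ucvg_lt ultraU r2 h) L0)) => j /= [h1 l0].
    rewrite ltr_pdivrMr// in h1; split; last by left.
    by apply/ltW/(lt_le_trans h1); rewrite mulNr oppr_le0 mulr_ge0// ltW.
  apply: (usub (uand (uand (ucvg_lt ultraU r2 h) (ucvg_lt ultraU r1 h')) (uand L0 mu_gt0))) => j /=.
  by move=> [[h1 h2] [l0 m0]]; rewrite ltr_pdivrMr// mul0r in h1; rewrite ltr_pdivrMr// in h2; split; [exact: ltW|right].
have [j] := U_ex ultraU (uand (uand (uand cD (uand S1 S2)) (uand w1 w2)) (uand (uand e1 e2) L0)).
move=> [[[/= cDj [s1 s2]] [v1 v2]] [[[f1 g1] [f2 g2]] l0]].
have nP : ~ D j (P j).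
  move=> DP; have [h1 h2] := s2 _ _ DP (Dq j).
  have z0 : rel (time L t j) (P j) (P j) = 0 by rewrite subrr mxE /= !mulr0 addr0.
  rewrite z0 !sub0r !pairE !normrN !ler_norml in h1 h2.
  by case: g2 => g2; move: h1 h2 => /andP[h1 _] /andP[h2 _]; lra.
apply: (@no_crossing _ F Fi M C ka contF contFi FK FiK dM quasi (D j) (p j) (q j) (P j)
  (time L s j) (time L t j)) => //.
- exact: time_le l0 (ltW st).
- move=> i i1 i2; have := v1 i; rewrite i1 (ltW i2) /= /safe_left /K => /(_ isT)[h|h]; [left|right].
    by apply: le_lt_trans h; lra.
  by apply: lt_le_trans h _; lra.
- move=> i i1 i2; have := v2 i; rewrite i1 (ltW i2) /= /safe_right /K => /(_ isT)[h|h]; [left|right].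
    by apply: le_lt_trans h; lra.
  by apply: le_lt_trans h; lra.
- case: g1 => g1; [left|right] => z Dz; have [h1 h2] := s1 _ _ Dz (Dq j);
    rewrite !pairE !ler_norml in h1 h2; move: h1 h2 => /andP[h1 h1'] /andP[h2 h2']; lra.
- case: g2 => g2; [left|right] => z Dz; have [h1 h2] := s2 _ _ Dz (Dq j);
    rewrite !pairE !ler_norml in h1 h2; move: h1 h2 => /andP[h1 h1'] /andP[h2 h2']; lra.
Qed.

End trace.

(** * Sets with bounded iterates: maps without twist *)

Section frames.
Context {R : realType}.
Implicit Types (z w b : R * R) (e : R).

Lemma dotC z w : dot z w = dot w z.
Proof. by rewrite /dot mulrC [z.2 * _]mulrC. Qed.
Lemma dotDr b z w : dot b (z + w) = dot b z + dot b w.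
Proof. by rewrite /dot !pairE; ring. Qed.
Lemma dotBr b z w : dot b (z - w) = dot b z - dot b w.
Proof. by rewrite /dot !pairE; ring. Qed.
Lemma dotZr b e z : dot b (e *: z) = e * dot b z.
Proof. by rewrite /dot !pairE; ring. Qed.
Lemma dotNr b z : dot b (- z) = - dot b z.
Proof. by rewrite /dot !pairE; ring. Qed.
Lemma dot_abs_le b z : `|dot b z| <= nrm b * nrm z.
Proof.
rewrite ler_norml dot_le andbT lerNl -dotNl -(nrmN b); exact: dot_le.
Qed.

(* Coordinates adapted to b: the second one is the component along b, the first
   one is the transverse component, oriented by the sign e. *)
Definition frame e b : (R * R) * (R * R) := ((- (e * b.2), e * b.1), b).

Lemma frame1 e b z : (mx (frame e b) z).1 = e * dot (- b.2, b.1) z.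
Proof. by rewrite mxE /dot /=; ring. Qed.
Lemma frame2 e b z : (mx (frame e b) z).2 = dot b z.
Proof. by rewrite mxE. Qed.

Lemma nrm_rot b : nrm (- b.2, b.1) = nrm b.
Proof. by rewrite /nrm /dot /= mulrNN addrC. Qed.

Lemma frame1_le e b z : `|e| = 1 -> `|(mx (frame e b) z).1| <= nrm b * nrm z.
Proof. by move=> e1; rewrite frame1 normrM e1 mul1r -(nrm_rot b) dot_abs_le. Qed.
Lemma frame2_le e b z : `|(mx (frame e b) z).2| <= nrm b * nrm z.
Proof. by rewrite frame2 dot_abs_le. Qed.

Lemma det_frame e b : `|e| = 1 -> b != 0 -> det (frame e b) != 0.
Proof.
move=> e1 b0; have -> : det (frame e b) = - e * dot b b by rewrite /det /dot /=; ring.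
rewrite mulf_neq0 ?oppr_eq0 ?(normr_gt0, oppr_eq0)//; first by rewrite -normr_gt0 e1.
by rewrite -nrm_sq expf_neq0// nrm_eq0.
Qed.

Lemma frame_inj b z : b != 0 -> dot (- b.2, b.1) z = 0 -> dot b z = 0 -> z = 0.
Proof.
move=> b0 h1 h2; apply: (@mx_inj0 _ (frame 1 b)); first by rewrite det_frame// normr1.
by apply: veq; rewrite ?frame1 ?frame2 ?h1 ?mulr0.
Qed.

Lemma mxB M z w : mx M (z - w) = mx M z - mx M w.
Proof. by rewrite !mxE; apply: veq; rewrite !pairE /=; ring. Qed.

Lemma lip_cont (g : R -> R) K : (forall s t, `|g s - g t| <= K * `|s - t|) -> continuous g.
Proof.
move=> H x; have K0 : 0 <= K.
  by have := H 1 0; rewrite subr0 normr1 mulr1; apply: le_trans.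
have K1 : 0 < K + 1 by rewrite ltr_wpDl.
apply/cvgrPdist_lt => e e0; near=> y.
apply: (le_lt_trans (H x y)).
have : `|x - y| < e / (K + 1).
  near: y; apply: (nbhsx_ballx x); exact: divr_gt0.
rewrite ltr_pdivlMr// => h; apply: le_lt_trans h; rewrite mulrC.
by apply: ler_wpM2l => //; rewrite lerDl.
Unshelve. all: by end_near. Qed.

Lemma lip_ivt (g : R -> R) K (s t x : R) : (forall s t, `|g s - g t| <= K * `|s - t|) ->
  s <= t -> g t <= x <= g s -> exists2 u, s <= u <= t & g u = x.
Proof.
move=> H st /andP[h1 h2].
have cg : {within `[s, t], continuous g} by apply: continuous_subspaceT; exact: lip_cont H.
have [|u] := IVT st cg (v := x).
  by rewrite ge_min le_max h1 h2 orbT.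
by rewrite in_itv; exists u.
Qed.

(** A function bounded below cannot lose more than [eta] on each of infinitely many consecutive
    windows of length [2 S]. *)
Lemma small_drop (H : R -> R) (B S eta T : R) : 0 < S -> 0 < eta ->
  (forall t, T <= t -> - B <= H t) ->
  exists2 tau, T + S <= tau & H (tau - S) - H (tau + S) <= eta.
Proof.
move=> S0 eta0 HB; apply: contrapT => no.
have st (k : nat) : H (T + 2 * S * k%:R) <= H T - k%:R * eta.
  elim: k => [|k IH]; first by rewrite mulr0 addr0 mul0r subr0.
  have k0 : 0 <= S * k%:R by rewrite mulr_ge0// ltW.
  have : eta < H (T + 2 * S * k%:R + S - S) - H (T + 2 * S * k%:R + S + S).
    rewrite ltNge; apply/negP => h; apply: no; exists (T + 2 * S * k%:R + S) => //; lra.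
  have -> : T + 2 * S * k.+1%:R = T + 2 * S * k%:R + S + S by rewrite -[k.+1%:R]natr1; ring.
  by rewrite addrK -[k.+1%:R]natr1; lra.
pose k := (Num.truncn ((H T + B) / eta)).+1.
have : H T + B < k%:R * eta by rewrite -ltr_pdivrMr//; exact: truncnS_gt.
have k0 : 0 <= S * k%:R by rewrite mulr_ge0// ltW.
have := st k; have := HB (T + 2 * S * k%:R); lra.
Qed.

End frames.

(** * Limit paths in the frame of a class of orbits *)

Section family.
Context {R : realType}.
Variables (F Fi : R * R -> R * R) (C1 : R).
Hypotheses (contF : continuous F) (contFi : continuous Fi).
Hypotheses (FK : cancel F Fi) (FiK : cancel Fi F).
Hypothesis step_bound : forall z, nrm (id (F z) - id z) <= C1.
Hypothesis equivF : forall z m : R * R, m.1 \is a Num.int -> m.2 \is a Num.int -> F (z + m) = F z + m.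
Local Notation it := (iterz F Fi).
Local Notation rt := (rate F id).

Lemma it_step t z : nrm (it (t + 1) z - it t z) <= C1.
Proof. by rewrite (iterzS FiK); exact: step_bound. Qed.

Lemma equivFi z m : m.1 \is a Num.int -> m.2 \is a Num.int -> Fi (z + m) = Fi z + m.
Proof. by move=> m1 m2; apply: (can_inj FK); rewrite equivF// !FiK. Qed.

Lemma it_equiv t z m : m.1 \is a Num.int -> m.2 \is a Num.int -> it t (z + m) = it t z + m.
Proof.
move=> m1 m2; case: t => n; rewrite /iterz.
  by elim: n => [//|n IH] /=; rewrite IH equivF.
by elim: n.+1 => [//|n' IH] /=; rewrite IH equivFi.
Qed.

Variable U : set_system nat.
Hypothesis ultraU : UltraFilter U.
Hypothesis freeU : forall n, U [set j | (n <= j)%N].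
Variable L : nat -> R.
Hypothesis L_infty : forall m : R, U [set j | m <= L j].
Let usub A B := @U_sub U ultraU A B.
Let uand (A B : set nat) : U A -> U B -> U (A `&` B).
Proof. exact: filterI. Qed.
Let L0 : U [set j | 0 < L j] := L_gt0 ultraU L_infty.
Let tcvg := time_cvg ultraU L_infty.

Let LL : U [set j | L j <= L j].
Proof. by apply: (U_all ultraU) => j /=. Qed.
Let L00 : U [set j | `|0 : R| * L j ^+ 2 <= 0 * L j].
Proof. by apply: (U_all ultraU) => j /=; rewrite normr0 !mul0r. Qed.

Variables (D : nat -> set (R * R)) (b m : nat -> R * R).
Hypothesis D_pc : forall j, pathconn (D j).
Hypothesis D_bound : forall j t z w, D j z -> D j w -> nrm (it t z - it t w) <= 2 * L j.
Hypotheses (Db : forall j, D j (b j)) (bm : forall j, nrm (b j - m j) <= 2).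

Definition orbit_limit (q : nat -> R * R) f := plimit U L L (fun j t => it t (q j) - m j) f.

Lemma orbit_limit_ex q (K : R) : U [set j | nrm (q j - m j) <= K * L j] ->
  exists f, orbit_limit q f.
Proof.
move=> hq; apply: (plimit_ex ultraU L_infty (k := 0) LL L00).
exists (Num.max C1 K); split => [j t|].
  have h := it_step t (q j); rewrite mul0r subr0 !pairE.
  have e x y : x - (m j).1 - (y - (m j).1) = x - y by ring.
  have e' x y : x - (m j).2 - (y - (m j).2) = x - y by ring.
  rewrite e e' le_max.
  have := le_trans (nrm_fst _) h; have := le_trans (nrm_snd _) h.
  by rewrite !pairE le_max => -> ->.
apply: (usub (uand hq L0)) => j /= [h l0].
have hm : nrm (q j - m j) <= Num.max C1 K * L j.
  by apply: le_trans h _; apply: ler_wpM2r; [exact: ltW|rewrite le_max lexx orbT].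
by split; apply: le_trans hm; [exact: (nrm_fst (q j - m j))|exact: (nrm_snd (q j - m j))].
Qed.

Lemma in_D_limit q : (forall j, D j (q j)) -> exists f, orbit_limit q f.
Proof.
move=> Dq; apply: (@orbit_limit_ex q 4).
apply: (usub (L_infty 1)) => j /= l1.
have := D_bound 0 (Dq j) (Db j) => /= h1; have h2 := bm j.
have := nrm_tri (q j) (b j) (m j); lra.
Qed.

Lemma orbit_limit_rate q f c s t : orbit_limit q f -> s <= t ->
  nrm (f t - f s - (t - s) *: c) <= (t - s) * rt c.
Proof.
move=> qf st; apply: (plimit_rate ultraU L_infty _ qf st).
move=> eta eta0; have [K HK] := orbit_pseudo_rate ultraU FK FiK step_bound q c eta0.
exists K; apply: (usub HK) => j h s' n; have := h s' n.
have -> : it (s' + n%:Z) (q j) - m j - (it s' (q j) - m j) = it (s' + n%:Z) (q j) - it s' (q j).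
  by rewrite opprB addrA subrK.
by [].
Qed.

Lemma orbit_limit_lip q f s t : orbit_limit q f -> nrm (f s - f t) <= rt 0 * `|s - t|.
Proof.
move=> qf; wlog st : s t / t <= s.
  move=> hw; have [/hw//|/ltW /hw] := leP t s.
  by rewrite nrmC distrC.
have := orbit_limit_rate 0 qf st; rewrite scaler0 subr0 => h.
by rewrite ger0_norm ?subr_ge0// mulrC.
Qed.

Section one_class.
Variables (c v : R * R).
Hypotheses (v_real : realized F Fi id v) (cv : nrm (v - c) = rt c) (cv0 : v - c != 0).
Let be := v - c.

Definition lag (f : R -> R * R) (t : R) : R * R := f t - t *: v.
Definition level (f : R -> R * R) (t : R) : R := dot be (lag f t).

(** This is [rate_energy] for [beta = v - c], and it drives the whole section: levels only decrease,
    and a path that does not lose level is frozen in the moving frame. *)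
Lemma lag_energy q f s t : orbit_limit q f -> s <= t ->
  nrm (lag f t - lag f s) ^+ 2 <= 2 * (t - s) * (level f s - level f t).
Proof.
move=> qf st; have -> : level f s - level f t = dot be (- (lag f t - lag f s)).
  by rewrite /level -dotBr -(opprB (lag f t)).
apply: rate_energy; first by rewrite subr_ge0.
rewrite /be cv; have := orbit_limit_rate c qf st; congr (nrm _ <= _).
by apply: veq; rewrite /lag !pairE; ring.
Qed.

Lemma level_noninc q f s t : orbit_limit q f -> s <= t -> level f t <= level f s.
Proof.
move=> qf; rewrite le_eqVlt => /predU1P[->//|st].
have := lag_energy qf (ltW st); move/(le_trans (sqr_ge0 _)).
by rewrite pmulr_rge0 ?subr_ge0// mulr_gt0// subr_gt0.
Qed.

Lemma level_const q f s t : orbit_limit q f -> level f s = level f t -> lag f s = lag f t.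
Proof.
move=> qf; wlog st : s t / s <= t.
  by move=> hw; have [/hw//|/ltW /hw h /esym /h ->] := leP s t.
move=> e; have := lag_energy qf st; rewrite e subrr mulr0 => h.
apply/esym/eqP; rewrite -subr_eq0 -nrm_eq0 -sqrf_eq0 eq_le sqr_ge0 andbT; exact: h.
Qed.

Lemma level_lip q f s t : orbit_limit q f ->
  `|level f s - level f t| <= nrm be * (rt 0 + nrm v) * `|s - t|.
Proof.
move=> qf; rewrite /level -dotBr; apply: le_trans (dot_abs_le _ _) _.
rewrite -mulrA; apply: ler_wpM2l; first exact: nrm_ge0.
have -> : lag f s - lag f t = (f s - f t) - (s - t) *: v.
  by apply: veq; rewrite /lag !pairE; ring.
apply: le_trans (nrmB _ _) _; rewrite nrmZ mulrDl [nrm v * _]mulrC lerD2r.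
exact: orbit_limit_lip qf.
Qed.

(** Integer translations commute with [F], and rounding [L *: P0] to an integer vector is invisible
    at scale [L]; a steady orbit can thus be started at any prescribed limit point. *)
Lemma class_orbit P0 : exists P, orbit_limit P (fun t => P0 + t *: v).
Proof.
(* Windows of length [L^2] eventually contain every multiple of [L]. *)
have [z Hz] := steady_sequence ultraU L_infty freeU (fun j => (Num.truncn (L j ^+ 2)).+1) v_real.
pose n j : R * R := ((Num.floor (L j * P0.1 + (m j).1 - (z j).1))%:~R,
                     (Num.floor (L j * P0.2 + (m j).2 - (z j).2))%:~R).
have nE j t : it t (z j + n j) = it t (z j) + n j by rewrite it_equiv// intr_int.
have near j : `|(z j + n j - m j).1 - L j * P0.1| <= 1 /\ `|(z j + n j - m j).2 - L j * P0.2| <= 1.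
  rewrite !pairE /n /=.
  have /andP[h1 h2] := floor_itv (L j * P0.1 + (m j).1 - (z j).1).
  have /andP[h3 h4] := floor_itv (L j * P0.2 + (m j).2 - (z j).2).
  by rewrite !ler_norml; rewrite !intrD in h2 h4; split; apply/andP; split; lra.
have [f Hf] : exists f, orbit_limit (fun j => z j + n j) f.
  apply: (@orbit_limit_ex _ (2 + `|P0.1| + `|P0.2|)).
  apply: (usub (L_infty 1)) => j /= l1; apply: le_trans (nrm_le_sum _) _.
  have [h1 h2] := near j; have l0 : 0 < L j by lra.
  have e1 : `|(z j + n j - m j).1| <= 1 + L j * `|P0.1|.
    rewrite -[(z j + n j - m j).1](subrK (L j * P0.1)); apply: le_trans (ler_normD _ _) _.
    by rewrite lerD// normrM gtr0_norm.
  have e2 : `|(z j + n j - m j).2| <= 1 + L j * `|P0.2|.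
    rewrite -[(z j + n j - m j).2](subrK (L j * P0.2)); apply: le_trans (ler_normD _ _) _.
    by rewrite lerD// normrM gtr0_norm.
  lra.
exists (fun j => z j + n j).
have f0 : f 0 = P0.
  have := U_all ultraU; have z0 : ucvg U (fun j => (0 : int)%:~R / L j) 0.
    by have := ucvg_cst_div ultraU 0 L_infty.
  move=> _; apply: veq.
    apply: (ucvg_uniq ultraU (Hf.1 _ _ z0)) => /=.
    apply: (ucvg_close ultraU (ucvg_cst ultraU _)).
    apply: (ucvg0_le ultraU (ucvg_cst_div ultraU 1 L_infty)).
    apply: (usub L0) => j /= l0; have [h1 _] := near j.
    have -> : (z j + n j - m j).1 / L j - P0.1 = ((z j + n j - m j).1 - L j * P0.1) / L j.
      by field; rewrite lt0r_neq0.
    by rewrite normrM normfV (gtr0_norm l0) ler_pM2r ?invr_gt0.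
  apply: (ucvg_uniq ultraU (Hf.2 _ _ z0)) => /=.
  apply: (ucvg_close ultraU (ucvg_cst ultraU _)).
  apply: (ucvg0_le ultraU (ucvg_cst_div ultraU 1 L_infty)).
  apply: (usub L0) => j /= l0; have [_ h1] := near j.
  have -> : (z j + n j - m j).2 / L j - P0.2 = ((z j + n j - m j).2 - L j * P0.2) / L j.
    by field; rewrite lt0r_neq0.
  by rewrite normrM normfV (gtr0_norm l0) ler_pM2r ?invr_gt0.
suff fE : f = (fun t => P0 + t *: v) by rewrite -fE.
apply/funext => t; rewrite -f0.
suff : nrm (f t - f 0 - t *: v) <= 0.
  move=> h; have := nrm_ge0 (f t - f 0 - t *: v); move=> h'.
  have /eqP : nrm (f t - f 0 - t *: v) = 0 by lra.
  by rewrite nrm_eq0 -addrA -opprD subr_eq0 => /eqP.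
apply/ler_addgt0Pr => eta eta0; rewrite add0r.
pose eps := eta / (`|t| + 1); have t1 : 0 < `|t| + 1 by rewrite ltr_wpDl.
have eps0 : 0 < eps by rewrite divr_gt0.
have z0 : ucvg U (fun j => (0 : int)%:~R / L j) 0 by have := ucvg_cst_div ultraU 0 L_infty.
have tt := tcvg t.
have c1 := ucvgB ultraU (ucvgB ultraU (Hf.1 _ _ tt) (Hf.1 _ _ z0)) (ucvgZ ultraU v.1 tt).
have c2 := ucvgB ultraU (ucvgB ultraU (Hf.2 _ _ tt) (Hf.2 _ _ z0)) (ucvgZ ultraU v.2 tt).
have lim1 := ucvg_nrm ultraU c1 c2.
have lim2 := ucvgD ultraU (ucvgZ ultraU eps (ucvg_abs ultraU tt)) (ucvg_cst ultraU eps).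
have etaE : eta = eps * `|t| + eps by rewrite /eps; field; rewrite lt0r_neq0.
have -> : f t - f 0 - t *: v = ((f t).1 - (f 0).1 - v.1 * t, (f t).2 - (f 0).2 - v.2 * t).
  by apply: veq; rewrite !pairE mulrC.
rewrite etaE; apply: (ucvg_le ultraU lim1 lim2).
apply: (usub (uand (Hz _ eps0) (L_infty (`|t| + 2)))) => j /= [h lt].
have l0 : 0 < L j by apply: lt_le_trans lt; rewrite ltr_wpDl.
set T := time L t j.
have TW : (`|T| <= (Num.truncn (L j ^+ 2)).+1)%N.
  have : `|T|%:~R <= L j ^+ 2.
    have /andP[g1 g2] := floor_itv (t * L j); rewrite intrD in g2.
    have : `|T%:~R - t * L j| <= 1 by rewrite ler_norml /T /time; apply/andP; lra.
    move=> g3; rewrite intr_norm -[T%:~R](subrK (t * L j)); apply: le_trans (ler_normD _ _) _.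
    have : `|t * L j| = `|t| * L j by rewrite normrM (gtr0_norm l0).
    move=> ->; rewrite expr2; have := normr_ge0 t; nra.
  move=> g; rewrite -(ler_nat R) natr_absz; apply: le_trans g _.
  by apply: ltW; exact: truncnS_gt.
have := h T TW; rewrite natr_absz intr_norm => h5.
rewrite -(ler_pM2r l0).
have Ln0 : L j != 0 by rewrite lt0r_neq0.
have -> : (eps * `|T%:~R / L j| + eps) * L j = eps * `|T%:~R| + eps * L j.
  by rewrite normrM normfV (gtr0_norm l0); field.
apply: le_trans h5.
rewrite -[leLHS]mulrC -{1}[L j]gtr0_norm// -nrmZ le_eqVlt; apply/orP; left; apply/eqP.
congr nrm; rewrite nE; by apply: veq; rewrite !pairE /=; field.
Qed.

Definition narrow (kappa tau : R) : Prop := U [set j | forall z w, D j z -> D j w ->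
  nrm (it (time L tau j) z - it (time L tau j) w) <= kappa * L j].

Lemma narrow2 tau : narrow 2 tau.
Proof. by apply: (U_all ultraU) => j z w; exact: D_bound. Qed.

Lemma narrow_limit p q fp fq kappa tau : (forall j, D j (p j)) -> (forall j, D j (q j)) ->
  orbit_limit p fp -> orbit_limit q fq -> narrow kappa tau -> nrm (fp tau - fq tau) <= kappa.
Proof.
move=> Dp Dq [p1 p2] [q1 q2] N.
have c1 := ucvgB ultraU (p1 _ _ (tcvg tau)) (q1 _ _ (tcvg tau)).
have c2 := ucvgB ultraU (p2 _ _ (tcvg tau)) (q2 _ _ (tcvg tau)).
apply: (ucvg_lec ultraU (ucvg_nrm ultraU c1 c2)).
apply: (usub (uand N L0)) => j /= [h l0].
have h3 := h _ _ (Dp j) (Dq j); rewrite -(ler_pM2r l0); apply: le_trans h3.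
rewrite -[leLHS]mulrC -{1}[L j]gtr0_norm// -nrmZ le_eqVlt; apply/orP; left; apply/eqP.
have Ln0 : L j != 0 by rewrite lt0r_neq0.
by congr nrm; apply: veq; rewrite !pairE /=; field.
Qed.

Lemma narrow_level p q fp fq kappa tau : (forall j, D j (p j)) -> (forall j, D j (q j)) ->
  orbit_limit p fp -> orbit_limit q fq -> narrow kappa tau ->
  `|level fp tau - level fq tau| <= nrm be * kappa.
Proof.
move=> Dp Dq pf qf N; rewrite /level -dotBr; apply: le_trans (dot_abs_le _ _) _.
apply: ler_wpM2l; first exact: nrm_ge0.
have -> : lag fp tau - lag fq tau = fp tau - fq tau.
  by apply: veq; rewrite /lag !pairE; ring.
exact: (narrow_limit Dp Dq pf qf N).
Qed.

Lemma frame_quasi e P w : `|e| = 1 ->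
  `|(mx (frame e be) (F (P + w) - F P)).1 - ((mx (frame e be) w).1 + 0 * (mx (frame e be) w).2)| <= nrm be * (2 * C1) /\
  `|(mx (frame e be) (F (P + w) - F P)).2 - (mx (frame e be) w).2| <= nrm be * (2 * C1).
Proof.
move=> e1; rewrite mul0r addr0.
have : nrm (F (P + w) - F P - w) <= 2 * C1.
  have h1 := step_bound (P + w); have h2 := step_bound P; rewrite /= in h1 h2.
  have -> : F (P + w) - F P - w = (F (P + w) - (P + w)) - (F P - P).
    by apply: veq; rewrite !pairE; ring.
  by have := nrmB (F (P + w) - (P + w)) (F P - P); lra.
move=> h; have nb := nrm_ge0 be; rewrite -fstB -sndB -mxB; split.
  by apply: le_trans (frame1_le _ _ e1) _; exact: ler_wpM2l.
by apply: le_trans (frame2_le _ _ _) _; exact: ler_wpM2l.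
Qed.

Lemma frame_plimit e p P fp g : orbit_limit p fp -> orbit_limit P g ->
  plimit U L L (fun j i => mx (frame e be) (it i (p j) - it i (P j)))
    (fun t => mx (frame e be) (fp t - g t)).
Proof.
move=> [p1 p2] [P1 P2]; split => tau t tt /=.
  have d1 := ucvgB ultraU (p1 _ _ tt) (P1 _ _ tt); have d2 := ucvgB ultraU (p2 _ _ tt) (P2 _ _ tt).
  have := ucvgD ultraU (ucvgZ ultraU (- (e * be.2)) d1) (ucvgZ ultraU (e * be.1) d2).
  have -> : (mx (frame e be) (fp tau - g tau)).1 =
    - (e * be.2) * ((fp tau).1 - (g tau).1) + e * be.1 * ((fp tau).2 - (g tau).2).
    by rewrite frame1 /dot /=; ring.
  move=> h x x0; apply: (usub (h x x0)) => j /=; congr (`|_ - _| < _).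
  by rewrite frame1 /dot !pairE /=; ring.
have d1 := ucvgB ultraU (p1 _ _ tt) (P1 _ _ tt); have d2 := ucvgB ultraU (p2 _ _ tt) (P2 _ _ tt).
have := ucvgD ultraU (ucvgZ ultraU be.1 d1) (ucvgZ ultraU be.2 d2).
have -> : (mx (frame e be) (fp tau - g tau)).2 =
  be.1 * ((fp tau).1 - (g tau).1) + be.2 * ((fp tau).2 - (g tau).2).
  by rewrite frame2 /dot /=; ring.
move=> h x x0; apply: (usub (h x x0)) => j /=; congr (`|_ - _| < _).
by rewrite frame2 /dot !pairE /=; ring.
Qed.

(* An orbit of velocity v placed between the points where two orbits of D cross a
   common level separates them. *)
Lemma level_pass p q fp fq lam s t k1 k2 u w :
  (forall j, D j (p j)) -> (forall j, D j (q j)) -> orbit_limit p fp -> orbit_limit q fq ->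
  s < t -> narrow k1 s -> narrow k2 t ->
  lam + nrm be * k1 < level fq s -> level fq t < lam - nrm be * k2 ->
  level fp u = lam -> level fq w = lam -> lag fp u = lag fq w.
Proof.
move=> Dp Dq pf qf st N1 N2 l1 l2 lu lw; apply/eqP; rewrite -subr_eq0; apply/negPn/negP => ne.
pose x := dot (- be.2, be.1) (lag fp u - lag fq w).
have x0 : x != 0.
  apply: contra ne => /eqP x0; apply/eqP; apply: (frame_inj cv0 x0).
  by rewrite dotBr -/(level fp u) -/(level fq w) lu lw subrr.
(* Orients the frame so that [p] lies to the left and [q] to the right of the midpoint [P0], which
   also has level [lam]. *)
pose e := - Num.sg x.
have e1 : `|e| = 1 by rewrite normrN normr_sg x0.
have ex : e * x < 0 by rewrite mulNr -normrEsg oppr_lt0 normr_gt0.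
pose P0 := 2^-1 *: (lag fp u + lag fq w).
have [P Pf] := class_orbit P0.
have lP y : fp y - (P0 + y *: v) = lag fp y - P0 /\ fq y - (P0 + y *: v) = lag fq y - P0.
  by rewrite /lag !opprD !addrA; split; rewrite addrAC.
have dP : dot be P0 = lam.
  by rewrite dotZr dotDr -/(level fp u) -/(level fq w) lu lw; field.
have n0 := nrm_ge0 be.
have Pp := frame_plimit e pf Pf; have Pq := frame_plimit e qf Pf.
have N k y : narrow k y -> U [set j | spread L L F Fi (frame e be) D P (nrm be * k) (time L y j) j].
  move=> Nk; apply: (usub Nk) => j h z z' Dz Dz'.
  have -> : mx (frame e be) (it (time L y j) z - it (time L y j) (P j)) -
    mx (frame e be) (it (time L y j) z' - it (time L y j) (P j)) =
    mx (frame e be) (it (time L y j) z - it (time L y j) z').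
    by rewrite -mxB opprB addrA subrK.
  have h' := h _ _ Dz Dz'; rewrite -mulrA; split.
    by apply: le_trans (frame1_le _ _ e1) _; exact: ler_wpM2l.
  by apply: le_trans (frame2_le _ _ _) _; exact: ler_wpM2l.
apply: (no_limit_crossing ultraU L_infty LL contF contFi FK FiK (det_frame e1 cv0)
  (fun P w => frame_quasi P w e1) _ Dp Dq Pp Pq st _ _ (N _ _ N1) (N _ _ N2)).
- by apply: (U_all ultraU) => j /=.
(* By [level_const] the lag is the same at all times of level [lam], so the side is the one found at
   time [u]. *)
- move=> y _ /=; rewrite (lP y).1 frame2 frame1 dotBr dP => /eqP; rewrite subr_eq0 => /eqP ly.
  have -> : lag fp y = lag fp u by apply: (level_const pf); rewrite lu.
  have -> : lag fp u - P0 = 2^-1 *: (lag fp u - lag fq w).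
    by apply: veq; rewrite /P0 !pairE; field.
  by rewrite dotZr mulrCA pmulr_rlt0.
- move=> y _ /=; rewrite (lP y).2 frame2 frame1 dotBr dP => /eqP; rewrite subr_eq0 => /eqP ly.
  have -> : lag fq y = lag fq w by apply: (level_const qf); rewrite lw.
  have -> : lag fq w - P0 = (- 2^-1) *: (lag fp u - lag fq w).
    by apply: veq; rewrite /P0 !pairE; field.
  by rewrite dotZr mulrCA nmulr_rgt0 ?oppr_lt0.
- by left; rewrite (lP s).2 frame2 dotBr dP -/(level fq s); lra.
- by left; rewrite (lP t).2 frame2 dotBr dP -/(level fq t); lra.
Qed.

Lemma level_slope w0 : nrm (w0 - c) <= rt c -> w0 != v -> dot be (w0 - v) < 0.
Proof.
move=> h ne.
have h1 : nrm (w0 - v + be) <= nrm be by rewrite /be subrKA cv.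
have : nrm (w0 - v + be) ^+ 2 <= nrm be ^+ 2.
  by rewrite ler_sqr ?nnegrE ?nrm_ge0.
rewrite !nrm_sq dotD [dot (w0 - v) be]dotC.
have : 0 < dot (w0 - v) (w0 - v).
  by rewrite -nrm_sq exprn_gt0// lt_neqAle nrm_ge0 andbT eq_sym nrm_eq0 subr_eq0.
lra.
Qed.

(** The level of a path of velocity [w0] runs linearly through all values and drags that of [q]
    along, as [D] has bounded size. Hence [level_pass] applies at the level of [fq 0], and the lags
    of [fp] form a line of direction [w0 - v]. *)
Lemma static_direction p q fp fq w0 : (forall j, D j (p j)) -> (forall j, D j (q j)) ->
  orbit_limit p fp -> orbit_limit q fq -> nrm (w0 - c) <= rt c -> w0 != v ->
  (forall t, fp t = fp 0 + t *: w0) -> exists u, fq 0 = fp 0 + u *: (w0 - v).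
Proof.
move=> Dp Dq pf qf hw ne fpE.
have sl := level_slope hw ne; set sg := - dot be (w0 - v).
have sg0 : 0 < sg by rewrite oppr_gt0.
have lE t : level fp t = level fp 0 - t * sg.
  by rewrite /level /lag fpE scale0r subr0 mulrN opprK -dotZr -dotDr scalerBr addrA.
pose lam := level fq 0; pose u := (level fp 0 - lam) / sg.
(* Of the term [4 |be|], one half covers the difference between the levels of [p] and [q], the other
   half the margin of [level_pass] for sets of size 2. *)
pose T := (`|level fp 0| + `|lam| + 4 * nrm be + 1) / sg.
have n0 := nrm_ge0 be.
have TE : T * sg = `|level fp 0| + `|lam| + 4 * nrm be + 1 by rewrite divfK ?lt0r_neq0.
have T0 : 0 < T by rewrite divr_gt0// ltr_wpDl// !addr_ge0// mulr_ge0.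
have lu : level fp u = lam.
  by rewrite lE divfK ?lt0r_neq0//; ring.
have a1 := ler_norm (level fp 0); have a2 := ler_norm lam.
have b1 := ler_norm (- level fp 0); have b2 := ler_norm (- lam); rewrite !normrN in b1 b2.
exists u.
have N1 := narrow_level Dp Dq pf qf (narrow2 (- T)); have N2 := narrow_level Dp Dq pf qf (narrow2 T).
rewrite lE ler_norml mulNr TE in N1; rewrite lE ler_norml TE in N2.
move: N1 N2 => /andP[N1 N1'] /andP[N2 N2'].
have := @level_pass p q fp fq lam (- T) T 2 2 u 0 Dp Dq pf qf.
rewrite -/lam lu => /(_ _ (narrow2 _) (narrow2 _) _ _ erefl erefl) h.
have : lag fp u = lag fq 0 by apply: h; lra.
rewrite /lag fpE scale0r subr0 => <-.
by rewrite scalerBr addrA.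
Qed.

(** A set that contains one nearly steady point is small compared with the bound on its iterates.
    The quantification over [l] and [E] allows use at any time and scale of a family. *)
Definition static_prop : Prop := forall eps : R, 0 < eps -> exists n : nat, forall (l : R) (E : set (R * R)) x,
  n%:R <= l -> pathconn E -> E x ->
  (forall t z w, E z -> E w -> nrm (it t z - it t w) <= 2 * l) ->
  (forall t : int, `|t%:~R| <= n%:R * l -> nrm (it t x - x - t%:~R *: v) <= l / n.+1%:R) ->
  forall z w, E z -> E w -> nrm (z - w) <= eps * l.

Lemma slow_window p fp tau S delta : orbit_limit p fp -> 0 < delta ->
  (forall u, `|u| <= S -> nrm (lag fp (tau + u) - lag fp tau) <= delta / 2) ->
  U [set j | forall t : int, `|t%:~R| <= S * L j ->
    nrm (it t (it (time L tau j) (p j)) - it (time L tau j) (p j) - t%:~R *: v) <= delta * L j].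
Proof.
move=> pf d0 H.
set X := [set j | _]; have [//|h] := U_or ultraU X.
pose B j (t : int) := `|t%:~R| <= S * L j /\
  delta * L j < nrm (it t (it (time L tau j) (p j)) - it (time L tau j) (p j) - t%:~R *: v).
have h' : U [set j | exists t : int, [/\ - S * L j <= t%:~R, t%:~R <= S * L j & B j t]].
  apply: (usub h) => j /=; rewrite /X /= -existsNE => -[t]; rewrite not_implyE => -[h1 /negP h2].
  move: (h1); rewrite ler_norml => /andP[h3 h4]; exists t; split => //; first by rewrite mulNr.
  by split=> //; rewrite ltNge.
have [u [i [/andP[u1 u2] iu Bi]]] := event_limit ultraU L_infty h'.
have uS : `|u| <= S by rewrite ler_norml u1.
have tu : ucvg U (fun j => (i j + time L tau j)%:~R / L j) (tau + u).
  have := ucvgD ultraU iu (tcvg tau); rewrite addrC => h2 e e0; apply: (usub (h2 e e0)) => j /=.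
  by rewrite intrD mulrDl.
have c1 := ucvgB ultraU (ucvgB ultraU (pf.1 _ _ tu) (pf.1 _ _ (tcvg tau))) (ucvgZ ultraU v.1 iu).
have c2 := ucvgB ultraU (ucvgB ultraU (pf.2 _ _ tu) (pf.2 _ _ (tcvg tau))) (ucvgZ ultraU v.2 iu).
have le : delta <= nrm (lag fp (tau + u) - lag fp tau).
  have -> : lag fp (tau + u) - lag fp tau =
    ((fp (tau + u)).1 - (fp tau).1 - v.1 * u, (fp (tau + u)).2 - (fp tau).2 - v.2 * u).
    by apply: veq; rewrite /lag !pairE /=; ring.
  apply: (ucvg_gec ultraU (ucvg_nrm ultraU c1 c2)).
  apply: (usub (uand Bi L0)) => j /= [[_ h1] l0].
  rewrite -(ler_pM2r l0); apply: le_trans (ltW h1) _.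
  rewrite -[leRHS]mulrC -{1}[L j]gtr0_norm// -nrmZ le_eqVlt; apply/orP; left; apply/eqP.
  have Ln0 : L j != 0 by rewrite lt0r_neq0.
  by rewrite (iterzD FK FiK); congr nrm; apply: veq; rewrite !pairE /=; field.
by have := H u uS; lra.
Qed.

Lemma narrow_of_slow p fp : static_prop -> (forall j, D j (p j)) -> orbit_limit p fp ->
  forall eps, 0 < eps -> exists n : nat, forall tau,
    (forall u, `|u| <= n%:R -> nrm (lag fp (tau + u) - lag fp tau) <= n.+1%:R^-1 / 2) ->
    narrow eps tau.
Proof.
move=> Hs Dp pf eps eps0; have [n Hn] := Hs _ eps0; exists n => tau Htau.
have d0 : 0 < n.+1%:R^-1 :> R by rewrite invr_gt0.
apply: (usub (uand (slow_window pf d0 Htau) (L_infty n%:R))) => j /= [h nl] z w Dz Dw.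
apply: (Hn (L j) (it (time L tau j) @` D j) (it (time L tau j) (p j))) => //.
- move=> _ _ [y1 Dy1 <-] [y2 Dy2 <-]; have [g [cg Dg g0 g1]] := D_pc Dy1 Dy2.
  exists (fun s => it (time L tau j) (g s)); split.
  + exact: (cont_comp cg (@iterz_cont _ F Fi (time L tau j) contF contFi)).
  + by move=> s; exists (g s).
  + by rewrite g0.
  + by rewrite g1.
- by exists (p j).
- by move=> t _ _ [y1 Dy1 <-] [y2 Dy2 <-]; rewrite -!(iterzD FK FiK); exact: D_bound.
- by move=> t ht; rewrite mulrC; exact: h.
Qed.

(** Since levels are monotone, the loss over [[tau - S, tau + S]] bounds the loss on every
    subinterval starting or ending at [tau]; [lag_energy] turns it into a displacement. *)
Lemma slow_of_drop p fp (n : nat) tau (S eta : R) : orbit_limit p fp -> n%:R <= S ->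
  0 <= eta -> level fp (tau - S) - level fp (tau + S) <= eta ->
  2 * S * eta <= (n.+1%:R^-1 / 2) ^+ 2 ->
  forall u, `|u| <= n%:R -> nrm (lag fp (tau + u) - lag fp tau) <= n.+1%:R^-1 / 2.
Proof.
move=> pf nS eta0 dr small u; rewrite ler_norml => /andP[u1 u2].
have nn : 0 <= n%:R :> R by [].
have d0 : 0 <= n.+1%:R^-1 / 2 :> R by rewrite divr_ge0.
rewrite -ler_sqr ?nnegrE ?nrm_ge0//; apply: le_trans small.
have [u0|u0] := leP 0 u.
  have tu : tau <= tau + u by rewrite lerDl.
  apply: le_trans (lag_energy pf tu) _.
  have h1 : tau - S <= tau by lra. have h2 : tau + u <= tau + S by lra.
  have g1 := level_noninc pf h1; have g2 := level_noninc pf h2; have g3 := level_noninc pf tu.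
  have -> : tau + u - tau = u by ring.
  rewrite -!mulrA ler_wpM2l//; apply: ler_pM => //; lra.
have tu : tau + u <= tau by lra.
rewrite nrmC; apply: le_trans (lag_energy pf tu) _.
have h1 : tau - S <= tau + u by lra. have h2 : tau <= tau + S by lra.
have g1 := level_noninc pf h1; have g2 := level_noninc pf h2; have g3 := level_noninc pf tu.
have -> : tau - (tau + u) = - u by ring.
rewrite -!mulrA ler_wpM2l//; apply: ler_pM; lra.
Qed.

(** A level bounded below has arbitrarily late long windows of negligible loss. There the path is
    nearly steady, and [static_prop] shrinks [D]. *)
Lemma collapse_forward p fp : static_prop -> (forall j, D j (p j)) -> orbit_limit p fp ->
  (exists B, forall t, 0 <= t -> - B <= level fp t) ->
  forall eps T, 0 < eps -> exists2 tau, T <= tau & narrow eps tau.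
Proof.
move=> Hs Dp pf [B HB] eps T eps0; have [n Hn] := narrow_of_slow Hs Dp pf eps0.
pose S : R := n%:R + 1; have S0 : 0 < S by rewrite ltr_wpDl.
have d0 : 0 < n.+1%:R^-1 / 2 :> R by rewrite divr_gt0// invr_gt0.
pose eta := (n.+1%:R^-1 / 2) ^+ 2 / (2 * S).
have eta0 : 0 < eta by rewrite divr_gt0 ?exprn_gt0 ?mulr_gt0.
have [|tau tT dr] := @small_drop _ (level fp) B S eta (Num.max T 0) S0 eta0.
  by move=> t; rewrite ge_max => /andP[_]; exact: HB.
have hT : T <= Num.max T 0 by rewrite le_max lexx.
exists tau; first by lra.
apply: Hn; apply: (slow_of_drop pf _ (ltW eta0) dr); first by rewrite lerDl.
by rewrite mulrC divfK// mulf_neq0// lt0r_neq0.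
Qed.

Lemma collapse_backward p fp : static_prop -> (forall j, D j (p j)) -> orbit_limit p fp ->
  (exists B, forall t, t <= 0 -> level fp t <= B) ->
  forall eps T, 0 < eps -> exists2 tau, tau <= T & narrow eps tau.
Proof.
move=> Hs Dp pf [B HB] eps T eps0; have [n Hn] := narrow_of_slow Hs Dp pf eps0.
pose S : R := n%:R + 1; have S0 : 0 < S by rewrite ltr_wpDl.
have d0 : 0 < n.+1%:R^-1 / 2 :> R by rewrite divr_gt0// invr_gt0.
pose eta := (n.+1%:R^-1 / 2) ^+ 2 / (2 * S).
have eta0 : 0 < eta by rewrite divr_gt0 ?exprn_gt0 ?mulr_gt0.
have [|tau tT dr] := @small_drop _ (fun x => - level fp (- x)) B S eta (Num.max (- T) 0) S0 eta0.
  by move=> t; rewrite ge_max => /andP[_ t0]; rewrite lerN2; apply: HB; rewrite oppr_le0.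
have hT : - T <= Num.max (- T) 0 by rewrite le_max lexx.
exists (- tau); first by lra.
have nS : n%:R <= S by rewrite lerDl.
apply: Hn; apply: (slow_of_drop pf nS (ltW eta0)).
  have q1 : - (tau - S) = - tau + S by ring. have q2 : - (tau + S) = - tau - S by ring.
  by rewrite /= q1 q2 in dr; lra.
by rewrite mulrC divfK// mulf_neq0// lt0r_neq0.
Qed.

(** Both paths are brought down through a level just above that of [q] at time 0, with the set clear
    of that level before and after. Then [level_pass] gives them the same lag at that level, and for
    [q] this lag is close to the one at time 0. *)
Lemma backward_trace p q fp fq e : static_prop -> (forall j, D j (p j)) -> (forall j, D j (q j)) ->
  orbit_limit p fp -> orbit_limit q fq -> level fp 0 <= level fq 0 -> 0 < e ->
  exists2 a, 0 <= a & nrm (lag fp (- a) - lag fq 0) <= e.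
Proof.
move=> Hs Dp Dq pf qf lpq e0; apply: contrapT => no.
set ell := level fq 0 in lpq; set nb := nrm be.
have n0 : 0 <= nb := nrm_ge0 be.
have nl k t : narrow k t -> level fp t - nb * k <= level fq t <= level fp t + nb * k.
  move=> /(narrow_level Dp Dq pf qf); rewrite ler_norml => /andP[h1 h2].
  by apply/andP; rewrite -/nb in h1 h2; lra.
have cut x : 0 < x -> exists2 y, 0 < y & nb * y <= x.
  move=> x0; exists (x / (nb + 1)); first by rewrite divr_gt0// ltr_wpDl.
  by rewrite mulrA ler_pdivrMr ?ltr_wpDl//; nra.
(* If the level of [p] is unbounded below, width 2 is good enough far down; otherwise [D] collapses,
   and the mere absence of gain is enough. *)
have fwd x : 0 < x -> exists t k, [/\ 0 < t, narrow k t & level fq t < ell + x - nb * k].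
  move=> x0; have [hB|hB] := pselect (exists B, forall t, 0 <= t -> - B <= level fp t).
    have [y y0 yx] := cut (x / 2) (divr_gt0 x0 (ltr0Sn R 1)).
    have [t t1 N] := collapse_forward Hs Dp pf hB 1 y0.
    have t0 : 0 < t by apply: lt_le_trans t1.
    exists t, y; split=> //; have := level_noninc qf (ltW t0); rewrite -/ell; lra.
  have [t [t0 ht]] : exists t, 0 <= t /\ level fp t < - (`|ell| + 4 * nb).
    apply: contrapT => h; apply: hB; exists (`|ell| + 4 * nb) => t t0.
    by rewrite leNgt; apply/negP => h'; apply: h; exists t.
  have tt : t <= t + 1 by rewrite lerDl.
  exists (t + 1), 2; split; [by rewrite ltr_wpDl|exact: narrow2|].
  have /andP[_ h1] := nl _ _ (narrow2 (t + 1)); have := level_noninc pf tt.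
  have := ler_norm (- ell); rewrite normrN; lra.
(* The same dichotomy in the past. The remaining case, where [p] never was above [ell], forces [q]
   to be frozen throughout the past; a collapse then puts [p] next to it directly. *)
have bwd : exists s k x, [/\ s <= 0, 0 < x, narrow k s, ell + x + nb * k < level fq s &
    ell + x < level fp s /\ ell + x < level fq s].
  have [hB|hB] := pselect (exists B, forall t, t <= 0 -> level fp t <= B); last first.
    have [s [s0 hs]] : exists s, s <= 0 /\ ell + 1 + 4 * nb < level fp s.
      apply: contrapT => h; apply: hB; exists (ell + 1 + 4 * nb) => t t0.
      by rewrite leNgt; apply/negP => h'; apply: h; exists t.
    exists s, 2, 1; have /andP[h1 _] := nl _ _ (narrow2 s).
    by split => //; [exact: narrow2|lra|split; lra].
  have [[t0 [t00 ht0]]|h] := pselect (exists t, t <= 0 /\ ell < level fp t).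
    pose y := level fp t0 - ell; have y0 : 0 < y by rewrite subr_gt0.
    have [z z0 zy] := cut (y / 8) (divr_gt0 y0 (ltr0Sn R 7)).
    have [s st N] := collapse_backward Hs Dp pf hB t0 z0.
    have h1 := level_noninc pf st; have /andP[h2 _] := nl _ _ N; rewrite -/nb in h2.
    exists s, z, (y / 2); rewrite /y in y0 zy *.
    by split; [exact: le_trans t00|lra|exact: N|lra|split; lra].
  have up t : t <= 0 -> level fp t <= ell.
    by move=> tt; rewrite leNgt; apply/negP => h'; apply: h; exists t.
  have up' s : s <= 0 -> level fq s = ell.
    move=> s0; apply/eqP; rewrite eq_le (level_noninc qf s0) andbT.
    apply/ler_addgt0Pr => x x0; have [y y0 yx] := cut x x0.
    have [t ts N] := collapse_backward Hs Dp pf hB s y0.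
    have /andP[_ h1] := nl _ _ N; have := level_noninc qf ts.
    have := up t (le_trans ts s0); rewrite -/nb in h1; lra.
  have [t t0 N] := collapse_backward Hs Dp pf hB 0 e0.
  exfalso; apply: no; exists (- t); first by rewrite oppr_ge0.
  rewrite opprK -(level_const qf (up' t t0)).
  have -> : lag fp t - lag fq t = fp t - fq t by apply: veq; rewrite /lag !pairE; ring.
  exact: (narrow_limit Dp Dq pf qf N).
have [s [k [x [s0 x0 Ns ls [lps lqs]]]]] := bwd.
have s1 : 0 < 2 * (- s) + 1 by rewrite ltr_wpDl// mulr_ge0// oppr_ge0.
(* Between the level [ell + y] and time 0 the path [q] loses [y] within time at most [- s], so
   [lag_energy] bounds its move by [e]. *)
pose y := Num.min x (e ^+ 2 / (2 * (- s) + 1)).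
have y0 : 0 < y by rewrite lt_min x0 divr_gt0// exprn_gt0.
have yx : y <= x by rewrite ge_min lexx.
have ye : 2 * (- s) * y <= e ^+ 2.
  have : y <= e ^+ 2 / (2 * (- s) + 1) by rewrite ge_min lexx orbT.
  by rewrite ler_pdivlMr//; have := ltW y0; nra.
have [t [k2 [t0 Nt lt]]] := fwd y y0.
have [|u /andP[u1 u2] lu] := @lip_ivt _ (level fp) _ s 0 (ell + y) (fun a b => level_lip a b pf) s0.
  by apply/andP; lra.
have [|w /andP[w1 w2] lw] := @lip_ivt _ (level fq) _ s 0 (ell + y) (fun a b => level_lip a b qf) s0.
  by apply/andP; rewrite -/ell; lra.
have st : s < t by exact: le_lt_trans t0.
have E := @level_pass p q fp fq (ell + y) s t k k2 u w Dp Dq pf qf st Ns Nt.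
apply: no; exists (- u); first by rewrite oppr_ge0.
rewrite opprK E ?lu ?lw//; last first.
  by rewrite -/nb; lra.
rewrite nrmC -ler_sqr ?nnegrE ?nrm_ge0 ?(ltW e0)//; apply: le_trans (lag_energy qf w2) _.
rewrite sub0r lw -/ell addrAC subrr add0r; apply: le_trans ye.
by rewrite -!mulrA ler_wpM2l// ler_wpM2r ?(ltW y0)// lerN2.
Qed.

End one_class.
End family.

(** * Traces in two frames, and the uniform bound on diameters *)

Section bounded_id.
Context {R : realType}.

Lemma free_ultrafilter : exists U : set_system nat, UltraFilter U /\ forall n, U [set j | (n <= j)%N].
Proof.
have [U [ultraU sU]] := @ultraFilterLemma nat \oo _.
by exists U; split=> // n; apply: sU; exists n.
Qed.

Lemma dot_lt0 (be w : R * R) : nrm (w + be) <= nrm be -> w != 0 -> dot be w < 0.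
Proof.
move=> h ne; have : nrm (w + be) ^+ 2 <= nrm be ^+ 2.
  by rewrite ler_sqr ?nnegrE ?nrm_ge0.
rewrite !nrm_sq dotD [dot w be]dotC.
have : 0 < dot w w by rewrite -nrm_sq exprn_gt0// lt_neqAle nrm_ge0 andbT eq_sym nrm_eq0.
lra.
Qed.

Section traces.
Variables (rt : R * R -> R) (f : R -> R * R) (q0 : R * R).
Hypothesis f_rate : forall c s t, s <= t -> nrm (f t - f s - (t - s) *: c) <= (t - s) * rt c.

(** The traces say [f (- a)] is near [q0 - a v1] and [f (- b)] near [q0 - b v2]. Going from the
    latter to the former overshoots the disc about [c2] by an amount proportional to [a], because
    [v1] lies strictly below [v2] in level; hence [a] is of order [e]. *)
Lemma two_traces_half (v1 c2 v2 : R * R) : nrm (v2 - c2) = rt c2 -> v2 - c2 != 0 ->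
  nrm (v1 - c2) <= rt c2 -> v1 != v2 ->
  exists K, forall e a b, 0 < e -> 0 <= a <= b ->
    nrm (lag v1 f (- a) - q0) <= e -> nrm (lag v2 f (- b) - q0) <= e -> nrm (q0 - f 0) <= e * K.
Proof.
move=> cv2 n2 h12 v12.
set be := v2 - c2 in n2.
have sl : dot be (v1 - v2) < 0.
  by apply: dot_lt0; rewrite ?subr_eq0// /be subrKA cv2.
set sg := - dot be (v1 - v2); have sg0 : 0 < sg by rewrite oppr_gt0.
have nb := nrm_ge0 be.
exists (1 + (2 * nrm be / sg) * (rt 0 + nrm v1)) => e a b e0 /andP[a0 ab] ha hb.
have fa := f_rate c2 (_ : - b <= - a); rewrite lerN2 in fa; have {fa} := fa ab.
rewrite opprK [- a + b]addrC -cv2 -/be => X.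
have ba : 0 <= b - a by rewrite subr_ge0.
set E := lag v1 f (- a) - q0 - (lag v2 f (- b) - q0).
have nE : nrm E <= 2 * e by have := nrmB (lag v1 f (- a) - q0) (lag v2 f (- b) - q0); rewrite -/E; lra.
have XE : f (- a) - f (- b) - (b - a) *: c2 = (b - a) *: be - a *: (v1 - v2) + E.
  by rewrite /E /lag /be; apply: veq; rewrite !pairE; ring.
have h2 : nrm be * nrm (f (- a) - f (- b) - (b - a) *: c2) <= nrm be * ((b - a) * nrm be).
  by apply: ler_wpM2l.
have h1 : dot be ((b - a) *: be - a *: (v1 - v2) + E) <= nrm be * nrm (f (- a) - f (- b) - (b - a) *: c2).
  by rewrite -XE dot_le.
have h3 : dot be ((b - a) *: be - a *: (v1 - v2) + E) = (b - a) * nrm be ^+ 2 + a * sg + dot be E.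
  by rewrite nrm_sq dotDr [dot be (_ - _)]dotBr !dotZr /sg; ring.
have h4 : - (nrm be * (2 * e)) <= dot be E.
  have := dot_abs_le be E; rewrite ler_norml => /andP[h _]; apply: le_trans h.
  by rewrite lerN2; apply: ler_wpM2l.
have asg : a * sg <= nrm be * (2 * e).
  rewrite h3 in h1; have := le_trans h1 h2; rewrite expr2; lra.
have ae : a <= 2 * nrm be / sg * e.
  have -> : 2 * nrm be / sg * e = nrm be * (2 * e) / sg by ring.
  by rewrite ler_pdivlMr.
have f0 : nrm (f 0 - f (- a)) <= a * rt 0.
  have aN : - a <= 0 by rewrite oppr_le0.
  by have := f_rate 0 aN; rewrite scaler0 subr0 sub0r opprK.
have -> : q0 - f 0 = - (lag v1 f (- a) - q0) + (- (f 0 - f (- a)) + a *: v1).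
  by rewrite /lag; apply: veq; rewrite !pairE; ring.
apply: le_trans (nrmD _ _) _; rewrite nrmN.
apply: le_trans (lerD ha (nrmD _ _)) _; rewrite nrmN nrmZ (ger0_norm a0).
rewrite mulrDr mulr1 lerD2l.
have r0 : 0 <= rt 0 + nrm v1.
  rewrite addr_ge0 ?nrm_ge0//; have := f_rate 0 (@ler01 R); rewrite subr0 mul1r.
  exact: le_trans (nrm_ge0 _).
apply: (@le_trans _ _ (a * (rt 0 + nrm v1))); first by rewrite mulrDr lerD2r.
by rewrite mulrA [e * _]mulrC; apply: ler_wpM2r.
Qed.

Lemma two_traces (c1 v1 c2 v2 : R * R) :
  nrm (v1 - c1) = rt c1 -> v1 - c1 != 0 -> nrm (v2 - c2) = rt c2 -> v2 - c2 != 0 ->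
  nrm (v2 - c1) <= rt c1 -> nrm (v1 - c2) <= rt c2 -> v1 != v2 ->
  (forall e, 0 < e -> exists2 a, 0 <= a & nrm (lag v1 f (- a) - q0) <= e) ->
  (forall e, 0 < e -> exists2 a, 0 <= a & nrm (lag v2 f (- a) - q0) <= e) -> q0 = f 0.
Proof.
move=> h1 n1 h2 n2 h21 h12 v12 T1 T2.
have [K HK] := two_traces_half h2 n2 h12 v12.
have v21 : v2 != v1 by rewrite eq_sym.
have [K' HK'] := two_traces_half h1 n1 h21 v21.
apply/eqP; rewrite -subr_eq0 -nrm_eq0 eq_le nrm_ge0 andbT.
apply/ler_addgt0Pr => x x0; rewrite add0r.
pose M := Num.max K K'; have M0 : 0 < `|M| + 1 by rewrite ltr_wpDl.
pose e := x / (`|M| + 1); have e0 : 0 < e by rewrite divr_gt0.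
have [a a0 ha] := T1 _ e0; have [b b0 hb] := T2 _ e0.
have eM : e * M <= x.
  rewrite /e mulrAC ler_pdivrMr// ler_wpM2l ?(ltW x0)//.
  by have := ler_norm M; lra.
apply: le_trans eM; have [ab|/ltW ba] := leP a b.
  have := HK e a b e0; rewrite a0 ab => /(_ isT ha hb) h; apply: le_trans h _.
  by apply: ler_wpM2l; [exact: ltW|rewrite le_max lexx].
have := HK' e b a e0; rewrite b0 ba => /(_ isT hb ha) h; apply: le_trans h _.
by apply: ler_wpM2l; [exact: ltW|rewrite le_max lexx orbT].
Qed.

End traces.

Variables (F Fi : R * R -> R * R) (C1 : R).
Hypotheses (contF : continuous F) (contFi : continuous Fi).
Hypotheses (FK : cancel F Fi) (FiK : cancel Fi F).
Hypothesis step_bound : forall z, nrm (id (F z) - id z) <= C1.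
Hypothesis equivF : forall z m : R * R, m.1 \is a Num.int -> m.2 \is a Num.int -> F (z + m) = F z + m.
Local Notation it := (iterz F Fi).
Local Notation rt := (rate F id).

Definition integer_part (z : R * R) : R * R := ((Num.floor z.1)%:~R, (Num.floor z.2)%:~R).

Lemma integer_part_int z : (integer_part z).1 \is a Num.int /\ (integer_part z).2 \is a Num.int.
Proof. by split; exact: intr_int. Qed.

Lemma integer_part_near z : nrm (z - integer_part z) <= 2.
Proof.
apply: le_trans (nrm_le_sum _) _; rewrite !pairE /=.
have /andP[h1 h2] := floor_itv z.1; have /andP[h3 h4] := floor_itv z.2.
rewrite !intrD in h2 h4; rewrite !ger0_norm ?subr_ge0//; lra.
Qed.

(** In a limit of counterexamples the steady point moves exactly at velocity [v0]. By
    [static_direction] for [v1] and for [v2], every other limit point lies on two lines through it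
    with independent directions, so the set has shrunk to a point. *)
Lemma static_prop_of_two v0 c1 v1 c2 v2 : realized F Fi id v0 ->
  realized F Fi id v1 -> nrm (v1 - c1) = rt c1 -> v1 - c1 != 0 ->
  realized F Fi id v2 -> nrm (v2 - c2) = rt c2 -> v2 - c2 != 0 ->
  (v1 - v0).1 * (v2 - v0).2 - (v1 - v0).2 * (v2 - v0).1 != 0 -> static_prop F Fi v0.
Proof.
move=> r0 r1 cv1 n1 r2 cv2 n2 nd eps eps0; apply: contrapT => no.
have v01 : v0 != v1.
  by apply: contra nd => /eqP ->; rewrite /= !subrr !mul0r subrr.
have v02 : v0 != v2.
  by apply: contra nd => /eqP ->; rewrite /= !subrr !mulr0 subrr.
have H (n : nat) : exists x : (R * set (R * R)) * ((R * R) * ((R * R) * (R * R))),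
    [/\ n%:R <= x.1.1 /\ pathconn x.1.2, [/\ x.1.2 x.2.1, x.1.2 x.2.2.1 & x.1.2 x.2.2.2],
    (forall t z w, x.1.2 z -> x.1.2 w -> nrm (it t z - it t w) <= 2 * x.1.1),
    (forall t : int, `|t%:~R| <= n%:R * x.1.1 -> nrm (it t x.2.1 - x.2.1 - t%:~R *: v0) <= x.1.1 / n.+1%:R) &
    eps * x.1.1 < nrm (x.2.2.1 - x.2.2.2)].
  apply: contrapT => h; apply: no; exists n => l E x nl cE Ex Eb Hx z w Ez Ew.
  rewrite leNgt; apply/negP => lt; apply: h.
  by exists ((l, E), (x, (z, w))).
have [X HX] := choice H.
have [U [ultraU freeU]] := free_ultrafilter.
pose L j := (X j).1.1; pose D j := (X j).1.2; pose p j := (X j).2.1.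
pose q j := (X j).2.2.1; pose q' j := (X j).2.2.2; pose m j := integer_part (p j).
have L_infty (x : R) : U [set j | x <= L j].
  apply: (U_sub ultraU (freeU (Num.truncn x).+1)) => j /= h.
  have [[h1 _] _ _ _ _] := HX j; apply: le_trans h1.
  by apply: le_trans (ltW (truncnS_gt _)) _; rewrite ler_nat.
have D_pc j : pathconn (D j) by have [[_ ?] _ _ _ _] := HX j.
have D_b j t z w : D j z -> D j w -> nrm (it t z - it t w) <= 2 * L j.
  by have [_ _ + _ _] := HX j; apply.
have Dp j : D j (p j) by have [_ [? _ _] _ _ _] := HX j.
have Dq j : D j (q j) by have [_ [_ ? _] _ _ _] := HX j.
have Dq' j : D j (q' j) by have [_ [_ _ ?] _ _ _] := HX j.
have pm j : nrm (p j - m j) <= 2 by exact: integer_part_near.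
have [fp pf] := in_D_limit FiK step_bound ultraU L_infty D_b Dp pm Dp.
have [fq qf] := in_D_limit FiK step_bound ultraU L_infty D_b Dp pm Dq.
have [fq' qf'] := in_D_limit FiK step_bound ultraU L_infty D_b Dp pm Dq'.
have tcvg := time_cvg ultraU L_infty.
have L0 := L_gt0 ultraU L_infty.
have z0 : ucvg U (fun j => (0 : int)%:~R / L j) 0 by have := ucvg_cst_div ultraU 0 L_infty.
have uand (A B : set nat) : U A -> U B -> U (A `&` B) by exact: filterI.
have fpE t : fp t = fp 0 + t *: v0.
  suff : nrm (fp t - fp 0 - t *: v0) <= 0.
    move=> h; have h' := nrm_ge0 (fp t - fp 0 - t *: v0).
    have /eqP : nrm (fp t - fp 0 - t *: v0) = 0 by lra.
    by rewrite nrm_eq0 -addrA -opprD subr_eq0 => /eqP.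
  apply/ler_addgt0Pr => x x0; rewrite add0r.
  have c1' := ucvgB ultraU (ucvgB ultraU (pf.1 _ _ (tcvg t)) (pf.1 _ _ z0)) (ucvgZ ultraU v0.1 (tcvg t)).
  have c2' := ucvgB ultraU (ucvgB ultraU (pf.2 _ _ (tcvg t)) (pf.2 _ _ z0)) (ucvgZ ultraU v0.2 (tcvg t)).
  have -> : fp t - fp 0 - t *: v0 = ((fp t).1 - (fp 0).1 - v0.1 * t, (fp t).2 - (fp 0).2 - v0.2 * t).
    by apply: veq; rewrite !pairE mulrC.
  apply: (ucvg_lec ultraU (ucvg_nrm ultraU c1' c2')).
  have fx := freeU (Num.truncn x^-1).+1.
  have ft := freeU (Num.truncn (`|t| + 1)).+1.
  have hh := uand _ _ (uand _ _ fx ft) (uand _ _ L0 (tcvg t _ (@ltr01 R))).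
  apply: (U_sub ultraU hh) => j /= [[h1 h2] [l0 h3]].
  have xj : j.+1%:R^-1 <= x.
    rewrite -[x]invrK lef_pV2 ?posrE ?invr_gt0//.
    by apply: le_trans (ltW (truncnS_gt _)) _; rewrite ler_nat ltnW.
  have tj : `|(time L t j)%:~R| <= j%:R * L j.
    have : `|(time L t j)%:~R / L j| <= `|t| + 1.
      rewrite -[_ / _](subrK t); apply: le_trans (ler_normD _ _) _; lra.
    rewrite normrM normfV (gtr0_norm l0) ler_pdivrMr// => h; apply: le_trans h _.
    rewrite ler_pM2r//; apply: le_trans (ltW (truncnS_gt _)) _; by rewrite ler_nat.
  have [_ _ _ hs _] := HX j; have {hs} h5 := hs _ tj.
  rewrite -/(L j) -/(p j) in h5.
  rewrite -(ler_pM2r l0).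
  have Ln0 : L j != 0 by rewrite lt0r_neq0.
  have h6 : L j / j.+1%:R <= x * L j by rewrite mulrC ler_pM2r.
  apply: le_trans h6; apply: le_trans h5.
  rewrite -[leLHS]mulrC -{1}[L j]gtr0_norm// -nrmZ le_eqVlt; apply/orP; left; apply/eqP.
  by congr nrm; apply: veq; rewrite !pairE /=; field.
have same g fg : (forall j, D j (g j)) -> orbit_limit F Fi U L m g fg -> fg 0 = fp 0.
  move=> Dg gf.
  have [u uE] := static_direction contF contFi FK FiK step_bound equivF ultraU freeU L_infty D_pc D_b
    r1 cv1 n1 Dp Dg pf gf (realized_in_disc step_bound c1 r0) v01 fpE.
  have [w wE] := static_direction contF contFi FK FiK step_bound equivF ultraU freeU L_infty D_pc D_b
    r2 cv2 n2 Dp Dg pf gf (realized_in_disc step_bound c2 r0) v02 fpE.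
  have e : u *: (v0 - v1) = w *: (v0 - v2) by apply: (addrI (fp 0)); rewrite -uE -wE.
  have e1 : u * (v0.1 - v1.1) = w * (v0.1 - v2.1) := congr1 fst e.
  have e2 : u * (v0.2 - v1.2) = w * (v0.2 - v2.2) := congr1 snd e.
  have : u * ((v1 - v0).1 * (v2 - v0).2 - (v1 - v0).2 * (v2 - v0).1) = 0.
    rewrite !pairE; transitivity ((u * (v0.1 - v1.1)) * (v0.2 - v2.2) - (u * (v0.2 - v1.2)) * (v0.1 - v2.1)).
      by ring.
    by rewrite e1 e2; ring.
  move/eqP; rewrite mulf_eq0 (negbTE nd) orbF => /eqP u0.
  by rewrite uE u0 scale0r addr0.
have c1' := ucvgB ultraU (qf.1 _ _ z0) (qf'.1 _ _ z0).
have c2' := ucvgB ultraU (qf.2 _ _ z0) (qf'.2 _ _ z0).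
have : eps <= nrm ((fq 0).1 - (fq' 0).1, (fq 0).2 - (fq' 0).2).
  apply: (ucvg_gec ultraU (ucvg_nrm ultraU c1' c2')).
  apply: (U_sub ultraU L0) => j /= l0; have [_ _ _ _ h] := HX j.
  rewrite -(ler_pM2r l0); apply: le_trans (ltW h) _.
  rewrite -[leRHS]mulrC -{1}[L j]gtr0_norm// -nrmZ le_eqVlt; apply/orP; left; apply/eqP.
  have Ln0 : L j != 0 by rewrite lt0r_neq0.
  by congr nrm; apply: veq; rewrite !pairE /=; field.
rewrite (same _ _ Dq qf) (same _ _ Dq' qf') !subrr.
by rewrite (_ : (0, 0) = 0)// nrm0 leNgt eps0.
Qed.

Variables (rho0 : R * R) (delta : R).
Hypotheses (delta0 : 0 < delta) (ball : rotation_ball F id rho0 delta).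

Lemma bounded_orbit_diameter_id : exists2 N : R, 0 < N & forall D, pathconn D ->
  (exists l, forall t z w, D z -> D w -> nrm (it t z - it t w) <= l) ->
  forall z w, D z -> D w -> nrm (z - w) <= N.
Proof.
apply: contrapT => no.
have [c [v [cv /= nd]]] := exists_three_realized FK FiK step_bound delta0 ball (fun=> erefl).
have rp i : v i - c i != 0.
  rewrite -nrm_eq0 (cv i).2; apply: lt0r_neq0.
  by apply: lt_le_trans (rotation_ball_rate step_bound ball erefl); rewrite ltr_wpDl ?nrm_ge0.
set i0 : 'I_3 := inord 0 in nd; set i1 : 'I_3 := inord 1 in nd; set i2 : 'I_3 := inord 2 in nd.
have st0 : static_prop F Fi (v i0).
  exact: (static_prop_of_two (cv i0).1 (cv i1).1 (cv i1).2 (rp i1) (cv i2).1 (cv i2).2 (rp i2)).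
have st1 : static_prop F Fi (v i1).
  apply: (static_prop_of_two (cv i1).1 (cv i0).1 (cv i0).2 (rp i0) (cv i2).1 (cv i2).2 (rp i2)).
  by apply: contra nd => /eqP h; apply/eqP; rewrite -[RHS]oppr0 -h /=; ring.
have st2 : static_prop F Fi (v i2).
  apply: (static_prop_of_two (cv i2).1 (cv i0).1 (cv i0).2 (rp i0) (cv i1).1 (cv i1).2 (rp i1)).
  by apply: contra nd => /eqP h; apply/eqP; rewrite -h /=; ring.
have v01 : v i0 != v i1.
  by apply: contra nd => /eqP ->; rewrite /= !subrr !mul0r subrr.
have v02 : v i0 != v i2.
  by apply: contra nd => /eqP ->; rewrite /= !subrr !mulr0 subrr.
have v12 : v i1 != v i2.
  by apply: contra nd => /eqP ->; rewrite mulrC subrr.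
have H (n : nat) : exists x : (R * set (R * R)) * ((R * R) * (R * R)),
    [/\ n%:R <= x.1.1 /\ pathconn x.1.2, x.1.2 x.2.1 /\ x.1.2 x.2.2,
    (forall t z w, x.1.2 z -> x.1.2 w -> nrm (it t z - it t w) <= 2 * x.1.1) &
    x.1.1 / 2 < nrm (x.2.1 - x.2.2)].
  apply: contrapT => h; apply: no; exists n.+1%:R => // D cD [l Dl] z w Dz Dw.
  rewrite leNgt; apply/negP => lt; apply: h.
  (* Normalisation: replacing [D] by an iterate of nearly maximal diameter bounds all iterates in
     terms of the diameter at time 0. *)
  pose A := [set x | exists t z w, [/\ D z, D w & x = nrm (it t z - it t w)]].
  have sA : has_sup A.
    split; first by exists (nrm (it 0 z - it 0 w)), 0, z, w.
    by exists l => _ [t [z' [w' [Dz' Dw' ->]]]]; exact: Dl.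
  have ub t z' w' : D z' -> D w' -> nrm (it t z' - it t w') <= sup A.
    by move=> ? ?; apply: (sup_upper_bound sA); exists t, z', w'.
  have Sn : n.+1%:R < sup A by apply: lt_le_trans lt (ub 0 z w Dz Dw).
  have S0 : 0 < sup A by apply: le_lt_trans Sn.
  have S2 : 0 < sup A / 2 by rewrite divr_gt0.
  have [_ [t [z' [w' [Dz' Dw' ->]]]] hS] := sup_adherent S2 sA.
  exists ((sup A, it t @` D), (it t z', it t w')); split => /=.
  - split; first by apply: le_trans (ltW Sn); rewrite ler_nat.
    move=> _ _ [y1 Dy1 <-] [y2 Dy2 <-]; have [g [cg Dg g0 g1]] := cD _ _ Dy1 Dy2.
    exists (fun s => it t (g s)); split.
    + exact: (cont_comp cg (@iterz_cont _ F Fi t contF contFi)).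
    + by move=> s; exists (g s).
    + by rewrite g0.
    + by rewrite g1.
  - by split; [exists z'|exists w'].
  - move=> s _ _ [y1 Dy1 <-] [y2 Dy2 <-]; rewrite -!(iterzD FK FiK).
    by apply: le_trans (ub _ _ _ Dy1 Dy2) _; lra.
  - lra.
have [X HX] := choice H.
have [U [ultraU freeU]] := free_ultrafilter.
pose L j := (X j).1.1; pose D j := (X j).1.2; pose p j := (X j).2.1.
pose q j := (X j).2.2; pose m j := integer_part (p j).
have L_infty (x : R) : U [set j | x <= L j].
  apply: (U_sub ultraU (freeU (Num.truncn x).+1)) => j /= h.
  have [[h1 _] _ _ _] := HX j; apply: le_trans h1.
  by apply: le_trans (ltW (truncnS_gt _)) _; rewrite ler_nat.
have D_pc j : pathconn (D j) by have [[_ ?] _ _ _] := HX j.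
have D_b j t z w : D j z -> D j w -> nrm (it t z - it t w) <= 2 * L j.
  by have [_ _ + _] := HX j; apply.
have Dp j : D j (p j) by have [_ [? _] _ _] := HX j.
have Dq j : D j (q j) by have [_ [_ ?] _ _] := HX j.
have pm j : nrm (p j - m j) <= 2 by exact: integer_part_near.
have [fp pf] := in_D_limit FiK step_bound ultraU L_infty D_b Dp pm Dp.
have [fq qf] := in_D_limit FiK step_bound ultraU L_infty D_b Dp pm Dq.
have L0 := L_gt0 ultraU L_infty.
have z0 : ucvg U (fun j => (0 : int)%:~R / L j) 0 by have := ucvg_cst_div ultraU 0 L_infty.
have c1' := ucvgB ultraU (pf.1 _ _ z0) (qf.1 _ _ z0).
have c2' := ucvgB ultraU (pf.2 _ _ z0) (qf.2 _ _ z0).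
have far : 2^-1 <= nrm ((fp 0).1 - (fq 0).1, (fp 0).2 - (fq 0).2).
  apply: (ucvg_gec ultraU (ucvg_nrm ultraU c1' c2')).
  apply: (U_sub ultraU L0) => j /= l0; have [_ _ _ h] := HX j.
  rewrite -(ler_pM2r l0) mulrC; apply: le_trans (ltW h) _.
  rewrite -[leRHS]mulrC -{1}[L j]gtr0_norm// -nrmZ le_eqVlt; apply/orP; left; apply/eqP.
  have Ln0 : L j != 0 by rewrite lt0r_neq0.
  by congr nrm; apply: veq; rewrite !pairE /=; field.
have ne : fp 0 <> fq 0.
  move=> e; move: far; rewrite e !subrr (_ : (0, 0) = 0)// nrm0.
  by rewrite leNgt invr_gt0 ltr0n.
have tr i (st : static_prop F Fi (v i)) g g' fg fg' :
    (forall j, D j (g j)) -> (forall j, D j (g' j)) ->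
    orbit_limit F Fi U L m g fg -> orbit_limit F Fi U L m g' fg' ->
    level (c i) (v i) fg 0 <= level (c i) (v i) fg' 0 ->
    forall e, 0 < e -> exists2 a, 0 <= a & nrm (lag (v i) fg (- a) - fg' 0) <= e.
  move=> Dg Dg' gf gf' le e e0.
  have := backward_trace contF contFi FK FiK step_bound equivF ultraU freeU L_infty D_pc D_b
    (cv i).1 (cv i).2 (rp i) st Dg Dg' gf gf' le e0.
  by rewrite [lag _ fg' 0]/lag scale0r subr0.
(* If two classes order [p] and [q] alike, the past of the lower path meets the higher one in both
   frames, and [two_traces] identifies their limits. *)
have pair i j : static_prop F Fi (v i) -> static_prop F Fi (v j) -> v i != v j ->
    (level (c i) (v i) fp 0 <= level (c i) (v i) fq 0) = (level (c j) (v j) fp 0 <= level (c j) (v j) fq 0) -> False.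
  move=> si sj vij.
  have ri k l : nrm (v k - c l) <= rt (c l).
    exact: (realized_in_disc step_bound (c l) (cv k).1).
  have [h /esym h'|/ltW h /esym/negbT] := leP (level (c i) (v i) fp 0).
    apply: ne; apply/esym; apply: (@two_traces rt fp (fq 0) _ (c i) (v i) (c j) (v j)) => //;
      try exact: (cv _).2.
    - by move=> c0 s t; exact: (orbit_limit_rate FK FiK step_bound ultraU L_infty c0 pf).
    - exact: tr si _ _ _ _ Dp Dq pf qf h.
    - exact: tr sj _ _ _ _ Dp Dq pf qf h'.
  rewrite -ltNge => /ltW h'.
  apply: ne; apply: (@two_traces rt fq (fp 0) _ (c i) (v i) (c j) (v j)) => //;
      try exact: (cv _).2.
  - by move=> c0 s t; exact: (orbit_limit_rate FK FiK step_bound ultraU L_infty c0 qf).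
  - exact: tr si _ _ _ _ Dq Dp qf pf h.
  - exact: tr sj _ _ _ _ Dq Dp qf pf h'.
(* Of three orderings with two possible values two coincide; this is why three velocities are
   taken. *)
have p01 := pair i0 i1 st0 st1 v01; have p02 := pair i0 i2 st0 st2 v02; have p12 := pair i1 i2 st1 st2 v12.
case: (_ <= _) p01 p02 => p01 p02; case: (_ <= _) p01 p12 => p01 p12; try exact: p01.
  by case: (_ <= _) p02 p12 => p02 p12; [exact: p02|exact: p12].
by case: (_ <= _) p02 p12 => p02 p12; [exact: p12|exact: p02].
Qed.

End bounded_id.

(** * Sets with bounded iterates: maps with twist *)

Section dehn_limits.
Context {R : realType}.
Variables (K B : R) (K0 : 0 < K).

(** The equation [xi' = K a] in integrated form, which asks for no differentiability. *)
Definition drifts (a xi : R -> R) : Prop := forall m s t, s <= t ->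
  ((forall u, s <= u <= t -> m <= a u) -> K * m * (t - s) <= xi t - xi s) /\
  ((forall u, s <= u <= t -> a u <= m) -> xi t - xi s <= K * m * (t - s)).

Definition noninc_lip (a : R -> R) : Prop :=
  (forall s t, s <= t -> a t <= a s) /\ exists C, forall s t, `|a s - a t| <= C * `|s - t|.

Definition strictly_crosses (a : R -> R) c : Prop := (exists t, c < a t) /\ (exists t, a t < c).

(* In the coordinates (xi, a) of a frame moving with a class of orbits, the orbit
   of the class at level c which starts at x0 is t |-> (x0 + K c t, c). *)
Definition left_of (a xi : R -> R) c x0 : Prop := forall t, a t = c -> xi t < x0 + K * c * t.
Definition right_of (a xi : R -> R) c x0 : Prop := forall t, a t = c -> x0 + K * c * t < xi t.

Definition unseparated (a xi a' xi' : R -> R) : Prop := forall c x0,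
  strictly_crosses a' c -> left_of a xi c x0 -> right_of a' xi' c x0 -> False.

Lemma level_value a xi c s t : noninc_lip a -> drifts a xi -> a s = c -> a t = c ->
  xi s - K * c * s = xi t - K * c * t.
Proof.
move=> [mono _] dr; wlog st : s t / s <= t.
  by move=> h; have [/h//|/ltW /h h' ? ?] := leP s t; apply/esym; exact: h'.
move=> hs ht; have ac u : s <= u <= t -> a u = c.
  move=> /andP[su ut]; have := mono _ _ su; have := mono _ _ ut; rewrite hs ht => ? ?.
  by apply/eqP; rewrite eq_le; apply/andP.
have [h1 h2] := dr c s t st.
have := h1 (fun u hu => ltac:(by rewrite (ac u hu))).
have := h2 (fun u hu => ltac:(by rewrite (ac u hu))).
by move=> ? ?; lra.
Qed.

(** If the two abscissas at level [c] differed, a class orbit at their midpoint would separate the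
    paths. *)
Lemma same_hit a xi a' xi' c s t : noninc_lip a -> noninc_lip a' ->
  drifts a xi -> drifts a' xi' -> unseparated a xi a' xi' -> unseparated a' xi' a xi ->
  strictly_crosses a c -> strictly_crosses a' c -> a s = c -> a' t = c ->
  xi s - K * c * s = xi' t - K * c * t.
Proof.
move=> na na' d d' sep sep' cr cr' hs ht.
set x := xi s - K * c * s; set y := xi' t - K * c * t.
have X u : a u = c -> xi u - K * c * u = x by move=> hu; exact: level_value na d hu hs.
have Y u : a' u = c -> xi' u - K * c * u = y by move=> hu; exact: level_value na' d' hu ht.
have [xy|xy|//] := ltgtP x y.
  exfalso; apply: (sep c ((x + y) / 2) cr') => u hu; [have := X u hu|have := Y u hu]; lra.
exfalso; apply: (sep' c ((x + y) / 2) cr) => u hu; [have := Y u hu|have := X u hu]; lra.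
Qed.

Lemma archi_gt (x y : R) : 0 < x -> exists2 t, 0 < t & y < x * t.
Proof.
move=> x0; exists ((`|y| + 1) / x); first by rewrite divr_gt0// ltr_wpDl.
by rewrite mulrC divfK ?lt0r_neq0//; have := ler_norm y; lra.
Qed.

Lemma level_ivt a s t c : noninc_lip a -> s <= t -> a t <= c <= a s ->
  exists2 u, s <= u <= t & a u = c.
Proof. by move=> [_ [C lip]] st h; exact: lip_ivt lip st h. Qed.

(** A persistent gap between [a] and [a'] would make [xi' - xi] grow linearly. So [a] came down
    through every level of the gap before [t0], and [a'] comes down through it after [t0], at the
    same moving abscissa by [same_hit]; the drifts between two such levels are then incompatible. *)
Lemma no_gap a xi a' xi' t0 : noninc_lip a -> noninc_lip a' ->
  drifts a xi -> drifts a' xi' -> unseparated a xi a' xi' -> unseparated a' xi' a xi ->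
  (forall t, `|xi t - xi' t| <= B) -> a t0 < a' t0 -> False.
Proof.
move=> na na' d d' sep sep' bd gap; have [mo _] := na; have [mo' _] := na'.
have bd2 s t : `|(xi' t - xi t) - (xi' s - xi s)| <= 2 * B.
  have := bd s; have := bd t; rewrite !ler_norml => /andP[? ?] /andP[? ?].
  by apply/andP; split; lra.
have below c : a t0 < c -> c < a' t0 -> exists2 t, t0 <= t & a' t < c.
  move=> c1 c2; apply: contrapT => no.
  have x0 : 0 < K * (c - a t0) by rewrite mulr_gt0// subr_gt0.
  have [T T0 hT] := archi_gt (2 * B) x0.
  have tT : t0 <= t0 + T by rewrite lerDl ltW.
  have [h1 _] := d' c _ _ tT; have [_ h2] := d (a t0) _ _ tT.
  have g1 : forall u, t0 <= u <= t0 + T -> c <= a' u.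
    by move=> u /andP[u1 _]; rewrite leNgt; apply/negP => h; apply: no; exists u.
  have g2 : forall u, t0 <= u <= t0 + T -> a u <= a t0 by move=> u /andP[u1 _]; exact: mo.
  have := bd2 t0 (t0 + T); rewrite ler_norml => /andP[_ ?].
  have := h1 g1; have := h2 g2; have -> : t0 + T - t0 = T by ring.
  by move=> ? ?; lra.
have above c : a t0 < c -> c < a' t0 -> exists2 t, t <= t0 & c < a t.
  move=> c1 c2; apply: contrapT => no.
  have x0 : 0 < K * (a' t0 - c) by rewrite mulr_gt0// subr_gt0.
  have [T T0 hT] := archi_gt (2 * B) x0.
  have tT : t0 - T <= t0 by rewrite gerDl oppr_le0 ltW.
  have [h1 _] := d' (a' t0) _ _ tT; have [_ h2] := d c _ _ tT.
  have g1 : forall u, t0 - T <= u <= t0 -> a' t0 <= a' u by move=> u /andP[_ u1]; exact: mo'.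
  have g2 : forall u, t0 - T <= u <= t0 -> a u <= c.
    by move=> u /andP[_ u1]; rewrite leNgt; apply/negP => h; apply: no; exists u.
  have := bd2 (t0 - T) t0; rewrite ler_norml => /andP[_ ?].
  have := h1 g1; have := h2 g2; have -> : t0 - (t0 - T) = T by ring.
  by move=> ? ?; lra.
pose c := a t0 + (a' t0 - a t0) / 3; pose c' := a t0 + 2 * (a' t0 - a t0) / 3.
have c1 : a t0 < c by rewrite /c; lra.
have cc : c < c' by rewrite /c /c'; lra.
have c2 : c' < a' t0 by rewrite /c'; lra.
have hit x : a t0 < x -> x < a' t0 -> exists s t, [/\ s <= t0 <= t, s != t0, a s = x, a' t = x &
    xi s - K * x * s = xi' t - K * x * t].
  move=> x1 x2; have [s s0 hs] := above x x1 x2; have [t t1 ht] := below x x1 x2.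
  have [|u /andP[u1 u2] au] := @level_ivt a s t0 x na s0; first by rewrite !ltW.
  have [|w /andP[w1 w2] aw] := @level_ivt a' t0 t x na' t1; first by rewrite !ltW.
  exists u, w; split=> //; first by rewrite u2 w1.
    by apply: contraPneq au => ->; apply/eqP; rewrite lt_eqF.
  apply: (@same_hit a xi a' xi' x) => //; split; solve [by exists s|by exists t0|by exists t].
have [s [t [/andP[st0 t0t] ss as_ at_ e]]] := hit c c1 (lt_trans cc c2).
have [s' [t' [/andP[st0' t0t'] ss' as' at' e']]] := hit c' (lt_trans c1 cc) c2.
have s's : s' <= s.
  by rewrite leNgt; apply/negP => /ltW /mo; rewrite as_ as' leNgt cc.
have t't : t' <= t.
  by rewrite leNgt; apply/negP => /ltW /mo'; rewrite at_ at' leNgt cc.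
have [_ h1] := d c' _ _ s's.
have {}h1 := h1 (fun u hu => ltac:(by rewrite -as'; apply: mo; case/andP: hu)).
have [h2 _] := d' c _ _ t't.
have {}h2 := h2 (fun u hu => ltac:(by rewrite -at_; apply: mo'; case/andP: hu)).
(* Subtracting the two coincidences and inserting the drift bounds leaves
   [K (c' - c) (t' - s) <= 0]. *)
have slt : s < t' by apply: lt_le_trans t0t'; rewrite lt_neqAle ss.
have : 0 < K * (c' - c) * (t' - s) by rewrite !mulr_gt0 ?subr_gt0.
lra.
Qed.

Lemma unseparated_eq a xi a' xi' : noninc_lip a -> noninc_lip a' ->
  drifts a xi -> drifts a' xi' -> unseparated a xi a' xi' -> unseparated a' xi' a xi ->
  (forall t, `|xi t - xi' t| <= B) -> a =1 a'.
Proof.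
move=> na na' d d' sep sep' bd t; have [h|h|//] := ltgtP (a t) (a' t).
  by have := @no_gap a xi a' xi' t na na' d d' sep sep' bd h.
have bd' u : `|xi' u - xi u| <= B by rewrite distrC.
by have := @no_gap a' xi' a xi t na' na d' d sep' sep bd' h.
Qed.

(** A nonconstant [a] strictly crosses an intermediate level, and there [same_hit] compares both
    paths at one time. *)
Lemma unseparated_same a xi a' xi' : noninc_lip a -> noninc_lip a' ->
  drifts a xi -> drifts a' xi' -> unseparated a xi a' xi' -> unseparated a' xi' a xi ->
  a =1 a' -> (exists s t, a s != a t) -> exists t, xi t = xi' t.
Proof.
move=> na na' d d' sep sep' aa [s [t st]].
have [s' [t' lt]] : exists s t, a s < a t.
  by move: st; rewrite neq_lt => /orP[h|h]; [exists s, t|exists t, s].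
have ts : t' <= s' by rewrite leNgt; apply/negP => /ltW /na.1; rewrite leNgt lt.
pose c := (a s' + a t') / 2.
have [|u _ au] := @level_ivt a t' s' c na ts; first by apply/andP; rewrite /c; lra.
have cr : strictly_crosses a c by split; [exists t'|exists s']; rewrite /c; lra.
have cr' : strictly_crosses a' c by case: cr => [[x hx] [y hy]]; split; [exists x|exists y]; rewrite -aa.
have au' : a' u = c by rewrite -aa.
by exists u; have := same_hit na na' d d' sep sep' cr cr' au au'; lra.
Qed.

End dehn_limits.

(** * Limit paths under a twist *)

Section dehn.
Context {R : realType}.
Variables (F Fi : R * R -> R * R) (k : int) (C1 : R).
Hypotheses (contF : continuous F) (contFi : continuous Fi).
Hypotheses (FK : cancel F Fi) (FiK : cancel Fi F) (k0 : k != 0).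
Local Notation kR := (k%:~R : R).
Hypothesis F_bound : forall z, `|(F z).1 - z.1 - kR * z.2| <= C1 /\ `|(F z).2 - z.2| <= C1.
Hypothesis equivF : forall z m : R * R, m.1 \is a Num.int -> m.2 \is a Num.int ->
  F (z + m) = F z + (m.1 + kR * m.2, m.2).
Local Notation it := (iterz F Fi).
Definition vertical (z : R * R) : R * R := (0, z.2).

Lemma nrm_vertical (x : R) : nrm (0, x) = `|x|.
Proof. by rewrite /nrm /dot /= mulr0 add0r -expr2 sqrtr_sqr. Qed.

Lemma vertical_step z : nrm (vertical (F z) - vertical z) <= C1.
Proof.
have -> : vertical (F z) - vertical z = (0, (F z).2 - z.2) by apply: veq; rewrite !pairE ?subrr.
by rewrite nrm_vertical; have [] := F_bound z.
Qed.

Lemma it_translate t z (n : R * R) : n.1 \is a Num.int -> n.2 \is a Num.int ->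
  it t (z + n) = it t z + (n.1 + kR * t%:~R * n.2, n.2).
Proof.
move=> n1 n2; have ti (s : int) : n.1 + kR * s%:~R * n.2 \is a Num.int.
  by rewrite rpredD ?rpredM ?intr_int.
have step (s : int) y : F (y + (n.1 + kR * s%:~R * n.2, n.2)) = F y + (n.1 + kR * (s + 1)%:~R * n.2, n.2).
  by rewrite equivF /= ?ti ?n2//; apply: veq; rewrite !pairE /= ?intrD; ring.
elim/int_ind: t => [|i IH|i IH].
- by rewrite /= mulr0 mul0r addr0 -surjective_pairing.
- have -> : i.+1%:Z = i%:Z + 1 by rewrite -addn1 PoszD.
  by rewrite !(iterzS FiK) IH step.
- have e : - i%:Z = - i.+1%:Z + 1 by rewrite -addn1 PoszD; ring.
  rewrite e !(iterzS FiK) -step in IH; exact: (can_inj FK IH).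
Qed.

Variable U : set_system nat.
Hypothesis ultraU : UltraFilter U.
Hypothesis freeU : forall n, U [set j | (n <= j)%N].
Variable L : nat -> R.
Hypothesis L_infty : forall m : R, U [set j | m <= L j].
Let usub A B := @U_sub U ultraU A B.
Let uand (A B : set nat) : U A -> U B -> U (A `&` B).
Proof. exact: filterI. Qed.
Let L0 : U [set j | 0 < L j] := L_gt0 ultraU L_infty.
Let tcvg := time_cvg ultraU L_infty.
Local Notation mu := (fun j => L j ^+ 2).

Let Lmu : U [set j | L j <= mu j].
Proof. by apply: (usub (L_infty 1)) => j /= h; rewrite expr2; have := h; nra. Qed.
Let kmu : U [set j | `|kR| * L j ^+ 2 <= `|kR| * mu j].
Proof. by apply: (U_all ultraU) => j /=. Qed.

Lemma ucvgM (u w : nat -> R) l m : ucvg U u l -> ucvg U w m -> ucvg U (fun j => u j * w j) (l * m).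
Proof.
move=> ul wm; apply: (ucvg_close ultraU (u := fun j => l * w j)).
  exact: ucvgZ.
apply: (ucvg0_le ultraU (v := fun j => (`|m| + 1) * `|u j - l|)).
  have := ucvgZ ultraU (`|m| + 1) (ucvg_abs ultraU (ucvgB ultraU ul (ucvg_cst ultraU l))).
  by rewrite subrr normr0 mulr0.
apply: (usub (wm _ ltr01)) => j /= h; rewrite -mulrBl normrM mulrC; apply: ler_wpM2r => //.
rewrite -[w j](subrK m); apply: le_trans (ler_normD _ _) _; lra.
Qed.

Definition pseudo_orbit (C : R) (p : nat -> int -> R * R) : Prop := forall j t,
  `|(p j (t + 1)).1 - (p j t).1 - kR * (p j t).2| <= C /\ `|(p j (t + 1)).2 - (p j t).2| <= C.

Lemma orbit_pseudo (z : nat -> R * R) : pseudo_orbit C1 (fun j t => it t (z j)).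
Proof. by move=> j t; rewrite (iterzS FiK); exact: F_bound. Qed.

Definition nearby (C : R) (p q : nat -> int -> R * R) : Prop := U [set j |
  `|(p j 0 - q j 0).1| <= C * L j ^+ 2 /\ `|(p j 0 - q j 0).2| <= C * L j].

Lemma rel_tame C C' B p q : pseudo_orbit C p -> pseudo_orbit C' q -> nearby B p q ->
  tame U L kR mu (fun j t => p j t - q j t).
Proof.
move=> hp hq near; exists (Num.max (C + C') B); split=> [j t|].
  have [h1 h2] := hp j t; have [h3 h4] := hq j t; rewrite !pairE !le_max; split; apply/orP; left.
    have -> : (p j (t + 1)).2 - (q j (t + 1)).2 - ((p j t).2 - (q j t).2) =
      ((p j (t + 1)).2 - (p j t).2) - ((q j (t + 1)).2 - (q j t).2) by ring.
    by apply: le_trans (ler_normB _ _) _; exact: lerD.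
  have -> : (p j (t + 1)).1 - (q j (t + 1)).1 - ((p j t).1 - (q j t).1) - kR * ((p j t).2 - (q j t).2) =
    ((p j (t + 1)).1 - (p j t).1 - kR * (p j t).2) - ((q j (t + 1)).1 - (q j t).1 - kR * (q j t).2) by ring.
  by apply: le_trans (ler_normB _ _) _; exact: lerD.
apply: (usub (uand near L0)) => j /= [[h1 h2] l0].
split; [apply: le_trans h1 _|apply: le_trans h2 _]; apply: ler_wpM2r.
- by rewrite exprn_ge0// ltW.
- by rewrite le_max lexx orbT.
- exact: ltW.
- by rewrite le_max lexx orbT.
Qed.

Lemma rel_limit C C' B p q : pseudo_orbit C p -> pseudo_orbit C' q -> nearby B p q ->
  exists f, plimit U L mu (fun j t => p j t - q j t) f.
Proof.
move=> hp hq near; exact: (plimit_ex ultraU L_infty Lmu kmu (rel_tame hp hq near)).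
Qed.

Section dehn_class.
Variables (c v : R * R).
Hypotheses (v_real : realized F Fi vertical v) (cv : nrm (v - c) = rate F vertical c).

Lemma realized_vertical : v.1 = 0.
Proof.
apply/eqP; rewrite -normr_eq0 eq_le normr_ge0 andbT; apply/ler_addgt0Pr => e e0; rewrite add0r.
have e2 : 0 < e / 2 by rewrite divr_gt0.
have [K0 HK] := v_real e2.
have [T T0 hT] := archi_gt K0 e2.
pose W := (Num.truncn T).+1; have [z /(_ W%:Z (leqnn _)) h] := HK W.
have WT : T < W%:R by exact: truncnS_gt.
have W0 : 0 < W%:R :> R by [].
have h1 := le_trans (nrm_fst _) h; rewrite !pairE /= in h1.
rewrite subrr sub0r normrN normrM ger0_norm// in h1.
have : K0 < e / 2 * W%:R by apply: lt_trans hT _; rewrite ltr_pM2l.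
rewrite -(ler_pM2l W0); lra.
Qed.

Lemma reference_orbit (b : nat -> R * R) : exists P : nat -> R * R,
  (forall j, `|(P j - b j).1| <= 1 /\ `|(P j - b j).2| <= 1) /\
  path_limit U L (fun j t => (it t (P j)).2 - (b j).2) L (fun t => t * v.2).
Proof.
have [z Hz] := steady_sequence ultraU L_infty freeU (fun j => (Num.truncn (L j ^+ 2)).+1) v_real.
pose n j : R * R := ((Num.floor ((b j).1 - (z j).1))%:~R, (Num.floor ((b j).2 - (z j).2))%:~R).
exists (fun j => z j + n j).
have near j : `|(z j + n j - b j).1| <= 1 /\ `|(z j + n j - b j).2| <= 1.
  rewrite !pairE /n /=.
  have /andP[h1 h2] := floor_itv ((b j).1 - (z j).1).
  have /andP[h3 h4] := floor_itv ((b j).2 - (z j).2).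
  by rewrite !ler_norml; rewrite !intrD in h2 h4; split; apply/andP; split; lra.
split=> // tau t tt.
have base : ucvg U (fun j => v.2 * ((t j)%:~R / L j)) (tau * v.2).
  by rewrite mulrC; apply: ucvgZ.
apply: (ucvg_close ultraU base) => e e0.
pose eps := e / (2 * (`|tau| + 2)); have eps0 : 0 < eps by rewrite divr_gt0// mulr_gt0// ltr_wpDl.
have epsE : eps * (`|tau| + 2) = e / 2 by rewrite /eps; field; rewrite lt0r_neq0// ltr_wpDl.
have e2 : 0 < e / 2 by rewrite divr_gt0.
have small := ucvg_cst_div ultraU 1 L_infty e2.
apply: (usub (uand (uand (Hz _ eps0) (L_infty (`|tau| + 2))) (uand small (tt _ ltr01)))).
move=> j /= [[h lt] [h2 h3]].
have l0 : 0 < L j by apply: lt_le_trans lt; rewrite ltr_wpDl.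
have tL : `|(t j)%:~R| <= (`|tau| + 1) * L j.
  rewrite -ler_pdivrMr// -[X in _ / X](gtr0_norm l0) -normfV -normrM.
  by rewrite -[_ / _](subrK tau); apply: le_trans (ler_normD _ _) _; rewrite addrC lerD2l ltW.
have TW : (`|t j| <= (Num.truncn (L j ^+ 2)).+1)%N.
  rewrite -(ler_nat R) natr_absz intr_norm; apply: le_trans (ltW (truncnS_gt _)).
  by apply: le_trans tL _; rewrite expr2 ler_pM2r//; lra.
have := h _ TW; rewrite natr_absz intr_norm => h5.
have := le_trans (nrm_snd _) h5; rewrite !pairE /= => h6.
rewrite subr0 it_translate ?intr_int// !pairE /=.
have [_ nj] := near j; rewrite !pairE /= in nj.
rewrite subr0 normrM normfV (gtr0_norm l0) normr1 in h2.
have -> : ((it (t j) (z j)).2 + (n j).2 - (b j).2) / L j - v.2 * ((t j)%:~R / L j) =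
   (((it (t j) (z j)).2 - (z j).2 - (t j)%:~R * v.2) + ((z j).2 + (n j).2 - (b j).2)) / L j.
  by field; rewrite lt0r_neq0.
rewrite normrM normfV (gtr0_norm l0) ltr_pdivrMr//; apply: le_lt_trans (ler_normD _ _) _.
have h7 : 1 < e / 2 * L j by rewrite -ltr_pdivrMr.
have : eps * `|(t j)%:~R| <= eps * ((`|tau| + 1) * L j) by rewrite ler_pM2l.
have : eps * (`|tau| + 2) * L j = e / 2 * L j by rewrite epsE.
lra.
Qed.

Definition vsign : R := if 0 <= (v - c).2 then 1 else -1.

Lemma vsign_norm : `|vsign| = 1.
Proof. by rewrite /vsign; case: ifP => _; rewrite ?normrN normr1. Qed.

Lemma vsign_sq : vsign * vsign = 1.
Proof. by rewrite /vsign; case: ifP => _; rewrite ?mulrNN mulr1. Qed.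

(** The vertical analogue of [lag_energy]: only the vertical component enters, as realised
    velocities are vertical, and [vsign] orients it so that levels decrease. *)
Lemma rel_noninc p (P b : nat -> R * R) f :
  pseudo_rate U (fun j t => vertical (p j t)) c (rate F vertical c) ->
  plimit U L mu (fun j t => p j t - it t (P j)) f ->
  path_limit U L (fun j t => (it t (P j)).2 - (b j).2) L (fun t => t * v.2) ->
  noninc_lip (fun t => vsign * (f t).2).
Proof.
move=> pr [_ pf] Pf; pose y t := (f t).2 + t * v.2.
have yl : path_limit U L (fun j t => (p j t).2 - (b j).2) L y.
  have := path_limitD ultraU pf Pf => h tau t tt; have := h tau t tt => h' e e0.
  apply: (usub (h' e e0)) => j /=; congr (`|_ / _ - _| < _); ring.
have yv : plimit U L L (fun j t => (0, (p j t).2 - (b j).2)) (fun t => (0, y t)).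
  by split=> //= tau t tt; have := ucvg_cst_div ultraU 0 L_infty.
have rate s t : s <= t -> nrm ((0, y t) - (0, y s) - (t - s) *: c) <= (t - s) * nrm (v - c).
  move=> st; rewrite cv; apply: (plimit_rate ultraU L_infty _ yv st) => eta eta0.
  have [K HK] := pr _ eta0; exists K; apply: (usub HK) => j h i n; have := h i n.
  congr (nrm (_ - _) <= _); apply: veq; rewrite !pairE /=; first by rewrite subrr.
  ring.
have v1 := realized_vertical; pose be := v - c.
have en s t : s <= t -> ((f t).2 - (f s).2) ^+ 2 <= 2 * (t - s) * ((v - c).2 * ((f s).2 - (f t).2)).
  move=> st; have ts : 0 <= t - s by rewrite subr_ge0.
  have := @rate_energy _ (0, (f t).2 - (f s).2) (v - c) (t - s) ts.
  rewrite nrm_vertical real_normK ?num_real//.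
  have -> : dot (v - c) (- (0, (f t).2 - (f s).2)) = (v - c).2 * ((f s).2 - (f t).2).
    by rewrite /dot !pairE /=; ring.
  apply; apply: le_trans (rate s t st); rewrite le_eqVlt; apply/orP; left; apply/eqP.
  congr nrm; apply: veq; rewrite /y !pairE /= ?v1; ring.
split=> [s t|].
  rewrite le_eqVlt => /predU1P[->//|st].
  have := en s t (ltW st) => h.
  have d0 : 0 <= (v - c).2 * ((f s).2 - (f t).2).
    have := le_trans (sqr_ge0 _) h; rewrite pmulr_rge0// mulr_gt0// subr_gt0//.
  have z0 : (v - c).2 = 0 -> (f s).2 = (f t).2.
    move=> e; move: h; rewrite e mul0r mulr0 => h.
    by apply/esym/eqP; rewrite -subr_eq0 -sqrf_eq0 eq_le h sqr_ge0.
  rewrite /vsign; case: (ltgtP 0 (v - c).2) d0 => [b0|b0|b0] d0.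
  - by rewrite !mul1r -subr_ge0 -(pmulr_rge0 _ b0).
  - by rewrite !mulN1r lerN2 -subr_le0 -(nmulr_rge0 _ b0).
  - by rewrite z0.
exists (nrm c + nrm (v - c) + `|v.2|) => s t.
rewrite -mulrBr normrM vsign_norm mul1r.
wlog st : s t / s <= t.
  by move=> h; have [/h//|/ltW /h] := leP s t; rewrite distrC [`|t - s|]distrC.
have h1 := le_trans (nrm_snd _) (rate s t st); rewrite !pairE /= in h1.
have -> : (f s).2 - (f t).2 = - (y t - y s - (t - s) * c.2) + (t - s) * v.2 - (t - s) * c.2.
  by rewrite /y; ring.
have e1 : `|s - t| = t - s by rewrite distrC ger0_norm// subr_ge0.
have ts : 0 <= t - s by rewrite subr_ge0.
apply: le_trans (ler_normB _ _) _; apply: le_trans (lerD (ler_normD _ _) (lexx _)) _.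
rewrite normrN !normrM (ger0_norm ts) e1.
have := nrm_snd c => h2; have : (t - s) * `|c.2| <= (t - s) * nrm c by exact: ler_wpM2l.
by lra.
Qed.

(** Chosen so that in the oriented frame the drift has the positive coefficient [|k|]
    ([hsign_k]). *)
Definition hsign : R := Num.sg kR * vsign.

Let kR0 : kR != 0. Proof. by rewrite intr_eq0. Qed.
Let nk : 0 < `|kR|. Proof. by rewrite normr_gt0. Qed.

Lemma hsign_norm : `|hsign| = 1.
Proof. by rewrite /hsign normrM vsign_norm mulr1 normr_sg kR0. Qed.

Lemma hsign_k x : hsign * (kR * x) = `|kR| * (vsign * x).
Proof. by rewrite /hsign normrEsg; ring. Qed.

Lemma rel_drifts C C' B p q f : pseudo_orbit C p -> pseudo_orbit C' q -> nearby B p q ->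
  plimit U L mu (fun j t => p j t - q j t) f ->
  drifts `|kR| (fun t => vsign * (f t).2) (fun t => hsign * (f t).1).
Proof.
move=> hp hq near pf m s t st; have tm := rel_tame hp hq near; split => H.
  rewrite -mulrBr; apply: (plimit_drift ultraU L_infty tm pf hsign_norm st) => u su.
  by rewrite hsign_k ler_pM2l//; exact: H.
have hN : `|- hsign| = 1 by rewrite normrN hsign_norm.
have : - (`|kR| * m) * (t - s) <= - hsign * ((f t).1 - (f s).1).
  apply: (plimit_drift ultraU L_infty tm pf hN st) => u su.
  by rewrite mulNr hsign_k lerN2 ler_pM2l//; exact: H.
by rewrite !mulNr lerN2 mulrBr.
Qed.

Definition dehn_frame : (R * R) * (R * R) := ((hsign, 0), (0, vsign)).

Lemma dehn_frameE z : mx dehn_frame z = (hsign * z.1, vsign * z.2).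
Proof. by rewrite mxE /= !mul0r addr0 add0r. Qed.

Lemma det_dehn_frame : det dehn_frame != 0.
Proof.
rewrite /det /= mul0r subr0 -normr_eq0 normrM hsign_norm vsign_norm mulr1; exact: oner_neq0.
Qed.

Lemma dehn_quasi P w :
  `|(mx dehn_frame (F (P + w) - F P)).1 - ((mx dehn_frame w).1 + `|kR| * (mx dehn_frame w).2)| <= 2 * C1 /\
  `|(mx dehn_frame (F (P + w) - F P)).2 - (mx dehn_frame w).2| <= 2 * C1.
Proof.
rewrite !dehn_frameE /= -hsign_k -mulrDr -!mulrBr (normrM hsign) (normrM vsign) hsign_norm vsign_norm !mul1r.
have [h1 h2] := F_bound (P + w); have [h3 h4] := F_bound P; rewrite !pairE in h1 h2 h3 h4 *.
have -> : (F (P + w)).1 - (F P).1 - (w.1 + kR * w.2) =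
  ((F (P + w)).1 - (P.1 + w.1) - kR * (P.2 + w.2)) - ((F P).1 - P.1 - kR * P.2) by ring.
have -> : (F (P + w)).2 - (F P).2 - w.2 = ((F (P + w)).2 - (P.2 + w.2)) - ((F P).2 - P.2) by ring.
by split; apply: le_trans (ler_normB _ _) _; lra.
Qed.

(* The integer translate of P at level lc whose scaled abscissa is near x0. *)
Definition shifted (P : nat -> R * R) (lc x0 : R) j : R * R :=
  P j + ((Num.floor (hsign * x0 * L j ^+ 2))%:~R, (Num.floor (vsign * lc * L j))%:~R).

Lemma floor_cvg (nu : nat -> R) x : (forall m : R, U [set j | m <= nu j]) ->
  ucvg U (fun j => (Num.floor (x * nu j))%:~R / nu j) x.
Proof. by move=> nui; exact: (time_cvg ultraU nui). Qed.

Lemma shifted_limit p P f lc x0 : plimit U L mu (fun j t => p j t - it t (P j)) f ->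
  plimit U L mu (fun j t => mx dehn_frame (p j t - it t (shifted P lc x0 j)))
    (fun t => (hsign * (f t).1 - (x0 + `|kR| * lc * t), vsign * (f t).2 - lc)).
Proof.
have mui : forall m : R, U [set j | m <= mu j] by move=> m; exact: (mu_infty ultraU L_infty Lmu m).
have n1 := floor_cvg (hsign * x0) mui; have n2 := floor_cvg (vsign * lc) L_infty.
have hs : hsign * hsign = 1.
  by rewrite -expr2 -real_normK ?num_real// hsign_norm expr1n.
have E j t : mx dehn_frame (p j t - it t (shifted P lc x0 j)) =
  (hsign * ((p j t - it t (P j)).1 - ((Num.floor (hsign * x0 * L j ^+ 2))%:~R + kR * t%:~R * (Num.floor (vsign * lc * L j))%:~R)),
   vsign * ((p j t - it t (P j)).2 - (Num.floor (vsign * lc * L j))%:~R)).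
  by rewrite dehn_frameE /shifted it_translate ?intr_int//; apply: veq; rewrite !pairE /=; ring.
move=> [f1 f2]; split => tau t tt /=.
  have c1 := ucvgZ ultraU hsign (ucvgB ultraU (f1 _ _ tt) (ucvgD ultraU n1 (ucvgZ ultraU kR (ucvgM tt n2)))).
  have -> : hsign * (f tau).1 - (x0 + `|kR| * lc * tau) =
    hsign * ((f tau).1 - (hsign * x0 + kR * (tau * (vsign * lc)))).
    have e1 : hsign * (kR * (tau * (vsign * lc))) = `|kR| * lc * tau.
      by rewrite hsign_k; transitivity (vsign * vsign * (`|kR| * lc * tau)); [ring|rewrite vsign_sq mul1r].
    rewrite -e1 -[x0 in LHS]mul1r -hs; ring.
  move=> e e0; apply: (usub (uand (c1 e e0) L0)) => j /= [h l0]; move: h; congr (`|_ - _| < _).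
  by rewrite E /=; field; rewrite lt0r_neq0.
have c2 := ucvgZ ultraU vsign (ucvgB ultraU (f2 _ _ tt) n2).
have -> : vsign * (f tau).2 - lc = vsign * ((f tau).2 - vsign * lc).
  by rewrite mulrBr mulrA vsign_sq mul1r.
move=> e e0; apply: (usub (uand (c2 e e0) L0)) => j /= [h l0]; move: h; congr (`|_ - _| < _).
by rewrite E /=; field; rewrite lt0r_neq0.
Qed.

(** Relative to a class orbit at level [lc], a path drifts to the right while above that level and
    to the left while below it. It is therefore arbitrarily far to the left both early and late,
    which replaces a vertical margin at the two ends of the crossing argument. *)
Lemma far_left a xi lc x0 B : drifts `|kR| a xi -> noninc_lip a -> strictly_crosses a lc ->
  exists s t, [/\ s < t, lc < a s, xi s - (x0 + `|kR| * lc * s) < - B, a t < lc &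
    xi t - (x0 + `|kR| * lc * t) < - B].
Proof.
move=> dr [mo _] [[s1 h1] [t1 h2]].
have st1 : s1 < t1 by rewrite ltNge; apply/negP => /mo; lra.
have p1 : 0 < `|kR| * (a s1 - lc) by rewrite mulr_gt0// subr_gt0.
have p2 : 0 < `|kR| * (lc - a t1) by rewrite mulr_gt0// subr_gt0.
have [S S0 hS] := archi_gt (xi s1 - (x0 + `|kR| * lc * s1) + B) p1.
have [T T0 hT] := archi_gt (xi t1 - (x0 + `|kR| * lc * t1) + B) p2.
have sS : s1 - S <= s1 by rewrite gerDl oppr_le0 ltW.
have tT : t1 <= t1 + T by rewrite lerDl ltW.
exists (s1 - S), (t1 + T).
have [g1 _] := dr (a s1) _ _ sS; have [_ g2] := dr (a t1) _ _ tT.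
have {}g1 := g1 (fun u hu => ltac:(by case/andP: hu => _ hu; exact: mo)).
have {}g2 := g2 (fun u hu => ltac:(by case/andP: hu => hu _; exact: mo)).
have e1 : s1 - (s1 - S) = S by ring. have e2 : t1 + T - t1 = T by ring.
rewrite e1 in g1; rewrite e2 in g2; have m1 := mo _ _ sS; have m2 := mo _ _ tT.
by split; lra.
Qed.

Definition rel_limits (p : nat -> int -> R * R) (P : nat -> R * R) f : Prop :=
  plimit U L mu (fun j t => p j t - it t (P j)) f.

Definition frame_unseparated f g : Prop :=
  unseparated `|kR| (fun t => vsign * (f t).2) (fun t => hsign * (f t).1)
    (fun t => vsign * (g t).2) (fun t => hsign * (g t).1).

(** Bounded separation forces equal levels, hence no relative drift; the difference is then
    constant, and one common abscissa makes it zero. The last hypothesis excludes that [p] is itself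
    steady in this class. *)
Lemma class_same C C' B p q (P b : nat -> R * R) f g h :
  pseudo_orbit C p -> pseudo_orbit C' q ->
  nearby B p (fun j t => it t (P j)) -> nearby B q (fun j t => it t (P j)) -> nearby B p q ->
  pseudo_rate U (fun j t => vertical (p j t)) c (rate F vertical c) ->
  pseudo_rate U (fun j t => vertical (q j t)) c (rate F vertical c) ->
  path_limit U L (fun j t => (it t (P j)).2 - (b j).2) L (fun t => t * v.2) ->
  rel_limits p P f -> rel_limits q P g -> plimit U L mu (fun j t => p j t - q j t) h ->
  frame_unseparated f g -> frame_unseparated g f ->
  (forall t, `|(h t).1| <= B) -> (exists s t, (f s).2 != (f t).2) -> h 0 = 0.
Proof.
move=> hp hq np nq npq rp rq Pb pf qg ph sep sep' bd [s [t st]].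
have nf := rel_noninc rp pf Pb; have ng := rel_noninc rq qg Pb.
have df := rel_drifts hp (orbit_pseudo P) np pf; have dg := rel_drifts hq (orbit_pseudo P) nq qg.
have hE u : h u = f u - g u.
  have := plimitB ultraU pf qg => fg.
  apply: veq.
    apply: (ucvg_uniq ultraU (ph.1 _ _ (tcvg u))); have := fg.1 _ _ (tcvg u) => lim e e0.
    by apply: (usub (lim e e0)) => j /=; congr (`|_ / _ - _| < _); ring.
  apply: (ucvg_uniq ultraU (ph.2 _ _ (tcvg u))); have := fg.2 _ _ (tcvg u) => lim e e0.
  by apply: (usub (lim e e0)) => j /=; congr (`|_ / _ - _| < _); ring.
have bd' u : `|hsign * (f u).1 - hsign * (g u).1| <= B.
  by rewrite -mulrBr normrM hsign_norm mul1r; have := bd u; rewrite hE.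
have fg := unseparated_eq nk nf ng df dg sep sep' bd'.
have vs0 : vsign != 0 by rewrite -normr_eq0 vsign_norm oner_neq0.
have hs0 : hsign != 0 by rewrite -normr_eq0 hsign_norm oner_neq0.
have h2 u : (h u).2 = 0.
  by have /(mulfI vs0) e := fg u; rewrite hE sndB e subrr.
have [u ue] : exists u, hsign * (f u).1 = hsign * (g u).1.
  apply: (unseparated_same nf ng df dg sep sep' fg).
  by exists s, t; rewrite (inj_eq (mulfI vs0)).
have hu : (h u).1 = 0 by move/(mulfI hs0): ue => e; rewrite hE fstB e subrr.
have dh := rel_drifts hp hq npq ph.
have const x y : x <= y -> (h x).1 = (h y).1.
  move=> xy; have [] := dh 0 x y xy => h3 h4.
  have {}h3 := h3 (fun z _ => ltac:(by rewrite h2 mulr0)).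
  have {}h4 := h4 (fun z _ => ltac:(by rewrite h2 mulr0)).
  by apply: (mulfI hs0); rewrite mulr0 mul0r in h3 h4; lra.
have e0 : (h 0).1 = (h u).1 by have [/const//|/ltW/const ->] := leP 0 u.
by apply: veq; rewrite ?h2//= e0 hu.
Qed.

(** A class orbit between the two paths would be overtaken by [p] and [q] on opposite sides. Since
    [far_left] supplies any horizontal margin, the size 2 of the family is harmless. *)
Lemma family_unseparated (D : nat -> set (R * R)) (p q P : nat -> R * R) f g :
  (forall j, pathconn (D j)) ->
  (forall j t z w, D j z -> D j w -> `|(it t z - it t w).1| <= 2 * L j ^+ 2 /\
     `|(it t z - it t w).2| <= 2 * L j) ->
  (forall j, D j (p j)) -> (forall j, D j (q j)) ->
  rel_limits (fun j t => it t (p j)) P f -> rel_limits (fun j t => it t (q j)) P g ->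
  noninc_lip (fun t => vsign * (g t).2) ->
  drifts `|kR| (fun t => vsign * (g t).2) (fun t => hsign * (g t).1) ->
  frame_unseparated f g.
Proof.
move=> Dpc Db Dp Dq pf qg ng dg lc x0 cr hl hr.
have [s [t [st a1 x1 a2 x2]]] := far_left x0 2 dg ng cr.
have N i : U [set j | spread L mu F Fi dehn_frame D (shifted P lc x0) 2 (time L i j) j].
  apply: (U_all ultraU) => j z w Dz Dw.
  have -> : mx dehn_frame (it (time L i j) z - it (time L i j) (shifted P lc x0 j)) -
    mx dehn_frame (it (time L i j) w - it (time L i j) (shifted P lc x0 j)) =
    mx dehn_frame (it (time L i j) z - it (time L i j) w).
    by rewrite -mxB opprB addrA subrK.
  have [h1 h2] := Db j (time L i j) z w Dz Dw.
  by rewrite dehn_frameE /= (normrM hsign) (normrM vsign) hsign_norm vsign_norm !mul1r.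
apply: (no_limit_crossing ultraU L_infty Lmu contF contFi FK FiK det_dehn_frame dehn_quasi
  (U_all ultraU Dpc) Dp Dq (shifted_limit lc x0 pf) (shifted_limit lc x0 qg) st _ _ (N s) (N t)).
- move=> u _ /= /eqP; rewrite subr_eq0 => /eqP /hl; lra.
- move=> u _ /= /eqP; rewrite subr_eq0 => /eqP /hr; lra.
- by right => /=; lra.
- by right => /=; lra.
Qed.

End dehn_class.

Section dehn_family.
Variables (D : nat -> set (R * R)) (p q : nat -> R * R).
Hypothesis D_pc : forall j, pathconn (D j).
Hypothesis D_b : forall j t z w, D j z -> D j w -> `|(it t z - it t w).1| <= 2 * L j ^+ 2 /\
     `|(it t z - it t w).2| <= 2 * L j.
Hypotheses (Dp : forall j, D j (p j)) (Dq : forall j, D j (q j)).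
Local Notation pp := (fun j t => it t (p j)).
Local Notation qq := (fun j t => it t (q j)).

Lemma family_nearby : nearby 3 pp qq.
Proof.
apply: (usub L0) => j /= l0; have [h1 h2] := D_b 0 (Dp j) (Dq j).
split; [apply: le_trans h1 _|apply: le_trans h2 _]; apply: ler_wpM2r; rewrite ?exprn_ge0 ?ltW//; lra.
Qed.

Lemma family_reference c v : realized F Fi vertical v -> nrm (v - c) = rate F vertical c ->
  exists (P : nat -> R * R) f, [/\ path_limit U L (fun j t => (it t (P j)).2 - (p j).2) L (fun t => t * v.2),
    rel_limits pp P f &
    forall h, plimit U L mu (fun j t => it t (p j) - it t (q j)) h ->
      (exists s t, (f s).2 != (f t).2) -> h 0 = 0].
Proof.
move=> vr cv; have [P [Pp Pl]] := reference_orbit vr p.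
have LL : U [set j | 1 <= L j] := L_infty 1.
have np : nearby 3 pp (fun j t => it t (P j)).
  apply: (usub LL) => j /= l1; have [h1 h2] := Pp j; rewrite !pairE in h1 h2.
  have L2 : 1 <= L j ^+ 2 by rewrite expr2; nra.
  rewrite /= distrC [`|(p j).2 - _|]distrC; split; lra.
have nq : nearby 3 qq (fun j t => it t (P j)).
  apply: (usub LL) => j /= l1; have [h1 h2] := Pp j; have [h3 h4] := D_b 0 (Dq j) (Dp j).
  have L2 : 1 <= L j ^+ 2 by rewrite expr2; nra.
  rewrite /= in h1 h2 h3 h4 *; rewrite !ler_norml in h1 h2 h3 h4 *.
  move: h1 h2 h3 h4 => /andP[? ?] /andP[? ?] /andP[? ?] /andP[? ?].
  by split; apply/andP; split; lra.
have [f pf] := rel_limit (orbit_pseudo p) (orbit_pseudo P) np.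
have [g qg] := rel_limit (orbit_pseudo q) (orbit_pseudo P) nq.
exists P, f; split=> // h ph.
have rp := orbit_pseudo_rate ultraU FK FiK vertical_step p c.
have rq := orbit_pseudo_rate ultraU FK FiK vertical_step q c.
have nf := rel_noninc vr cv rp pf Pl; have ng := rel_noninc vr cv rq qg Pl.
have df := rel_drifts c v (orbit_pseudo p) (orbit_pseudo P) np pf.
have dg := rel_drifts c v (orbit_pseudo q) (orbit_pseudo P) nq qg.
have bd t : `|(h t).1| <= 3.
  apply: (ucvg_lec ultraU (ucvg_abs ultraU (ph.1 _ _ (tcvg t)))).
  apply: (usub L0) => j /= l0; have [h1 _] := D_b (time L t j) (Dp j) (Dq j).
  have L2 : 0 < L j ^+ 2 by rewrite exprn_gt0.
  rewrite normrM normfV (gtr0_norm L2) ler_pdivrMr//; lra.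
apply: (class_same vr cv (orbit_pseudo p) (orbit_pseudo q) np nq family_nearby rp rq Pl pf qg ph _ _ bd).
  exact: (family_unseparated D_pc D_b Dp Dq pf qg ng dg).
exact: (family_unseparated D_pc D_b Dq Dp qg pf nf df).
Qed.

(** A path cannot be steady in two classes of different velocities, so [class_same] applies to at
    least one of them. *)
Lemma family_collapse c1 v1 c2 v2 h :
  realized F Fi vertical v1 -> nrm (v1 - c1) = rate F vertical c1 ->
  realized F Fi vertical v2 -> nrm (v2 - c2) = rate F vertical c2 -> v1 != v2 ->
  plimit U L mu (fun j t => it t (p j) - it t (q j)) h -> h 0 = 0.
Proof.
move=> r1 e1 r2 e2 ne ph.
have [P1 [f1 [Pl1 pf1 H1]]] := family_reference r1 e1.
have [P2 [f2 [Pl2 pf2 H2]]] := family_reference r2 e2.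
have [h1|h1] := pselect (exists s t, (f1 s).2 != (f1 t).2); first exact: H1 ph h1.
have [h2|h2] := pselect (exists s t, (f2 s).2 != (f2 t).2); first exact: H2 ph h2.
have c1' s t : (f1 s).2 = (f1 t).2 by apply/eqP/negPn/negP => h'; apply: h1; exists s, t.
have c2' s t : (f2 s).2 = (f2 t).2 by apply/eqP/negPn/negP => h'; apply: h2; exists s, t.
have E t : (f1 t).2 + t * v1.2 = (f2 t).2 + t * v2.2.
  have l1 := path_limitD ultraU pf1.2 Pl1 (tcvg t).
  have l2 := path_limitD ultraU pf2.2 Pl2 (tcvg t).
  apply: (ucvg_uniq ultraU l1) => e e0; apply: (usub (l2 e e0)) => j /=.
  by congr (`|_ / _ - _| < _); ring.
have e : v1.2 = v2.2.
  have := E 0; have := E 1; rewrite !mul0r !mul1r !addr0 (c1' 1 0) (c2' 1 0) => e3 e4.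
  by move: e3; rewrite e4 => /addrI.
move/eqP: ne; case; apply: veq => //.
by rewrite (realized_vertical r1) (realized_vertical r2).
Qed.

End dehn_family.
End dehn.

Section bounded_dehn.
Context {R : realType}.
Variables (F Fi : R * R -> R * R) (k : int) (C1 : R).
Hypotheses (contF : continuous F) (contFi : continuous Fi).
Hypotheses (FK : cancel F Fi) (FiK : cancel Fi F) (k0 : k != 0).
Local Notation kR := (k%:~R : R).
Hypothesis F_bound : forall z, `|(F z).1 - z.1 - kR * z.2| <= C1 /\ `|(F z).2 - z.2| <= C1.
Hypothesis equivF : forall z m : R * R, m.1 \is a Num.int -> m.2 \is a Num.int ->
  F (z + m) = F z + (m.1 + kR * m.2, m.2).
Local Notation it := (iterz F Fi).

(* Under a twist horizontal lengths scale as the square of vertical ones. *)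
Definition gauge (z : R * R) : R := Num.max `|z.2| (Num.sqrt `|z.1|).

Lemma gauge_ge0 z : 0 <= gauge z.
Proof. by rewrite le_max normr_ge0. Qed.

Lemma gauge_le z (l : R) : 0 <= l -> (gauge z <= l) = (`|z.2| <= l) && (`|z.1| <= l ^+ 2).
Proof.
move=> l0; rewrite ge_max; congr (_ && _).
have e : l = Num.sqrt (l ^+ 2) by rewrite sqrtr_sqr ger0_norm.
by rewrite {1}e ler_sqrt ?sqr_ge0.
Qed.

Lemma nrm_gauge z : nrm z <= gauge z + gauge z ^+ 2.
Proof.
have := lexx (gauge z); rewrite {1}gauge_le ?gauge_ge0// => /andP[h1 h2].
by apply: le_trans (nrm_le_sum _) _; lra.
Qed.

Lemma gauge_nrm z : gauge z <= nrm z + 1.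
Proof.
have n0 := nrm_ge0 z; rewrite gauge_le ?addr_ge0//.
have h1 := nrm_fst z; have h2 := nrm_snd z; rewrite sqrrD; apply/andP; split; first lra.
have := sqr_ge0 (nrm z); rewrite mulr1 expr1n; lra.
Qed.

Variables (rho0 : R * R) (delta : R).
Hypotheses (delta0 : 0 < delta) (ball : rotation_ball F vertical rho0 delta).

Lemma bounded_orbit_diameter_dehn : exists2 N : R, 0 < N & forall D, pathconn D ->
  (exists l, forall t z w, D z -> D w -> nrm (it t z - it t w) <= l) ->
  forall z w, D z -> D w -> nrm (z - w) <= N.
Proof.
apply: contrapT => no.
have [c1 [c2 [v1 [v2 [[r1 e1] [r2 e2] v12]]]]] :=
  exists_two_realized FK FiK (vertical_step F_bound) delta0 ball
    (fun v rv => @veq _ (vertical v) v (esym (realized_vertical rv)) erefl).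
have H (n : nat) : exists x : (R * set (R * R)) * ((R * R) * (R * R)),
    [/\ n%:R <= x.1.1 /\ pathconn x.1.2, x.1.2 x.2.1 /\ x.1.2 x.2.2,
    (forall t z w, x.1.2 z -> x.1.2 w -> gauge (it t z - it t w) <= x.1.1) &
    x.1.1 / 2 < gauge (x.2.1 - x.2.2)].
  apply: contrapT => h; apply: no; exists (n.+1%:R + n.+1%:R ^+ 2); first by rewrite addr_gt0// exprn_gt0.
  move=> D cD [l Dl] z w Dz Dw.
  rewrite leNgt; apply/negP => lt; apply: h.
  pose A := [set x | exists t z w, [/\ D z, D w & x = gauge (it t z - it t w)]].
  have sA : has_sup A.
    split; first by exists (gauge (it 0 z - it 0 w)), 0, z, w.
    exists (l + 1) => _ [t [z' [w' [Dz' Dw' ->]]]]; apply: le_trans (gauge_nrm _) _.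
    by rewrite lerD2r; exact: Dl.
  have ub t z' w' : D z' -> D w' -> gauge (it t z' - it t w') <= sup A.
    by move=> ? ?; apply: (sup_upper_bound sA); exists t, z', w'.
  have Sn : n.+1%:R < sup A.
    apply: lt_le_trans (ub 0 z w Dz Dw); rewrite ltNge; apply/negP => g1.
    move: lt; rewrite ltNge => /negP; apply; apply: le_trans (nrm_gauge _) _.
    by rewrite lerD// lerXn2r ?nnegrE ?gauge_ge0//.
  have S0 : 0 < sup A by apply: le_lt_trans Sn.
  have S2 : 0 < sup A / 2 by rewrite divr_gt0.
  have [_ [t [z' [w' [Dz' Dw' ->]]]] hS] := sup_adherent S2 sA.
  exists ((sup A, it t @` D), (it t z', it t w')); split => /=.
  - split; first by apply: le_trans (ltW Sn); rewrite ler_nat.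
    move=> _ _ [y1 Dy1 <-] [y2 Dy2 <-]; have [g [cg Dg g0 g1]] := cD _ _ Dy1 Dy2.
    exists (fun s => it t (g s)); split.
    + exact: (cont_comp cg (@iterz_cont _ F Fi t contF contFi)).
    + by move=> s; exists (g s).
    + by rewrite g0.
    + by rewrite g1.
  - by split; [exists z'|exists w'].
  - move=> s _ _ [y1 Dy1 <-] [y2 Dy2 <-]; rewrite -!(iterzD FK FiK).
    exact: ub.
  - lra.
have [X HX] := choice H.
have [U [ultraU freeU]] := free_ultrafilter.
pose L j := (X j).1.1; pose D j := (X j).1.2; pose p j := (X j).2.1; pose q j := (X j).2.2.
have L_infty (x : R) : U [set j | x <= L j].
  apply: (U_sub ultraU (freeU (Num.truncn x).+1)) => j /= h.
  have [[h1 _] _ _ _] := HX j; apply: le_trans h1.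
  by apply: le_trans (ltW (truncnS_gt _)) _; rewrite ler_nat.
have D_pc j : pathconn (D j) by have [[_ ?] _ _ _] := HX j.
have L_ge0 j : 0 <= L j by have [[h _] _ _ _] := HX j; apply: le_trans h.
have D_b j t z w : D j z -> D j w -> `|(it t z - it t w).1| <= 2 * L j ^+ 2 /\
     `|(it t z - it t w).2| <= 2 * L j.
  move=> Dz Dw; have [_ _ + _] := HX j => /(_ t z w Dz Dw); rewrite gauge_le; last exact: L_ge0.
  have l0 := L_ge0 j; have l2 : 0 <= L j ^+ 2 by rewrite exprn_ge0.
  by rewrite -/(L j) => /andP[h1 h2]; split; lra.
have Dp j : D j (p j) by have [_ [? _] _ _] := HX j.
have Dq j : D j (q j) by have [_ [_ ?] _ _] := HX j.
have L0 := L_gt0 ultraU L_infty.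
have z0 : ucvg U (fun j => (0 : int)%:~R / L j) 0 by have := ucvg_cst_div ultraU 0 L_infty.
have [h ph] := rel_limit ultraU L_infty (orbit_pseudo FiK F_bound p) (orbit_pseudo FiK F_bound q)
  (family_nearby ultraU L_infty D_b Dp Dq).
have h0 := family_collapse contF contFi FK FiK k0 F_bound equivF ultraU freeU L_infty D_pc D_b Dp Dq
  r1 e1 r2 e2 v12 ph.
(* Gauge [L/2] allows the horizontal length [(L/2)^2 = L^2 / 4], hence the constant. *)
have q0 : 0 < 1 / 4 :> R by rewrite divr_gt0.
have l1 := ph.1 _ _ z0 _ q0; have l2 := ph.2 _ _ z0 _ q0.
have uand (A B : set nat) : U A -> U B -> U (A `&` B) by exact: filterI.
have [j [[/= g1 g2] l0]] := U_ex ultraU (uand _ _ (uand _ _ l1 l2) L0).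
have [_ _ _] := HX j; rewrite ltNge => /negP; apply.
have L2 : 0 < L j ^+ 2 by rewrite exprn_gt0.
rewrite -/(L j) gauge_le ?divr_ge0 ?(ltW l0)//.
rewrite h0 /= !subr0 in g1 g2.
rewrite normrM normfV (gtr0_norm L2) ltr_pdivrMr// in g1.
rewrite normrM normfV (gtr0_norm l0) ltr_pdivrMr// in g2.
rewrite /= -/(p j) -/(q j); apply/andP; split; first lra.
by rewrite expr_div_n; lra.
Qed.

End bounded_dehn.

(** * Simply connected invariant sets with recurrence *)

Section cyclic_orbits.
Context {R : realType}.
Variables (F Fi : R * R -> R * R) (a : R * R -> R * R).

(* The periodic pseudo-orbit z, F z, ..., F^(T-1) z, z, F z, ... *)
Definition cyc (z : R * R) (T : nat) (t : int) : R * R := iter `|(t %% T%:Z)%Z|%N F z.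

Lemma cyc_res T s : (0 < T)%N -> (s %% T%:Z)%Z = `|(s %% T%:Z)%Z|%N%:Z.
Proof. by move=> T0; rewrite gez0_abs// modz_ge0// eqz_nat -lt0n. Qed.

Lemma cyc_res_lt T s : (0 < T)%N -> (`|(s %% T%:Z)%Z| < T)%N.
Proof. by move=> T0; rewrite -ltz_nat -cyc_res// ltz_pmod// ltz_nat. Qed.

Lemma cycD z T s n : (0 < T)%N ->
  cyc z T (s + n%:Z) = iter ((`|(s %% T%:Z)%Z| + n) %% T)%N F z.
Proof.
move=> T0; have := cyc_res s T0; set r := `|(s %% T%:Z)%Z|%N => rE.
by rewrite /cyc -modzDml [X in (X + _)%R]rE -PoszD modz_nat absz_nat.
Qed.

Lemma cycT z T s (m : nat) : cyc z T (s + (m * T)%:Z) = cyc z T s.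
Proof. by rewrite /cyc PoszM addrC modzMDl. Qed.

Lemma cyc_step z T s : (0 < T)%N -> cyc z T (s + 1) = F (cyc z T s) \/
  (cyc z T (s + 1) = z /\ F (cyc z T s) = iter T F z).
Proof.
move=> T0; have := cyc_res_lt s T0; have := cycD z s 1 T0.
rewrite /cyc -/(cyc z T (s + 1)); move: `|(s %% T%:Z)%Z|%N => r -> rT.
rewrite addn1; have [rT'|Tr] := ltnP r.+1 T; first by left; rewrite modn_small.
have e : r.+1 = T by apply/eqP; rewrite eqn_leq rT Tr.
by right; rewrite e modnn -e.
Qed.

(** Whole periods produce no displacement and cost only [|c|] per unit of time, which the near
    return bounds by [rho + eta]. The rest meets the seam at most once, so the error [K] occurs at
    most twice, plus 1 for the jump. *)
Lemma cyc_rate z T (c : R * R) (rho eta K : R) : (0 < T)%N -> 0 < eta -> 0 <= rho ->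
  (forall n y, nrm (disp F a n y - n%:R *: c) <= rho * n%:R + K) ->
  nrm (a (iter T F z) - a z) <= 1 -> K + 1 <= eta * T%:R -> forall s n,
  nrm (a (cyc z T (s + n%:Z)) - a (cyc z T s) - n%:R *: c) <= (rho + eta) * n%:R + (2 * K + 1).
Proof.
move=> T0 eta0 rho0 HK close KT s n.
have K0 : 0 <= K.
  by have := le_trans (nrm_ge0 _) (HK 0%N z); rewrite mulr0 add0r.
rewrite cycD//; have rT := cyc_res_lt s T0; rewrite /cyc.
move: `|(s %% T%:Z)%Z|%N rT => r rT.
pose m := (n %/ T)%N; pose n' := (n %% T)%N.
have nE : n = (m * T + n')%N by exact: divn_eq.
have n'T : (n' < T)%N by rewrite ltn_mod.
have -> : ((r + n) %% T = (r + n') %% T)%N by rewrite nE addnCA modnMDl.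
have cT : T%:R * nrm c <= (rho + eta) * T%:R.
  have -> : T%:R * nrm c = nrm (T%:R *: c) by rewrite nrmZ ger0_norm.
  have -> : T%:R *: c = disp F a T z - (disp F a T z - T%:R *: c) by rewrite subKr.
  apply: le_trans (nrmB _ _) _; have := HK T z; rewrite {1}/disp; lra.
have mT : nrm ((m * T)%:R *: c) <= (rho + eta) * (m * T)%:R.
  have -> : nrm ((m * T)%:R *: c) = m%:R * (T%:R * nrm c).
    by rewrite nrmZ ger0_norm// natrM mulrA.
  by rewrite natrM [leRHS]mulrCA; apply: ler_wpM2l.
suff h : nrm (a (iter ((r + n') %% T) F z) - a (iter r F z) - n'%:R *: c) <= rho * n'%:R + (2 * K + 1).
  have -> : a (iter ((r + n') %% T) F z) - a (iter r F z) - n%:R *: c =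
    (a (iter ((r + n') %% T) F z) - a (iter r F z) - n'%:R *: c) - (m * T)%:R *: c.
    by rewrite nE natrD scalerDl opprD addrA addrAC.
  apply: le_trans (nrmB _ _) _; rewrite nE natrD mulrDr.
  have : 0 <= eta * n'%:R by rewrite mulr_ge0// ltW.
  by move=> ?; lra.
have n'0 : 0 <= n'%:R :> R by [].
have [h|h] := ltnP (r + n') T.
  rewrite modn_small// addnC iterD; apply: le_trans (HK n' (iter r F z)) _; lra.
have -> : ((r + n') %% T = r + n' - T)%N.
  by rewrite -{1}(subnK h) modnDr modn_small// ltn_subLR//; lia.
set u := (r + n' - T)%N; have uE : (n' = u + (T - r))%N by rewrite /u; lia.
have -> : a (iter u F z) - a (iter r F z) - n'%:R *: c =
  (disp F a u z - u%:R *: c) + (disp F a (T - r) (iter r F z) - (T - r)%:R *: c) - (a (iter T F z) - a z).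
  rewrite /disp -iterD subnK ?(ltnW rT)// {1}uE natrD scalerDl.
  by apply: veq; rewrite !pairE; ring.
apply: le_trans (nrmB _ _) _; apply: le_trans (lerD (nrmD _ _) close) _.
have h1 := HK u z; have h2 := HK (T - r)%N (iter r F z).
by rewrite uE natrD mulrDr; lra.
Qed.

End cyclic_orbits.

(** * Crossing counts for pseudo-orbits with jumps *)

Section jumps.
Context {R : realType}.
Variables (F Fi : R * R -> R * R) (M : (R * R) * (R * R)) (C ka CM : R).
Hypotheses (contF : continuous F) (contFi : continuous Fi).
Hypotheses (FK : cancel F Fi) (FiK : cancel Fi F) (dM : det M != 0).
Hypothesis quasi : forall P w,
  `|(mx M (F (P + w) - F P)).1 - ((mx M w).1 + ka * (mx M w).2)| <= C /\
  `|(mx M (F (P + w) - F P)).2 - (mx M w).2| <= C.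
Hypothesis mx_bound : forall w, `|(mx M w).1| <= CM * nrm w /\ `|(mx M w).2| <= CM * nrm w.
Local Notation it := (iterz F Fi).

Variable D : set (R * R).
Hypotheses (cD : pathconn D) (hD : paths_homotopic D).
Hypotheses (DF : forall z, D z -> D (F z)) (DFi : forall z, D (F z) -> D z).

Definition linked (S : R) (x y : R * R) : Prop :=
  exists sp, path_in D sp x y /\ forall s, nrm (sp s - y) <= S.

Lemma it_invariant t z : D z -> D (it t z).
Proof.
case: t => n; first by elim: n => [//|n IH] /IH; exact: DF.
rewrite /iterz; elim: n.+1 => [//|n' IH] /IH h /=.
by apply: DFi; rewrite FiK.
Qed.

Lemma it_outside t P : ~ D P -> ~ D (it t P).
Proof.
move=> nP /(it_invariant (- t)); rewrite -(iterzD FK FiK) addNr; exact: nP.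
Qed.

(** The counterpart of [no_crossing] for ends that jump inside [D], the constant path at [b] being
    one of them. By [homotopic_rows_jump] the arc may be chosen anew at every time, and the margin
    [K] exceeds the size of the jumps. *)
Lemma jump_no_crossing b (q : int -> R * R) P (ta tb : int) S K g0 h0 :
  ta < tb -> ~ D P -> D b -> (forall t, D (q t)) ->
  linked S (F b) b -> (forall t, linked S (F (q t)) (q (t + 1))) ->
  (1 + `|ka|) * C + C <= K -> CM * S <= K ->
  (forall t, ta <= t <= tb -> K < `|(mx M (b - it t P)).2| \/ (mx M (b - it t P)).1 < - K) ->
  (forall t, ta <= t <= tb -> K < `|(mx M (q t - it t P)).2| \/ K < (mx M (q t - it t P)).1) ->
  path_in D g0 b (q ta) -> (forall s, 0 < (mx M (g0 s - it ta P)).2) ->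
  path_in D h0 b (q tb) -> (forall s, (mx M (h0 s - it tb P)).2 < 0) -> False.
Proof.
move=> tab nP Db Dq [sp [psp spS]] lq K1 K2 Hb Hq pg g2 ph h2.
have C0 : 0 <= C by have [] := quasi 0 0; move=> h _; apply: le_trans (normr_ge0 _) h.
have kaC : 0 <= `|ka| * C by rewrite mulr_ge0.
have kC : C <= K by lra. have kC' : (1 + `|ka|) * C <= K by lra.
have CM0 : 0 <= CM.
  have [h _] := mx_bound (1, 0).
  have n1 : nrm ((1, 0) : R * R) = 1 by rewrite /nrm /dot /= mulr0 addr0 mulr1 sqrtr1.
  by rewrite n1 mulr1 in h; apply: le_trans h.
have pert x y t : nrm (x - y) <= S -> (mx M (x - it t P)) =
    (mx M (y - it t P)) + mx M (x - y) /\ `|(mx M (x - y)).1| <= K /\ `|(mx M (x - y)).2| <= K.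
  move=> xy; have [e1 e2] := mx_bound (x - y); have e3 : CM * nrm (x - y) <= K.
    by apply: le_trans K2; apply: ler_wpM2l.
  split; last by split; lra.
  by rewrite !mxE; apply: veq; rewrite !pairE /=; ring.
have sl t : ta <= t <= tb -> safe_left C ka (mx M (b - it t P)).
  by move=> /Hb[h|h]; [left|right]; lra.
have sr t : ta <= t <= tb -> safe_right C ka (mx M (q t - it t P)).
  by move=> /Hq[h|h]; [left|right]; lra.
have chain (n : nat) : ta + n.+1%:Z <= tb -> forall h, path_in D h b (q (ta + n.+1%:Z)) ->
    homotopic_rows (fun s => mx M (g0 s - it ta P)) (fun s => mx M (h s - it (ta + n.+1%:Z) P)).
  have step (t : int) g h : ta <= t -> t + 1 <= tb -> path_in D g b (q t) -> path_in D h b (q (t + 1)) ->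
      homotopic_rows (fun s => mx M (g s - it t P)) (fun s => mx M (h s - it (t + 1) P)).
    move=> t1 t2 gp hp; have [sq [psq sqS]] := lq t.
    have tt : ta <= t <= tb by rewrite t1 (le_trans _ t2)// lerDl.
    have tt' : ta <= t + 1 <= tb by rewrite t2 (le_trans t1)// lerDl.
    rewrite (iterzS FiK).
    apply: (homotopic_rows_jump contF FK dM quasi hD DF (@it_outside t P nP) _ gp hp psp psq (sl _ tt) (sr _ tt)).
    - by rewrite -(iterzS FiK); exact: it_outside.
    - move=> s; have [e [e1 e2]] := pert _ _ (t + 1) (spS s); rewrite -(iterzS FiK) e.
      rewrite !ler_norml in e1 e2; move: e1 e2 => /andP[e1 e1'] /andP[e2 e2'].
      have [h3|h3] := Hb _ tt'; [left|right]; rewrite pairE; last by lra.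
      by apply/eqP => h4; move: h3; rewrite ltNge ler_norml => /negP; apply; apply/andP; lra.
    - move=> s; have [e [e1 e2]] := pert _ _ (t + 1) (sqS s); rewrite -(iterzS FiK) e.
      rewrite !ler_norml in e1 e2; move: e1 e2 => /andP[e1 e1'] /andP[e2 e2'].
      have [h3|h3] := Hq _ tt'; [left|right]; rewrite pairE; last by lra.
      by apply/eqP => h4; move: h3; rewrite ltNge ler_norml => /negP; apply; apply/andP; lra.
  elim: n => [|n IH] nb h hp; first by apply: step.
  have e : ta + n.+2%:Z = ta + n.+1%:Z + 1 by rewrite -addrA -PoszD addn1.
  rewrite e in nb hp *.
  have nb' : ta + n.+1%:Z <= tb by apply: le_trans nb; rewrite lerDl.
  have [g gp] := cD Db (Dq (ta + n.+1%:Z)).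
  apply: (homotopic_rows_trans (IH nb' g gp)); apply: step => //; by rewrite lerDl.
have [n nE] : exists n, tb = ta + n.+1%:Z.
  exists `|(tb - ta)%R|.-1; rewrite prednK ?absz_gt0 ?subr_eq0 ?gt_eqF//.
  by rewrite gez0_abs ?subr_ge0 ?ltW// addrC subrK.
have := chain n; rewrite -nE => /(_ (lexx _) h0 ph) H.
apply: (one_sided_contra H).
- by constructor 1 => s; exact: g2.
- by constructor 2 => s; exact: h2.
- exact: g2.
- exact: ltW.
Qed.

Variable U : set_system nat.
Hypothesis ultraU : UltraFilter U.
Hypothesis freeU : forall n, U [set j | (n <= j)%N].
Variables L mu : nat -> R.
Hypothesis L_infty : forall m : R, U [set j | m <= L j].
Hypothesis L_mu : U [set j | L j <= mu j].
Let usub A B := @U_sub U ultraU A B.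
Let uand (A B : set nat) : U A -> U B -> U (A `&` B).
Proof. exact: filterI. Qed.
Let L0 : U [set j | 0 < L j] := L_gt0 ultraU L_infty.
Let tcvg := time_cvg ultraU L_infty.

Variables (a : R * R -> R * R) (b : R * R) (N : nat -> nat).
Hypothesis Db : D b.

(** The orbit has gone past [z] after a time proportional to the distance of [z], on opposite sides
    for positive and negative times; [N j] is the length of the window in which it is known to be
    steady. *)
Definition passes_far (P : nat -> R * R) (tau : R) : Prop := forall K,
  U [set j | forall (t : int) z, (`|t| <= N j)%N ->
    tau * (L j + nrm (a z - a b)) <= `|t%:~R| ->
    (0 < t -> (mx M (z - it t (P j))).2 < - K) /\
    (t < 0 -> K < (mx M (z - it t (P j))).2)].

(** Since [q] returns at the times [N j] and [- N j], the same arc from [b] serves at both ends, and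
    by [passes_far] the separating orbit has swept over all of it. Times of order [L] are controlled
    by the limit paths, the others by [passes_far]. *)
Lemma returning_crossing (q : nat -> int -> R * R) P fp fq S tau :
  plimit U L mu (fun j t => mx M (b - it t (P j))) fp ->
  plimit U L mu (fun j t => mx M (q j t - it t (P j))) fq ->
  (forall u, (fp u).2 = 0 -> (fp u).1 < 0) -> (forall u, (fq u).2 = 0 -> 0 < (fq u).1) ->
  0 < tau -> passes_far P tau -> (forall j, ~ D (P j)) ->
  (forall j t, nrm (a (q j t) - a b) <= L j) -> (forall j t, D (q j t)) ->
  linked S (F b) b -> (forall j t, linked S (F (q j t)) (q j (t + 1))) ->
  (forall j, q j (N j)%:Z = q j 0 /\ q j (- (N j)%:Z) = q j 0) ->
  (forall j, exists g, path_in D g b (q j 0) /\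
     forall s, j%:R * (L j + nrm (a (g s) - a b)) <= (N j)%:R) -> False.
Proof.
move=> pf qf Hp Hq tau0 far nP qL Dq lb lq qN arcs.
pose K := Num.max ((1 + `|ka|) * C + C) (CM * S).
have K1 : (1 + `|ka|) * C + C <= K by rewrite le_max lexx.
have K2 : CM * S <= K by rewrite le_max lexx orbT.
(* Points within [L] of [b] have been passed after time [2 tau L]; the additional 1 absorbs the
   rounding of times. *)
pose T := 2 * tau + 1.
have w1 := safe_window_left ultraU L_infty L_mu K pf (tcvg (- T)) (tcvg T) (fun u _ => Hp u).
have w2 := safe_window_right ultraU L_infty L_mu K qf (tcvg (- T)) (tcvg T) (fun u _ => Hq u).
have [j] := U_ex ultraU (uand (uand (uand w1 w2) (uand (far `|K|) (L_infty 1)))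
  (freeU (Num.truncn tau).+1)).
move=> [[[/= v1 v2] [fr l1]] jt].
have l0 : 0 < L j by lra.
have tj : tau <= j%:R by apply: le_trans (ltW (truncnS_gt _)) _; rewrite ler_nat.
have [g [gp gN]] := arcs j; have [qN1 qN2] := qN j.
have N1 : 1 <= (N j)%:R :> R.
  apply: le_trans (gN 0); have j1 : 1 <= j%:R :> R by rewrite ler1n (leq_trans _ jt).
  have := nrm_ge0 (a (g 0) - a b); nra.
have N0 : (0 < N j)%N by rewrite -(ltr_nat R); lra.
have K0 : K <= `|K| by exact: ler_norm.
have win (t : int) : `|t%:~R| < 2 * tau * L j -> time L (- T) j <= t <= time L T j.
  rewrite ltr_norml => /andP[h1 h2].
  have /andP[f1 f2] := floor_itv (- T * L j); have /andP[f3 f4] := floor_itv (T * L j).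
  rewrite intrD in f4; rewrite /time; apply/andP; split.
    by rewrite -(ler_int R); apply: le_trans f1 _; rewrite /T; lra.
  by rewrite -ltzD1 -(ltr_int R) intrD; apply: le_lt_trans f4; rewrite /T; lra.
have out (t : int) z : - (N j)%:Z <= t <= (N j)%:Z -> nrm (a z - a b) <= L j ->
    2 * tau * L j <= `|t%:~R| -> K < `|(mx M (z - it t (P j))).2|.
  move=> tN zb ht.
  have tN' : (`|t| <= N j)%N by rewrite -lez_nat abszE ler_norml.
  have far_t : tau * (L j + nrm (a z - a b)) <= `|t%:~R|.
    by apply: le_trans ht; rewrite -mulrA mulrCA ler_wpM2l ?(ltW tau0)//; lra.
  have [h1 h2] := fr t z tN' far_t.
  have [t0|t0|t0] := ltgtP t 0.
  - by apply: le_lt_trans K0 _; apply: lt_le_trans (h2 t0) (ler_norm _).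
  - by have := h1 t0; have := ler_norm (- (mx M (z - it t (P j))).2); rewrite normrN; lra.
  - move: ht; rewrite t0 normr0 leNgt => /negP; case.
    by rewrite !mulr_gt0.
have bb : nrm (a b - a b) <= L j by rewrite subrr nrm0 ltW.
have Nab : `|(N j)%:Z%:~R| = (N j)%:R :> R by rewrite ger0_norm.
have Nab' : `|(- (N j)%:Z)%:~R| = (N j)%:R :> R by rewrite intrN normrN ger0_norm.
have arc_far s : tau * (L j + nrm (a (g s) - a b)) <= (N j)%:R.
  apply: le_trans (gN s); apply: ler_wpM2r => //; rewrite addr_ge0 ?nrm_ge0//; exact: ltW.
apply: (@jump_no_crossing b (q j) (P j) (- (N j)%:Z) (N j)%:Z S K g g _ (nP j) Db (Dq j) lb (lq j) K1 K2).
- by apply: (@lt_trans _ _ 0); rewrite ?oppr_lt0 ltz_nat.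
- move=> t tN; have [h|h] := ltP `|t%:~R| (2 * tau * L j); first exact: v1 (win t h).
  by left; apply: out.
- move=> t tN; have [h|h] := ltP `|t%:~R| (2 * tau * L j); first exact: v2 (win t h).
  by left; apply: out.
- by rewrite qN2.
- move=> s; have tN : (`|(- (N j)%:Z)%R| <= N j)%N by rewrite abszN absz_nat.
  have tf : tau * (L j + nrm (a (g s) - a b)) <= `|(- (N j)%:Z)%:~R| by rewrite Nab'.
  have [_ h] := fr _ _ tN tf.
  by apply: le_lt_trans (h _); rewrite ?oppr_lt0 ?ltz_nat.
- by rewrite qN1.
- move=> s; have tN : (`|(N j)%:Z| <= N j)%N by rewrite absz_nat.
  have tf : tau * (L j + nrm (a (g s) - a b)) <= `|(N j)%:Z%:~R| by rewrite Nab.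
  have [h _] := fr _ _ tN tf.
  by apply: lt_le_trans (h _) _; rewrite ?ltz_nat// oppr_le0.
Qed.

(** As [dot be v] is positive, the orbit advances linearly in the direction [be], while its error
    and the position of [z] retard it by small fractions. *)
Lemma class_passes_far (be v : R * R) (P : nat -> R * R) (C0 : R) :
  (forall z w, (mx M (z - w)).2 = dot be (a z - a w)) -> 0 < dot be v ->
  (forall eps, 0 < eps -> U [set j | forall t : int, (`|t| <= N j)%N ->
     nrm (a (it t (P j)) - a (P j) - t%:~R *: v) <= eps * `|t|%N%:R + eps * L j]) ->
  U [set j | nrm (a (P j) - a b) <= C0 * L j] ->
  exists2 tau, 0 < tau & passes_far P tau.
Proof.
move=> M2 sg0 steadyP nearP; set sg := dot be v in sg0.
have nb := nrm_ge0 be; have nb1 : 0 < nrm be + 1 by rewrite ltr_wpDl.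
(* The linear error takes at most a quarter of the advance [sg |t|]; [tau] is fixed so that
   distances take another quarter, and the remaining half exceeds [K]. *)
pose eps := sg / (4 * (nrm be + 1)); have eps0 : 0 < eps by rewrite divr_gt0// mulr_gt0.
have nbe : nrm be * eps <= sg / 4.
  have -> : sg / 4 = (nrm be + 1) * eps by rewrite /eps; field; rewrite lt0r_neq0.
  by rewrite mulrDl mul1r lerDl ltW.
pose c0 := eps + `|C0| + 1; have c00 : 0 < c0 by rewrite ltr_wpDl// addr_ge0// ltW.
pose tau := 4 * nrm be * c0 / sg + 1.
have tau0 : 0 < tau by rewrite ltr_wpDl// divr_ge0 ?(ltW sg0)// !mulr_ge0// ltW.
exists tau => // K.
apply: (usub (uand (uand (steadyP _ eps0) nearP) (uand L0 (L_infty ((`|K| + 1) * 2 / sg))))) => j /=.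
move=> [[h1 h2] [l0 h3]] t z tN ht.
have e1 := h1 t tN; rewrite natr_absz intr_norm in e1.
set X := nrm (a z - a b) in ht; have X0 : 0 <= X := nrm_ge0 _.
set E := a (it t (P j)) - a (P j) - t%:~R *: v in e1.
have phi : (mx M (z - it t (P j))).2 = - t%:~R * sg - dot be E - dot be (a (P j) - a b) + dot be (a z - a b).
  rewrite M2 /E /sg /dot !pairE; ring.
have b1 : `|dot be E| <= nrm be * (eps * `|t%:~R| + eps * L j).
  by apply: le_trans (dot_abs_le _ _) _; exact: ler_wpM2l.
have b2 : `|dot be (a (P j) - a b)| <= nrm be * (`|C0| * L j).
  apply: le_trans (dot_abs_le _ _) _; apply: ler_wpM2l => //; apply: le_trans h2 _.
  by apply: ler_wpM2r; [exact: ltW|exact: ler_norm].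
have b3 : `|dot be (a z - a b)| <= nrm be * X by exact: dot_abs_le.
have LX : 0 <= L j + X by rewrite addr_ge0// ltW.
have big : nrm be * c0 * (L j + X) <= sg / 4 * `|t%:~R|.
  have : 4 * nrm be * c0 / sg * (L j + X) <= `|t%:~R|.
    by apply: le_trans ht; rewrite ler_wpM2r// lerDl.
  have -> : 4 * nrm be * c0 / sg * (L j + X) = nrm be * c0 * (L j + X) * 4 / sg by ring.
  by rewrite ler_pdivrMr//; lra.
have n1 : nrm be * (eps * `|t%:~R|) <= sg / 4 * `|t%:~R| by rewrite mulrA ler_wpM2r.
have n2 : nrm be * (eps * L j) + nrm be * (`|C0| * L j) + nrm be * X <= nrm be * c0 * (L j + X).
  have -> : nrm be * (eps * L j) + nrm be * (`|C0| * L j) + nrm be * X =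
    nrm be * ((eps + `|C0|) * L j + X) by ring.
  rewrite -[leRHS]mulrA; apply: ler_wpM2l => //; rewrite /c0.
  have q0 : 0 <= eps + `|C0| by rewrite addr_ge0// ltW.
  have : 0 <= (eps + `|C0|) * X by rewrite mulr_ge0.
  by lra.
have tL : L j <= `|t%:~R|.
  have tau1 : 1 <= tau by rewrite /tau lerDr divr_ge0 ?(ltW sg0)// !mulr_ge0// ltW.
  have : 1 * (L j + X) <= tau * (L j + X) by exact: ler_wpM2r.
  by rewrite mul1r; lra.
have KL : `|K| + 1 <= sg / 2 * `|t%:~R|.
  have : `|K| + 1 <= sg / 2 * L j.
    by move: h3; rewrite ler_pdivrMr//; lra.
  move=> h; apply: le_trans h _; apply: ler_wpM2l => //; rewrite divr_ge0// ltW//.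
have KK := ler_norm K; rewrite !ler_norml in b1 b2 b3.
move: b1 b2 b3 => /andP[b1 b1'] /andP[b2 b2'] /andP[b3 b3'].
rewrite phi; split => t0.
  have tt : `|t%:~R| = t%:~R :> R by rewrite ger0_norm// ler0z ltW.
  rewrite tt in KL n1 b1 b1' big; lra.
have tt : `|t%:~R| = - t%:~R :> R by rewrite ler0_norm// lerz0 ltW.
rewrite tt in KL n1 b1 b1' big; lra.
Qed.

Lemma steady_limit (v : R * R) (P : nat -> R * R) :
  (forall eps, 0 < eps -> U [set j | forall t : int, (`|t| <= N j)%N ->
     nrm (a (it t (P j)) - a (P j) - t%:~R *: v) <= eps * `|t|%N%:R + eps * L j]) ->
  (forall K : R, U [set j | K * L j <= (N j)%:R]) ->
  path_limit U L (fun j t => (a (it t (P j)) - a (P j)).1) L (fun t => t * v.1) /\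
  path_limit U L (fun j t => (a (it t (P j)) - a (P j)).2) L (fun t => t * v.2).
Proof.
move=> steadyP NL.
have key tau (t : nat -> int) : ucvg U (fun j => (t j)%:~R / L j) tau -> forall e, 0 < e ->
    U [set j | nrm (a (it (t j) (P j)) - a (P j) - (t j)%:~R *: v) < e * L j].
  move=> tt e e0; have t2 : 0 < `|tau| + 2 by rewrite ltr_wpDl.
  pose eps := e / (2 * (`|tau| + 2)); have eps0 : 0 < eps by rewrite divr_gt0// mulr_gt0.
  have epsE : eps * (`|tau| + 2) = e / 2 by rewrite /eps; field; rewrite lt0r_neq0.
  apply: (usub (uand (uand (steadyP _ eps0) (NL (`|tau| + 1))) (uand L0 (tt _ ltr01)))) => j /= [[h1 h2] [l0 h3]].
  have tL : `|(t j)%:~R| <= (`|tau| + 1) * L j.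
    rewrite -ler_pdivrMr// -[X in _ / X](gtr0_norm l0) -normfV -normrM.
    by rewrite -[_ / _](subrK tau); apply: le_trans (ler_normD _ _) _; rewrite addrC lerD2l ltW.
  have tN : (`|t j| <= N j)%N by rewrite -(ler_nat R) natr_absz intr_norm (le_trans tL).
  have := h1 _ tN; rewrite natr_absz intr_norm => h; apply: le_lt_trans h _.
  have : eps * `|(t j)%:~R| <= eps * ((`|tau| + 1) * L j) by rewrite ler_pM2l.
  have : eps * (`|tau| + 2) * L j = e / 2 * L j by rewrite epsE.
  have : 0 < e * L j by rewrite mulr_gt0.
  lra.
split=> tau t tt; have k := key _ _ tt.
  have base : ucvg U (fun j => v.1 * ((t j)%:~R / L j)) (tau * v.1) by rewrite mulrC; apply: ucvgZ.
  apply: (ucvg_close ultraU base) => e e0.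
  apply: (usub (uand (k _ e0) L0)) => j /= [h l0]; rewrite subr0.
  have h' := le_lt_trans (nrm_fst _) h; rewrite !pairE in h'.
  have -> : (a (it (t j) (P j)) - a (P j)).1 / L j - v.1 * ((t j)%:~R / L j) =
    ((a (it (t j) (P j))).1 - (a (P j)).1 - (t j)%:~R * v.1) / L j by rewrite /=; ring.
  by rewrite normrM normfV (gtr0_norm l0) ltr_pdivrMr.
have base : ucvg U (fun j => v.2 * ((t j)%:~R / L j)) (tau * v.2) by rewrite mulrC; apply: ucvgZ.
apply: (ucvg_close ultraU base) => e e0.
apply: (usub (uand (k _ e0) L0)) => j /= [h l0]; rewrite subr0.
have h' := le_lt_trans (nrm_snd _) h; rewrite !pairE in h'.
have -> : (a (it (t j) (P j)) - a (P j)).2 / L j - v.2 * ((t j)%:~R / L j) =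
  ((a (it (t j) (P j))).2 - (a (P j)).2 - (t j)%:~R * v.2) / L j by rewrite /=; ring.
by rewrite normrM normfV (gtr0_norm l0) ltr_pdivrMr.
Qed.

End jumps.

(** * Periodic pseudo-orbits from recurrence *)

Section returning.
Context {R : realType}.
Variables (F Fi : R * R -> R * R) (C1 : R).
Hypotheses (contF : continuous F) (contFi : continuous Fi).
Hypotheses (FK : cancel F Fi) (FiK : cancel Fi F).
Local Notation it := (iterz F Fi).

Variable D : set (R * R).
Hypotheses (oD : open D) (cD : pathconn D) (hD : paths_homotopic D).
Hypotheses (DF : forall z, D z -> D (F z)) (DFi : forall z, D (F z) -> D z).
Hypothesis D_disjoint : forall z m : R * R, m.1 \is a Num.int -> m.2 \is a Num.int ->
  D z -> D (z + m) -> m = 0.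
Hypothesis D_returns : forall V : set (R * R), open V -> V !=set0 -> V `<=` D ->
  forall n : nat, exists T z, [/\ (n <= T)%N, V z & V (iter T F z)].

Lemma argmax_nat (f : nat -> R) T : (0 < T)%N ->
  exists2 r, (r < T)%N & forall i, (i < T)%N -> f i <= f r.
Proof.
case: T => // T _; elim: T => [|T [r rT Hr]].
  by exists 0%N => // i; rewrite ltnS leqn0 => /eqP ->.
have [h|h] := leP (f r) (f T.+1).
  exists T.+1 => // i; rewrite ltnS leq_eqVlt => /predU1P[->//|iT].
  by apply: le_trans h; exact: Hr.
exists r => [|i]; first exact: ltnW.
by rewrite ltnS leq_eqVlt => /predU1P[->|iT]; [exact: ltW|exact: Hr].
Qed.

Lemma clamp_path (x y b : R * R) : D x -> D y -> exists g, path_in D g x y /\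
  exists r : R, forall s, nrm (g s - b) <= r.
Proof.
move=> Dx Dy; have [g [cg Dg g0 g1]] := cD Dx Dy.
exists (fun s => g (clamp s)); split.
  split; first exact: (cont_comp clamp_cont cg).
  - by move=> s; exact: Dg.
  - by rewrite clamp_id ?lexx ?ler01.
  - by rewrite clamp_id ?lexx ?ler01.
pose f s : R := `|(g s - b).1| + `|(g s - b).2|.
have cf : continuous f.
  have cgb : continuous (fun s => g s - b) by apply: cont_vsub => //; exact: cont_cst.
  have cn : continuous (fun x : R => `|x|) by exact: norm_continuous.
  by apply: cont_add; [exact: (cont_comp (cont_fst cgb) cn)|exact: (cont_comp (cont_snd cgb) cn)].
have [c c01 Hc] := @EVT_max R f 0 1 ler01 (continuous_subspaceT cf).
exists (f c) => s; apply: le_trans (nrm_le_sum _) _; apply: Hc.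
by rewrite in_itv /=; exact: clamp01.
Qed.

Lemma link_bounded x y : D x -> D y -> exists S : R, linked D S x y.
Proof.
move=> Dx Dy; have [g [gp [r Hr]]] := clamp_path y Dx Dy; exists r, g; split=> //.
Qed.

Lemma linked_le (S S' : R) x y : S <= S' -> linked D S x y -> linked D S' x y.
Proof. by move=> SS [g [gp Hg]]; exists g; split=> // s; exact: le_trans SS. Qed.

Lemma linked_dist (S : R) x y : linked D S x y -> nrm (x - y) <= S.
Proof. by move=> [g [[_ _ <- _] Hg]]; exact: Hg. Qed.

(** Recurrence is applied to a small ball inside [D]; the ball being convex, a segment closes up the
    orbit. *)
Lemma close_return q (n : nat) : D q -> exists z T, [/\ (n <= T)%N, D z,
  nrm (z - q) <= 1 & linked D 1 (iter T F z) z].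
Proof.
move=> Dq; have /nbhs_ballP[r /= r0 rD] : nbhs q D by exact: open_nbhs_nbhs.
pose e := Num.min r (1 / 4); have e0 : 0 < e by rewrite lt_min r0 divr_gt0.
have e4 : e <= 1 / 4 by rewrite ge_min lexx orbT.
have bD : ball q e `<=` D.
  by move=> x; move/(le_ball (_ : e <= r)) => h; apply: rD; apply: h; rewrite ge_min lexx.
have ob : open (ball q e) by apply: ball_open.
have bq : ball q e q by exact: ballxx.
have [T [z [nT Vz VT]]] := D_returns ob (ex_intro _ q bq) bD n.
have bE x : ball q e x <-> `|q.1 - x.1| < e /\ `|q.2 - x.2| < e by split=> [[]|].
have [z1 z2] := (bE z).1 Vz; have [w1 w2] := (bE _).1 VT; set w := iter T F z in VT w1 w2 *.
have near x y : ball q e x -> ball q e y -> nrm (x - y) <= 1.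
  move=> /bE[a1 a2] /bE[b1 b2]; apply: le_trans (nrm_le_sum _) _; rewrite !pairE.
  rewrite !ltr_norml in a1 a2 b1 b2.
  move: a1 a2 b1 b2 => /andP[? ?] /andP[? ?] /andP[? ?] /andP[? ?].
  have : `|x.1 - y.1| <= 2^-1 by rewrite ler_norml; apply/andP; lra.
  have : `|x.2 - y.2| <= 2^-1 by rewrite ler_norml; apply/andP; lra.
  lra.
exists z, T; split=> //; first exact: bD.
  by apply: near => //; exact: ballxx.
pose g s := w + clamp s *: (z - w).
have gb s : ball q e (g s).
  apply/bE; have /andP[c0 c1] := clamp01 s; rewrite /g; set c := clamp s in c0 c1 *.
  have lin (x y u : R) : `|u - x| < e -> `|u - y| < e -> `|u - (x + c * (y - x))| < e.
    move=> h1 h2; have -> : u - (x + c * (y - x)) = (1 - c) * (u - x) + c * (u - y) by ring.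
    apply: le_lt_trans (ler_normD _ _) _; rewrite !normrM (ger0_norm c0) ger0_norm ?subr_ge0//.
    have : (1 - c) * `|u - x| <= (1 - c) * e by apply: ler_wpM2l; rewrite ?subr_ge0// ltW.
    have [->|cn] := eqVneq c 0; first by rewrite mul0r addr0 subr0 !mul1r.
    have : c * `|u - y| < c * e by rewrite ltr_pM2l// lt_neqAle eq_sym cn.
    lra.
  by rewrite !pairE; split; apply: lin.
exists g; split; last by move=> s; apply: near.
split.
- apply: cont_vadd; first exact: cont_cst.
  by apply: cont_vscale; [exact: clamp_cont|exact: cont_cst].
- by move=> s; exact: bD.
- by rewrite /g clamp_id ?lexx ?ler01// scale0r addr0.
- by rewrite /g clamp_id ?lexx ?ler01// scale1r addrC subrK.
Qed.

Variables (a : R * R -> R * R) (gg : R * R -> R) (b : R * R).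
Hypothesis Db : D b.
Hypothesis a_short : forall z w, nrm (a z - a w) <= nrm (z - w).
Hypothesis gg_big : forall x : R, exists K : R, forall z, K < nrm z -> x < gg z.
Hypothesis D_unbounded : forall K : R, exists2 z, D z & K < nrm (z - b).

Lemma iter_in (n : nat) z : D z -> D (iter n F z).
Proof. by elim: n => [//|n IH] /IH; exact: DF. Qed.

(** The origin of time is put at the farthest point of each cycle, so that after rescaling by its
    gauge [L j] the cycle stays in the unit ball and is on its boundary at time 0. The times [N j]
    are multiples of the period, as large as the arc from [b] requires. *)
Lemma returning_sequences : exists (z : nat -> R * R) (T : nat -> nat) (r : nat -> nat)
    (q : nat -> int -> R * R) (L : nat -> R) (N : nat -> nat) (S : R),
  [/\ forall j, (j < T j)%N /\ nrm (iter (T j) F (z j) - z j) <= 1,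
      forall j t, q j t = cyc F (z j) (T j) (t + (r j)%:Z),
      forall j, [/\ j%:R <= L j, forall t, D (q j t), forall t, gg (q j t - b) <= L j & gg (q j 0 - b) = L j],
      linked D S (F b) b /\ forall j t, linked D S (F (q j t)) (q j (t + 1)) &
      forall j, [/\ q j (N j)%:Z = q j 0, q j (- (N j)%:Z) = q j 0 &
        exists g, path_in D g b (q j 0) /\
          forall s, j%:R * (L j + nrm (a (g s) - a b)) <= (N j)%:R]].
Proof.
have /choice[zT HzT] : forall j : nat, exists zT : (R * R) * nat, [/\ (j.+1 <= zT.2)%N, D zT.1,
    j%:R < gg (zT.1 - b) & linked D 1 (iter zT.2 F zT.1) zT.1].
  move=> j; have [K HK] := gg_big j%:R; have [q0 Dq far] := D_unbounded (K + 1).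
  have [z [T [jT Dz zq lz]]] := close_return j.+1 Dq; exists (z, T); split=> //=.
  apply: HK; have := nrm_tri q0 z b; rewrite nrmC in zq; lra.
pose z j := (zT j).1; pose T j := (zT j).2.
have T0 j : (0 < T j)%N by have [h _ _ _] := HzT j; exact: leq_trans h.
have /choice[r Hr] : forall j, exists r, (r < T j)%N /\
    forall i, (i < T j)%N -> gg (iter i F (z j) - b) <= gg (iter r F (z j) - b).
  by move=> j; have [r r1 r2] := @argmax_nat (fun i => gg (iter i F (z j) - b)) (T j) (T0 j); exists r.
pose q j t := cyc F (z j) (T j) (t + (r j)%:Z).
pose L j := gg (iter (r j) F (z j) - b).
have q0 j : q j 0 = iter (r j) F (z j).
  by rewrite /q add0r -[X in cyc _ _ _ X]add0r cycD// mod0z absz0 add0n modn_small//; case: (Hr j).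
have Dz j : D (z j) by have [_ ? _ _] := HzT j.
have Dq j t : D (q j t) by exact: iter_in.
have [S HS] := link_bounded (DF Db) Db.
pose S' := Num.max S 1.
have /choice[gR HgR] : forall j, exists gR : (R -> R * R) * R, path_in D gR.1 b (q j 0) /\
    forall s, nrm (gR.1 s - b) <= gR.2.
  by move=> j; have [g [gp [rr Hrr]]] := clamp_path b Db (Dq j 0); exists (g, rr).
pose m j := (Num.truncn (j%:R * (L j + (gR j).2))).+1.
exists z, T, r, q, L, (fun j => (m j * T j)%N), S'; split=> //.
- by move=> j; have [h1 _ _ /linked_dist h2] := HzT j.
- move=> j; split=> [||t|].
  + have [_ _ h _] := HzT j; apply: le_trans (ltW h) _.
    by have [_ h2] := Hr j; exact: (h2 0%N (T0 j)).
  + exact: Dq.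
  + have [_ h2] := Hr j; rewrite /q /cyc; apply: h2; exact: cyc_res_lt.
  + by rewrite q0.
- split; first by apply: linked_le HS; rewrite le_max lexx.
  move=> j t; rewrite /q addrAC; have [->|[-> ->]] := cyc_step F (z j) (t + (r j)%:Z) (T0 j).
    exists (fun=> F (cyc F (z j) (T j) (t + (r j)%:Z))); split.
      by split=> //; [exact: cont_cst|move=> s; apply: DF; exact: Dq].
    by move=> s; rewrite subrr nrm0 le_max ler01 orbT.
  have [_ _ _ h] := HzT j; apply: linked_le h; by rewrite le_max lexx orbT.
- move=> j; split.
  + by rewrite /q add0r addrC cycT.
  + rewrite /q add0r -(cycT F (z j) (T j) (- (m j * T j)%:Z + (r j)%:Z) (m j)).
    by rewrite addrAC addNr add0r.
  + exists (gR j).1; have [gp Hg] := HgR j; split=> // s.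
    have mj : j%:R * (L j + (gR j).2) <= (m j)%:R by apply: ltW; exact: truncnS_gt.
    have mT : (m j)%:R <= (m j * T j)%N%:R :> R by rewrite ler_nat leq_pmulr.
    apply: le_trans (le_trans mj mT); apply: ler_wpM2l => //; rewrite lerD2l.
    by apply: le_trans (a_short _ _) _; exact: Hg.
Qed.

End returning.

Section rates.
Context {R : realType}.
Variables (F : R * R -> R * R) (a : R * R -> R * R) (C1 : R).
Hypothesis step_bound : forall z, nrm (a (F z) - a z) <= C1.
Hypothesis a_short : forall z w, nrm (a z - a w) <= nrm (z - w).

Lemma rate_ge0 c : 0 <= rate F a c.
Proof.
apply: lb_le_inf; first exact: (rate_has_inf step_bound c).1.
by move=> rho /grows_ge0.
Qed.

Variable U : set_system nat.
Hypothesis ultraU : UltraFilter U.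
Hypothesis freeU : forall n, U [set j | (n <= j)%N].
Variables (z : nat -> R * R) (T r : nat -> nat) (q : nat -> int -> R * R).
Hypothesis zT : forall j, (j < T j)%N /\ nrm (iter (T j) F (z j) - z j) <= 1.
Hypothesis qE : forall j t, q j t = cyc F (z j) (T j) (t + (r j)%:Z).

Let long (eta K : R) : 0 < eta -> forall j, ((Num.truncn (K / eta)).+1 <= j)%N -> K <= eta * (T j)%:R.
Proof.
move=> eta0 j jK; rewrite mulrC -ler_pdivrMr//; apply: le_trans (ltW (truncnS_gt _)) _.
by rewrite ler_nat (leq_trans jK)// ltnW//; case: (zT j).
Qed.

Lemma returning_pseudo_rate c : pseudo_rate U (fun j t => a (q j t)) c (rate F a c).
Proof.
move=> eta eta0; have e2 : 0 < eta / 2 by rewrite divr_gt0.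
have [K K0 HK] := rate_upper step_bound c e2.
exists (2 * K + 1); apply: (U_sub ultraU (freeU (Num.truncn ((K + 1) / (eta / 2))).+1)) => j /= jK s n.
have [Tj close] := zT j; rewrite !qE [s + n%:Z + _]addrAC.
have T0 : (0 < T j)%N by exact: leq_ltn_trans Tj.
have rho0 : 0 <= rate F a c + eta / 2 by rewrite addr_ge0 ?rate_ge0// ltW.
have close' := le_trans (a_short _ _) close.
have KT : K + 1 <= eta / 2 * (T j)%:R := @long (eta / 2) (K + 1) e2 j jK.
have h := cyc_rate T0 e2 rho0 HK close' KT (s + (r j)%:Z) n.
have e : rate F a c + eta / 2 + eta / 2 = rate F a c + eta by lra.
by rewrite e in h.
Qed.

(** Long returns with displacement at most 1 show that velocity 0 is attained, so 0 belongs to the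
    disc about every [c]. *)
Lemma returning_disc c : nrm c <= rate F a c.
Proof.
apply/ler_addgt0Pr => eta eta0; have e2 : 0 < eta / 2 by rewrite divr_gt0.
have [K K0 HK] := rate_upper step_bound c e2.
have lj := @long (eta / 2) (K + 1) e2 _ (leqnn _); move: lj; set j := (Num.truncn _).+1 => lj.
have [Tj close] := zT j.
have T0 : 0 < (T j)%:R :> R by rewrite ltr0n; exact: leq_ltn_trans Tj.
rewrite -(ler_pM2l T0).
have -> : (T j)%:R * nrm c = nrm ((T j)%:R *: c) by rewrite nrmZ ger0_norm// ltW.
have -> : (T j)%:R *: c = disp F a (T j) (z j) - (disp F a (T j) (z j) - (T j)%:R *: c) by rewrite subKr.
apply: le_trans (nrmB _ _) _; have h := HK (T j) (z j).
have : nrm (disp F a (T j) (z j)) <= 1 by exact: le_trans (a_short _ _) close.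
lra.
Qed.

End rates.

(** * Recurrent components are bounded: no twist *)

Section returning_id.
Context {R : realType}.
Variables (F Fi : R * R -> R * R) (C1 : R).
Hypotheses (contF : continuous F) (contFi : continuous Fi).
Hypotheses (FK : cancel F Fi) (FiK : cancel Fi F).
Hypothesis step_bound : forall z, nrm (id (F z) - id z) <= C1.
Hypothesis equivF : forall z m : R * R, m.1 \is a Num.int -> m.2 \is a Num.int -> F (z + m) = F z + m.
Local Notation it := (iterz F Fi).
Variable D : set (R * R).
Hypotheses (oD : open D) (cD : pathconn D) (hD : paths_homotopic D).
Hypotheses (DF : forall z, D z -> D (F z)) (DFi : forall z, D (F z) -> D z).
Hypothesis D_disjoint : forall z m : R * R, m.1 \is a Num.int -> m.2 \is a Num.int ->
  D z -> D (z + m) -> m = 0.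
Hypothesis D_returns : forall V : set (R * R), open V -> V !=set0 -> V `<=` D ->
  forall n : nat, exists T z, [/\ (n <= T)%N, V z & V (iter T F z)].
Variables (rho0 : R * R) (delta : R).
Hypotheses (delta0 : 0 < delta) (ball : rotation_ball F id rho0 delta).

Definition unit1 : R * R := (1, 0).

(** Of two points differing by a horizontal unit vector at most one lies in [D]. A horizontal
    correction is not altered by a shear, so the lemma also serves for twists. *)
Lemma avoid_D z : exists n : R * R, [/\ n.1 \is a Num.int, n.2 \is a Num.int, nrm n <= 1, n.2 = 0 & ~ D (z + n)].
Proof.
have [Dz|nD] := pselect (D z); last by exists 0; rewrite nrm0 addr0 ler01 !rpred0.
have n1 : nrm unit1 = 1 by rewrite /nrm /dot /= mulr0 addr0 mulr1 sqrtr1.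
exists unit1; rewrite n1 lexx rpred1 rpred0; split=> // Dz1.
have : unit1 = 0 by apply: (D_disjoint _ _ Dz Dz1); rewrite ?rpred1 ?rpred0.
by move=> /(congr1 fst)/eqP; rewrite oner_eq0.
Qed.

Lemma mx_plimit (U : set_system nat) (ultraU : UltraFilter U) (L : nat -> R) M A f :
  plimit U L L A f -> plimit U L L (fun j t => mx M (A j t)) (fun t => mx M (f t)).
Proof.
move=> [A1 A2]; split => tau t tt /=.
  have := ucvgD ultraU (ucvgZ ultraU M.1.1 (A1 _ _ tt)) (ucvgZ ultraU M.1.2 (A2 _ _ tt)).
  move=> h e e0; apply: (U_sub ultraU (h e e0)) => j /=; rewrite !mxE /=.
  by congr (`|_ - _| < _); ring.
have := ucvgD ultraU (ucvgZ ultraU M.2.1 (A1 _ _ tt)) (ucvgZ ultraU M.2.2 (A2 _ _ tt)).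
move=> h e e0; apply: (U_sub ultraU (h e e0)) => j /=; rewrite !mxE /=.
by congr (`|_ - _| < _); ring.
Qed.

Lemma returning_bounded_id b : D b -> exists l : R, forall z, D z -> nrm (z - b) <= l.
Proof.
move=> Db; apply: contrapT => no.
have unb (K : R) : exists2 z, D z & K < nrm (z - b).
  apply: contrapT => h; apply: no; exists K => z Dz.
  by rewrite leNgt; apply/negP => h'; apply: h; exists z.
have short (z w : R * R) : nrm (id z - id w) <= nrm (z - w) by [].
have big (x : R) : exists K : R, forall z, K < nrm z -> x < nrm z :> R by exists x.
have [z [T [r [q [L [N [S [zT qE qL [lb lq] qN]]]]]]]] := returning_sequences oD cD DF D_returns Db short big unb.
have [U [ultraU freeU]] := @free_ultrafilter.
have usub := @U_sub U ultraU.
have uand (A B : set nat) : U A -> U B -> U (A `&` B) by exact: filterI.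
have L_infty (x : R) : U [set j | x <= L j].
  apply: (usub _ _ (freeU (Num.truncn x).+1)) => j /= h; have [h1 _ _ _] := qL j.
  by apply: le_trans h1; apply: le_trans (ltW (truncnS_gt _)) _; rewrite ler_nat.
have L0 := L_gt0 ultraU L_infty; have tcvg := time_cvg ultraU L_infty.
have LL : U [set j | L j <= L j] by apply: (U_all ultraU) => j /=.
have L00 : U [set j | `|0 : R| * L j ^+ 2 <= 0 * L j].
  by apply: (U_all ultraU) => j /=; rewrite normr0 !mul0r.
have z0 : ucvg U (fun j => (0 : int)%:~R / L j) 0 by have := ucvg_cst_div ultraU 0 L_infty.
have [fq qf] : exists f, plimit U L L (fun j t => q j t - b) f.
  apply: (plimit_ex ultraU L_infty (k := 0) LL L00); exists (Num.max (S + C1) 1); split=> [j t|].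
    have h1 := linked_dist (lq j t); have h2 := step_bound (q j t); rewrite /= in h2.
    have h3 : nrm (q j (t + 1) - q j t) <= S + C1.
      have -> : q j (t + 1) - q j t = (F (q j t) - q j t) - (F (q j t) - q j (t + 1)).
        by apply: veq; rewrite !pairE; ring.
      by apply: le_trans (nrmB _ _) _; lra.
    rewrite mul0r subr0 !pairE.
    have e x y (m : R) : x - m - (y - m) = x - y by ring.
    rewrite !e !le_max; have := le_trans (nrm_fst _) h3; have := le_trans (nrm_snd _) h3.
    by rewrite !pairE => -> ->.
  apply: (usub _ _ L0) => j /= l0; have [_ _ _ h] := qL j.
  have LM : L j <= Num.max (S + C1) 1 * L j.
    by rewrite -{1}[L j]mul1r ler_wpM2r ?(ltW l0)// le_max lexx orbT.
  have h1 := nrm_fst (q j 0 - b); have h2 := nrm_snd (q j 0 - b); rewrite h in h1 h2.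
  by split; apply: le_trans LM.
have fq_rate c s t : s <= t -> nrm (fq t - fq s - (t - s) *: c) <= (t - s) * rate F id c.
  move=> st; apply: (plimit_rate ultraU L_infty _ qf st) => eta eta0.
  have [K HK] := returning_pseudo_rate step_bound short ultraU freeU zT qE c eta0.
  exists K; apply: (usub _ _ HK) => j h s' n; have := h s' n.
  have -> // : q j (s' + n%:Z) - b - (q j s' - b) = q j (s' + n%:Z) - q j s'.
  by rewrite opprB addrA subrK.
have disc c : nrm c <= rate F id c := returning_disc step_bound short zT c.
have fq1 : nrm (fq 0) = 1.
  rewrite [fq 0]surjective_pairing.
  apply: (ucvg_uniq ultraU (ucvg_nrm ultraU (qf.1 _ _ z0) (qf.2 _ _ z0))).
  move=> e e0; apply: (usub _ _ L0) => j /= l0; have [_ _ _ h] := qL j.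
  have -> : nrm (((q j 0).1 - b.1) / L j, ((q j 0).2 - b.2) / L j) = 1; last by rewrite subrr normr0.
  have -> : (((q j 0).1 - b.1) / L j, ((q j 0).2 - b.2) / L j) = (L j)^-1 *: (q j 0 - b).
    by apply: veq; rewrite !pairE /= mulrC.
  by rewrite nrmZ h normfV (gtr0_norm l0) mulVf// lt0r_neq0.
(* The base point [b] has the constant limit 0. Seen from the class of [v] it moves along the line
   of [v], so a far point off this line would be separated from it by a class orbit. *)
have claim c v : realized F Fi id v -> nrm (v - c) = rate F id c -> v - c != 0 -> v != 0 ->
    exists u, fq 0 = u *: v.
  move=> vr cv n0 v0; apply: contrapT => nu.
  pose be := v - c; pose sg := dot be v.
  have sg0 : 0 < sg.
    have := @dot_lt0 _ be (- v); rewrite dotNr oppr_lt0 oppr_eq0; apply=> //.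
    by rewrite /be addrA addNr sub0r nrmN cv disc.
  pose lam := dot be (fq 0); pose w := (lam / sg) *: v - fq 0.
  have w2 : dot be w = 0 by rewrite dotBr dotZr -/sg divfK ?lt0r_neq0// subrr.
  have w0 : w != 0.
    by apply/eqP => /eqP; rewrite subr_eq0 => /eqP e; apply: nu; exists (lam / sg).
  pose x := dot (- be.2, be.1) w.
  have x0 : x != 0 by apply: contra w0 => /eqP x0; apply/eqP; exact: (frame_inj n0 x0 w2).
  pose e := - Num.sg x.
  have e1 : `|e| = 1 by rewrite normrN normr_sg x0.
  have ex : e * x < 0 by rewrite mulNr -normrEsg oppr_lt0 normr_gt0.
  (* The midpoint between [fq 0] and the point of the line of [v] at the same level [lam]. *)
  pose P0 := 2^-1 *: ((lam / sg) *: v + fq 0).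
  have P02 : dot be P0 = lam by rewrite dotZr dotDr dotZr -/sg divfK ?lt0r_neq0// -/lam; field.
  have [y Hy] := steady_sequence ultraU L_infty freeU N vr.
  pose n j := integer_part (L j *: P0 + b - y j).
  have /choice[n' Hn'] := fun j => avoid_D (y j + n j).
  pose P j := y j + (n j + n' j).
  have nP j : ~ D (P j) by have [_ _ _ _] := Hn' j; rewrite /P addrA.
  have itP j t : it t (P j) = it t (y j) + (n j + n' j).
    by have [i1 i2 _ _ _] := Hn' j; rewrite (it_equiv FK FiK equivF)// rpredD ?intr_int.
  have near j : nrm (P j - b - L j *: P0) <= 3.
    have h1 := integer_part_near (L j *: P0 + b - y j); have [_ _ h2 _ _] := Hn' j.
    have -> : P j - b - L j *: P0 = n' j - (L j *: P0 + b - y j - n j).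
      by apply: veq; rewrite /P !pairE; ring.
    by apply: le_trans (nrmB _ _) _; rewrite -/(n j) in h1; lra.
  have Pst eps : 0 < eps -> U [set j | forall t : int, (`|t| <= N j)%N ->
      nrm (id (it t (P j)) - id (P j) - t%:~R *: v) <= eps * `|t|%N%:R + eps * L j].
    move=> eps0; apply: (usub _ _ (Hy eps eps0)) => j h t tN; have := h t tN.
    have -> // : id (it t (P j)) - id (P j) = it t (y j) - y j.
    by rewrite itP /P /=; apply: veq; rewrite !pairE; ring.
  have NL (K : R) : U [set j | K * L j <= (N j)%:R].
    apply: (usub _ _ (uand _ _ (freeU (Num.truncn K).+1) L0)) => j /= [h l0].
    have [_ _ [g [_ Hg]]] := qN j; apply: le_trans (Hg 0).
    have Kj : K <= j%:R by apply: le_trans (ltW (truncnS_gt _)) _; rewrite ler_nat.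
    have l1 : 0 <= nrm (id (g 0) - id b) := nrm_ge0 _.
    have j0 : 0 <= j%:R :> R by [].
    apply: (@le_trans _ _ (j%:R * L j)); first by apply: ler_wpM2r => //; exact: ltW.
    by apply: ler_wpM2l => //; rewrite lerDl.
  have [s1 s2] := steady_limit (a := @id (R * R)) ultraU L_infty Pst NL.
  have [Q QE] : exists Q : nat -> R * R, forall j, Q j = L j *: P0 by eexists.
  have bP : plimit U L L (fun j t => b - it t (P j)) (fun t => - (P0 + t *: v)).
    have c0 : plimit U L L (fun j t => P j - b - Q j) (fun=> 0).
      by split=> tau t tt /=; apply: (ucvg0_le ultraU (ucvg_cst_div ultraU 3 L_infty));
        apply: (usub _ _ L0) => j /= l0; have h := near j; rewrite -QE in h;
        rewrite normrM normfV (gtr0_norm l0) ler_pM2r ?invr_gt0//;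
        [apply: le_trans (nrm_fst _) h|apply: le_trans (nrm_snd _) h].
    split=> tau t tt /=.
      have := ucvgN ultraU (ucvgD ultraU (ucvgD ultraU (s1 _ _ tt) (c0.1 _ _ tt)) (ucvg_cst ultraU P0.1)).
      move=> h eps eps0; apply: (usub _ _ (uand _ _ (h eps eps0) L0)) => j /= [h1 l0]; move: h1.
      by congr (`|_ - _| < _); rewrite ?QE ?pairE /GRing.scale /=; [field; rewrite ?(lt0r_neq0 sg0) ?(lt0r_neq0 l0)|ring].
    have := ucvgN ultraU (ucvgD ultraU (ucvgD ultraU (s2 _ _ tt) (c0.2 _ _ tt)) (ucvg_cst ultraU P0.2)).
    move=> h eps eps0; apply: (usub _ _ (uand _ _ (h eps eps0) L0)) => j /= [h1 l0]; move: h1.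
    by congr (`|_ - _| < _); rewrite ?QE ?pairE /GRing.scale /=; [field; rewrite ?(lt0r_neq0 sg0) ?(lt0r_neq0 l0)|ring].
  have qP : plimit U L L (fun j t => q j t - it t (P j)) (fun t => fq t - (P0 + t *: v)).
    split=> tau t tt /=.
      have := ucvgD ultraU (qf.1 _ _ tt) (bP.1 _ _ tt) => h eps eps0.
      by apply: (usub _ _ (h eps eps0)) => j /=; congr (`|_ - _| < _); ring.
    have := ucvgD ultraU (qf.2 _ _ tt) (bP.2 _ _ tt) => h eps eps0.
    by apply: (usub _ _ (h eps eps0)) => j /=; congr (`|_ - _| < _); ring.
  have nb := nrm_ge0 be.
  have mxb u : `|(mx (frame e be) u).1| <= nrm be * nrm u /\ `|(mx (frame e be) u).2| <= nrm be * nrm u.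
    by split; [exact: frame1_le|exact: frame2_le].
  have M2 u u' : (mx (frame e be) (u - u')).2 = dot be (id u - id u') by rewrite frame2.
  have Pb : U [set j | nrm (id (P j) - id b) <= (nrm P0 + 3) * L j].
    apply: (usub _ _ (L_infty 1)) => j /= l1; have h := near j.
    rewrite -[P j - b](subrK (L j *: P0)); apply: le_trans (nrmD _ _) _.
    by rewrite nrmZ ger0_norm; lra.
  have [tau tau0 far] := class_passes_far (a := @id (R * R)) ultraU L_infty M2 sg0 Pst Pb.
  apply: (returning_crossing contF FK FiK (det_frame e1 n0)
    (fun P w => frame_quasi step_bound c v P w e1) mxb cD hD DF DFi ultraU freeU L_infty LL
    Db (mx_plimit ultraU (frame e be) bP) (mx_plimit ultraU (frame e be) qP) _ _ tau0 far nP _ _ lb lq).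
  - move=> u /=; rewrite frame2 dotNr dotDr dotZr P02 -/sg => h2.
    have uE : u = - (lam / sg).
      apply: (mulIf (lt0r_neq0 sg0)); rewrite mulNr divfK ?lt0r_neq0//; lra.
    have -> : - (P0 + u *: v) = 2^-1 *: w.
      by rewrite uE /P0 /w; apply: veq; rewrite !pairE; field; exact: lt0r_neq0.
    by rewrite frame1 dotZr mulrCA pmulr_rlt0.
  - move=> u /=; rewrite frame2 dotBr dotDr dotZr P02 -/sg => h2.
    (* A path that is at level [lam] at the two times [u] and 0 is frozen in between, by
       [rate_energy]. *)
    have lE : fq u - u *: v = fq 0.
      have en s t : s <= t -> dot be (fq s - s *: v) = dot be (fq t - t *: v) -> fq t - t *: v = fq s - s *: v.
        move=> st h; have ts : 0 <= t - s by rewrite subr_ge0.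
        have := @rate_energy _ (fq t - t *: v - (fq s - s *: v)) be (t - s) ts.
        rewrite dotNr dotBr h subrr oppr0 mulr0 => h4.
        apply/eqP; rewrite -subr_eq0 -nrm_eq0 -sqrf_eq0 eq_le sqr_ge0 andbT; apply: h4.
        rewrite /be cv; apply: le_trans (fq_rate c s t st); rewrite le_eqVlt; apply/orP; left; apply/eqP.
        by congr nrm; apply: veq; rewrite !pairE; ring.
      have h0 : dot be (fq u - u *: v) = dot be (fq 0 - 0 *: v).
        by rewrite scale0r subr0 -/lam dotBr dotZr -/sg; lra.
      have [u0|/ltW u0] := leP 0 u.
        by rewrite (en _ _ u0 (esym h0)) scale0r subr0.
      by rewrite -(en _ _ u0 h0) scale0r subr0.
    have -> : fq u - (P0 + u *: v) = (- 2^-1) *: w.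
      have -> : fq u - (P0 + u *: v) = (fq u - u *: v) - P0 by apply: veq; rewrite !pairE; ring.
      by rewrite lE /P0 /w; apply: veq; rewrite !pairE; field; exact: lt0r_neq0.
    by rewrite frame1 dotZr mulrCA nmulr_rgt0 ?oppr_lt0.
  - by move=> j t; have [_ _ h _] := qL j; exact: h.
  - by move=> j t; have [_ h _ _] := qL j; exact: h.
  - by move=> j; have [h1 h2 _] := qN j.
  - by move=> j; have [_ _ h] := qN j.
have [c [v [cv /= nd]]] := exists_three_realized FK FiK step_bound delta0 ball (fun=> erefl).
have rp i : v i - c i != 0.
  rewrite -nrm_eq0 (cv i).2; apply: lt0r_neq0.
  by apply: lt_le_trans (rotation_ball_rate step_bound ball erefl); rewrite ltr_wpDl ?nrm_ge0.
(* As [fq 0] has norm 1, all three velocities lie on one line through the origin, against their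
   non-collinearity. *)
have mult i : exists w, v i = w *: fq 0.
  have [->|vi] := eqVneq (v i) 0; first by exists 0; rewrite scale0r.
  have [u uE] := claim _ _ (cv i).1 (cv i).2 (rp i) vi.
  have u0 : u != 0.
    by apply/eqP => u0; move: fq1; rewrite uE u0 scale0r nrm0 => /eqP; rewrite eq_sym oner_eq0.
  exists u^-1; rewrite uE scalerA mulVf// scale1r//.
have [w0 e0] := mult (inord 0); have [w1 e1] := mult (inord 1); have [w2 e2] := mult (inord 2).
by move/eqP: nd; apply; rewrite e0 e1 e2 !pairE; ring.
Qed.

End returning_id.

(** * Recurrent components are bounded: twist *)

Section returning_dehn.
Context {R : realType}.
Variables (F Fi : R * R -> R * R) (k : int) (C1 : R).
Hypotheses (contF : continuous F) (contFi : continuous Fi).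
Hypotheses (FK : cancel F Fi) (FiK : cancel Fi F) (k0 : k != 0).
Local Notation kR := (k%:~R : R).
Hypothesis F_bound : forall z, `|(F z).1 - z.1 - kR * z.2| <= C1 /\ `|(F z).2 - z.2| <= C1.
Hypothesis equivF : forall z m : R * R, m.1 \is a Num.int -> m.2 \is a Num.int ->
  F (z + m) = F z + (m.1 + kR * m.2, m.2).
Local Notation it := (iterz F Fi).
Variable D : set (R * R).
Hypotheses (oD : open D) (cD : pathconn D) (hD : paths_homotopic D).
Hypotheses (DF : forall z, D z -> D (F z)) (DFi : forall z, D (F z) -> D z).
Hypothesis D_disjoint : forall z m : R * R, m.1 \is a Num.int -> m.2 \is a Num.int ->
  D z -> D (z + m) -> m = 0.
Hypothesis D_returns : forall V : set (R * R), open V -> V !=set0 -> V `<=` D ->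
  forall n : nat, exists T z, [/\ (n <= T)%N, V z & V (iter T F z)].
Variables (rho0 : R * R) (delta : R).
Hypotheses (delta0 : 0 < delta) (ball : rotation_ball F vertical rho0 delta).
Let step_bound := vertical_step F_bound.

Lemma vertical_short (z w : R * R) : nrm (vertical z - vertical w) <= nrm (z - w).
Proof.
have -> : vertical z - vertical w = (0, (z - w).2) by apply: veq; rewrite !pairE ?subrr.
by rewrite nrm_vertical nrm_snd.
Qed.

Lemma gauge_big (x : R) : exists K : R, forall z, K < nrm z -> x < gauge z.
Proof.
exists (`|x| + x ^+ 2) => z h; rewrite ltNge; apply/negP => g.
have g0 := gauge_ge0 z; have x0 : 0 <= x by exact: le_trans g.
have := nrm_gauge z; have : gauge z ^+ 2 <= x ^+ 2 by rewrite lerXn2r ?nnegrE.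
rewrite ger0_norm// in h; lra.
Qed.

(** In [returning_crossing] the base point is always on the left; the sign [e = -1] mirrors the
    frame, so that both orders of [b] and [q] can be treated. *)
Definition signed_frame e c v : (R * R) * (R * R) := ((e * hsign k c v, 0), (0, vsign c v)).

Lemma signed_frameE e c v z : mx (signed_frame e c v) z = (e * (hsign k c v * z.1), vsign c v * z.2).
Proof. by rewrite mxE /=; congr pair; ring. Qed.

(** The constant path at [b] and the cycles through far points are compared by [class_same]. They
    are found to coincide at time 0, although there the gauge of their difference is [L j]. *)
Lemma returning_bounded_dehn b : D b -> exists l : R, forall z, D z -> nrm (z - b) <= l.
Proof.
move=> Db; apply: contrapT => no.
have unb (K : R) : exists2 z, D z & K < nrm (z - b).
  apply: contrapT => h; apply: no; exists K => z Dz.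
  by rewrite leNgt; apply/negP => h'; apply: h; exists z.
have [z [T [r [q [L [N [S [zT qE qL [lb lq] qN]]]]]]]] :=
  returning_sequences oD cD DF D_returns Db vertical_short gauge_big unb.
have [U [ultraU freeU]] := @free_ultrafilter.
have usub := @U_sub U ultraU.
have uand (A B : set nat) : U A -> U B -> U (A `&` B) by exact: filterI.
have L_infty (x : R) : U [set j | x <= L j].
  apply: (usub _ _ (freeU (Num.truncn x).+1)) => j /= h; have [h1 _ _ _] := qL j.
  by apply: le_trans h1; apply: le_trans (ltW (truncnS_gt _)) _; rewrite ler_nat.
have L0 := L_gt0 ultraU L_infty; have tcvg := time_cvg ultraU L_infty.
have L_mu : U [set j | L j <= L j ^+ 2].
  by apply: (usub _ _ (L_infty 1)) => j /= h; rewrite expr2; nra.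
have mui : forall m : R, U [set j | m <= L j ^+ 2] by move=> m; exact: (mu_infty ultraU L_infty L_mu m).
have z0 : ucvg U (fun j => (0 : int)%:~R / L j) 0 by have := ucvg_cst_div ultraU 0 L_infty.
have Lge j : 0 <= L j by have [h _ _ _] := qL j; apply: le_trans h.
have qb j t : `|(q j t - b).2| <= L j /\ `|(q j t - b).1| <= L j ^+ 2.
  by have [_ _ h _] := qL j; have := h t; rewrite gauge_le// => /andP[].
(* A constant path is a pseudo-orbit with the fixed error [|k b.2|]. *)
pose p (j : nat) (t : int) := b.
have pp : pseudo_orbit k `|kR * b.2| p.
  by move=> j t; rewrite /p subrr sub0r normrN subrr normr0.
have qq : pseudo_orbit k (C1 + S) q.
  move=> j t; have h := linked_dist (lq j t); have [h1 h2] := F_bound (q j t).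
  have h3 := le_trans (nrm_fst _) h; have h4 := le_trans (nrm_snd _) h; rewrite !pairE in h3 h4.
  split.
    have -> : (q j (t + 1)).1 - (q j t).1 - kR * (q j t).2 =
      ((F (q j t)).1 - (q j t).1 - kR * (q j t).2) - ((F (q j t)).1 - (q j (t + 1)).1) by ring.
    by apply: le_trans (ler_normB _ _) _; exact: lerD.
  have -> : (q j (t + 1)).2 - (q j t).2 = ((F (q j t)).2 - (q j t).2) - ((F (q j t)).2 - (q j (t + 1)).2) by ring.
  by apply: le_trans (ler_normB _ _) _; exact: lerD.
have npq : nearby U L 3 p q.
  apply: (usub _ _ L0) => j /= l0; have [h2 h1] := qb j 0.
  rewrite /p /= in h1 h2 *; rewrite distrC [`|b.2 - _|]distrC.
  have L2 : 0 <= L j ^+ 2 by rewrite exprn_ge0// ltW.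
  split; lra.
have [h ph] := rel_limit ultraU L_infty pp qq npq.
have rq c := returning_pseudo_rate step_bound vertical_short ultraU freeU zT qE c.
have disc c : nrm c <= rate F vertical c := returning_disc step_bound vertical_short zT c.
have rp c : pseudo_rate U (fun j t => vertical (p j t)) c (rate F vertical c).
  move=> eta eta0; exists 0; apply: (U_all ultraU) => j s n.
  rewrite /p subrr sub0r nrmN nrmZ ger0_norm// addr0 mulrC; apply: ler_wpM2r => //.
  by have := disc c; lra.
have bd t : `|(h t).1| <= 3.
  apply: (ucvg_lec ultraU (ucvg_abs ultraU (ph.1 _ _ (tcvg t)))).
  apply: (usub _ _ L0) => j /= l0; have [_ h1] := qb j (time L t j).
  have L2 : 0 < L j ^+ 2 by rewrite exprn_gt0.
  rewrite normrM normfV (gtr0_norm L2) ler_pdivrMr//.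
  by rewrite /p /= in h1 *; rewrite distrC; lra.
have claim c v : realized F Fi vertical v -> nrm (v - c) = rate F vertical c -> v.2 != 0 -> h 0 = 0.
  move=> vr cv v2; have v1 := realized_vertical vr.
  set s := vsign c v; set hs := hsign k c v.
  (* The disc about [c] contains 0, so strict convexity gives [<v - c, v> > 0]: the class orbits
     move upwards in the oriented frame. *)
  have sv : 0 < s * v.2.
    have v0 : - v != 0.
      by rewrite oppr_eq0; apply: contra v2 => /eqP ->.
    have := @dot_lt0 _ (v - c) (- v) _ v0; rewrite dotNr oppr_lt0 => hh.
    have : 0 < dot (v - c) v by apply: hh; rewrite addrA addNr sub0r nrmN cv disc.
    rewrite /dot v1 mulr0 add0r /s /vsign; case: ifP => [b0|/negbT].
      rewrite mul1r => hh'; rewrite ltNge; apply/negP => vle.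
      by move: hh'; rewrite ltNge => /negP; apply; exact: mulr_ge0_le0.
    rewrite -ltNge => b0 hh'; rewrite mulN1r oppr_gt0 ltNge; apply/negP => vge.
    by move: hh'; rewrite ltNge => /negP; apply; apply: mulr_le0_ge0 => //; exact: ltW.
  have [y Hy] := steady_sequence ultraU L_infty freeU N vr.
  pose n j := integer_part (b - y j); pose P j := y j + n j.
  have near j : nrm (P j - b) <= 2.
    have := integer_part_near (b - y j); rewrite nrmC.
    by have -> : integer_part (b - y j) - (b - y j) = P j - b by apply: veq; rewrite /P !pairE; ring.
  have Pst (m : nat -> R * R) eps : (forall j, (m j).1 \is a Num.int /\ (m j).2 \is a Num.int) -> 0 < eps ->
      U [set j | forall t : int, (`|t| <= N j)%N ->
      nrm (vertical (it t (P j + m j)) - vertical (P j + m j) - t%:~R *: v) <= eps * `|t|%N%:R + eps * L j].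
    move=> mi eps0; apply: (usub _ _ (Hy eps eps0)) => j hh t tN; have := hh t tN.
    have [m1 m2] := mi j.
    have -> // : vertical (it t (P j + m j)) - vertical (P j + m j) = vertical (it t (y j)) - vertical (y j).
    rewrite /P -addrA (it_translate FK FiK equivF) ?rpredD ?intr_int//.
    by apply: veq; rewrite /vertical !pairE /=; ring.
  have NL (K : R) : U [set j | K * L j <= (N j)%:R].
    apply: (usub _ _ (uand _ _ (freeU (Num.truncn K).+1) L0)) => j /= [hh l0].
    have [_ _ [g [_ Hg]]] := qN j; apply: le_trans (Hg 0).
    have Kj : K <= j%:R by apply: le_trans (ltW (truncnS_gt _)) _; rewrite ler_nat.
    have l1 : 0 <= nrm (vertical (g 0) - vertical b) := nrm_ge0 _.
    have j0 : 0 <= j%:R :> R by [].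
    apply: (@le_trans _ _ (j%:R * L j)); first by apply: ler_wpM2r => //; exact: ltW.
    by apply: ler_wpM2l => //; rewrite lerDl.
  have Pst0 eps : 0 < eps -> U [set j | forall t : int, (`|t| <= N j)%N ->
      nrm (vertical (it t (P j)) - vertical (P j) - t%:~R *: v) <= eps * `|t|%N%:R + eps * L j].
    move=> eps0; have := Pst (fun=> 0) eps (fun=> conj (rpred0 _) (rpred0 _)) eps0.
    by move=> hh; apply: (usub _ _ hh) => j hj t tN; have := hj t tN; rewrite addr0.
  have [_ Pl'] := steady_limit (a := vertical) ultraU L_infty Pst0 NL.
  have nearP j : `|(P j).1 - b.1| <= 2 /\ `|(P j).2 - b.2| <= 2.
    by split; apply: le_trans (near j); [exact: (nrm_fst (P j - b))|exact: (nrm_snd (P j - b))].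
  have Pl : path_limit U L (fun j t => (it t (P j)).2 - b.2) L (fun t => t * v.2).
    move=> tau t tt; have := Pl' _ _ tt => lim.
    apply: (ucvg_close ultraU lim); apply: (ucvg0_le ultraU (ucvg_cst_div ultraU 2 L_infty)).
    apply: (usub _ _ L0) => j /= l0; rewrite -mulrBl normrM normfV (gtr0_norm l0) ler_pM2r ?invr_gt0//.
    have [_ hh] := nearP j; have -> // : (it (t j) (P j)).2 - b.2 - ((it (t j) (P j)).2 - (P j).2) = (P j).2 - b.2 by ring.
  have np : nearby U L 3 p (fun j t => it t (P j)).
    apply: (usub _ _ (L_infty 1)) => j /= l1; have [h1 h2] := nearP j.
    have L2 : 1 <= L j ^+ 2 by rewrite expr2; nra.
    rewrite /p distrC [`|b.2 - _|]distrC; split; lra.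
  have nq : nearby U L 3 q (fun j t => it t (P j)).
    apply: (usub _ _ (L_infty 1)) => j /= l1; have [h1 h2] := nearP j; have [h4 h3] := qb j 0.
    have L2 : 1 <= L j ^+ 2 by rewrite expr2; nra.
    rewrite /= in h1 h2 h3 h4 *; rewrite !ler_norml in h1 h2 h3 h4 *.
    move: h1 h2 h3 h4 => /andP[? ?] /andP[? ?] /andP[? ?] /andP[? ?].
    by split; apply/andP; split; lra.
  have PP := orbit_pseudo FiK F_bound P.
  have [f pf] := rel_limit ultraU L_infty pp PP np.
  have [g qg] := rel_limit ultraU L_infty qq PP nq.
  have f2 t : (f t).2 = - (t * v.2).
    apply: (ucvg_uniq ultraU (pf.2 _ _ (tcvg t))).
    have := ucvgN ultraU (Pl _ _ (tcvg t)) => lim e e0; apply: (usub _ _ (lim e e0)) => j /=.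
    by congr (`|_ - _| < _); rewrite /p /=; ring.
  have sep e p1 p2 f1 g1 : `|e| = 1 ->
      rel_limits F Fi U L p1 P f1 -> rel_limits F Fi U L p2 P g1 ->
      forall lc x0, exists2 P' : nat -> R * R, (forall j, ~ D (P' j)) /\
        (exists2 tau, 0 < tau & passes_far F Fi (signed_frame e c v) U L vertical b N P' tau) &
        plimit U L (fun j => L j ^+ 2) (fun j t => mx (signed_frame e c v) (p1 j t - it t (P' j)))
          (fun t => (e * (hs * (f1 t).1 - (x0 + `|kR| * lc * t)), s * (f1 t).2 - lc)) /\
        plimit U L (fun j => L j ^+ 2) (fun j t => mx (signed_frame e c v) (p2 j t - it t (P' j)))
          (fun t => (e * (hs * (g1 t).1 - (x0 + `|kR| * lc * t)), s * (g1 t).2 - lc)).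
    move=> e1 l1 l2 lc x0.
    have /choice[n' Hn'] := fun j => avoid_D D_disjoint (shifted k L c v P lc x0 j).
    pose P' j := shifted k L c v P lc x0 j + n' j.
    pose m j : R * R := ((Num.floor (hs * x0 * L j ^+ 2))%:~R, (Num.floor (s * lc * L j))%:~R) + n' j.
    have P'E j : P' j = P j + m j by rewrite /P' /shifted /m addrA.
    have mi j : (m j).1 \is a Num.int /\ (m j).2 \is a Num.int.
      by have [i1 i2 _ _ _] := Hn' j; split; rewrite /m !pairE /= rpredD ?intr_int.
    have change p3 f3 : rel_limits F Fi U L p3 P f3 ->
        plimit U L (fun j => L j ^+ 2) (fun j t => mx (signed_frame e c v) (p3 j t - it t (P' j)))
          (fun t => (e * (hs * (f3 t).1 - (x0 + `|kR| * lc * t)), s * (f3 t).2 - lc)).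
      move=> l3; have [S1 S2] := shifted_limit FK FiK k0 equivF ultraU L_infty c v lc x0 l3.
      have E j t : p3 j t - it t (P' j) = p3 j t - it t (shifted k L c v P lc x0 j) - ((n' j).1, 0).
        have [i1 i2 _ n2 _] := Hn' j; rewrite /P' (it_translate FK FiK equivF)// n2 mulr0 addr0.
        by rewrite opprD addrA.
      split => tau t tt /=.
        have := ucvgZ ultraU e (S1 _ _ tt) => lim; apply: (ucvg_close ultraU lim).
        apply: (ucvg0_le ultraU (ucvg_cst_div ultraU 1 mui)).
        apply: (usub _ _ L0) => j /= l0; have L2 : 0 < L j ^+ 2 by rewrite exprn_gt0.
        rewrite mulrA -mulrBl normrM normfV (gtr0_norm L2) ler_pM2r ?invr_gt0//.
        rewrite signed_frameE dehn_frameE E /=.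
        have -> : e * (hs * ((p3 j (t j)).1 - (it (t j) (shifted k L c v P lc x0 j)).1 - (n' j).1)) -
          e * (hs * ((p3 j (t j)).1 - (it (t j) (shifted k L c v P lc x0 j)).1)) = - (e * (hs * (n' j).1)) by ring.
        rewrite normrN (normrM e) (normrM hs) e1 (hsign_norm k0 c v) !mul1r.
        by have [_ _ hn _ _] := Hn' j; apply: le_trans (nrm_fst _) hn.
      have lim := S2 _ _ tt; move=> eps eps0; apply: (usub _ _ (lim eps eps0)) => j /=.
      by rewrite signed_frameE dehn_frameE E /= subr0.
    exists P'; last by split; exact: change.
    split; first by move=> j; have [_ _ _ _] := Hn' j.
    have M2 u u' : (mx (signed_frame e c v) (u - u')).2 = dot (0, s) (vertical u - vertical u').
      by rewrite signed_frameE /dot /vertical /= -/s; ring.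
    have sg : 0 < dot (0, s) v by rewrite /dot /= mul0r add0r.
    apply: (@class_passes_far _ F Fi _ U ultraU L L_infty vertical b N (0, s) v P' (`|lc| + 4) M2 sg).
      move=> eps eps0; have := Pst m eps mi eps0 => hh; apply: (usub _ _ hh) => j hj t tN.
      by rewrite P'E; exact: hj.
    apply: (usub _ _ (L_infty 1)) => j /= l1'; have l0 : 0 < L j by lra.
    have -> : vertical (P' j) - vertical b = (0, (P' j).2 - b.2) by apply: veq; rewrite !pairE ?subrr.
    have -> : (P' j).2 - b.2 = (P j).2 - b.2 + (Num.floor (s * lc * L j))%:~R.
      by have [_ _ _ n2 _] := Hn' j; rewrite P'E /m /P !pairE /= n2; ring.
    rewrite nrm_vertical.
    have [_ h1] := nearP j; have /andP[h2 h3] := floor_itv (s * lc * L j); rewrite intrD in h3.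
    have h4 : `|s * lc * L j| = `|lc| * L j.
      by rewrite (normrM (s * lc)) (normrM s) (vsign_norm c v) mul1r (gtr0_norm l0).
    have h5 := ler_norm (s * lc * L j); have h6 := ler_norm (- (s * lc * L j)); rewrite normrN in h6.
    rewrite h4 in h5 h6; rewrite !ler_norml in h1 *; move: h1 => /andP[h1 h1'].
    have ? : 0 <= `|lc| * L j by rewrite mulr_ge0// ltW.
    by apply/andP; split; lra.
  have quasi e : `|e| = 1 -> forall P w,
    `|(mx (signed_frame e c v) (F (P + w) - F P)).1 - ((mx (signed_frame e c v) w).1 + (e * `|kR|) * (mx (signed_frame e c v) w).2)| <= 2 * C1 /\
    `|(mx (signed_frame e c v) (F (P + w) - F P)).2 - (mx (signed_frame e c v) w).2| <= 2 * C1.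
    move=> e1 P1 w; have [h1 h2] := dehn_quasi k0 F_bound c v P1 w.
    rewrite !dehn_frameE /= in h1 h2; rewrite !signed_frameE /=; split=> //.
    by rewrite -mulrA -mulrDr -mulrBr normrM e1 mul1r.
  have dM e : `|e| = 1 -> det (signed_frame e c v) != 0.
    move=> e1; rewrite /det /= mul0r subr0 -normr_eq0 (normrM _ (vsign c v)) (normrM e) e1.
    by rewrite (hsign_norm k0 c v) (vsign_norm c v) !mul1r oner_neq0.
  have mxb e : `|e| = 1 -> forall w, `|(mx (signed_frame e c v) w).1| <= 1 * nrm w /\
      `|(mx (signed_frame e c v) w).2| <= 1 * nrm w.
    move=> e1 w; rewrite signed_frameE /= (normrM e) (normrM (hsign k c v)) (normrM (vsign c v)) e1.
    by rewrite (hsign_norm k0 c v) (vsign_norm c v) !mul1r nrm_fst nrm_snd.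
  have qv j t : nrm (vertical (q j t) - vertical b) <= L j.
    have -> : vertical (q j t) - vertical b = (0, (q j t - b).2) by apply: veq; rewrite !pairE ?subrr.
    by rewrite nrm_vertical; case: (qb j t).
  have Dq j t : D (q j t) by have [_ hh _ _] := qL j; exact: hh.
  have qN1 j : q j (N j) = q j 0 /\ q j (- (N j)%:Z) = q j 0 by have [hh hh' _] := qN j.
  have arcs j : exists g, path_in D g b (q j 0) /\
     forall s, j%:R * (L j + nrm (vertical (g s) - vertical b)) <= (N j)%:R by have [_ _ hh] := qN j.
  have sep1 : frame_unseparated k c v f g.
    move=> lc x0 _ hl hr; have n1 : `|1 : R| = 1 by rewrite normr1.
    have [P' [nP [tau tau0 far]] [l1 l2]] := sep 1 p q f g n1 pf qg lc x0.
    apply: (returning_crossing contF FK FiK (dM _ n1) (quasi _ n1) (mxb _ n1) cD hD DF DFi ultraU freeU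
      L_infty L_mu Db l1 l2 _ _ tau0 far nP qv Dq lb lq qN1 arcs) => u /= /eqP;
      rewrite subr_eq0 mul1r => /eqP; [move/hl|move/hr]; rewrite -/hs; lra.
  (* With the roles exchanged [b] would be on the right, hence the mirrored frame. *)
  have sep2 : frame_unseparated k c v g f.
    move=> lc x0 _ hl hr; have n1 : `|- 1 : R| = 1 by rewrite normrN normr1.
    have [P' [nP [tau tau0 far]] [l1 l2]] := sep (- 1) p q f g n1 pf qg lc x0.
    apply: (returning_crossing contF FK FiK (dM _ n1) (quasi _ n1) (mxb _ n1) cD hD DF DFi ultraU freeU
      L_infty L_mu Db l1 l2 _ _ tau0 far nP qv Dq lb lq qN1 arcs) => u /= /eqP;
      rewrite subr_eq0 mulN1r => /eqP; [move/hr|move/hl]; rewrite -/hs; lra.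
  apply: (class_same FiK k0 F_bound ultraU L_infty vr cv pp qq np nq npq (rp c) (rq c)
    (b := fun=> b) Pl pf qg ph sep1 sep2 bd).
  by exists 0, 1; rewrite !f2 mul0r mul1r oppr0 eq_sym oppr_eq0.
have [c1 [c2 [v1 [v2 [[r1 e1] [r2 e2] v12]]]]] := exists_two_realized FK FiK step_bound delta0 ball
    (fun v rv => @veq _ (vertical v) v (esym (realized_vertical rv)) erefl).
(* Distinct vertical velocities cannot both vanish, so [claim] applies to one of them. *)
have h0 : h 0 = 0.
  have [v1z|/(claim _ _ r1 e1)//] := eqVneq v1.2 0.
  have [v2z|/(claim _ _ r2 e2)//] := eqVneq v2.2 0.
  exfalso; move/eqP: v12; apply; apply: veq; last by rewrite v1z v2z.
  by rewrite (realized_vertical r1) (realized_vertical r2).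
have q0 : 0 < 1 / 4 :> R by rewrite divr_gt0.
have l1 := ph.1 _ _ z0 _ q0; have l2 := ph.2 _ _ z0 _ q0.
have [j [[/= g1 g2] l0]] := U_ex ultraU (uand _ _ (uand _ _ l1 l2) L0).
have L2 : 0 < L j ^+ 2 by rewrite exprn_gt0.
have [_ _ _ gL] := qL j.
have : gauge (q j 0 - b) <= L j / 2.
  rewrite gauge_le ?divr_ge0 ?(ltW l0)// !pairE.
  rewrite h0 /p /= !subr0 in g1 g2.
  rewrite normrM normfV (gtr0_norm L2) ltr_pdivrMr// distrC in g1.
  rewrite normrM normfV (gtr0_norm l0) ltr_pdivrMr// distrC in g2.
  by apply/andP; split; [lra|rewrite expr_div_n; lra].
by rewrite gL; lra.
Qed.

End returning_dehn.

(** * Lifts to the plane *)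

Section lifting.
Context {R : realType}.
Local Notation torus := (torus R).
Implicit Types (z w m u v : R * R).

Definition int2 m : Prop := m.1 \is a Num.int /\ m.2 \is a Num.int.

Lemma int2D m u : int2 m -> int2 u -> int2 (m + u).
Proof. by move=> [? ?] [? ?]; split; rewrite /= rpredD. Qed.
Lemma int2N m : int2 m -> int2 (- m).
Proof. by move=> [? ?]; split; rewrite /= rpredN. Qed.
Lemma int2B m u : int2 m -> int2 u -> int2 (m - u).
Proof. by move=> hm hu; apply: int2D => //; exact: int2N. Qed.
Lemma int2_0 : int2 0.
Proof. by split; rewrite rpred0. Qed.

Lemma torus_pi_eq z w : torus_pi z = torus_pi w <-> int2 (z - w).
Proof. by rewrite torus_piP; split=> [/andP[]|[h1 h2]] //; apply/andP. Qed.

Lemma torus_pi_shift z m : int2 m -> torus_pi (z + m) = torus_pi z.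
Proof. by move=> hm; apply/torus_pi_eq; rewrite addrAC subrr add0r. Qed.

Lemma torus_pi_surj (t : torus) : exists z, torus_pi z = t.
Proof. by exists (repr t); rewrite /torus_pi reprK. Qed.

Lemma torus_openP (A : set torus) : open A <-> open (torus_pi @^-1` A).
Proof. by []. Qed.

Lemma torus_pi_cont : continuous (@torus_pi R).
Proof. by apply/continuousP => A oA; exact/torus_openP. Qed.

Lemma torus_pi_open (A : set (R * R)) : open A -> open (torus_pi @` A).
Proof.
move=> oA; apply/torus_openP; rewrite openE => z [u Au /torus_pi_eq uz].
have cs : continuous (fun y : R * R => y + (u - z)).
  by apply: cont_vadd; [exact: cont_id|exact: cont_cst].
have An : nbhs (z + (u - z)) A by apply: open_nbhs_nbhs; split=> //; rewrite addrC subrK.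
have h : nbhs z [set y | A (y + (u - z))] := cs z _ An.
apply: (@filterS _ (nbhs z) _ _ _ _ h) => y /= Ay; exists (y + (u - z)) => //.
exact: torus_pi_shift.
Qed.

Lemma int_small (x : R) : x \is a Num.int -> `|x| < 1 -> x = 0.
Proof.
move=> /intrP[n ->]; rewrite -intr_norm -(mulr1z 1) ltr_int => n1.
have : (`|n|%N < 1)%N by rewrite -ltz_nat abszE.
by rewrite ltnS leqn0 absz_eq0 => /eqP ->.
Qed.

(* Two such vectors v differ by an integer vector with entries of modulus less
   than 1, hence coincide. *)
Definition delta (t t' : torus) : R * R := xget 0 [set v | exists u,
  [/\ torus_pi u = t, torus_pi (u + v) = t', `|v.1| < 1 / 2 & `|v.2| < 1 / 2]].

Lemma deltaE u v : `|v.1| < 1 / 2 -> `|v.2| < 1 / 2 -> delta (torus_pi u) (torus_pi (u + v)) = v.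
Proof.
move=> v1 v2; rewrite /delta; case: xgetP => [v' _ [u' [e1 e2 w1 w2]]|/(_ v)[]]; last by exists u.
have [i1 i2] : int2 (v' - v).
  have h1 := (torus_pi_eq _ _).1 e1; have h2 := (torus_pi_eq _ _).1 e2.
  have -> : v' - v = (u' + v' - (u + v)) - (u' - u) by apply: veq; rewrite !pairE; ring.
  exact: int2B.
rewrite !ltr_norml in v1 v2 w1 w2; move: v1 v2 w1 w2 => /andP[? ?] /andP[? ?] /andP[? ?] /andP[? ?].
rewrite !pairE in i1 i2.
have d1 : v'.1 - v.1 = 0 by apply: int_small => //; rewrite ltr_norml; apply/andP; lra.
have d2 : v'.2 - v.2 = 0 by apply: int_small => //; rewrite ltr_norml; apply/andP; lra.
by apply: veq; apply/eqP; rewrite -subr_eq0 ?d1 ?d2.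
Qed.

Lemma ballE (z : R * R) (e : R) w : ball z e w <-> `|z.1 - w.1| < e /\ `|z.2 - w.2| < e.
Proof. by split=> [[]|]. Qed.

Lemma delta_cvg (X : topologicalType) (h1 h2 : X -> torus) x0 u v :
  h1 @ x0 --> h1 x0 -> h2 @ x0 --> h2 x0 ->
  torus_pi u = h1 x0 -> torus_pi (u + v) = h2 x0 -> `|v.1| < 1 / 2 -> `|v.2| < 1 / 2 ->
  (fun x => delta (h1 x) (h2 x)) @ x0 --> delta (h1 x0) (h2 x0).
Proof.
move=> c1 c2 e1 e2 v1 v2; rewrite -e1 -e2 deltaE//.
apply/cvg_ballP => e e0.
pose d := Num.min (e / 2) (Num.min ((1 / 2 - `|v.1|) / 2) ((1 / 2 - `|v.2|) / 2)).
have d0 : 0 < d by rewrite !lt_min !divr_gt0 ?subr_gt0.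
have de : d <= e / 2 by rewrite ge_min lexx.
have dv1 : d <= (1 / 2 - `|v.1|) / 2 by rewrite !ge_min lexx orbT.
have dv2 : d <= (1 / 2 - `|v.2|) / 2 by rewrite !ge_min lexx !orbT.
have nb y : nbhs (torus_pi y) (torus_pi @` ball y d).
  by apply: open_nbhs_nbhs; split; [apply: torus_pi_open; exact: ball_open|exists y => //; exact: ballxx].
have n1 : nbhs x0 (h1 @^-1` (torus_pi @` ball u d)) := c1 _ (eq_ind _ (fun t => nbhs t (torus_pi @` ball u d)) (nb u) _ e1).
have n2 : nbhs x0 (h2 @^-1` (torus_pi @` ball (u + v) d)) := c2 _ (eq_ind _ (fun t => nbhs t (torus_pi @` ball (u + v) d)) (nb (u + v)) _ e2).
have FF : Filter (nbhs x0) by exact: nbhs_filter.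
have nn := @filterI _ _ FF _ _ n1 n2.
suff res : nbhs x0 [set x | ball v e (delta (h1 x) (h2 x))] by exact: res.
apply: (@filterS _ _ FF _ _ _ nn) => x [[u' /ballE[a1 a2] /= <-] [w' /ballE[b1 b2] /= <-]].
have a3 := ler_norm v.1; have a4 := ler_norm v.2.
have a5 := ler_norm (- v.1); have a6 := ler_norm (- v.2); rewrite !normrN in a5 a6.
rewrite !pairE in b1 b2; rewrite !ltr_norml in a1 a2 b1 b2.
move: a1 a2 b1 b2 => /andP[? ?] /andP[? ?] /andP[? ?] /andP[? ?].
have -> : torus_pi w' = torus_pi (u' + (w' - u')) by rewrite addrC subrK.
rewrite deltaE ?pairE.
- by apply/ballE; rewrite !pairE !ltr_norml; split; apply/andP; lra.
- by rewrite ltr_norml; apply/andP; lra.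
- by rewrite ltr_norml; apply/andP; lra.
Qed.

Lemma square_compact : compact (`[0%R, 1%R]%classic `*` `[0%R, 1%R]%classic : set (R * R)).
Proof. by apply: compact_setX; exact: segment_compact. Qed.

Lemma clamp2_in z : (`[0%R, 1%R]%classic `*` `[0%R, 1%R]%classic) (clamp2 z).
Proof. by split; rewrite /= in_itv /=; exact: clamp01. Qed.

(* The lift at x is obtained by adding up the small displacements of h along the
   segment from 0 to x, cut into N pieces. *)
Lemma lift_square (h : R * R -> torus) z0 : continuous h -> torus_pi z0 = h 0 ->
  exists H : R * R -> R * R, [/\ continuous H, H 0 = z0 & forall x, torus_pi (H x) = h (clamp2 x)].
Proof.
move=> ch e0; pose K : set (R * R) := `[0%R, 1%R]%classic `*` `[0%R, 1%R]%classic.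
pose P (A : set (R * R)) := exists z, forall x, A x -> exists2 w, ball z (1 / 8 : R) w & torus_pi w = h x.
have e8 : 0 < 1 / 8 :> R by rewrite divr_gt0.
have [||x Kx|N0 HN] := @lebesgue_number _ _ K P.
- by move=> A B AB [z Hz]; exists z => x /AB; exact: Hz.
- exact: square_compact.
- have [z zx] := torus_pi_surj (h x).
  have nb : nbhs (h x) (torus_pi @` ball z (1 / 8)).
    rewrite -zx; apply: open_nbhs_nbhs.
    by split; [apply: torus_pi_open; exact: ball_open|exists z => //; exact: ballxx].
  have /nbhs_ballP[e /= e1 He] := ch x _ nb; exists e => //; exists z => y /He[w zw <-].
  by exists w.
have {}HN := HN N0 (leqnn _).
pose N := N0.+2; have N1 : 0 < N%:R :> R by rewrite ltr0n.
pose pt (i : nat) x : R * R := (i%:R / N%:R) *: x.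
have ptK i x : (i <= N)%N -> K x -> K (pt i x).
  move=> iN [/=]; rewrite !in_itv /= => /andP[a1 a2] /andP[b1 b2].
  have /andP[c1 c2] : 0 <= (i%:R / N%:R : R) <= 1 by apply: unit_grid.
  have in01 (y : R) : 0 <= y -> y <= 1 -> 0 <= i%:R / N%:R * y <= 1.
    by move=> y0 y1; rewrite mulr_ge0//= -[leRHS]mulr1; apply: ler_pM.
  by split; rewrite /= in_itv /= in01.
have near i x : (i < N)%N -> K x -> ball (pt i x) N0.+1%:R^-1 (pt i.+1 x).
  move=> iN [/=]; rewrite !in_itv /= => /andP[a1 a2] /andP[b1 b2].
  have dist (y : R) : 0 <= y -> y <= 1 -> `|i%:R / N%:R * y - i.+1%:R / N%:R * y| < N0.+1%:R^-1.
    move=> y0 y1; have -> : i%:R / N%:R * y - i.+1%:R / N%:R * y = - (y / N%:R).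
      by rewrite -[i.+1%:R]natr1; field; rewrite lt0r_neq0.
    rewrite normrN ger0_norm ?divr_ge0// ?ltW//.
    apply: (@le_lt_trans _ _ (N%:R^-1)); first by rewrite ler_pdivrMr// mulVf ?lt0r_neq0.
    by rewrite ltf_pV2 ?posrE ?ltr0n// ltr_nat.
  by apply/ballE; split; apply: dist.
have step i x : (i < N)%N -> K x -> exists u v, [/\ torus_pi u = h (pt i x),
    torus_pi (u + v) = h (pt i.+1 x), `|v.1| < 1 / 2 & `|v.2| < 1 / 2].
  move=> iN Kx; have [z Hz] := HN _ (ptK i x (ltnW iN) Kx).
  have r0 : 0 < N0.+1%:R^-1 :> R by rewrite invr_gt0.
  have [u /ballE[u1 u2] ue] := Hz _ (ballxx _ r0); have [w /ballE[w1 w2] we] := Hz _ (near i x iN Kx).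
  exists u, (w - u); rewrite [u + _]addrC subrK; split => //; rewrite !pairE.
    by move: u1 w1; rewrite !ltr_norml => /andP[? ?] /andP[? ?]; apply/andP; lra.
  by move: u2 w2; rewrite !ltr_norml => /andP[? ?] /andP[? ?]; apply/andP; lra.
pose S j x := z0 + \sum_(i < j) delta (h (pt i x)) (h (pt i.+1 x)).
have cpt i : continuous (pt i) by apply: cont_vscale; [exact: cont_cst|exact: cont_id].
have cS j x : (j <= N)%N -> K x -> S j @ x --> S j x.
  move=> jN Kx; elim: j jN => [|j IH] jN.
    have -> : S 0%N = fun=> z0 by apply/funext => y; rewrite /S big_ord0 addr0.
    exact: cvg_cst.
  have SE y : S j.+1 y = S j y + delta (h (pt j y)) (h (pt j.+1 y)) by rewrite /S big_ord_recr /= addrA.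
  have -> : S j.+1 = fun y => S j y + delta (h (pt j y)) (h (pt j.+1 y)) by apply/funext.
  have [u [v [e1 e2 v1 v2]]] := step j x jN Kx.
  apply: cvgD; first exact: IH (ltnW jN).
  by apply: (delta_cvg _ _ e1 e2 v1 v2); [exact: (cont_comp (cpt j) ch)|exact: (cont_comp (cpt j.+1) ch)].
have piS j x : (j <= N)%N -> K x -> torus_pi (S j x) = h (pt j x).
  move=> jN Kx; elim: j jN => [|j IH] jN.
    by rewrite /S big_ord0 addr0 e0 /pt mul0r scale0r.
  have [u [v [e1 e2 v1 v2]]] := step j x jN Kx.
  have -> : S j.+1 x = S j x + v.
    by rewrite /S big_ord_recr /= addrA -e1 -e2 deltaE.
  have hm : int2 (S j x - u) by apply/torus_pi_eq; rewrite e1; exact: IH (ltnW jN).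
  have -> : S j x + v = u + v + (S j x - u) by apply: veq; rewrite !pairE; ring.
  by rewrite torus_pi_shift.
have K2 x : K (clamp2 x) by exact: clamp2_in.
exists (fun x => S N (clamp2 x)); split.
- move=> x; apply: (@cvg_comp _ _ _ clamp2 (S N) _ (nbhs (clamp2 x))); first exact: clamp2_cont.
  exact: cS.
- have -> : clamp2 0 = 0 :> R * R by rewrite /clamp2 /= !clamp_id ?lexx ?ler01.
  rewrite /S big1 ?addr0// => i _; rewrite /pt !scaler0.
  have [y <-] := torus_pi_surj (h 0); rewrite -{2}[y]addr0 deltaE ?normr0 ?divr_gt0//.
- move=> x; rewrite piS// /pt divff ?scale1r// lt0r_neq0//.
Qed.

Lemma int_valued_const1 (g : R -> R) : continuous g -> (forall x, g x \is a Num.int) ->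
  forall x y, g x = g y.
Proof.
move=> cg gi x y; wlog xy : x y / x <= y.
  by move=> hw; have [/hw//|/ltW /hw] := leP x y.
apply/eqP; rewrite -subr_eq0; apply/eqP/int_small; first by rewrite rpredB.
rewrite ltNge; apply/negP => big.
have [w wb wd] : exists2 w, Num.min (g x) (g y) <= w <= Num.max (g x) (g y) & `|w - g x| = 1 / 2.
  have h2 : 0 <= 1 / 2 :> R by rewrite divr_ge0.
  have [h|h] := leP (g x) (g y).
    rewrite ler0_norm ?subr_le0// in big; exists (g x + 1 / 2); first by apply/andP; lra.
    by rewrite addrAC subrr add0r ger0_norm.
  rewrite gtr0_norm ?subr_gt0// in big; exists (g x - 1 / 2); first by apply/andP; lra.
  by rewrite addrAC subrr add0r normrN ger0_norm.
have [c _ gc] := IVT xy (continuous_subspaceT cg) wb.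
have : g c - g x = 0.
  by apply: int_small; [rewrite rpredB|rewrite gc wd; lra].
by move=> e; move: wd; rewrite -gc e normr0; lra.
Qed.

Lemma int_valued_const (g : R * R -> R * R) : continuous g -> (forall z, int2 (g z)) ->
  forall z w, g z = g w.
Proof.
move=> cg gi z w; pose l (s : R) := z + s *: (w - z).
have cl : continuous l.
  by apply: cont_vadd; [exact: cont_cst|apply: cont_vscale; [exact: cont_id|exact: cont_cst]].
have cgl := cont_comp cl cg.
have h1 := int_valued_const1 (cont_fst cgl) (fun s => (gi (l s)).1) 0 1.
have h2 := int_valued_const1 (cont_snd cgl) (fun s => (gi (l s)).2) 0 1.
have l0 : l 0 = z by rewrite /l scale0r addr0.
have l1 : l 1 = w by rewrite /l scale1r addrC subrK.
by rewrite l0 l1 in h1 h2; exact: veq.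
Qed.

Lemma lift_unique (A B : R * R -> R * R) : continuous A -> continuous B ->
  (forall z, torus_pi (A z) = torus_pi (B z)) -> forall z w, A z - B z = A w - B w.
Proof.
move=> cA cB e; apply: int_valued_const; first exact: cont_vsub.
by move=> z; apply/torus_pi_eq.
Qed.

Lemma lift_unique1 (A B : R -> R * R) : continuous A -> continuous B ->
  (forall s, torus_pi (A s) = torus_pi (B s)) -> forall s t, A s - B s = A t - B t.
Proof.
move=> cA cB e s t.
exact: (lift_unique (cont_comp cfst cA) (cont_comp cfst cB) (fun z => e z.1) (s, 0) (t, 0)).
Qed.

Lemma lift_path (c : R -> torus) z0 : continuous c -> torus_pi z0 = c 0 ->
  exists C : R -> R * R, [/\ continuous C, C 0 = z0 & forall s, torus_pi (C s) = c (clamp s)].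
Proof.
move=> cc e0; have [H [cH H0 He]] := lift_square (cont_comp cfst cc) e0.
exists (fun s => H (s, 0)); split=> //.
- by apply: cont_comp cH; apply: cont_pair; [exact: cont_id|exact: cont_cst].

Qed.

End lifting.

Section lifts.
Context {R : realType}.
Local Notation torus := (torus R).
Implicit Types (z w m : R * R) (f g : torus -> torus) (F : R * R -> R * R).

Definition shear (k : int) z : R * R := (z.1 + k%:~R * z.2, z.2).

Lemma shearD k z w : shear k (z + w) = shear k z + shear k w.
Proof. by apply: veq; rewrite /shear !pairE /=; ring. Qed.
Lemma shear_int k m : int2 m -> int2 (shear k m).
Proof. by move=> [m1 m2]; split; rewrite /= ?rpredD ?rpredM ?intr_int. Qed.
Lemma shear_inj k m : shear k m = 0 -> m = 0.
Proof. by move=> [h1 h2]; apply: veq => //=; move: h1; rewrite h2 mulr0 addr0. Qed.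
Lemma shear_cont k : continuous (shear k).
Proof.
apply: (cont_pair (f := fun z : R * R => z.1 + k%:~R * z.2)); last exact: csnd.
by apply: cont_add; [exact: cfst|apply: cont_mul; [exact: cont_cst|exact: csnd]].
Qed.
Lemma shear_comp k l z : shear k (shear l z) = shear (k + l) z.
Proof. by apply: veq; rewrite /shear /= ?intrD; ring. Qed.

Lemma homotopic_dehn0 f : homotopic f id -> homotopic f (dehn_twist 0).
Proof.
move=> [H [cH H0 H1]]; exists H; split=> // t; rewrite H1 /=.
by have [z <-] := torus_pi_surj t; rewrite dehn_twistE mul0r addr0 -surjective_pairing.
Qed.

(** The homotopy along the segment from [z] to [z + m] lifts to a square. Up to constants its left
    edge is [F] on the segment and its right edge the shear, while the two horizontal edges lie over
    the same path and differ by a constant; so the left and right increments agree. *)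
Lemma lift_equivariant f F k : is_lift F f -> homotopic f (dehn_twist k) ->
  forall z m, int2 m -> F (z + m) = F z + shear k m.
Proof.
move=> [cF Fpi] [H [cH H0 H1]] z m hm.
pose l (t : R) := z + t *: m.
have cl : continuous l.
  by apply: cont_vadd; [exact: cont_cst|apply: cont_vscale; [exact: cont_id|exact: cont_cst]].
pose r (x : R * R) : R * torus := (clamp x.1, torus_pi (l x.2)).
have cr : continuous r.
  exact: (cont_pair (cont_comp cfst clamp_cont) (cont_comp (cont_comp csnd cl) (@torus_pi_cont R))).
have rA x : (`[0%R, 1%R]%classic `*` [set: torus]) (r x).
  by split=> //=; rewrite in_itv /=; exact: clamp01.
have ch : continuous (fun x => H (r x)) by exact: (within_retract cr rA cH).
have c0 : clamp 0 = 0 :> R by rewrite clamp_id ?lexx ?ler01.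
have c1 : clamp 1 = 1 :> R by rewrite clamp_id ?lexx ?ler01.
have l0 : l 0 = z by rewrite /l scale0r addr0.
have l1 : l 1 = z + m by rewrite /l scale1r.
have e0 : torus_pi (F z) = H (r 0) by rewrite /r /= c0 l0 H0 Fpi.
have [Ht [cHt Ht0 HtE]] := lift_square ch e0.
have edge (a b : R -> R) : continuous a -> continuous b -> continuous (fun t => Ht (a t, b t)).
  by move=> ca cb; exact: (cont_comp (cont_pair ca cb) cHt).
have cc (a : R) : continuous (fun _ : R => a) by exact: cont_cst.
have ci : continuous (fun t : R => t) by exact: cont_id.
have clc := cont_comp (@clamp_cont R) cl.
have left := lift_unique1 (edge _ _ (cc 0) ci) (cont_comp clc cF).
have {}left := left (fun t => ltac:(by rewrite HtE /r /= !c0 H0 Fpi)) 0 1.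
have right := lift_unique1 (edge _ _ (cc 1) ci) (cont_comp clc (@shear_cont k)).
have {}right := right (fun t => ltac:(by rewrite HtE /r /= !c1 H1 dehn_twistE)) 0 1.
have hor := lift_unique1 (edge _ _ ci (cc 0)) (edge _ _ ci (cc 1)).
have {}hor := hor (fun t => ltac:(by rewrite !HtE /r /= c0 c1 l0 l1 (torus_pi_shift z hm))) 0 1.
rewrite c0 c1 l0 l1 in left right; rewrite shearD in right.
have : F (z + m) = F z + (Ht (0, 1) - Ht (0, 0)).
  have -> : Ht (0, 0) = Ht (0, 1) - F (z + m) + F z by rewrite -left subrK.
  by apply: veq; rewrite !pairE; ring.
move=> ->; congr (_ + _).
have -> : Ht (0, 1) - Ht (0, 0) = Ht (1, 1) - Ht (1, 0).
  by rewrite -[LHS]opprB -[RHS]opprB hor.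
have -> : Ht (1, 0) = Ht (1, 1) - (shear k z + shear k m) + shear k z by rewrite -right subrK.
by apply: veq; rewrite !pairE; ring.
Qed.

(** [F o G] differs from the identity by a constant, by uniqueness of lifts; subtracting it in the
    argument of [G] gives the inverse. *)
Lemma lift_inverse f g F G : cancel f g -> cancel g f -> is_lift F f -> is_lift G g ->
  exists Fi, [/\ continuous Fi, cancel F Fi & cancel Fi F].
Proof.
move=> fg gf [cF Fpi] [cG Gpi].
have cid : continuous (fun z : R * R => z) by exact: cont_id.
have h1 := lift_unique (cont_comp cG cF) cid.
have {}h1 := h1 (fun z => ltac:(by rewrite Fpi Gpi gf)).
have h2 := lift_unique (cont_comp cF cG) cid.
have {}h2 := h2 (fun z => ltac:(by rewrite Gpi Fpi fg)).
pose n := F (G 0) - 0; have FG z : F (G z) = z + n by rewrite /n -(h1 z 0) addrC subrK.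
have injF z w : F z = F w -> z = w.
  by move=> e; have := h2 z w; rewrite e => /addrI/oppr_inj.
exists (fun z => G (z - n)); split.
- by apply: cont_comp cG; apply: cont_vsub; [exact: cont_id|exact: cont_cst].
- by move=> z; apply: injF; rewrite FG subrK.
- by move=> z; rewrite FG subrK.
Qed.

Lemma periodic_bounded (phi : R * R -> R) : continuous phi ->
  (forall z m, int2 m -> phi (z + m) = phi z) -> exists C, forall z, `|phi z| <= C.
Proof.
move=> cphi per.
have : compact (phi @` (`[0%R, 1%R]%classic `*` `[0%R, 1%R]%classic)).
  by apply: continuous_compact; [exact: continuous_subspaceT|exact: square_compact].
move=> /compact_bounded [M [_ HM]]; exists (M + 1) => z.
have zE : phi z = phi (z - integer_part z).
  by rewrite per//; apply: int2N; exact: integer_part_int.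
rewrite zE; apply: (HM (M + 1)); first by rewrite ltrDl.
exists (z - integer_part z) => //; rewrite /integer_part.
have /andP[h1 h2] := floor_itv z.1; have /andP[h3 h4] := floor_itv z.2.
by rewrite !intrD in h2 h4; split; rewrite /= in_itv /=; apply/andP; lra.
Qed.

Lemma lift_bounded F k : continuous F -> (forall z m, int2 m -> F (z + m) = F z + shear k m) ->
  exists C, forall z, `|(F z).1 - z.1 - k%:~R * z.2| <= C /\ `|(F z).2 - z.2| <= C.
Proof.
move=> cF eF.
have c1 : continuous (fun z : R * R => (F z).1 - z.1 - k%:~R * z.2).
  apply: cont_sub; first by apply: cont_sub; [exact: cont_fst|exact: cfst].
  by apply: cont_mul; [exact: cont_cst|exact: csnd].
have c2 : continuous (fun z : R * R => (F z).2 - z.2).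
  by apply: cont_sub; [exact: cont_snd|exact: csnd].
have [|C1 H1] := periodic_bounded c1.
  by move=> z m hm; rewrite eF// /shear !pairE /=; ring.
have [|C2 H2] := periodic_bounded c2.
  by move=> z m hm; rewrite eF// /shear !pairE /=; ring.
exists (Num.max C1 C2) => z; split; rewrite le_max ?H1 ?H2 ?orbT//.
Qed.

End lifts.

(** * Path components of the preimage of a disk *)

Section reach.
Context {R : realType}.
Local Notation torus := (torus R).
Implicit Types (z w m : R * R).

Lemma clamp0 : clamp 0 = 0 :> R. Proof. by rewrite clamp_id ?lexx ?ler01. Qed.
Lemma clamp1 : clamp 1 = 1 :> R. Proof. by rewrite clamp_id ?lexx ?ler01. Qed.
Lemma clampK (s : R) : clamp (clamp s) = clamp s.
Proof. by rewrite clamp_id// clamp01. Qed.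
Lemma clamp_le0 (x : R) : x <= 0 -> clamp x = 0.
Proof. by move=> x0; rewrite /clamp (min_idPr _) ?(max_idPl _)// (le_trans x0). Qed.
Lemma clamp_ge1 (x : R) : 1 <= x -> clamp x = 1.
Proof. by move=> x1; rewrite /clamp (min_idPl _) ?(max_idPr _). Qed.

Lemma clamp_affine_cont (T : topologicalType) (g : R -> T) (a b : R) : continuous g ->
  continuous (fun s => g (clamp (a + b * s))).
Proof.
move=> cg; apply: cont_comp cg; apply: cont_comp (@clamp_cont R).
by apply: cont_add; [exact: cont_cst|apply: cont_mul; [exact: cont_cst|exact: cont_id]].
Qed.

Lemma path_in_cat (A : set (R * R)) g h x y z : path_in A g x y -> path_in A h y z ->
  exists k, path_in A k x z.
Proof.
move=> [cg Ag g0 g1] [ch Ah h0 h1].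
exists (fun s => g (clamp (0 + 2 * s)) + (h (clamp (- 1 + 2 * s)) - y)); split.
- apply: cont_vadd; first exact: clamp_affine_cont.
  by apply: cont_vsub; [exact: clamp_affine_cont|exact: cont_cst].
- move=> s; have [s2|s2] := leP s (1 / 2).
    by rewrite [clamp (- 1 + _)]clamp_le0 ?h0 ?subrr ?addr0//; lra.
  by rewrite clamp_ge1 ?g1 1?addrC ?subrK//; lra.
- by rewrite mulr0 !addr0 clamp0 g0 clamp_le0 ?h0 ?subrr ?addr0// lerN10.
- rewrite clamp_ge1; last by lra.
  by rewrite clamp_ge1 ?g1 ?h1 1?addrC ?subrK//; lra.
Qed.

Lemma path_in_rev (A : set (R * R)) g x y : path_in A g x y -> exists k, path_in A k y x.
Proof.
move=> [cg Ag g0 g1]; exists (fun s => g (1 - s)); split=> //.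
- by apply: cont_comp cg; apply: cont_sub; [exact: cont_cst|exact: cont_id].
- by rewrite subr0.
- by rewrite subrr.
Qed.

Lemma path_in_sub (A : set (R * R)) g x y s : path_in A g x y -> exists k, path_in A k x (g s).
Proof.
move=> [cg Ag g0 g1]; exists (fun u => g (s * u)); split=> //.
- by apply: cont_comp cg; apply: cont_mul; [exact: cont_cst|exact: cont_id].
- by rewrite mulr0.
- by rewrite mulr1.
Qed.

Lemma ball_path (A : set (R * R)) z (e : R) x y : ball z e `<=` A -> ball z e x -> ball z e y ->
  exists g, path_in A g x y.
Proof.
move=> bA bx bya; exists (fun s => x + clamp s *: (y - x)); split.
- apply: cont_vadd; first exact: cont_cst.
  by apply: cont_vscale; [exact: clamp_cont|exact: cont_cst].
- move=> s; apply: bA; move: bx bya => /ballE[x1 x2] /ballE[y1 y2]; apply/ballE.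
  have /andP[c0 c1] := clamp01 s; set c := clamp s in c0 c1 *.
  have lin (a b u : R) : `|u - a| < e -> `|u - b| < e -> `|u - (a + c * (b - a))| < e.
    move=> h1 h2; have -> : u - (a + c * (b - a)) = (1 - c) * (u - a) + c * (u - b) by ring.
    apply: le_lt_trans (ler_normD _ _) _; rewrite !normrM (ger0_norm c0) ger0_norm ?subr_ge0//.
    have : (1 - c) * `|u - a| <= (1 - c) * e by apply: ler_wpM2l; rewrite ?subr_ge0// ltW.
    have [->|cn] := eqVneq c 0; first by rewrite mul0r addr0 subr0 !mul1r.
    have : c * `|u - b| < c * e by rewrite ltr_pM2l// lt_neqAle eq_sym cn.
    lra.
  by rewrite !pairE; split; apply: lin.
- by rewrite clamp0 scale0r addr0.
- by rewrite clamp1 scale1r addrC subrK.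
Qed.

Definition reach (A : set (R * R)) z : set (R * R) := [set w | exists g, path_in A g z w].

Lemma reach_sub A z : reach A z `<=` A.
Proof. by move=> w [g [_ Ag _ <-]]. Qed.

Lemma reach_refl A z : A z -> reach A z z.
Proof. by move=> Az; exists (fun=> z); split=> //; exact: cont_cst. Qed.

Lemma reach_path A z g x y : reach A z x -> path_in A g x y -> path_in (reach A z) g x y.
Proof.
move=> [h hp] gp; have [cg _ g0 g1] := gp; split=> // s.
by have [k kp] := path_in_sub s gp; exact: path_in_cat hp kp.
Qed.

Lemma reach_pathconn A z : pathconn (reach A z).
Proof.
move=> x y [g gp] hy; have [h hp] := path_in_rev gp; have [k kp] := hy.
have [l lp] := path_in_cat hp kp; exists l; apply: reach_path lp; by exists g.
Qed.

Lemma reach_nbhs (A : set (R * R)) x : open A -> A x ->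
  exists2 e : R, 0 < e & forall y y', ball x e y -> ball x e y' -> exists g, path_in A g y y'.
Proof.
move=> oA Ax; have /nbhs_ballP[e /= e0 eA] : nbhs x A by exact: open_nbhs_nbhs.
by exists e => // y y' hy hy'; exact: ball_path eA hy hy'.
Qed.

Lemma reach_open A z : open A -> open (reach A z).
Proof.
move=> oA; rewrite openE => x hx; have [e e0 He] := reach_nbhs oA (reach_sub hx).
apply/nbhs_ballP; exists e => //= y hy; have [g gp] := He x y (ballxx _ e0) hy.
by have [h hp] := hx; exact: path_in_cat hp gp.
Qed.

Lemma unreach_open A z : open A -> open (A `\` reach A z).
Proof.
move=> oA; rewrite openE => x [Ax hx]; have [e e0 He] := reach_nbhs oA Ax.
apply/nbhs_ballP; exists e => //= y hy; split.
  by have [g [_ Ag _ <-]] := He x y (ballxx _ e0) hy.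
move=> [h hp]; apply: hx; have [g gp] := He y x hy (ballxx _ e0).
exact: path_in_cat hp gp.
Qed.

(** Inside the open set [A] both the path component and its complement are open, so a connected set
    that meets the former stays in it. *)
Lemma component_sub_reach (A : set (R * R)) z : open A -> A z ->
  connected_component A z `<=` reach A z.
Proof.
move=> oA Az w [C [Cz CA cC] Cw].
suff e : C `&` reach A z = C by move: Cw; rewrite -e => -[].
apply: cC.
- by exists z; split=> //; exact: reach_refl.
- by exists (reach A z) => //; exact: reach_open.
- exists (~` (A `\` reach A z)); first by apply: open_closedC; exact: unreach_open.
  apply/seteqP; split=> x [Cx hx]; split=> //.
    by move=> [_]; apply.
  by apply: contrapT => nx; apply: hx; split=> //; exact: CA.
Qed.

Variable D : set torus.
Hypotheses (oD : open D) (pD : path_connected D) (lD : loops_contractible D).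
Local Notation pre := (torus_pi @^-1` D).

Lemma pre_open : open pre.
Proof. exact/torus_openP. Qed.

Lemma pre_shift z m : int2 m -> pre z -> pre (z + m).
Proof. by move=> hm; rewrite /preimage /= torus_pi_shift. Qed.

(** The three sides of the square where the null-homotopy equals the base point lift to constants.
    In particular the lifted loop closes. *)
Lemma lift_contraction (g : R -> R * R) : continuous g -> (forall s, pre (g s)) ->
  torus_pi (g 0) = torus_pi (g 1) ->
  exists H : R * R -> R * R, [/\ continuous H, forall x, pre (H x),
    forall t, H (0, t) = g (clamp t), forall s, H (s, 0) = g 0 /\ H (s, 1) = g 0 & forall t, H (1, t) = g 0].
Proof.
move=> cg Dg g01; have cc : continuous (torus_pi \o g) by exact: (cont_comp cg (@torus_pi_cont R)).
have cD : (torus_pi \o g) @` `[0%R, 1%R]%classic `<=` D by move=> _ [s _ <-]; exact: Dg.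
have [H [cH HD H0 H1 Hb]] := lD (continuous_subspaceT cc) cD g01.
have ch : continuous (fun x => H (clamp2 x)) by exact: (within_retract (@clamp2_cont R) (@clamp2_in R) cH).
have in01 (t : R) : `[0%R, 1%R]%classic (clamp t) by rewrite /= in_itv /=; exact: clamp01.
have c00 : clamp2 0 = (0, 0) :> R * R by rewrite /clamp2 /= clamp0.
have i0 : `[0%R, 1%R]%classic (0 : R) by rewrite -[X in _ X]clamp0.
have i1 : `[0%R, 1%R]%classic (1 : R) by rewrite -[X in _ X]clamp1.
have e0 : torus_pi (g 0) = H (clamp2 0) by rewrite c00 H0.
have [Ht [cHt Ht0 HtE]] := lift_square ch e0.
have edge (a b : R -> R) : continuous a -> continuous b -> continuous (fun t => Ht (a t, b t)).
  by move=> ca cb; exact: (cont_comp (cont_pair ca cb) cHt).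
have cc' (a : R) : continuous (fun _ : R => a) by exact: cont_cst.
have ci : continuous (fun t : R => t) by exact: cont_id.
have cg0 : continuous (fun _ : R => g 0) by exact: cont_cst.
have L t : Ht (0, t) = g (clamp t).
  have left := lift_unique1 (edge _ _ (cc' 0) ci) (cont_comp (@clamp_cont R) cg).
  have {}left := left (fun s => ltac:(by rewrite HtE /clamp2 /= !clamp0 clampK H0)) t 0.
  move: left; rewrite clamp0 (_ : Ht (0, 0) = g 0)// subrr => /eqP.
  by rewrite subr_eq0 => /eqP.
have B s : Ht (s, 0) = g 0.
  have bot := lift_unique1 (edge _ _ ci (cc' 0)) cg0.
  have {}bot := bot (fun s => ltac:(by rewrite HtE /clamp2 /= !clamp0 clampK; case: (Hb _ (in01 s)) => -> _)) s 0.
  move: bot; rewrite (_ : Ht (0, 0) = g 0)// subrr => /eqP.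
  by rewrite subr_eq0 => /eqP.
have Rt t : Ht (1, t) = g 0.
  have rt := lift_unique1 (edge _ _ (cc' 1) ci) cg0.
  have {}rt := rt (fun s => ltac:(by rewrite HtE /clamp2 /= !clamp1 clampK H1)) t 0.
  by move: rt; rewrite B subrr => /eqP; rewrite subr_eq0 => /eqP.
have T s : Ht (s, 1) = g 0.
  have top := lift_unique1 (edge _ _ ci (cc' 1)) cg0.
  have {}top := top (fun s => ltac:(by rewrite HtE /clamp2 /= !clamp1 clampK; case: (Hb _ (in01 s)) => _ ->)) s 1.
  by move: top; rewrite Rt subrr => /eqP; rewrite subr_eq0 => /eqP.
exists Ht; split=> // x; rewrite /preimage /= HtE; apply: HD.
by exists (clamp2 (clamp2 x)) => //; exact: clamp2_in.
Qed.

Lemma reach_disjoint a z m : int2 m -> reach pre a z -> reach pre a (z + m) -> m = 0.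
Proof.
move=> hm hz hzm; have [g gp] := reach_pathconn hz hzm; have [cg Dg g0 g1] := gp.
have e : torus_pi (g 0) = torus_pi (g 1) by rewrite g0 g1 torus_pi_shift.
have [H [_ _ HL Hb _]] := lift_contraction cg (fun s => reach_sub (Dg s)) e.
have := (Hb 0).2; rewrite HL clamp1 g0 g1 => /eqP.
by rewrite -subr_eq0 addrAC subrr add0r => /eqP.
Qed.

(** The loop formed by [g] and the reverse of [h] is contracted, and the square is then
    reparametrised so that each half of the loop becomes one edge. *)
Lemma reach_paths_homotopic z0 : paths_homotopic (reach pre z0).
Proof.
move=> a b g h gp hp; have [cg Dg g0 g1] := gp; have [ch Dh h0 h1] := hp.
pose l (t : R) := g (clamp (0 + 2 * t)) + (h (clamp (2 + (- 2) * t)) - b).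
have cl : continuous l.
  apply: cont_vadd; first exact: clamp_affine_cont.
  by apply: cont_vsub; [exact: clamp_affine_cont|exact: cont_cst].
have lL t : t <= 1 / 2 -> l t = g (clamp (2 * t)).
  by move=> t2; rewrite /l add0r [clamp (2 + _)]clamp_ge1 ?h1 ?subrr ?addr0//; lra.
have lR t : 1 / 2 <= t -> l t = h (clamp (2 - 2 * t)).
  by move=> t2; rewrite /l clamp_ge1 ?g1 1?addrC ?subrK// ?mulNr//; lra.
have Dl t : pre (l t).
  have [t2|t2] := leP t (1 / 2); first by rewrite lL//; exact: reach_sub (Dg _).
  by rewrite lR ?ltW//; exact: reach_sub (Dh _).
have l0 : l 0 = a by rewrite lL ?divr_ge0// mulr0 clamp0.
have l1 : l 1 = a by rewrite lR ?mulr1 ?subrr ?clamp0//; lra.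
have [H [cH DH HL Hb HR]] := lift_contraction cl Dl (congr1 _ (etrans l0 (esym l1))).
rewrite l0 in Hb HR.
have EH x : reach pre z0 (H x).
  have za : reach pre z0 a by rewrite -g0; exact: Dg.
  have [k kp] := za; suff [k' kp'] : exists k', path_in pre k' a (H x) by exact: path_in_cat kp kp'.
  exists (fun u => H (u *: x)); split=> //.
  - by apply: cont_comp cH; apply: cont_vscale; [exact: cont_id|exact: cont_cst].
  - by rewrite scale0r (Hb 0).1.
  - by rewrite scale1r.
(* Sends the bottom edge to the half of the loop running along [g], the top edge to the half running
   along [h], the right edge to the midpoint over [b], and the left edge around the three sides
   where [H] is constantly [a]. *)
pose psi (x : R * R) : R * R :=
  ((1 - x.1) * clamp (Num.min (3 * x.2) (3 - 3 * x.2)), x.1 / 2 + (1 - x.1) * clamp (3 * x.2 - 1)).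
have cpsi : continuous psi.
  have c1 : continuous (fun x : R * R => 1 - x.1) by apply: cont_sub; [exact: cont_cst|exact: cfst].
  have c3 : continuous (fun x : R * R => 3 * x.2) by apply: cont_mul; [exact: cont_cst|exact: csnd].
  apply: (cont_pair (f := fun x : R * R => (1 - x.1) * clamp (Num.min (3 * x.2) (3 - 3 * x.2)))).
    apply: cont_mul => //; apply: cont_comp (@clamp_cont R) => x.
    apply: (@continuous_min R _ (fun x : R * R => 3 * x.2) (fun x : R * R => 3 - 3 * x.2)); first exact: c3.
    by apply: cont_sub => //; exact: cont_cst.
  apply: cont_add; first by apply: cont_mul; [exact: cfst|exact: cont_cst].
  apply: cont_mul => //; apply: cont_comp (@clamp_cont R).
  by apply: cont_sub => //; exact: cont_cst.
have psi0 s : psi (s, 0) = (0, s / 2).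
  have e2 : Num.min (3 * 0) (3 - 3 * 0) = 0 :> R by rewrite mulr0 subr0 (min_idPl _).
  have e3 : clamp (3 * 0 - 1) = 0 :> R by apply: clamp_le0; lra.
  by rewrite /psi /= e2 e3 clamp0 !mulr0 addr0.
have psi1 s : psi (s, 1) = (0, 1 - s / 2).
  have e1 : 3 - 3 * 1 = 0 :> R by lra.
  have e2 : Num.min (3 * 1) (3 - 3 * 1) = 0 :> R by rewrite e1 mulr1 (min_idPr _).
  have e3 : clamp (3 * 1 - 1) = 1 :> R by apply: clamp_ge1; lra.
  by rewrite /psi /= e2 e3 clamp0 !mulr0 mulr1; congr pair; field.
exists (fun x => H (psi x)); split.
- exact: cont_comp cpsi cH.
- by move=> s t _ _; exact: EH.
- move=> s s01; have /andP[s0 s1] := s01; rewrite psi0 psi1 !HL; split.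
    rewrite clamp_id ?lL; [|lra|lra]; congr (g _); rewrite clamp_id; [by field|].
    by have -> : 2 * (s / 2) = s by field.
  rewrite clamp_id ?lR; [|lra|lra]; congr (h _).
  by have -> : 2 - 2 * (1 - s / 2) = s by [field|]; rewrite clamp_id.
- move=> t /andP[t0 t1]; split; last first.
    have -> : psi (1, t) = (0, 1 / 2) by rewrite /psi /= subrr !mul0r addr0.
    rewrite HL clamp_id ?lL; [|lra|lra].
    by have -> : 2 * (1 / 2) = 1 :> R by [field|]; rewrite clamp1 g1.
  have [t3|t3] := leP t (1 / 3).
    have -> : psi (0, t) = (clamp (Num.min (3 * t) (3 - 3 * t)), 0).
      by rewrite /psi /= subr0 !mul1r mul0r add0r [clamp (_ - 1)]clamp_le0//; lra.
    by rewrite (Hb _).1.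
  have [t4|t4] := leP t (2 / 3).
    have -> : psi (0, t) = (1, clamp (3 * t - 1)).
      rewrite /psi /= subr0 !mul1r mul0r add0r clamp_ge1// le_min; apply/andP; lra.
    by rewrite HR.
  have -> : psi (0, t) = (clamp (Num.min (3 * t) (3 - 3 * t)), 1).
    by rewrite /psi /= subr0 !mul1r mul0r add0r [clamp (_ - 1)]clamp_ge1//; lra.
  by rewrite (Hb _).2.
Qed.

Lemma reach_translate z w : pre z -> pre w -> exists2 m, int2 m & reach pre z (w + m).
Proof.
move=> Dz Dw; have [c [cc cD c0 c1]] := pD Dz Dw.
have in01 (t : R) : `[0%R, 1%R]%classic (clamp t) by rewrite /= in_itv /=; exact: clamp01.
have ccl : continuous (fun s => c (clamp s)) by exact: (within_retract (@clamp_cont R) in01 cc).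
have e0 : torus_pi z = c (clamp 0) by rewrite clamp0 c0.
have [C [cC C0 CE]] := lift_path ccl e0.
have DC s : pre (C s).
  by rewrite /preimage /= CE; apply: cD; exists (clamp (clamp s)).
exists (C 1 - w).
  by apply/torus_pi_eq; rewrite CE !clamp1 c1.
by exists C; rewrite addrC subrK.
Qed.

End reach.

(** * Recurrence of area-preserving maps *)

Section recurrence.
Context {R : realType}.
Local Notation torus := (torus R).
Local Notation leb2 := ((@lebesgue_measure R) \x (@lebesgue_measure R))%E.
Local Notation borelR := (g_sigma_algebraType (R.-ocitv.-measurable)).
Local Notation measurable2 := (@measurable _ (borelR * borelR)%type).

(** A countable union of boxes with rational corners; a box not inside [U] contributes the empty
    set, which keeps the index type simple. *)
Lemma open_measurable2 (U : set (R * R)) : open U -> measurable2 U.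
Proof.
move=> oU.
pose box (q : rat * rat * rat * rat) : set (R * R) :=
  `]ratr q.1.1.1 : R, ratr q.1.1.2 : R[%classic `*` `]ratr q.1.2 : R, ratr q.2 : R[%classic.
have -> : U = \bigcup_q (box q `&` [set _ | box q `<=` U]).
  apply/seteqP; split=> [z Uz|z [q _ [bz /(_ _ bz)]]] //.
  have /nbhs_ballP[e /= e0 He] : nbhs z U by exact: open_nbhs_nbhs.
  have pick (x : R) : exists2 a : rat, (x - e < ratr a :> R) & (ratr a < x :> R).
    have /rat_in_itvoo[a] : x - e < x by rewrite ltrBlDr ltrDl.
    by rewrite in_itv /= => /andP[? ?]; exists a.
  have pick' (x : R) : exists2 a : rat, (x < ratr a :> R) & (ratr a < x + e :> R).
    have /rat_in_itvoo[a] : x < x + e by rewrite ltrDl.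
    by rewrite in_itv /= => /andP[? ?]; exists a.
  have [a a1 a2] := pick z.1; have [b b1 b2] := pick' z.1.
  have [c c1 c2] := pick z.2; have [d d1 d2] := pick' z.2.
  exists (a, b, c, d) => //; split.
    by split; rewrite /= in_itv /=; apply/andP.
  move=> w [/=]; rewrite !in_itv /= => /andP[? ?] /andP[? ?].
  by apply: He; apply/ballE; rewrite !ltr_norml; split; apply/andP; lra.
apply: countable_bigcupT_measurable => [|q]; first exact: countableP.
have [h|h] := pselect (box q `<=` U).
  have -> : box q `&` [set _ | box q `<=` U] = box q by apply/seteqP; split=> [? []|].
  by apply: measurableX; exact: measurable_itv.
have -> : box q `&` [set _ | box q `<=` U] = set0 by apply/seteqP; split=> [? []|].
exact: measurable0.
Qed.

Let unit_sq : set (R * R) := `[0, 1[%classic `*` `[0, 1[%classic.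

Let unit_sq_measurable : measurable2 unit_sq.
Proof. by apply: measurableX; exact: measurable_itv. Qed.

Lemma torus_open_measurable (A : set torus) : open A -> measurable2 (torus_pi @^-1` A `&` unit_sq).
Proof. by move=> oA; apply: measurableI => //; apply: open_measurable2; exact/torus_openP. Qed.

Lemma box_area (a b c d : R) : a < b -> c < d ->
  (leb2 (`[a, b[%classic `*` `[c, d[%classic) = ((b - a) * (d - c))%:E)%E.
Proof.
have leb_co (x y : R) : x < y -> @lebesgue_measure R [set` `[x, y[] = (y - x)%:E.
  by move=> xy; rewrite lebesgue_measure_itv /= lte_fin xy.
move=> ab cd; rewrite EFinM -(leb_co _ _ ab) -(leb_co _ _ cd).
by apply: product_measure1E; exact: measurable_itv.
Qed.

Lemma torus_area_le1 (A : set torus) : open A -> (torus_area A <= 1)%E.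
Proof.
move=> oA; have -> : (1 = leb2 unit_sq)%E.
  by rewrite /unit_sq box_area// subr0 mulr1.
apply: le_measure; rewrite ?inE//; exact: torus_open_measurable.
Qed.

Lemma torus_area_gt0 (A : set torus) : open A -> A !=set0 -> (0 < torus_area A)%E.
Proof.
move=> oA [t At]; have [z0 z0t] := torus_pi_surj t.
pose fl (x : R) : R := (Num.floor x)%:~R.
pose z := (z0.1 - fl z0.1, z0.2 - fl z0.2).
have zt : torus_pi z = t.
  rewrite -z0t; apply/torus_pi_eq; split; rewrite /z /= addrAC subrr add0r rpredN; exact: intr_int.
have fl01 (x : R) : 0 <= x - fl x < 1.
  by rewrite subr_ge0 floor_le ltrBlDl -[X in _ < X]intrD1 floorD1_gt.
have /andP[z10 z11] : 0 <= z.1 < 1 by exact: fl01.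
have /andP[z20 z21] : 0 <= z.2 < 1 by exact: fl01.
clearbody z.
have /nbhs_ballP[e /= e0 He] : nbhs z (torus_pi @^-1` A).
  by apply: open_nbhs_nbhs; split; [exact/torus_openP|rewrite /= zt].
pose d := Num.min e (Num.min (1 - z.1) (1 - z.2)).
have d0 : 0 < d by rewrite !lt_min e0 !subr_gt0 z11.
have de : d <= e by rewrite ge_min lexx.
have dz1 : d <= 1 - z.1 by rewrite !ge_min lexx orbT.
have dz2 : d <= 1 - z.2 by rewrite !ge_min lexx !orbT.
pose B : set (R * R) := `[z.1, z.1 + d[%classic `*` `[z.2, z.2 + d[%classic.
have mB : measurable2 B by apply: measurableX; exact: measurable_itv.
apply: (@lt_le_trans _ _ (leb2 B)).
  by rewrite box_area ?ltrDl// lte_fin !(addrAC _ d) !subrr !add0r mulr_gt0.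
apply: le_measure; rewrite ?inE//; first exact: torus_open_measurable.
move=> w [/=]; rewrite !in_itv /= => /andP[? ?] /andP[? ?]; split.
  by apply: He; apply/ballE; rewrite !ltr_norml; split; apply/andP; split; lra.
split; apply/andP; split; lra.
Qed.

Lemma area_preserving_iter (f : torus -> torus) B n : continuous f -> area_preserving f -> open B ->
  open (iter n f @^-1` B) /\ torus_area (iter n f @^-1` B) = torus_area B.
Proof.
move=> cf af oB; elim: n => [//|n [oI aI]].
have -> : iter n.+1 f @^-1` B = f @^-1` (iter n f @^-1` B).
  by apply/seteqP; split=> x; rewrite /preimage /= -iterSr.
split; first by move/continuousP: cf; apply.
by rewrite af// -?aI//; apply: sub_gen_smallest.
Qed.

(* Otherwise the preimages of B under the iterates of f^N would be pairwise
   disjoint sets of the same positive area. *)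
Lemma area_recurrence (f : torus -> torus) (B : set torus) (N : nat) :
  continuous f -> area_preserving f -> open B -> B !=set0 -> (0 < N)%N ->
  exists i x, [/\ (0 < i)%N, B x & B (iter (i * N) f x)].
Proof.
move=> cf af oB Bn N0; apply: contrapT => no.
pose A i := iter (i * N) f @^-1` B.
have a0 := torus_area_gt0 oB Bn.
have a1 := torus_area_le1 oB.
have afin : torus_area B \is a fin_num by rewrite ge0_fin_numE ?(ltW a0)// (le_lt_trans a1)// ltry.
have aE := fineK afin; move: a0; rewrite -aE lte_fin; set a := fine _ => a0.
pose S i := torus_pi @^-1` (A i) `&` unit_sq.
have oA i : open (A i) by apply: (area_preserving_iter _ _ _ _).1.
have mS i : measurable2 (S i) by exact: torus_open_measurable.
have SE i : (leb2 (S i) = a%:E)%E.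
  by rewrite aE; exact: (area_preserving_iter _ cf af oB).2.
have tS : trivIset setT S.
  (* A common point would have its image under [iter (i * N) f] in [B], returning there after
     [(j - i) * N] steps. *)
  have half i j z : (i < j)%N -> S i z -> S j z -> False.
    move=> ij [Ai _] [Aj _]; apply: no; exists (j - i)%N, (iter (i * N) f (torus_pi z)).
    by split=> //; rewrite ?subn_gt0// -iterD -mulnDl subnK // ltnW.
  move=> i j _ _ [z [Si Sj]]; apply/eqP; case: ltngtP => // ij; exfalso; [exact: (half _ _ _ ij Si Sj)|exact: (half _ _ _ ij Sj Si)].
have key n : n%:R * a <= 1.
  have : (leb2 (\big[setU/set0]_(k < n) S k) <= 1)%E.
    have -> : \big[setU/set0]_(k < n) S k = torus_pi @^-1` (\bigcup_(k in `I_n) A k) `&` unit_sq.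
      rewrite -bigcup_mkord; apply/seteqP; split=> [z [k kn [? ?]]|z [[k kn ?] ?]].
        by split=> //; exists k.
      by exists k.
    by apply: torus_area_le1; apply: bigcup_open => i _; exact: oA.
  rewrite measure_semi_additive_ord_I//.
  - rewrite (eq_bigr (fun=> a%:E)) => [|i _]; last exact: SE.
    by rewrite sumEFin sumr_const card_ord lee_fin mulr_natl.
  - exact: sub_trivIset tS.
  - by apply: bigsetU_measurable => i _; exact: mS.
have [n /ltW hn] : exists n : nat, a^-1 + 1 < n%:R.
  by exists (Num.truncn (a^-1 + 1)).+1; exact: truncnS_gt.
have := key n; have := mulVf (lt0r_neq0 a0); nra.
Qed.

End recurrence.

(** * Periodic disks *)

Section disk.
Context {R : realType}.

Lemma nrm_cont : continuous (@nrm R).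
Proof.
apply: cont_comp (@sqrt_continuous R).
by apply: cont_add; apply: cont_mul; first [exact: cfst|exact: csnd].
Qed.

Local Notation torus := (torus R).
Variables (f : torus -> torus) (F Fi : R * R -> R * R) (k : int).
Hypotheses (contf : continuous f) (injf : injective f) (areaf : area_preserving f).
Hypothesis contF : continuous F.
Hypotheses (FK : cancel F Fi) (FiK : cancel Fi F).
Hypothesis liftF : forall z, torus_pi (F z) = f (torus_pi z).
Hypothesis equivF : forall z m, int2 m -> F (z + m) = F z + shear k m.
Variable a : R * R -> R * R.
Hypothesis cases : (k = 0 /\ a = id) \/ (k != 0 /\ a = vertical).
Variables (rho0 : R * R) (del : R).
Hypotheses (del0 : 0 < del) (rotF : rotation_ball F a rho0 del).

Let aD z w : a (z + w) = a z + a w.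
Proof. by case: cases => [[_ ->]|[_ ->]] //; apply: veq; rewrite !pairE //= addr0. Qed.

Let aN z : a (- z) = - a z.
Proof. by case: cases => [[_ ->]|[_ ->]] //; apply: veq; rewrite !pairE //= oppr0. Qed.

Let aZ c z : a (c *: z) = c *: a z.
Proof. by case: cases => [[_ ->]|[_ ->]] //; apply: veq; rewrite !pairE //= mulr0. Qed.

Let aa z : a (a z) = a z.
Proof. by case: cases => [[_ ->]|[_ ->]]. Qed.

Let a_shear (j : int) m : a (shear (k * j) m) = a m.
Proof.
case: cases => [[-> ->]|[_ ->]]; apply: veq => //=.
by rewrite mul0r mulr0z mul0r addr0.
Qed.

Let a_short z w : nrm (a z - a w) <= nrm (z - w).
Proof. by case: cases => [[_ ->]|[_ ->]]; [exact: lexx|exact: vertical_short]. Qed.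

Let a_cont : continuous a.
Proof.
case: cases => [[_ ->]|[_ ->]]; first exact: cont_id.
by apply: cont_pair; [exact: cont_cst|exact: csnd].
Qed.

Lemma shearNK (j : int) (m : R * R) : shear j (shear (- j) m) = m.
Proof. by rewrite shear_comp subrr; apply: veq; rewrite //= mulr0z mul0r addr0. Qed.

Lemma iter_shear j z m : int2 m -> iter j F (z + m) = iter j F z + shear (k * j) m.
Proof.
move=> hm; elim: j => [|j IH]; first by rewrite mulr0; apply: veq; rewrite !pairE //= mulr0z mul0r addr0.
rewrite !iterS IH equivF; last exact: shear_int.
by rewrite shear_comp; congr (_ + shear _ _); rewrite -addn1 PoszD; ring.
Qed.

Lemma iter_lift j z : torus_pi (iter j F z) = iter j f (torus_pi z).
Proof. by elim: j => //= j <-. Qed.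

Lemma iter_cont j : continuous (iter j F).
Proof. by elim: j => [|j IH]; [exact: cont_id|exact: cont_comp IH contF]. Qed.

Let bound : exists C, forall z, nrm (a (F z) - a z) <= C.
Proof.
have [C HC] := lift_bounded contF equivF.
case: cases => [[k0 ->]|[_ ->]]; last by exists C; exact: vertical_step HC.
exists (C + C) => z; apply: le_trans (nrm_le_sum _) _; have [h1 h2] := HC z.
by rewrite k0 mulr0z mul0r subr0 in h1; rewrite !pairE lerD.
Qed.

Let spread : exists C, 0 <= C /\
  forall x y, nrm (F x - F y) <= (1 + `|k%:~R|) * nrm (x - y) + C.
Proof.
have [C HC] := lift_bounded contF equivF.
have C0 : 0 <= C by apply: le_trans (HC 0).2.
exists (4 * C); split; first by rewrite mulr_ge0.
move=> x y; have [x1 x2] := HC x; have [y1 y2] := HC y.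
set u := F x - shear k x; set v := F y - shear k y.
have uC : nrm u <= 2 * C.
  apply: le_trans (nrm_le_sum _) _; rewrite /u !pairE /= opprD addrA; lra.
have vC : nrm v <= 2 * C.
  apply: le_trans (nrm_le_sum _) _; rewrite /v !pairE /= opprD addrA; lra.
have -> : F x - F y = ((x - y) + (k%:~R * (x - y).2, 0)) + (u - v).
  by apply: veq; rewrite /u /v !pairE /= ?pairE; ring.
have h : nrm (k%:~R * (x - y).2, 0) <= `|k%:~R : R| * nrm (x - y).
  apply: le_trans (nrm_le_sum _) _; rewrite /= normr0 addr0 normrM.
  by apply: ler_wpM2l => //; exact: (nrm_snd (x - y)).
apply: le_trans (nrmD _ _) _; have := nrmD (x - y) (k%:~R * (x - y).2, 0); have := nrmB u v; lra.
Qed.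

Let iter_spread n (l : R) : exists l', forall r x y, (r <= n)%N -> nrm (x - y) <= l ->
  nrm (iter r F x - iter r F y) <= l'.
Proof.
have [C [C0 HC]] := spread.
elim: n => [|n [l' IH]]; first by exists l => r x y; rewrite leqn0 => /eqP ->.
have l0' : 0 <= `|l'| by [].
exists ((1 + `|k%:~R : R|) * `|l'| + C + `|l'|) => r x y.
have kp : 0 <= `|k%:~R : R| by [].
rewrite leq_eqVlt => /orP[/eqP -> |rn] h.
  rewrite !iterS; apply: le_trans (HC _ _) _.
  have h2 : nrm (iter n F x - iter n F y) <= `|l'| by apply: le_trans (IH n x y (leqnn n) h) (ler_norm _).
  have := ler_wpM2l (addr_ge0 ler01 kp) h2; lra.
have h2 := le_trans (IH r x y rn h) (ler_norm _); have := mulr_ge0 (addr_ge0 ler01 kp) l0'; lra.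
Qed.

Variables (D : set torus) (n : nat).
Hypotheses (oD : open D) (pD : path_connected D) (lD : loops_contractible D).
Hypotheses (n0 : (0 < n)%N) (fD : iter n f @` D = D).
Local Notation pre := (torus_pi @^-1` D).
Variable z0 : R * R.
Hypothesis Dz0 : pre z0.
Local Notation E := (reach pre z0).

Let pre_F z : pre (iter n F z) <-> pre z.
Proof.
rewrite /preimage /= iter_lift; split=> h; last by rewrite -fD; exists (torus_pi z).
move: h; rewrite -[X in X (iter n f _)]fD => -[x Dx e].
suff inj : injective (iter n f) by rewrite -(inj _ _ e).
by elim: (n) => [|j IH] // u v /= /injf; exact: IH.
Qed.

Lemma return_shift : exists2 m, int2 m & E (iter n F z0 + m).
Proof. by apply: (reach_translate pD) => //; exact: (pre_F z0).2. Qed.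

Variable m0 : R * R.
Hypotheses (int_m0 : int2 m0) (E_m0 : E (iter n F z0 + m0)).
(** The lift of the [n]-th iterate of [f] that preserves the component [E]. *)
Let G z := iter n F z + m0.
Let Gi w := iter n Fi (w - m0).

Let GK : cancel G Gi.
Proof.
move=> z; rewrite /G /Gi addrK; elim: (n) => // j IH.
by rewrite iterSr iterS FK.
Qed.

Let GiK : cancel Gi G.
Proof.
move=> z; rewrite /G /Gi -[RHS](subrK m0); congr (_ + _).
by elim: (n) => // j IH; rewrite iterSr iterS FiK.
Qed.

Let contG : continuous G.
Proof. by apply: cont_vadd; [exact: iter_cont|exact: cont_cst]. Qed.

Let equivG z m : int2 m -> G (z + m) = G z + shear (k * n) m.
Proof. by move=> hm; rewrite /G iter_shear// addrAC. Qed.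

Let E_G z : E z -> E (G z).
Proof.
move=> [g [cg gA g0 g1]]; have [h hp] := E_m0.
have p : path_in pre (fun s => G (g s)) (iter n F z0 + m0) (G z).
  split; first by apply: cont_comp cg contG.
  - by move=> s; apply: pre_shift => //; exact: (pre_F _).2.
  - by rewrite g0.
  - by rewrite g1.
exact: path_in_cat hp p.
Qed.

(** Some translate [z + m] lies in [E]; its image is the translate of [G z] by a sheared integer
    vector, and disjointness from translates makes this vector, hence [m], zero. *)
Let E_Gi z : E (G z) -> E z.
Proof.
move=> h; have pG := reach_sub h.
have pz : pre z.
  apply/pre_F; rewrite -(addrK m0 (iter n F z)); apply: pre_shift pG; exact: int2N.
have [m hm Em] := reach_translate pD Dz0 pz.
have := E_G Em; rewrite equivG// => h2.
have := reach_disjoint lD (shear_int _ hm) h h2 => /shear_inj m00.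
by rewrite m00 addr0 in Em.
Qed.

Let iter_G T : exists m, [/\ int2 m, a m = T%:R *: a m0 & forall z, iter T G z = iter (T * n) F z + m].
Proof.
elim: T => [|T [m [hm am IH]]].
  exists 0; split=> [||z]; [exact: int2_0| |by rewrite addr0].
  by rewrite -{1}(scale0r m0) aZ.
exists (shear (k * n) m + m0); split=> [||z].
- by apply: int2D => //; exact: shear_int.
- by rewrite aD a_shear am -natr1 scalerDl scale1r.
- by rewrite iterS IH equivG// /G -iterD -mulSn -addrA [m0 + _]addrC addrA.
Qed.

(** Recurrence on the torus is applied with period [N.+1 * n]. The lifted return agrees with a point
    of [V] up to an integer vector, which vanishes because both points lie in [E]. *)
Let E_returns (V : set (R * R)) : open V -> V !=set0 -> V `<=` E ->
  forall N : nat, exists T z, [/\ (N <= T)%N, V z & V (iter T G z)].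
Proof.
move=> oV [v0 Vv0] VE N.
have [i [x [i0 [v Vv vx]]]] : exists i x, [/\ (0 < i)%N, (torus_pi @` V) x &
    (torus_pi @` V) (iter (i * (N.+1 * n)) f x)].
  apply: area_recurrence; rewrite ?muln_gt0 ?n0 //; first exact: torus_pi_open.
  by exists (torus_pi v0), v0.
rewrite -vx mulnA => -[u Vu uE].
have [m [hm _ mE]] := iter_G (i * N.+1).
exists (i * N.+1)%N, v; split=> //.
  by apply: leq_trans (leqnSn N) _; rewrite leq_pmull.
have Ev : E (iter (i * N.+1) G v).
  by elim: (i * N.+1)%N => [|j IH]; [exact: VE|exact: E_G].
have /torus_pi_eq hd : torus_pi (iter (i * N.+1) G v) = torus_pi u.
  by rewrite mE torus_pi_shift// iter_lift uE.
have d0 : iter (i * N.+1) G v - u = 0.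
  by apply: (reach_disjoint lD hd (VE _ Vu)); rewrite addrC subrK.
by move/eqP: d0; rewrite subr_eq0 => /eqP ->.
Qed.

(** Velocities of [G] are [n] times those of [F] shifted by [a m0], so the ball is scaled by [n];
    steps that do not fill a period only change the additive constant. *)
Let rotG : rotation_ball G a (n%:R *: rho0 + a m0) (n%:R * del).
Proof.
have [C HC] := bound; have nR : 0 < n%:R :> R by rewrite ltr0n.
have C0 : 0 <= C := le_trans (nrm_ge0 _) (HC 0).
have [r0 rF] := rotF; split; first by rewrite aD aZ r0 aa.
move=> c rho ac gr; have rho_ge0 := grows_ge0 gr; have [K HK] := gr.
pose c' := n%:R^-1 *: (c - a m0).
have ncE : n%:R *: c' = c - a m0 by rewrite scalerA divff ?scale1r// lt0r_neq0.
have gr' : grows F a c' (rho / n%:R).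
  exists (K + (C + nrm c') * n%:R) => N z.
  rewrite (divn_eq N n); set j := (N %/ n)%N; set r := (N %% n)%N.
  have rn : (r <= n)%N by rewrite ltnW// ltn_mod.
  have [m [hm am mE]] := iter_G j.
  have dj : disp F a (j * n) z - (j * n)%:R *: c' = disp G a j z - j%:R *: c.
    rewrite /disp mE aD am natrM -scalerA ncE scalerBr.
    by apply: veq; rewrite !pairE; ring.
  rewrite addnC dispD natrD scalerDl.
  have -> : disp F a r (iter (j * n) F z) + disp F a (j * n) z - (r%:R *: c' + (j * n)%:R *: c') =
    (disp F a r (iter (j * n) F z) - r%:R *: c') + (disp G a j z - j%:R *: c).
    by rewrite -dj; apply: veq; rewrite !pairE; ring.
  apply: le_trans (nrmD _ _) _.
  have h1 := disp_sub_le HC r (iter (j * n) F z) c'.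
  have h2 := HK j z.
  have h3 : (C + nrm c') * r%:R <= (C + nrm c') * n%:R.
    by apply: ler_wpM2l; rewrite ?ler_nat// addr_ge0 ?nrm_ge0.
  have h4 : rho / n%:R * (r%:R + (j * n)%:R) = rho / n%:R * r%:R + rho * j%:R.
    by rewrite natrM; field; exact: lt0r_neq0.
  have h5 : 0 <= rho / n%:R * r%:R by rewrite mulr_ge0 ?divr_ge0 ?ler0n.
  by rewrite h4; lra.
have ac' : a c' = c' by rewrite aZ aD aN ac aa.
have := rF _ _ ac' gr'; rewrite ler_pdivlMr// mulrDl.
have -> : n%:R *: rho0 + a m0 - c = n%:R *: (rho0 - c').
  by rewrite scalerBr ncE; apply: veq; rewrite !pairE; ring.
by rewrite nrmZ ger0_norm ?ler0n// [nrm _ * _]mulrC [del * _]mulrC.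
Qed.

Let E_bounded : exists l, forall z, E z -> nrm (z - z0) <= l.
Proof.
have [C HC] := lift_bounded contG equivG.
have ndel : 0 < n%:R * del by rewrite mulr_gt0 ?ltr0n.
have Ez0 := reach_refl Dz0.
have oE : open E by apply: reach_open; exact: pre_open.
have pE := @reach_pathconn _ pre z0.
have hE : paths_homotopic E by exact: reach_paths_homotopic.
have dE z m : m.1 \is a Num.int -> m.2 \is a Num.int -> E z -> E (z + m) -> m = 0.
  by move=> m1 m2; apply: (reach_disjoint lD); split.
have rG := rotG.
case: cases => [[k0 aE]|[k0 aE]]; rewrite aE in rG.
  have kn : (k * n)%:~R = 0 :> R by rewrite k0 mul0r.
  have stepG z : nrm (id (G z) - id z) <= C + C.
    apply: le_trans (nrm_le_sum _) _; have [h1 h2] := HC z.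
    by rewrite kn mul0r subr0 in h1; rewrite !pairE lerD.
  have eG z m : m.1 \is a Num.int -> m.2 \is a Num.int -> G (z + m) = G z + m.
    move=> m1 m2; rewrite equivG//; congr (_ + _).
    by apply: veq; rewrite //= kn mul0r addr0.
  exact: (returning_bounded_id contG GK GiK stepG eG oE pE hE E_G E_Gi dE E_returns ndel rG Ez0).
have kn0 : k * n != 0 by rewrite mulf_neq0// -lt0n.
have eG z m : m.1 \is a Num.int -> m.2 \is a Num.int ->
  G (z + m) = G z + (m.1 + (k * n)%:~R * m.2, m.2) by move=> m1 m2; rewrite equivG.
exact: (returning_bounded_dehn contG GK GiK kn0 HC eG oE pE hE E_G E_Gi dE E_returns ndel rG Ez0).
Qed.

Let iterz_G (q : int) : exists m, forall z, iterz F Fi (q * n) z = iterz G Gi q z + m /\ int2 m.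
Proof.
have stepn (t : int) z : iterz F Fi (t + n) z = iter n F (iterz F Fi t z).
  by rewrite (addrC t) (iterzD FK FiK).
elim/int_ind: q => [|q [m IH]|q [m IH]].
- by exists 0 => z; split; [rewrite mul0r addr0|exact: int2_0].
- exists (shear (k * n) m - m0) => z; have [e hm] := IH z; split; last by apply: int2B => //; exact: shear_int.
  have -> : q.+1%:Z * n = q%:Z * n + n by rewrite -addn1 PoszD; ring.
  rewrite stepn e iter_shear//.
  have -> : q.+1%:Z = q%:Z + 1 by rewrite -addn1 PoszD.
  by rewrite (iterzS GiK) /G; apply: veq; rewrite !pairE; ring.
- exists (shear (- (k * n)) (m0 + m)) => z; have [e hm] := IH z.
  have hm' : int2 (shear (- (k * n)) (m0 + m)) by apply: shear_int; exact: int2D.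
  split=> //.
  have inj : injective (iter n F).
    by elim: (n) => [|j IHj] // u v /= /(can_inj FK); exact: IHj.
  apply: inj; rewrite iter_shear// -stepn.
  have -> : - q.+1%:Z * n + n = - q%:Z * n by rewrite -addn1 PoszD; ring.
  rewrite e shearNK.
  have -> : iterz G Gi (- q%:Z) z = G (iterz G Gi (- q.+1%:Z) z).
    by rewrite -(iterzS GiK); congr (iterz _ _ _ _); rewrite -addn1 PoszD; ring.
  by rewrite /G addrA.
Qed.

Lemma component_orbit_bounded : exists l, forall t z w, E z -> E w ->
  nrm (iterz F Fi t z - iterz F Fi t w) <= l.
Proof.
have [l0 Hl] := E_bounded.
have [l Hl'] := iter_spread n (l0 + l0).
exists l => t z w Ez Ew.
pose q := (t %/ n)%Z; pose r := `|(t %% n)%Z|%N.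
have nz : n%:Z != 0 by rewrite -lt0n.
have rE : r%:Z = (t %% n)%Z by rewrite /r gez0_abs// modz_ge0.
have rn : (r <= n)%N by rewrite -lez_nat rE ltW// ltz_pmod.
have -> : t = r%:Z + q * n by rewrite rE addrC -divz_eq.
rewrite !(iterzD FK FiK); apply: Hl' => //.
have [m Hm] := iterz_G q; rewrite (Hm z).1 (Hm w).1.
have -> (x y : R * R) : x + m - (y + m) = (x - z0) - (y - z0) by apply: veq; rewrite !pairE; ring.
apply: le_trans (nrmB _ _) _.
by apply: lerD; apply: Hl; exact: (it_invariant GiK E_G E_Gi).
Qed.

(* The iterates of the disk would be dense, so the displacements of G, which are
   bounded on them, would be bounded on the plane, and its rotation set a point. *)
Lemma not_transitive : ~ topologically_transitive f.
Proof.
move=> tr; have [l Hl] := E_bounded; have [C HC] := bound.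
have C0 : 0 <= C := le_trans (nrm_ge0 _) (HC 0).
pose B := C * n%:R + (l + l) + C * n%:R.
pose good : set (R * R) := [set z | forall T, nrm (disp G a T z) <= B].
have dense (V : set (R * R)) : open V -> V !=set0 -> exists2 w, V w & good w.
  move=> oV [v Vv].
  have [i [t [[d Dd dt] [w Vw wt]]]] : exists i, (iter i f @` D) `&` (torus_pi @` V) !=set0.
    apply: tr => //; [exact: torus_pi_open|by exists (torus_pi z0)|by exists (torus_pi v), v].
  exists w => //.
  (* Multiples of [n] preserve [D], so fewer than [n] steps separate [w] from the disk. *)
  have [d' Dd' dE] : exists2 d', D d' & iter (i %% n) f d' = torus_pi w.
    rewrite wt -dt {2}(divn_eq i n) addnC iterD; eexists; last by [].
    elim: (i %/ n)%N => [//|j IH]; rewrite mulSn iterD.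
    by rewrite -fD; exists (iter (j * n) f d).
  have [e0 e0d] := torus_pi_surj d'.
  have pe0 : pre e0 by rewrite /preimage /= e0d.
  have [m hm Ee] := reach_translate pD Dz0 pe0.
  set e := e0 + m in Ee; set r := (i %% n)%N in dE.
  have rn : (r <= n)%N by rewrite ltnW// ltn_mod.
  have /torus_pi_eq : torus_pi w = torus_pi (iter r F e).
    by rewrite iter_lift torus_pi_shift// e0d dE.
  set m' := w - _ => hm'.
  have wE : w = iter r F e + m' by rewrite addrC subrK.
  clearbody m' e r.
  move=> T; have [M [hM _ ME]] := iter_G T.
  have EG : E (iter T G e) by elim: (T) => [//|j IH]; exact: E_G.
  have Fe : iter (T * n) F e = iter T G e - M by rewrite ME addrK.
  (* The shifts cancel because [a] does not see the shears involved. The outer terms cost at most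
     [C n] each, and the middle one is bounded by the size of [E]. *)
  have -> : disp G a T w = disp F a r (iter T G e) + (a (iter T G e) - a e) - disp F a r e.
    have e1 : iter T G w = iter r F (iter T G e) - shear (k * r) M + shear (k * (T * n)%N) m' + M.
      rewrite ME wE iter_shear// -iterD addnC iterD Fe iter_shear; last exact: int2N.
      congr (_ + _ + _ + _); apply: veq; rewrite !pairE //=; rewrite ?pairE; ring.
    rewrite /disp e1 wE !aD aN !a_shear.
    by apply: veq; rewrite !pairE; ring.
  have h1 := disp_le HC r (iter T G e); have h2 := disp_le HC r e.
  have h3 : C * r%:R <= C * n%:R by apply: ler_wpM2l; rewrite ?ler_nat.
  have h4 : nrm (a (iter T G e) - a e) <= l + l.
    apply: le_trans (a_short _ _) _.
    have -> : iter T G e - e = (iter T G e - z0) - (e - z0) by apply: veq; rewrite !pairE; ring.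
    by apply: le_trans (nrmB _ _) _; apply: lerD; exact: Hl.
  apply: le_trans (nrmB _ _) _; have := nrmD (disp F a r (iter T G e)) (a (iter T G e) - a e).
  by rewrite /B; lra.
have a0 : a 0 = 0 by rewrite -(scale0r z0) aZ !scale0r.
have gr : grows G a 0 0.
  exists B => T z; rewrite mul0r add0r scaler0 subr0 leNgt; apply/negP => big.
  have cd : continuous (disp G a T).
    apply: cont_vsub => //; apply: cont_comp a_cont.
    by elim: T {big} => [|j IH]; [exact: cont_id|exact: cont_comp IH contG].
  have cn : continuous (fun z => nrm (disp G a T z)).
    apply: cont_comp cd _; exact: nrm_cont.
  have oV : open [set x | B < nrm (disp G a T x)].
    have := open_gt (y := B); move/continuousP: cn; exact.
  have [w Vw gw] := dense _ oV (ex_intro _ z big).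
  by move: (gw T); rewrite leNgt Vw.
have := rotG.2 _ _ a0 gr; have := nrm_ge0 (n%:R *: rho0 + a m0 - 0).
have : 0 < n%:R * del by rewrite mulr_gt0 ?ltr0n.
lra.
Qed.

End disk.

Section rotation.
Context {R : realType}.
Variable F : R * R -> R * R.

Lemma grows_limit a (V c : R * R) (rho : R) :
  (forall eps : R, 0 < eps -> forall i : nat, exists n z,
     [/\ (i <= n)%N & nrm (V - n%:R^-1 *: disp F a n z) <= eps]) ->
  grows F a c rho -> nrm (V - c) <= rho.
Proof.
move=> lim [K HK]; apply/ler_addgt0Pr => eps eps0; have e2 : 0 < eps / 2 by rewrite divr_gt0.
have [n [z [ni h]]] := lim _ e2 (Num.truncn (`|K| / (eps / 2))).+1.
have nK : `|K| <= (eps / 2) * n%:R.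
  rewrite mulrC -ler_pdivrMr//; apply: le_trans (ltW (truncnS_gt _)) _; by rewrite ler_nat.
have n0 : 0 < n%:R :> R by rewrite ltr0n; exact: leq_ltn_trans ni.
have ne0 := lt0r_neq0 n0.
have -> : V - c = (V - n%:R^-1 *: disp F a n z) + n%:R^-1 *: (disp F a n z - n%:R *: c).
  by move: (disp F a n z) => x; rewrite scalerBr scalerA mulVf// scale1r subrKA.
apply: le_trans (nrmD _ _) _.
have h2 : nrm (n%:R^-1 *: (disp F a n z - n%:R *: c)) <= rho + eps / 2.
  rewrite nrmZ ger0_norm ?invr_ge0 ?ler0n// mulrC ler_pdivrMr// mulrDl.
  apply: le_trans (HK n z) _; rewrite lerD2l; exact: le_trans (ler_norm _) nK.
lra.
Qed.

Lemma rotation_set_rate (V c : R * R) (rho : R) : rotation_set F V -> grows F id c rho -> nrm (V - c) <= rho.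
Proof.
move=> rV; apply: grows_limit => eps eps0 i.
have e2 : 0 < eps / 2 by rewrite divr_gt0.
have := rV i.+1 isT => /(_ _ (nbhsx_ballx V _ e2))[_ [[n /= ni [z _ <-]] /ballE[h1 h2]]].
exists n, z; split; first exact: ltnW.
apply: le_trans (nrm_le_sum _) _; rewrite /disp !pairE in h1 h2 *; lra.
Qed.

Lemma vertical_rotation_set_rate (v : R) (c : R * R) (rho : R) :
  vertical_rotation_set F v -> grows F vertical c rho -> nrm ((0, v) - c) <= rho.
Proof.
move=> rV; apply: grows_limit => eps eps0 i.
have := rV i.+1 isT => /(_ _ (nbhsx_ballx v _ eps0))[_ [[n /= ni [z _ <-]] h]].
exists n, z; split; first exact: ltnW.
have -> : (0, v) - n%:R^-1 *: disp F vertical n z = (0, v - ((iter n F z).2 - z.2) / n%:R).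
  by apply: veq; rewrite /disp !pairE /= ?subrr ?mulr0 ?subr0// mulrC.
by rewrite nrm_vertical ltW.
Qed.

(** Moving from the interior point [V0] directly away from [c] by [e/2] stays in the rotation set,
    and this point is farther from [c] by exactly [e/2]. *)
Lemma rotation_ball_id : interior (rotation_set F) !=set0 ->
  exists rho0 (del : R), 0 < del /\ rotation_ball F id rho0 del.
Proof.
move=> [V0 /nbhs_ballP[e /= e0 He]]; exists V0, (e / 2); split; first by rewrite divr_gt0.
split=> // c rho _ gr.
have [u [u1 uE]] : exists u, nrm u = 1 /\ V0 - c = nrm (V0 - c) *: u.
  have [h|h] := eqVneq (V0 - c) 0.
    by exists (0, 1); rewrite nrm_vertical normr1 h nrm0 scale0r.
  have p : nrm (V0 - c) != 0 by rewrite nrm_eq0.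
  exists ((nrm (V0 - c))^-1 *: (V0 - c)); split; last by rewrite scalerA divff// scale1r.
  by rewrite nrmZ ger0_norm ?invr_ge0 ?nrm_ge0// mulVf.
have hu1 := nrm_fst u; have hu2 := nrm_snd u; rewrite u1 in hu1 hu2.
have e2 : 0 < e / 2 by rewrite divr_gt0.
have small (x : R) : `|x| <= 1 -> `|e / 2 * x| < e.
  by move=> x1; rewrite normrM gtr0_norm//; have := ler_wpM2l (ltW e2) x1; lra.
have rV : rotation_set F (V0 + (e / 2) *: u).
  apply: He; apply/ballE; rewrite !pairE !opprD.
  by split; rewrite addrA subrr add0r normrN; exact: small.
have := rotation_set_rate rV gr.
have -> : V0 + (e / 2) *: u - c = (nrm (V0 - c) + e / 2) *: u.
  by rewrite scalerDl -uE; apply: veq; rewrite !pairE; ring.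
by rewrite nrmZ u1 mulr1 (ger0_norm (addr_ge0 (nrm_ge0 _) (ltW e2))).
Qed.

(** On the axis distances from [c] are absolute values, so one of the two points [v0 + e/2] and
    [v0 - e/2] is farther from [c] by [e/2]. *)
Lemma rotation_ball_vertical : interior (vertical_rotation_set F) !=set0 ->
  exists rho0 (del : R), 0 < del /\ rotation_ball F vertical rho0 del.
Proof.
move=> [v0 /nbhs_ballP[e /= e0 He]]; exists (0, v0), (e / 2); split; first by rewrite divr_gt0.
split=> // c rho c1 gr.
have e2 : 0 < e / 2 by rewrite divr_gt0.
have vE (v : R) : nrm ((0, v) - c) = `|v - c.2|.
  by rewrite -nrm_vertical; congr nrm; apply: veq; rewrite !pairE /= ?subr0 // -c1 subrr.
have h1 : nrm ((0, v0 + e / 2) - c) <= rho.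
  by apply: vertical_rotation_set_rate gr; apply: He; rewrite /ball /= opprD addrA subrr add0r normrN gtr0_norm//; lra.
have h2 : nrm ((0, v0 - e / 2) - c) <= rho.
  by apply: vertical_rotation_set_rate gr; apply: He; rewrite /ball /= opprB addrC subrK gtr0_norm//; lra.
rewrite !vE in h1 h2 *; move: h1 h2; rewrite !ler_norml => /andP[? ?] /andP[? ?].
rewrite -lerBrDr ler_norml; apply/andP; split; lra.
Qed.

End rotation.

Section conclusion.
Context {R : realType}.

Lemma lift_continuous (f : torus R -> torus R) F : is_lift F f -> continuous f.
Proof.
move=> [contF liftF]; apply/continuousP => A oA; apply/torus_openP.
have -> : torus_pi @^-1` (f @^-1` A) = F @^-1` (torus_pi @^-1` A).
  by apply/seteqP; split=> z; rewrite /preimage /= liftF.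
by move/continuousP: contF; apply; exact/torus_openP.
Qed.

Lemma periodic_disk_bound (f : torus R -> torus R) F k a rho0 (del : R) :
  is_lift F f -> area_preserving_diffeo f -> homotopic f (dehn_twist k) ->
  (k = 0 /\ a = id) \/ (k != 0 /\ a = vertical) -> 0 < del -> rotation_ball F a rho0 del ->
  (topologically_transitive f -> ~ exists D, periodic_open_disk f D) /\
  exists2 N : R, 0 < N & forall D, periodic_open_disk f D -> forall z0, (torus_pi @^-1` D) z0 ->
    forall z w, reach (torus_pi @^-1` D) z0 z -> reach (torus_pi @^-1` D) z0 w -> nrm (z - w) <= N.
Proof.
move=> lF [af [eps _ [g [fg gf _ [G lG _]]]]] hf cases del0 rotF.
have [Fi [contFi FK FiK]] := lift_inverse fg gf lF lG.
have equivF := lift_equivariant lF hf.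
have contf := lift_continuous lF; have [contF liftF] := lF.
have injf := can_inj fg.
split=> [tr [D [[oD [t Dt] _ [pD lD]] [n n0 fD]]]|].
  have [z0 z0t] := torus_pi_surj t.
  have Dz0 : (torus_pi @^-1` D) z0 by rewrite /preimage /= z0t.
  have [m0 int_m0 E_m0] := return_shift injf liftF pD fD Dz0.
  exact: (not_transitive contf injf af contF FK FiK liftF equivF cases del0 rotF
    oD pD lD n0 fD Dz0 int_m0 E_m0 tr).
have [N N0 HN] : exists2 N : R, 0 < N & forall D, pathconn D ->
    (exists l, forall t z w, D z -> D w -> nrm (iterz F Fi t z - iterz F Fi t w) <= l) ->
    forall z w, D z -> D w -> nrm (z - w) <= N.
  have [C HC] := lift_bounded contF equivF.
  case: cases => [[k0 aE]|[k0 aE]]; rewrite aE in rotF.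
    have step z : nrm (id (F z) - id z) <= C + C.
      apply: le_trans (nrm_le_sum _) _; have [h1 h2] := HC z.
      by rewrite k0 mulr0z mul0r subr0 in h1; rewrite !pairE lerD.
    apply: (bounded_orbit_diameter_id contF contFi FK FiK step _ del0 rotF).
    move=> z m m1 m2; rewrite equivF//; congr (_ + _).
    by rewrite k0; apply: veq; rewrite //= mulr0z mul0r addr0.
  apply: (bounded_orbit_diameter_dehn contF contFi FK FiK k0 HC _ del0 rotF).
  by move=> z m m1 m2; rewrite equivF.
exists N => // D [[oD [t Dt] _ [pD lD]] [n n0 fD]] z0 Dz0.
have [m0 int_m0 E_m0] := return_shift injf liftF pD fD Dz0.
apply: HN; first exact: reach_pathconn.
exact: (component_orbit_bounded contf injf af contF FK FiK liftF equivF cases del0 rotF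
    oD pD lD n0 fD Dz0 int_m0 E_m0).
Qed.

End conclusion.

Theorem lemma2 (R : realType) (f : torus R -> torus R) (F : R * R -> R * R)
    (lift_F : is_lift F f)
    (hf : (Diff0 f /\ interior (rotation_set F) !=set0) \/
          (exists k : int,
             [/\ k != 0, DiffDehn k f &
                 interior (vertical_rotation_set F) !=set0])) :
  (topologically_transitive f -> ~ exists D, periodic_open_disk f D) /\
  (exists2 M : R, 0 < M &
     forall D, periodic_open_disk f D ->
       forall Dt : set (R * R),
         (exists2 z, (torus_pi @^-1` D) z &
            Dt = connected_component (torus_pi @^-1` D) z) ->
         (diam Dt < M%:E)%E).
Proof.
have [k [a [rho0 [del [df hf' cases del0 rotF]]]]] : exists k a rho0 (del : R),
    [/\ area_preserving_diffeo f, homotopic f (dehn_twist k),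
    (k = 0 /\ a = id) \/ (k != 0 /\ a = vertical), 0 < del & rotation_ball F a rho0 del].
  case: hf => [[[df hf'] /rotation_ball_id[rho0 [del [del0 rotF]]]]|
      [k [k0 [df hf'] /rotation_ball_vertical[rho0 [del [del0 rotF]]]]]].
    by exists 0, id, rho0, del; split=> //; [exact: homotopic_dehn0|left].
  by exists k, vertical, rho0, del; split=> //; right.
have [tr [N N0 HN]] := periodic_disk_bound lift_F df hf' cases del0 rotF.
(* One more than [N], since the bound on the diameter is to be strict. *)
split=> //; exists (N + 1); first by rewrite addr_gt0.
move=> D pD _ [z0 Dz0 ->]; have oD : open D by case: pD => -[].
apply: (@le_lt_trans _ _ N%:E); last by rewrite lte_fin ltrDl.
apply: ge_ereal_sup => _ [[z w] [/= Cz Cw] <-]; rewrite lee_fin.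
have -> : euclidean_dist z w = nrm (z - w) by rewrite /nrm /dot !pairE -!expr2.
have sub := component_sub_reach (pre_open oD) Dz0.
by apply: (HN _ pD _ Dz0); exact: sub.
Qed.
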